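(* Let $(Q,\mathcal S)$ be a Jacobi-finite quiver with potential with Jacobian algebra $J$, and let $\delta\in\mathbb Z^{Q_0}$. (1) $\operatorname{PHom}_J(\delta)$ and $\operatorname{IHom}_J(\check\delta)$ have the same principal component, where $\check\delta=\delta+\underline{\dim}(\delta)B_Q$. (2) $M$ is a general representation in $\operatorname{PC}(\delta)$ if and only if $\hat\tau\mathcal M$ is a general representation in $\operatorname{PC}(\tau\delta)$.
   Context: Setting. $k$ is an algebraically closed field of characteristic zero. $Q$ is a finite quiver without loops with vertex set $Q_0$; $B_Q=(b_{u,v})$ is the skew-symmetric matrix with $b_{u,v}=|\{\text{arrows }u\to v\}|-|\{\text{arrows }v\to u\}|$. Vectors are row vectors; $[x]_+=\max(x,0)$, entrywise for vectors. A potential $\mathcal S$ is a (possibly infinite) linear combination of oriented cycles, considered in $\widehat{kQ}/\overline{[\widehat{kQ},\widehat{kQ}]}$; the Jacobian algebra $J=J(Q,\mathcal S)$ is the quotient of the completed path algebra $\widehat{kQ}$ by the closed ideal generated by the cyclic derivatives $\partial_a\mathcal S$. $(Q,\mathcal S)$ is Jacobi-finite if $\dim_kJ<\infty$. Modules are right modules, viewed as representations of $Q$. $P_u,I_u$ are the projective cover and injective envelope of the simple $S_u$; $P(\beta)=\bigoplus_u\beta(u)P_u$, $I(\beta)=\bigoplus_u\beta(u)I_u$. Decorated representations. A decorated representation $\mathcal M=(M,M^-)$ consists of $M\in\operatorname{rep}J$ and a finite-dimensional $k^{Q_0}$-module $M^-$. Decorated representations up to isomorphism correspond bijectively to projective presentations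 $d_{\mathcal M}:P(\beta_-)\to P(\beta_+)$ up to homotopy equivalence: $M$ corresponds to its minimal presentation and $(0,S_u)$ to $P_u\to0$. The $\delta$-vector (weight) of $\mathcal M$ is $\beta_+-\beta_-$. Dually $\mathcal M$ has an injective presentation $\check d_{\mathcal M}:I(\check\beta_+)\to I(\check\beta_-)$ (minimal for $M$; $0\to I_u$ for $(0,S_u)$) and dual weight $\check\beta_+-\check\beta_-$. $\tau\mathcal M$ is the decorated representation with injective presentation $\nu(d_{\mathcal M})$, $\nu$ the Nakayama functor; $\hat\tau\mathcal M$ is the representation obtained from $\tau\mathcal M$ by forgetting the decorated part. General presentations. $\operatorname{PHom}_J(\delta)=\operatorname{Hom}_J(P([-\delta]_+),P([\delta]_+))$ and $\operatorname{IHom}_J(\check\delta)=\operatorname{Hom}_J(I([\check\delta]_+),I([-\check\delta]_+))$. The cokernels of general presentations in $\operatorname{PHom}_J(\delta)$ have constant dimension vector $\underline{\dim}(\delta)$ and lie in a single irreducible component of the representation variety $\operatorname{rep}_{\underline{\dim}(\delta)}(J)$, called the principal component $\operatorname{PC}(\delta)$ of $\operatorname{PHom}_J(\delta)$. The principal component of $\operatorname{IHom}_J(\check\delta)$ is defined dually, using kernels of general injective presentations. $\tau\delta$ denotes the (constant) $\delta$-vector of $\tau d$ for a general presentation $d$ of weight $\delta$. In (2), $\mathcal M$ is a decorated representation corresponding to a presentation of weight $\delta$, with underlying representation $M$; ''general'' refers to lying in a suitable nonempty open (hence dense) subset, so that (2) says that, under $\mathcal M\mapsto\tau\mathcal M$,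 nonempty open subsets of $\operatorname{PC}(\delta)$ and $\operatorname{PC}(\tau\delta)$ (up to isomorphism of representations) correspond. *)

(* Defs.v *)
From HB Require Import structures.
From mathcomp Require Import all_boot all_order all_algebra all_field.
From mathcomp Require Import boolp classical_sets.

Set Implicit Arguments.
Unset Strict Implicit.
Unset Printing Implicit Defensive.

Import GRing.Theory.
Local Open Scope ring_scope.
Local Open Scope classical_set_scope.

(** * Quivers and completed path algebras *)

Record quiver := Quiver {
  vert : finType;
  arr : finType;
  src : arr -> vert;
  tgt : arr -> vert
}.

Definition loopless (Q : quiver) := forall a : arr Q, src a != tgt a.

(* Paths are composed from left to right. *)
Fixpoint walk (Q : quiver) (u : vert Q) (p : seq (arr Q)) : bool :=
  if p is a :: p' then (src a == u) && walk (tgt a) p' else true.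

Definition wend (Q : quiver) (u : vert Q) (p : seq (arr Q)) : vert Q :=
  last u (map (@tgt Q) p).

Definition qpath (Q : quiver) := {q : vert Q * seq (arr Q) | walk q.1 q.2}.

Definition plen (Q : quiver) (q : qpath Q) : nat := size (sval q).2.

(* The formal series over all paths, i.e. the completed path algebra, given by
   its coefficients. *)
Definition cpa (k : closedFieldType) (Q : quiver) := qpath Q -> k.

Section PathAlgebra.
Variables (k : closedFieldType) (Q : quiver).
Implicit Types (x y : cpa k Q) (u : vert Q) (a : arr Q) (p : seq (arr Q)).

Definition pcoef x u p : k :=
  if insub (u, p) is Some q then x q else 0.

Definition cpa_mul x y : cpa k Q := fun q =>
  let: (u, p) := sval q in
  \sum_(i < (size p).+1)
    pcoef x u (take i p) * pcoef y (wend u (take i p)) (drop i p).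

Definition cpa_one : cpa k Q := fun q => (plen q == 0%N)%:R.

Definition cpa_vert u : cpa k Q := fun q => (sval q == (u, [::]))%:R.

Definition cpa_arr a : cpa k Q := fun q => (sval q == (src a, [:: a]))%:R.

(* A potential is represented by a family of coefficients indexed by words in
   the arrows; only the values on oriented cycles are ever used. Cyclically
   equivalent potentials have the same cyclic derivatives. *)
Definition potential := seq (arr Q) -> k.

(* The coefficient of a path p from [tgt a] to [src a] in the cyclic
   derivative by a: the cycles w1 a w2 contributing to p are those with
   w2 w1 = p. *)
Definition cyc_deriv (W : potential) a : cpa k Q := fun q =>
  let: (u, p) := sval q in
  if (u == tgt a) && (wend u p == src a) then
    \sum_(i < (size p).+1) W (drop i p ++ a :: take i p)
  else 0.

Definition jacobian_ideal (W : potential) x : Prop :=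
  exists s : seq (cpa k Q * arr Q * cpa k Q), forall q,
    x q = \sum_(t <- s) cpa_mul (cpa_mul t.1.1 (cyc_deriv W t.1.2)) t.2 q.

(* Closure for the topology given by the path length filtration. *)
Definition closed_jacobian_ideal (W : potential) x : Prop :=
  forall n : nat, exists2 y, jacobian_ideal W y &
    forall q, (plen q < n)%N -> x q = y q.

(* A finite-dimensional Jacobian algebra of (Q, W): the quotient of the
   completed path algebra by the closed ideal. Its existence is
   Jacobi-finiteness of (Q, W). A [falgType] is a nonzero ring, so Q has at
   least one vertex. *)
Record jacobian_algebra (W : potential) := JacobianAlgebra {
  jalg :> falgType k;
  jproj : cpa k Q -> jalg;
  jprojD : forall (c : k) x y,
    jproj (fun q => c * x q + y q) = c *: jproj x + jproj y;
  jprojM : forall x y, jproj (cpa_mul x y) = jproj x * jproj y;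
  jproj1 : jproj cpa_one = 1;
  jproj_surj : forall z, exists x, jproj x = z;
  jproj_ker : forall x, jproj x = 0 <-> closed_jacobian_ideal W x
}.

Definition jvert W (J : jacobian_algebra W) u : J := jproj J (cpa_vert u).
Definition jarr W (J : jacobian_algebra W) a : J := jproj J (cpa_arr a).

End PathAlgebra.

(** * Finite-dimensional right modules *)

(* [ract x v] is v x. *)
Record rmod (k : fieldType) (A : falgType k) := RMod {
  rsort :> vectType k;
  ract : A -> 'End(rsort);
  ract_linear : forall (c : k) x y, ract (c *: x + y) = c *: ract x + ract y;
  ractM : forall x y, ract (x * y) = (ract y \o ract x)%VF;
  ract1 : ract 1 = \1%VF
}.

Section Modules.
Variables (k : fieldType) (A : falgType k).
Implicit Types (M N X Y : rmod A).

Definition is_hom M N (f : 'Hom(M, N)) : Prop :=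
  forall x, (f \o ract M x)%VF = (ract N x \o f)%VF.

Definition submodule M (U : {vspace M}) : Prop :=
  forall x, (ract M x @: U <= U)%VS.

Definition is_coker X Y (d : 'Hom(X, Y)) N : Prop :=
  exists p : 'Hom(Y, N), [/\ is_hom p, limg p = fullv & lker p = limg d].

Definition is_ker X Y (d : 'Hom(X, Y)) N : Prop :=
  exists i : 'Hom(N, X), [/\ is_hom i, lker i = 0%VS & limg i = lker d].

Definition projective (P : rmod A) : Prop :=
  forall M N (g : 'Hom(M, N)) (h : 'Hom(P, N)),
    is_hom g -> limg g = fullv -> is_hom h ->
    exists2 l : 'Hom(P, M), is_hom l & (g \o l)%VF = h.

Definition injective_mod (E : rmod A) : Prop :=
  forall M N (g : 'Hom(M, N)) (h : 'Hom(M, E)),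
    is_hom g -> lker g = 0%VS -> is_hom h ->
    exists2 l : 'Hom(N, E), is_hom l & (l \o g)%VF = h.

Definition superfluous M (K : {vspace M}) : Prop :=
  forall U : {vspace M}, submodule U -> (U + K)%VS = fullv -> U = fullv.

Definition essential M (L : {vspace M}) : Prop :=
  forall U : {vspace M}, submodule U -> (U :&: L)%VS = 0%VS -> U = 0%VS.

Definition proj_cover X M (p : 'Hom(X, M)) : Prop :=
  [/\ is_hom p, projective X, limg p = fullv & superfluous (lker p)].

Definition inj_envelope M X (i : 'Hom(M, X)) : Prop :=
  [/\ is_hom i, injective_mod X, lker i = 0%VS & essential (limg i)].

(* X1 -> X0 -> M -> 0 exact, X0 a projective cover of M and X1 a projective
   cover of the kernel of X0 -> M. *)
Definition min_proj_pres M X1 X0 (d : 'Hom(X1, X0)) : Prop :=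
  exists p : 'Hom(X0, M), proj_cover p /\
    [/\ is_hom d, projective X1, limg d = lker p & superfluous (lker d)].

Definition min_inj_pres M X0 X1 (d : 'Hom(X0, X1)) : Prop :=
  exists i : 'Hom(M, X0), inj_envelope i /\
    [/\ is_hom d, injective_mod X1, lker d = limg i & essential (limg d)].

Definition biproduct (I : finType) (Y : I -> rmod A) X
    (inj : forall i, 'Hom(Y i, X)) (prj : forall i, 'Hom(X, Y i)) : Prop :=
  [/\ forall i, is_hom (inj i) /\ is_hom (prj i),
      forall i, (prj i \o inj i)%VF = \1%VF,
      forall i j, i != j -> (prj j \o inj i)%VF = 0
    & \sum_i (inj i \o prj i)%VF = \1%VF].

(* Homotopy equivalence of two-term complexes. *)
Definition homotopy_equiv X1 X0 (d : 'Hom(X1, X0)) Y1 Y0 (d' : 'Hom(Y1, Y0)) :=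
  exists (f1 : 'Hom(X1, Y1)) (f0 : 'Hom(X0, Y0))
         (g1 : 'Hom(Y1, X1)) (g0 : 'Hom(Y0, X0))
         (h : 'Hom(X0, X1)) (h' : 'Hom(Y0, Y1)),
  [/\ [/\ is_hom f1, is_hom f0, is_hom g1 & is_hom g0],
      is_hom h /\ is_hom h',
      (d' \o f1 = f0 \o d)%VF /\ (d \o g1 = g0 \o d')%VF,
      (g1 \o f1 = \1 + (h \o d))%VF /\ (g0 \o f0 = \1 + (d \o h))%VF
    & (f1 \o g1 = \1 + (h' \o d'))%VF /\ (f0 \o g0 = \1 + (d' \o h'))%VF].

(** ** The Nakayama functor D Hom(-, A) *)

Fact regular_linear (c : k) (x y : A) :
  amulr (c *: x + y) = c *: amulr x + amulr y.
Proof.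
by apply/lfunP=> z; rewrite add_lfunE scale_lfunE !lfunE /= mulrDr scalerAr.
Qed.
Fact regularM (x y : A) : amulr (x * y) = (amulr y \o amulr x)%VF.
Proof. by apply/lfunP=> z; rewrite comp_lfunE !lfunE /= mulrA. Qed.
Fact regular1 : amulr (1 : A) = \1%VF.
Proof. by apply/lfunP=> z; rewrite !lfunE /= mulr1. Qed.

Definition regular_mod : rmod A := RMod regular_linear regularM regular1.

Definition hom_defect M N (x : A) (f : 'Hom(M, N)) : 'Hom(M, N) :=
  (f \o ract M x)%VF - (ract N x \o f)%VF.

Fact hom_defect_linear M N x : linear (@hom_defect M N x).
Proof.
move=> c f g; rewrite /hom_defect comp_lfunDl comp_lfunDr -comp_lfunZl.
by rewrite -comp_lfunZr scalerBr opprD addrACA.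
Qed.
HB.instance Definition _ M N x :=
  GRing.isSemilinear.Build k 'Hom(M, N) 'Hom(M, N) _ (@hom_defect M N x)
  (GRing.semilinear_linear (@hom_defect_linear M N x)).

(* The A-linear maps as a subspace of the linear maps; see [hom_spaceP]. *)
Definition hom_space M N : {vspace 'Hom(M, N)} :=
  (\bigcap_(i < \dim {:A})
     lker (linfun (@hom_defect M N (vbasis {:A})`_i)))%VS.

Lemma ractZ M c x : ract M (c *: x) = c *: ract M x.
Proof.
have ract0 : ract M 0 = 0.
  have := ract_linear M (-1) 0 0.
  by rewrite scaler0 add0r scaleN1r addNr.
by have := ract_linear M c x 0; rewrite ract0 !addr0.
Qed.

Lemma ractD M x y : ract M (x + y) = ract M x + ract M y.
Proof. by have := ract_linear M 1 x y; rewrite !scale1r. Qed.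

Lemma hom_spaceP M N (f : 'Hom(M, N)) : f \in hom_space M N <-> is_hom f.
Proof.
split=> [fH x | fH]; last first.
  by rewrite memvE; apply/subv_bigcapP => i _; rewrite -memvE memv_ker lfunE /=
    /hom_defect fH subrr.
have fb (i : 'I_(\dim {:A})) : (f \o ract M (vbasis {:A})`_i)%VF =
    (ract N (vbasis {:A})`_i \o f)%VF.
  move: fH; rewrite memvE => /subv_bigcapP/(_ i isT).
  by rewrite -memvE memv_ker lfunE /= /hom_defect subr_eq0 => /eqP.
rewrite (coord_vbasis (memvf x)).
elim/big_rec: _ => [|i y _ IH].
  by rewrite -(scale0r 0) !ractZ !scale0r comp_lfun0r comp_lfun0l.
by rewrite !ractD !ractZ comp_lfunDl comp_lfunDr -comp_lfunZl -comp_lfunZr fb IH.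
Qed.

Section Nakayama.
Variable M : rmod A.

(* Hom(M, A), a left module through left multiplication on A. *)
Definition homA := subvs_of (hom_space M regular_mod).

Fact lmul_hom x (f : 'Hom(M, regular_mod)) :
  f \in hom_space M regular_mod ->
  (amull x \o f)%VF \in hom_space M regular_mod.
Proof.
move=> /hom_spaceP fH; apply/hom_spaceP => y.
rewrite -comp_lfunA fH; apply/lfunP=> v.
by rewrite !comp_lfunE !lfunE /= mulrA.
Qed.

Definition homA_mul (x : A) (f : homA) : homA :=
  vsproj (hom_space M regular_mod) (amull x \o vsval f)%VF.

Fact homA_mul_linear x : linear (homA_mul x).
Proof.
move=> c f g; rewrite /homA_mul -linearP; congr vsproj.
by rewrite linearP comp_lfunDr -comp_lfunZr.
Qed.
HB.instance Definition _ x := GRing.isSemilinear.Build k homA homA _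
  (homA_mul x) (GRing.semilinear_linear (homA_mul_linear x)).

Definition homA_act (x : A) : 'End(homA) := linfun (homA_mul x).

Lemma homA_actE x f : vsval (homA_act x f) = (amull x \o vsval f)%VF.
Proof. by rewrite lfunE /= vsprojK // lmul_hom // subvsP. Qed.

Definition nak_mul (x : A) (phi : 'Hom(homA, k^o)) : 'Hom(homA, k^o) :=
  (phi \o homA_act x)%VF.

Fact nak_mul_linear x : linear (nak_mul x).
Proof. by move=> c f g; rewrite /nak_mul comp_lfunDl -comp_lfunZl. Qed.
HB.instance Definition _ x :=
  GRing.isSemilinear.Build k 'Hom(homA, k^o) 'Hom(homA, k^o) _
  (nak_mul x) (GRing.semilinear_linear (nak_mul_linear x)).

Definition nak_act (x : A) : 'End('Hom(homA, k^o)) := linfun (nak_mul x).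

Lemma nak_actE x phi : nak_act x phi = (phi \o homA_act x)%VF.
Proof. by rewrite lfunE. Qed.

Fact nak_linear (c : k) x y : nak_act (c *: x + y) = c *: nak_act x + nak_act y.
Proof.
apply/lfunP=> phi; rewrite add_lfunE scale_lfunE !nak_actE.
rewrite comp_lfunZr -comp_lfunDr; congr (_ \o _)%VF.
apply/lfunP=> f; apply/val_inj; rewrite /= homA_actE.
rewrite add_lfunE scale_lfunE linearP /= !homA_actE.
by rewrite comp_lfunZl -comp_lfunDl.
Qed.

Fact nakM x y : nak_act (x * y) = (nak_act y \o nak_act x)%VF.
Proof.
apply/lfunP=> phi; rewrite comp_lfunE !nak_actE -comp_lfunA.
congr (_ \o _)%VF; apply/lfunP=> f; apply/val_inj; rewrite /= comp_lfunE.
rewrite !homA_actE comp_lfunA; congr (_ \o _)%VF.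
by apply/lfunP=> z; rewrite comp_lfunE !lfunE /= mulrA.
Qed.

Fact nak1 : nak_act 1 = \1%VF.
Proof.
apply/lfunP=> phi; rewrite nak_actE id_lfunE; apply/lfunP=> f.
rewrite comp_lfunE; congr (phi _); apply/val_inj; rewrite /= homA_actE.
by apply/lfunP=> z; rewrite comp_lfunE lfunE /= mul1r.
Qed.

Definition nakayama : rmod A := RMod nak_linear nakM nak1.

End Nakayama.

Section NakayamaMap.
Variables (X Y : rmod A) (d : 'Hom(X, Y)).

Definition precomp (g : homA Y) : homA X :=
  vsproj (hom_space X regular_mod) (vsval g \o d)%VF.

Fact precomp_linear : linear precomp.
Proof.
move=> c f g; rewrite /precomp -linearP; congr vsproj.
by rewrite linearP comp_lfunDl -comp_lfunZl.
Qed.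
HB.instance Definition _ := GRing.isSemilinear.Build k (homA Y) (homA X) _
  precomp (GRing.semilinear_linear precomp_linear).

Definition nak_fun (phi : 'Hom(homA X, k^o)) : 'Hom(homA Y, k^o) :=
  (phi \o linfun precomp)%VF.

Fact nak_fun_linear : linear nak_fun.
Proof. by move=> c f g; rewrite /nak_fun comp_lfunDl -comp_lfunZl. Qed.
HB.instance Definition _ :=
  GRing.isSemilinear.Build k 'Hom(homA X, k^o) 'Hom(homA Y, k^o) _
  nak_fun (GRing.semilinear_linear nak_fun_linear).

Definition nakayama_map : 'Hom(nakayama X, nakayama Y) := linfun nak_fun.

End NakayamaMap.

End Modules.

(** * Zariski topology *)

Section Zariski.
Variables (k : fieldType) (X : Type) (coord : set (X -> k)).

(* The polynomial functions in the coordinates. *)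
Inductive polyfun : (X -> k) -> Prop :=
| polyfun_coord f : coord f -> polyfun f
| polyfun_const c : polyfun (fun=> c)
| polyfun_add f g : polyfun f -> polyfun g -> polyfun (fun x => f x + g x)
| polyfun_mul f g : polyfun f -> polyfun g -> polyfun (fun x => f x * g x).

Definition zclosed (F : set X) : Prop :=
  exists2 E : set (X -> k), E `<=` polyfun &
    F = [set x | forall f, E f -> f x = 0].

Definition zopen (U : set X) : Prop := zclosed (~` U).

Definition zopen_in (A U : set X) : Prop := exists2 O, zopen O & U = A `&` O.

(* The property p holds for a general element of A. *)
Definition general (A p : set X) : Prop :=
  exists2 U, zopen_in A U & U !=set0 /\ U `<=` p.

Definition zirreducible (A : set X) : Prop :=
  A !=set0 /\ forall F G, zclosed F -> zclosed G ->
    A `<=` F `|` G -> A `<=` F \/ A `<=` G.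

Definition irreducible_component (A C : set X) : Prop :=
  [/\ C `<=` A, zirreducible C &
      forall C', zirreducible C' -> C `<=` C' -> C' `<=` A -> C' = C].

End Zariski.

Definition lin_coord (k : fieldType) (V : vectType k) : set (V -> k) :=
  [set f : V -> k | exists l : 'Hom(V, k^o), f = (fun v => l v)].

(** * General presentations over a Jacobian algebra *)

Section QP.
Variables (k : closedFieldType) (Q : quiver) (W : potential k Q).
Variable J : jacobian_algebra W.
Implicit Types (u v : vert Q) (a : arr Q) (alpha beta : vert Q -> nat)
  (delta : vert Q -> int) (M N X : rmod J).

(** ** Modules as representations of the quiver *)

Definition has_dimv N alpha : Prop :=
  forall u, \dim (limg (ract N (jvert J u))) = alpha u.

Definition repspace alpha := forall a, 'M[k]_(alpha (src a), alpha (tgt a)).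

Definition rep_coord alpha : set (repspace alpha -> k) :=
  [set f | exists a i j, f = fun x : repspace alpha => x a i j].

(* x is isomorphic to N viewed as a representation of Q: the space at u is
   N e_u and the arrow a acts by right multiplication. *)
Definition realizes alpha (x : repspace alpha) N : Prop :=
  exists f : forall u, 'Hom('rV[k]_(alpha u), N),
    (forall u, lker (f u) = 0%VS /\ limg (f u) = limg (ract N (jvert J u))) /\
    (forall a (w : 'rV[k]_(alpha (src a))),
      f (tgt a) (w *m x a) = ract N (jarr J a) (f (src a) w)).

Definition repvar alpha : set (repspace alpha) :=
  [set x | exists N, realizes x N].

(** ** Projectives and injectives *)

Definition simple_at u N : Prop :=
  [/\ \dim {:N} = 1%N, ract N (jvert J u) = \1%VF &
      forall a, ract N (jarr J a) = 0].

Definition is_P u X : Prop :=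
  exists N (p : 'Hom(X, N)), simple_at u N /\ proj_cover p.

Definition is_I u X : Prop :=
  exists N (i : 'Hom(N, X)), simple_at u N /\ inj_envelope i.

(* X is isomorphic to P(beta). *)
Definition is_Psum beta X : Prop :=
  exists (Y : {u : vert Q & 'I_(beta u)} -> rmod J)
         (inj : forall i, 'Hom(Y i, X)) (prj : forall i, 'Hom(X, Y i)),
    (forall i, is_P (tag i) (Y i)) /\ biproduct inj prj.

(* X is isomorphic to I(beta). *)
Definition is_Isum beta X : Prop :=
  exists (Y : {u : vert Q & 'I_(beta u)} -> rmod J)
         (inj : forall i, 'Hom(Y i, X)) (prj : forall i, 'Hom(X, Y i)),
    (forall i, is_I (tag i) (Y i)) /\ biproduct inj prj.

(** ** Decorated representations *)

Record decrep := DecRep {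
  dmod : rmod J;
  ddec : vert Q -> vectType k
}.

Definition two X X' (b : bool) : rmod J := if b then X else X'.

Definition dec_dim (D : decrep) u : nat := \dim {:ddec D u}.

(* The presentation attached to (M, M^-): the minimal presentation
   X1 -> X0 of M plus P(m) -> 0, with m the dimension vector of M^-. *)
Definition proj_pres (D : decrep) (Z1 X0 : rmod J) (d : 'Hom(Z1, X0)) : Prop :=
  exists (X1 R : rmod J) (dM : 'Hom(X1, X0))
         (inj : forall b : bool, 'Hom(two X1 R b, Z1))
         (prj : forall b : bool, 'Hom(Z1, two X1 R b)),
    [/\ min_proj_pres (dmod D) dM, is_Psum (dec_dim D) R,
        biproduct inj prj
      & d = (dM \o prj true)%VF].

(* Dually, the minimal injective presentation of M plus 0 -> I(m). *)
Definition inj_pres (D : decrep) (X0 Z1 : rmod J) (d : 'Hom(X0, Z1)) : Prop :=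
  exists (X1 R : rmod J) (dM : 'Hom(X0, X1))
         (inj : forall b : bool, 'Hom(two X1 R b, Z1))
         (prj : forall b : bool, 'Hom(Z1, two X1 R b)),
    [/\ min_inj_pres (dmod D) dM, is_Isum (dec_dim D) R,
        biproduct inj prj
      & d = (inj true \o dM)%VF].

(* D corresponds to the injective presentation d. *)
Definition dec_of_inj (D : decrep) (X0 X1 : rmod J) (d : 'Hom(X0, X1)) : Prop :=
  exists (Y0 Y1 : rmod J) (d' : 'Hom(Y0, Y1)), inj_pres D d' /\ homotopy_equiv d d'.

Definition has_weight (D : decrep) delta : Prop :=
  exists beta_m beta_p (Z1 Z0 : rmod J) (d : 'Hom(Z1, Z0)),
    [/\ proj_pres D d, is_Psum beta_m Z1, is_Psum beta_p Z0 &
        forall u, delta u = (beta_p u)%:Z - (beta_m u)%:Z].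

(* E = tau D. *)
Definition is_tau (D E : decrep) : Prop :=
  exists (Z1 Z0 : rmod J) (d : 'Hom(Z1, Z0)),
    proj_pres D d /\ dec_of_inj E (nakayama_map d).

(** ** General presentations and principal components *)

Definition pospart delta u : nat := `|Num.max (delta u) 0|%N.
Definition negpart delta u : nat := `|Num.max (- delta u) 0|%N.

(* R holds for a general presentation in PHom(delta). *)
Definition PHom_general delta
    (R : forall X1 X0 : rmod J, 'Hom(X1, X0) -> Prop) : Prop :=
  exists X1 X0 : rmod J,
    [/\ is_Psum (negpart delta) X1, is_Psum (pospart delta) X0 &
        general (@lin_coord k 'Hom(X1, X0)) [set d | is_hom d] (R X1 X0)].

(* R holds for a general presentation in IHom(delta). *)
Definition IHom_general delta
    (R : forall X0 X1 : rmod J, 'Hom(X0, X1) -> Prop) : Prop :=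
  exists X0 X1 : rmod J,
    [/\ is_Isum (pospart delta) X0, is_Isum (negpart delta) X1 &
        general (@lin_coord k 'Hom(X0, X1)) [set d | is_hom d] (R X0 X1)].

(* alpha is the general dimension vector \underline{dim}(delta). *)
Definition general_dimv delta alpha : Prop :=
  PHom_general delta (fun X1 X0 d => exists2 N, is_coker d N & has_dimv N alpha).

(* Irreducible components are stable under base change, so that it does not
   matter which representation isomorphic to the cokernel lies in C. *)
Definition principal_component delta alpha (C : set (repspace alpha)) : Prop :=
  irreducible_component (@rep_coord alpha) (@repvar alpha) C /\
  PHom_general delta (fun X1 X0 d =>
    exists N x, [/\ is_coker d N, realizes x N & C x]).

Definition dual_principal_component delta alpha (C : set (repspace alpha)) :=
  irreducible_component (@rep_coord alpha) (@repvar alpha) C /\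
  IHom_general delta (fun X0 X1 d =>
    exists N x, [/\ is_ker d N, realizes x N & C x]).

(* eta = tau delta: the weight of tau d for a general presentation d. *)
Definition general_tau delta (eta : vert Q -> int) : Prop :=
  PHom_general delta (fun X1 X0 d =>
    exists2 E, dec_of_inj E (nakayama_map d) & has_weight E eta).

End QP.

(** * The skew-symmetric matrix and dual weights *)

Definition Bmat (Q : quiver) (u v : vert Q) : int :=
  #|[set a : arr Q | (src a == u) && (tgt a == v)]%SET|%:Z -
  #|[set a : arr Q | (src a == v) && (tgt a == u)]%SET|%:Z.

(* delta + alpha B_Q, for row vectors. *)
Definition dual_weight (Q : quiver) (delta : vert Q -> int)
    (alpha : vert Q -> nat) (v : vert Q) : int :=
  delta v + \sum_u (alpha u)%:Z * Bmat u v.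

(* Main.v *)
(* The Jacobian algebra J and its converse satisfy the same axioms [qpa], with
   the arrows reversed: the class of a second cyclic derivative does not depend
   on the order of derivation. For a module with a minimal presentation
   P(b1) -> P(b0) these axioms express b0 - b1 at u through the dimensions at u
   and its predecessors and through the rank of the map induced by the second
   derivatives; that rank is the same for the dual module, hence the dual weight
   is the weight plus (dimension vector) B_Q.

   Let alpha be the general cokernel dimension vector of Hom(P1, P0) over the
   converse algebra, and consider the exact sequences Y1 -> Y0 -> D P0 -> D P1
   over J, with Y1, Y0 projective and middle rank alpha. When the weights match,
   a dimension count lets every tangent vector at Y1 -> Y0 be followed by a curve
   of such sequences, so that the maps Y1 -> Y0 that occur are dense in
   Hom(Y1, Y0) in characteristic 0. Thus some module is at once a cokernel of a
   general projective presentation and a kernel of a general injective one. Both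
   kinds of modules form open irreducible subsets of the representation variety,
   which have the same closure as soon as they meet; this is (1).

   For (2), nu is dual to Hom(-, J), which is fully faithful on projectives, and
   presentations with the same weight and the same cokernel are homotopy
   equivalent. So M is the cokernel of a general presentation d exactly when
   tau M is the kernel of nu d, and by (1), applied to tau delta, the kernels of
   general nu d lie in PC(tau delta). *)

Require Import Defs.
From HB Require Import structures.
From mathcomp Require Import all_boot all_order all_algebra all_field.
From mathcomp Require Import boolp classical_sets.
From mathcomp Require Import zify.

Set Implicit Arguments.
Unset Strict Implicit.
Unset Printing Implicit Defensive.

Import Order.TTheory GRing.Theory Num.Theory passmx.
Local Open Scope ring_scope.
Local Open Scope classical_set_scope.

(** * Polynomial maps *)

(** The dimension count deforms an exact sequence, so one such sequence must exist beforehand. The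
    weights fix only differences of multiplicities, and Y0 may be too small to map onto the dual of
    the general cokernel. The same projective P(x) is therefore added to both terms, with x the top
    of that dual module; the rank formula shows that its kernel is then covered as well. Density
    leads back to the original terms, because invertibility of the P(x)-block is an open condition.
    The hypothesis of the count is a single number: the weight and the dual weight have the same
    pairing with alpha, since alpha B pairs to zero with alpha for skew-symmetric B. Characteristic
    zero enters at one point: a polynomial with zero derivative is constant. Injectives are handled
    as duals of projectives over the converse algebra, so only presentations by sums of the P_u are
    ever counted, and the central statement is used in both directions with the two algebras
    exchanged. Representations near a given one act on one fixed space graded by the vertices, with
    matrices varying polynomially. *)

Definition hom_of (R : fieldType) (V W : vectType R) (f : V -> W)
  (linf : linear f) : 'Hom(V, W) := linfun f.
Arguments hom_of {R V W f} linf.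

Lemma hom_ofE (R : fieldType) (V W : vectType R) (f : V -> W) (linf : linear f) v :
  hom_of linf v = f v.
Proof.
pose mix := GRing.isSemilinear.Build R V W _ f (GRing.semilinear_linear linf).
pose F : {linear V -> W} := HB.pack f mix.
exact: (lfunE F).
Qed.

Section Polyfun.
Variables (k : fieldType) (X : Type) (crd : set (X -> k)).
Local Notation pf := (polyfun crd).

Lemma eq_polyfun f g : f =1 g -> pf f -> pf g.
Proof. by move=> /funext->. Qed.

Lemma polyfunZ c f : pf f -> pf (fun x => c * f x).
Proof. by move=> pff; apply: polyfun_mul => //; apply: polyfun_const. Qed.

Lemma polyfunB f g : pf f -> pf g -> pf (fun x => f x - g x).
Proof.
move=> pff pfg; apply: polyfun_add => //.
by apply: (eq_polyfun (fun x => mulN1r (g x))); apply: polyfunZ.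
Qed.

Lemma polyfun_sum I (r : seq I) (F : I -> X -> k) :
  (forall i, pf (F i)) -> pf (fun x => \sum_(i <- r) F i x).
Proof.
move=> pfF; elim: r => [|i r IH].
  by apply: (@eq_polyfun (fun=> 0)) => [x|]; [rewrite big_nil | apply: polyfun_const].
apply: (@eq_polyfun (fun x => F i x + \sum_(i <- r) F i x)) => [x|].
  by rewrite big_cons.
exact: polyfun_add.
Qed.

Lemma polyfun_prod I (r : seq I) (F : I -> X -> k) :
  (forall i, pf (F i)) -> pf (fun x => \prod_(i <- r) F i x).
Proof.
move=> pfF; elim: r => [|i r IH].
  by apply: (@eq_polyfun (fun=> 1)) => [x|]; [rewrite big_nil | apply: polyfun_const].
apply: (@eq_polyfun (fun x => F i x * \prod_(i <- r) F i x)) => [x|].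
  by rewrite big_cons.
exact: polyfun_mul.
Qed.

Lemma polyfun_det n (A : X -> 'M[k]_n) :
  (forall i j, pf (fun x => A x i j)) -> pf (fun x => \det (A x)).
Proof.
move=> pfA; rewrite /determinant; apply: polyfun_sum => s.
by apply: polyfunZ; apply: polyfun_prod => i.
Qed.

Lemma polyfun_adj n (A : X -> 'M[k]_n) :
  (forall i j, pf (fun x => A x i j)) ->
  forall i j, pf (fun x => (\adj (A x)) i j).
Proof.
move=> pfA i j.
apply: (@eq_polyfun (fun x => cofactor (A x) j i)) => [x|]; first by rewrite mxE.
apply: polyfunZ; apply: polyfun_det => i1 j1.
by apply: eq_polyfun (pfA (lift j i1) (lift i j1)) => x; rewrite !mxE.
Qed.

(** Testing against every functional keeps the notion independent of a basis; polynomial coordinates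
    in one basis are equivalent. *)
Definition polymap (V : vectType k) (c : X -> V) :=
  forall l : 'Hom(V, k^o), pf (fun x => l (c x)).

Section Polymap.
Variables V W : vectType k.

Lemma polymap_const (v : V) : polymap (fun=> v).
Proof. by move=> l; apply: polyfun_const. Qed.

Lemma polymapD (c c' : X -> V) :
  polymap c -> polymap c' -> polymap (fun x => c x + c' x).
Proof.
move=> pc pc' l; apply: (@eq_polyfun (fun x => l (c x) + l (c' x))) => [x|].
  by rewrite linearD.
by apply: polyfun_add; [apply: pc | apply: pc'].
Qed.

Lemma polymapZ (q : X -> k) (c : X -> V) :
  pf q -> polymap c -> polymap (fun x => q x *: c x).
Proof.
move=> pq pc l; apply: (@eq_polyfun (fun x => q x * l (c x))) => [x|].
  by rewrite linearZ.
by apply: polyfun_mul => //; apply: pc.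
Qed.

Lemma polymapB (c c' : X -> V) :
  polymap c -> polymap c' -> polymap (fun x => c x - c' x).
Proof.
move=> pc pc' l; apply: (@eq_polyfun (fun x => l (c x) - l (c' x))) => [x|].
  by rewrite linearB.
by apply: polyfunB; [apply: pc | apply: pc'].
Qed.

Lemma polymap_sum I (r : seq I) (F : I -> X -> V) :
  (forall i, polymap (F i)) -> polymap (fun x => \sum_(i <- r) F i x).
Proof.
move=> pF l; apply: (@eq_polyfun (fun x => \sum_(i <- r) l (F i x))) => [x|].
  by rewrite linear_sum.
by apply: polyfun_sum => i; apply: pF.
Qed.

Lemma polymap_lin (f : {linear V -> W}) (c : X -> V) :
  polymap c -> polymap (fun x => f (c x)).
Proof.
move=> pc l; apply: eq_polyfun (pc (l \o linfun f)%VF) => x.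
by rewrite comp_lfunE lfunE.
Qed.

Lemma polyfun_lin (f : {scalar V}) (c : X -> V) :
  polymap c -> pf (fun x => f (c x)).
Proof.
move=> pc; apply: eq_polyfun (pc (linfun (f : V -> k^o))) => x.
by rewrite lfunE.
Qed.

Lemma polymap_app (f : 'Hom(V, W)) (c : X -> V) :
  polymap c -> polymap (fun x => f (c x)).
Proof. exact: polymap_lin. Qed.

End Polymap.

(** The second argument is expanded in a basis; each term is then a polynomial function times a
    fixed linear image of [u x]. *)
Lemma polymap_bilin (U V W : vectType k) (B : U -> V -> W) (u : X -> U) (v : X -> V) :
  (forall w, linear (B w)) -> (forall w, linear (B^~ w)) ->
  polymap u -> polymap v -> polymap (fun x => B (u x) (v x)).
Proof.
move=> linB linB' pu pv.
pose Bl w := hom_of (linB w); pose Br w := hom_of (linB' w).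
have BlE w z : Bl w z = B w z := hom_ofE (linB w) z.
have BrE w z : Br w z = B z w := hom_ofE (linB' w) z.
pose b := vbasis {:V}.
have -> : (fun x => B (u x) (v x)) =
    (fun x => \sum_i coord b i (v x) *: Br b`_i (u x)).
  apply/funext=> x; rewrite -BlE {1}(coord_vbasis (memvf (v x))) linear_sum.
  by apply: eq_bigr => i _; rewrite linearZ /= BlE BrE.
apply: polymap_sum => i; apply: polymapZ; first exact: polyfun_lin.
exact: polymap_app.
Qed.


Lemma polymap_comp (U V W : vectType k) (F : X -> 'Hom(V, W)) (G : X -> 'Hom(U, V)) :
  polymap F -> polymap G -> polymap (fun x => (F x \o G x)%VF).
Proof.
apply: (@polymap_bilin _ _ _ (fun F G => F \o G)%VF) => w c f g.
  by rewrite comp_lfunDr comp_lfunZr.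
by rewrite comp_lfunDl comp_lfunZl.
Qed.

Lemma polymap_eval (V W : vectType k) (F : X -> 'Hom(V, W)) (v : X -> V) :
  polymap F -> polymap v -> polymap (fun x => F x (v x)).
Proof.
apply: (@polymap_bilin 'Hom(V, W) V W (fun F v => F v) F v) => w c f g.
  by rewrite linearP.
by rewrite add_lfunE scale_lfunE.
Qed.

(** Cramer's rule in a basis of [V]: [q] is the determinant and [T] the adjugate, so [T] inverts [S]
    up to the factor [q] and stays polynomial where [S] degenerates. *)
Lemma polymap_adj (V : vectType k) (S : X -> 'End(V)) : polymap S ->
  exists (q : X -> k) (T : X -> 'End(V)), [/\ pf q, polymap T,
    forall x, (S x \o T x)%VF = q x *: \1%VF,
    forall x, (T x \o S x)%VF = q x *: \1%VF &
    forall x, S x = \1%VF -> q x = 1].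
Proof.
move=> pS; set b := vbasis {:V}; have bP : basis_of {:V} b := vbasisP _.
have bfree := basis_free bP.
pose M x := mxof b b (S x); pose q x := \det (M x).
pose T x := hommx b b (\adj (M x)).
have pM i j : pf (fun x => M x i j).
  pose l (F : 'End(V)) : k^o := mxof b b F i j.
  have linl : linear l by move=> c F G; rewrite /l linearP !mxE.
  by apply: eq_polyfun (pS (hom_of linl)) => x; rewrite hom_ofE.
exists q, T; split.
- exact: polyfun_det.
- move=> l; pose u i j := l (hommx b b (delta_mx i j)).
  apply: (@eq_polyfun (fun x => \sum_i \sum_j (\adj (M x)) i j * u i j)) => [x|].
    rewrite /T {2}[\adj (M x)]matrix_sum_delta !linear_sum; apply: eq_bigr => i _.
    by rewrite !linear_sum; apply: eq_bigr => j _; rewrite !linearZ.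
  apply: polyfun_sum => i; apply: polyfun_sum => j.
  by apply: polyfun_mul; [apply: polyfun_adj | apply: polyfun_const].
- move=> x; rewrite -[S x](mxofK bP bP) -/(M x) /T -(hommx_mul bP bP bP) mul_adj_mx -/(q x).
  by rewrite -scalemx1 linearZ /= hommx1.
- move=> x; rewrite -[S x](mxofK bP bP) -/(M x) /T -(hommx_mul bP bP bP) mul_mx_adj -/(q x).
  by rewrite -scalemx1 linearZ /= hommx1.
- by move=> x Sx; rewrite /q /M Sx mxof1 // det1.
Qed.

(** With [G] a pseudo-inverse of [A x0], one has A x0 S x = A x0 G A x, so [S x] sends ker A x into
    ker A x0, and it is injective where its determinant [q] is nonzero. This bounds the nullity near
    [x0]. When the nullities agree, the adjugate [T x] carries ker A x0 back into ker A x, which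
    yields kernel vectors depending polynomially on x. *)
Lemma kernel_solver (V W : vectType k) (A : X -> 'Hom(V, W)) x0 : polymap A ->
  exists (q : X -> k) (S T : X -> 'End(V)) G, [/\ [/\ pf q, polymap T, polymap S & q x0 = 1],
    [/\ forall x, (S x \o T x)%VF = q x *: \1%VF, S x0 = \1%VF, T x0 = \1%VF &
    forall x, S x = (\1 + (G \o (A x - A x0)))%VF], (A x0 \o G \o A x0 = A x0)%VF &
    forall x, q x != 0 -> (\dim (lker (A x)) <= \dim (lker (A x0)))%N /\
      ((\dim (lker (A x0)) <= \dim (lker (A x)))%N ->
        forall v, v \in lker (A x0) -> A x (T x v) = 0)].
Proof.
move=> pA; pose G := ((A x0)^-1)%VF.
pose S x := (\1 + (G \o (A x - A x0)))%VF.
have AGA : (A x0 \o G \o A x0 = A x0)%VF := inv_lfun_def _.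
have pS : polymap S.
  apply: polymapD; first exact: polymap_const.
  apply: polymap_comp; first exact: polymap_const.
  by apply: polymapB => //; apply: polymap_const.
have [q [T [pq pT ST TS q1]]] := polymap_adj pS.
have S0 : S x0 = \1%VF by rewrite /S subrr comp_lfun0r addr0.
have qx0 := q1 _ S0.
have T0 : T x0 = \1%VF by have := ST x0; rewrite S0 qx0 scale1r comp_lfun1l.
exists q, S, T, G; split=> // x qx.
have TSE v : T x (S x v) = q x *: v by rewrite -comp_lfunE TS scale_lfunE id_lfunE.
have AGAE v : A x0 (G (A x0 v)) = A x0 v by rewrite -[in RHS]AGA !comp_lfunE.
have injS : lker (S x) == 0%VS.
  apply/lker0P=> v w /(congr1 (T x)).
  by rewrite !TSE => /(scalerI qx).
have SK : (S x @: lker (A x) <= lker (A x0))%VS.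
  apply/subvP=> _ /memv_imgP[v vK ->]; rewrite memv_ker.
  move: vK; rewrite memv_ker => /eqP Av.
  rewrite /S add_lfunE comp_lfunE add_lfunE Av opp_lfunE add0r id_lfunE.
  by rewrite !linearN linearD linearN /= AGAE subrr.
have dimSK : \dim (S x @: lker (A x)) = \dim (lker (A x)).
  by apply: limg_dim_eq; rewrite (eqP injS) capv0.
split; first by rewrite -dimSK dimvS.
move=> le_dim v vK; have : v \in (S x @: lker (A x))%VS.
  by rewrite (_ : (_ @: _)%VS = lker (A x0)) //; apply/eqP; rewrite eqEdim SK dimSK.
case/memv_imgP=> w wK ->; rewrite TSE linearZ /=.
by move: wK; rewrite memv_ker => /eqP->; rewrite scaler0.
Qed.

End Polyfun.

Lemma polyfun_polymap (k : fieldType) X (crd : set (X -> k)) (V : vectType k)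
    (f : V -> k) (c : X -> V) :
  polyfun (@lin_coord k V) f -> polymap crd c -> polyfun crd (fun x => f (c x)).
Proof.
move=> pf pc; elim: pf => [_ [l ->]|a|g h _ IHg _ IHh|g h _ IHg _ IHh].
- exact: pc.
- exact: polyfun_const.
- exact: polyfun_add.
- exact: polyfun_mul.
Qed.

Lemma polymap_id (k : fieldType) (V : vectType k) : polymap (@lin_coord k V) id.
Proof. by move=> l; apply: polyfun_coord; exists l. Qed.

Lemma polyfun_linear (k : fieldType) (V W : vectType k) (f : V -> W) (linf : linear f) (G : W -> k) :
  polyfun (@lin_coord k W) G -> polyfun (@lin_coord k V) (fun z => G (f z)).
Proof.
move=> pG; have -> : (fun z => G (f z)) = fun z => G (hom_of linf z).
  by apply/funext=> z; rewrite hom_ofE.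
by apply: (polyfun_polymap pG); apply: polymap_app; apply: polymap_id.
Qed.

(** * Density along curves *)

Section Curves.
Variable k : closedFieldType.
Local Notation crv := [set (@id k)].

Lemma polyfun_id : polyfun crv id. Proof. exact: polyfun_coord. Qed.

Lemma polyfun_horner f : polyfun crv f <-> exists p : {poly k}, forall t, f t = p.[t].
Proof.
split=> [pf | [p fE]].
  elim: pf => [_ -> | c | g h _ [p pE] _ [q qE] | g h _ [p pE] _ [q qE]].
  - by exists 'X => t; rewrite hornerX.
  - by exists c%:P => t; rewrite hornerC.
  - by exists (p + q) => t; rewrite hornerD pE qE.
  - by exists (p * q) => t; rewrite hornerM pE qE.
have -> : f = (fun t => \sum_(i < size p) p`_i * \prod_(j < i) t).
  apply/funext=> t; rewrite fE horner_coef; apply: eq_bigr => i _.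
  by rewrite prodr_const card_ord.
apply: polyfun_sum => i; apply: polyfunZ; apply: polyfun_prod => j.
exact: polyfun_id.
Qed.

Lemma poly_eq0_off0 (p : {poly k}) : (forall t, t != 0 -> p.[t] = 0) -> p = 0.
Proof.
move=> p0; apply/eqP/negPn/negP => pN0.
have : p * 'X != 0 by rewrite mulf_neq0 // polyX_eq0.
case/closed_nonrootP=> t; rewrite rootM rootX negb_or => /andP[+ t0].
by rewrite rootE p0 // eqxx.
Qed.

Lemma poly_ext (p q : {poly k}) : (forall t, p.[t] = q.[t]) -> p = q.
Proof.
move=> pq; apply/eqP; rewrite -subr_eq0; apply/eqP; apply: poly_eq0_off0 => t _.
by rewrite hornerD hornerN pq subrr.
Qed.

(** Irreducibility of the affine line: the product of two nonzero polynomials has a non-root. *)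
Lemma polyfun_crv_irr f g s t : polyfun crv f -> polyfun crv g ->
  f s != 0 -> g t != 0 -> exists u, f u != 0 /\ g u != 0.
Proof.
move=> /polyfun_horner[p pE] /polyfun_horner[q qE] fs gt.
have : p * q != 0.
  apply: mulf_neq0.
    by apply: contraNneq fs => p0; rewrite pE p0 horner0.
  by apply: contraNneq gt => q0; rewrite qE q0 horner0.
case/closed_nonrootP=> u; rewrite rootM negb_or => /andP[pu qu]; exists u.
by rewrite pE qE -!rootE.
Qed.

Lemma hom_sep (V : vectType k) (v : V) : (forall l : 'Hom(V, k^o), l v = 0) -> v = 0.
Proof.
move=> v0; rewrite (coord_vbasis (memvf v)) big1 // => i _.
have := v0 (linfun (coord (vbasis {:V}) i : V -> k^o)).
by rewrite lfunE /= => ->; rewrite scale0r.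
Qed.

(** First-order Taylor expansion at 0. The remainder is required to be polynomial, so that a jet
    makes the curve polynomial and determines its value and its derivative at 0. *)
Definition jet1 (V : vectType k) (c : k -> V) v0 v1 :=
  exists2 r : k -> V, polymap crv r &
    forall t, c t = v0 + t *: v1 + t ^+ 2 *: r t.

Lemma polyfun_exp2 : polyfun crv (fun t => t ^+ 2).
Proof. by apply: (@polyfun_mul _ _ _ id id); apply: polyfun_id. Qed.

Lemma jet1_polymap (V : vectType k) (c : k -> V) v0 v1 :
  jet1 c v0 v1 -> polymap crv c.
Proof.
case=> r pr cE; have -> : c = (fun t => v0 + t *: v1 + t ^+ 2 *: r t) by apply/funext.
apply: polymapD; last by apply: polymapZ => //; apply: polyfun_exp2.
apply: polymapD; first exact: polymap_const.
by apply: polymapZ; [apply: polyfun_id | apply: polymap_const].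
Qed.

Lemma polymap_jet (V : vectType k) (c : k -> V) :
  polymap crv c -> exists v0 v1, jet1 c v0 v1.
Proof.
move=> pc; pose b := vbasis {:V}.
have pE i : exists p : {poly k}, forall t, coord b i (c t) = p.[t].
  by apply/polyfun_horner; apply: polyfun_lin.
have [p {}pE] := choice pE.
exists (\sum_i (p i)`_0 *: b`_i), (\sum_i (p i)`_1 *: b`_i).
exists (fun t => \sum_i (drop_poly 2 (p i)).[t] *: b`_i).
  apply: polymap_sum => i; apply: polymapZ; last exact: polymap_const.
  by apply/polyfun_horner; exists (drop_poly 2 (p i)).
move=> t; rewrite {1}(coord_vbasis (memvf (c t))) !scaler_sumr -!big_split /=.
apply: eq_bigr => i _; rewrite !scalerA -!scalerDl; congr (_ *: _).
rewrite pE -{1}(poly_take_drop 2 (p i)) hornerD hornerM hornerXn.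
rewrite /take_poly poly_def horner_sum !big_ord_recl big_ord0 addr0 /=.
by rewrite !hornerZ !hornerXn expr0 mulr1 expr1 mulrC [X in _ + X]mulrC mulrC.
Qed.

Lemma jet1_at0 (V : vectType k) (c : k -> V) v0 v1 : jet1 c v0 v1 -> c 0 = v0.
Proof. by case=> r _ ->; rewrite expr0n !scale0r !addr0. Qed.

(** After subtraction and division by t, l (v1 - w1) + t p(t) vanishes for t nonzero, hence
    identically; its value at 0 is l (v1 - w1). *)
Lemma jet1_inj (V : vectType k) (c : k -> V) v0 v1 w0 w1 :
  jet1 c v0 v1 -> jet1 c w0 w1 -> v0 = w0 /\ v1 = w1.
Proof.
move=> jv jw; have v0E := jet1_at0 jv; have w0E := jet1_at0 jw.
split; first by rewrite -v0E.
case: jv jw => r pr rE [r' pr' rE']; move: rE'; rewrite -w0E v0E => rE'.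
apply/eqP; rewrite -subr_eq0; apply/eqP/hom_sep => l.
have /polyfun_horner[p pE] := polymapB pr pr' l.
suff P0 : (l (v1 - w1))%:P + 'X * p = 0.
  by have := congr1 (horner^~ 0) P0; rewrite !hornerE.
apply: poly_eq0_off0 => t t0; rewrite !hornerE -pE.
have := rE t; rewrite rE' -!addrA => /addrI/eqP; rewrite eq_sym -subr_eq0.
rewrite opprD addrACA -!scalerBr expr2 -scalerA -scalerDr scaler_eq0 (negPf t0) /=.
by move=> /eqP/(congr1 l); rewrite linearD linearZ /= linear0.
Qed.

Lemma jet1_const (V : vectType k) (v : V) : jet1 (fun=> v) v 0.
Proof.
exists (fun=> 0); first exact: polymap_const.
by move=> t; rewrite !scaler0 !addr0.
Qed.

Lemma jet1D (V : vectType k) (c d : k -> V) v0 v1 w0 w1 :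
  jet1 c v0 v1 -> jet1 d w0 w1 -> jet1 (fun t => c t + d t) (v0 + w0) (v1 + w1).
Proof.
case=> r pr rE [r' pr' rE']; exists (fun t => r t + r' t); first exact: polymapD.
move=> t; rewrite rE rE' !scalerDr addrACA; congr (_ + _).
by rewrite addrACA.
Qed.

Lemma jet1_line (V : vectType k) (v0 v1 : V) : jet1 (fun t => v0 + t *: v1) v0 v1.
Proof.
exists (fun=> 0); first exact: polymap_const.
by move=> t; rewrite scaler0 addr0.
Qed.

(** The Leibniz rule; [R] is the sum of the terms divisible by t^2, divided by t^2. *)
Lemma jet1_bilin (U V W : vectType k) (B : U -> V -> W) u v u0 u1 v0 v1 :
  (forall w, linear (B w)) -> (forall w, linear (B^~ w)) ->
  jet1 u u0 u1 -> jet1 v v0 v1 ->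
  jet1 (fun t => B (u t) (v t)) (B u0 v0) (B u0 v1 + B u1 v0).
Proof.
move=> linB linB' [r pr uE] [r' pr' vE].
have BD w x y : B w (x + y) = B w x + B w y.
  by have := linB w 1 x y; rewrite !scale1r.
have B0 w : B w 0 = 0.
  by have := linB w (-1) 0 0; rewrite scaler0 addr0 scaleN1r addNr.
have BZ w c x : B w (c *: x) = c *: B w x.
  by have := linB w c x 0; rewrite B0 !addr0.
have BD' w x y : B (x + y) w = B x w + B y w.
  by have := linB' w 1 x y; rewrite !scale1r.
have B0' w : B 0 w = 0.
  by have := linB' w (-1) 0 0; rewrite scaler0 addr0 scaleN1r addNr.
have BZ' w c x : B (c *: x) w = c *: B x w.
  by have := linB' w c x 0; rewrite B0' !addr0.
pose R t := B u0 (r' t) + B u1 v1 + t *: B u1 (r' t) + B (r t) (v t).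
exists R.
  have pu0 (w : U) (c : k -> V) : polymap crv c -> polymap crv (fun t => B w (c t)).
    move=> pc; apply: (@polymap_bilin _ _ _ U V W B (fun=> w) c) => //.
    exact: polymap_const.
  apply: polymapD; last first.
    apply: (@polymap_bilin _ _ _ U V W B r v) => //.
    by apply: (@jet1_polymap _ v v0 v1); exists r'.
  apply: polymapD; last by apply: polymapZ; [apply: polyfun_id | apply: pu0].
  by apply: polymapD; [apply: pu0 | apply: polymap_const].
move=> t; rewrite /R uE !(BD', BZ').
move: (r t) (r' t) (v t) (vE t) => x y z zE.
rewrite [in B u0 _]zE [in B u1 _]zE !(BD, BZ) !scalerDr !scalerA expr2 !addrA.
by rewrite mulrA; congr (_ + _ + _ + _); rewrite addrAC.
Qed.

Lemma polymap_scal X (crd : set (X -> k)) (q : X -> k) :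
  polyfun crd q -> polymap crd (q : X -> k^o).
Proof.
move=> pq l; apply: (@eq_polyfun _ _ _ (fun x => l 1 * q x)); last exact: polyfunZ.
by move=> x; rewrite -[q x in RHS]mulr1 -[_ * 1]/(_ *: (1 : k^o)) linearZ mulrC.
Qed.

Lemma jet1_scale (V : vectType k) (s : k -> k) (c : k -> V) s0 s1 v0 v1 :
  jet1 (s : k -> k^o) s0 s1 -> jet1 c v0 v1 ->
  jet1 (fun t => s t *: c t) (s0 *: v0) (s0 *: v1 + s1 *: v0).
Proof.
apply: (@jet1_bilin k^o V V (fun s v => s *: v)) => w a x y.
  by rewrite scalerDr !scalerA mulrC.
by rewrite scalerDl -[a *: x]/(a * x) scalerA.
Qed.

Lemma jet1_comp (U V W : vectType k) (F : k -> 'Hom(V, W)) (G : k -> 'Hom(U, V))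
    F0 F1 G0 G1 : jet1 F F0 F1 -> jet1 G G0 G1 ->
  jet1 (fun t => F t \o G t)%VF (F0 \o G0)%VF ((F0 \o G1) + (F1 \o G0))%VF.
Proof.
apply: (@jet1_bilin _ _ _ (fun F G => F \o G)%VF) => w c f g.
  by rewrite comp_lfunDr comp_lfunZr.
by rewrite comp_lfunDl comp_lfunZl.
Qed.

Lemma jet1_eval (V W : vectType k) (F : k -> 'Hom(V, W)) v F0 F1 v0 v1 :
  jet1 F F0 F1 -> jet1 v v0 v1 ->
  jet1 (fun t => F t (v t)) (F0 v0) (F0 v1 + F1 v0).
Proof.
apply: (@jet1_bilin 'Hom(V, W) V W (fun F v => F v)) => w c f g.
  by rewrite linearP.
by rewrite add_lfunE scale_lfunE.
Qed.

(** A first-order solution of A t (c t) = 0 is the jet of an exact one as long as the kernel does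
    not shrink: a line inside ker A0 is carried into ker A t by the adjugate [T] of
    [kernel_solver]. *)
Lemma curve_solver (V W : vectType k) (A : k -> 'Hom(V, W)) A0 A1 v0 v1 :
  jet1 A A0 A1 -> A0 v0 = 0 -> A0 v1 + A1 v0 = 0 ->
  exists c q, [/\ polyfun crv q, q 0 = 1, jet1 c v0 v1 &
    forall t, q t != 0 -> (\dim (lker A0) <= \dim (lker (A t)))%N -> A t (c t) = 0].
Proof.
move=> jA Av0 Av1; have pA := jet1_polymap jA; have A0E := jet1_at0 jA.
have [q [S [T [G [[pq pT pS q0] [ST S0 T0 SE] AGA sol]]]]] := kernel_solver 0 pA.
(* The correction puts [w] in ker A0, because A1 v0 = - A0 v1 lies in the image of A0; the
   derivative of [T] at 0 takes it away again. *)
rewrite A0E in AGA sol SE; pose w := v1 + G (A1 v0).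
have [q0' [q1 jq]] := polymap_jet (polymap_scal pq).
have [T0' [T1 jT]] := polymap_jet pT.
have := jet1_at0 jq; rewrite q0 => eq0'; rewrite -{q0'}eq0' in jq.
have := jet1_at0 jT; rewrite T0 => eT0'; rewrite -{T0'}eT0' in jT.
have jS : jet1 S \1%VF (G \o A1)%VF.
  have j1 := jet1_comp (jet1_const G) (jet1D jA (jet1_const (- A0))).
  have := jet1D (jet1_const \1%VF) j1.
  rewrite subrr comp_lfun0r !addr0 comp_lfun0l addr0 add0r.
  by case=> r pr rE; exists r => // t; rewrite SE rE.
(* Derivative at 0 of the identity S T = q. *)
have T1E : T1 = q1 *: \1%VF - (G \o A1)%VF.
  have j1 := jet1_comp jS jT.
  have j2 := jet1_scale jq (jet1_const (\1%VF : 'End(V))).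
  have j1' : jet1 (fun t => q t *: (\1%VF : 'End(V)))
      (\1 \o \1)%VF ((\1 \o T1) + ((G \o A1) \o \1))%VF.
    by case: j1 => r pr rE; exists r => // t; rewrite -ST rE.
  have [_] := jet1_inj j1' j2.
  by rewrite comp_lfun1l comp_lfun1r scaler0 add0r => /(canRL (addrK _)).
(* [T t] has jet 1 + t (q1 - G A1): the scalar factor cancels [q1] and the choice of [w] cancels G
   A1 v0, leaving the tangent [v1]. *)
exists (fun t => (1 + t * - q1) *: T t (v0 + t *: w)), q; split=> //.
  have js : jet1 (fun t => 1 + t * - q1 : k^o) 1 (- q1) by apply: jet1_line.
  have := jet1_scale js (jet1_eval jT (jet1_line v0 w)).
  rewrite !id_lfunE !scale1r T1E add_lfunE opp_lfunE scale_lfunE id_lfunE comp_lfunE.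
  by rewrite /w scaleNr [_ + _ + (_ - _)]addrACA subrr addr0 addrK.
move=> t qt le_dim; rewrite linearZ /=; apply/eqP; rewrite scaler_eq0; apply/orP; right.
apply/eqP; have [_ /(_ le_dim) solt] := sol t qt; apply: solt.
rewrite memv_ker /w linearD linearZ /= Av0 linearD /= add0r.
have -> : A0 (G (A1 v0)) = A1 v0.
  have -> : A1 v0 = A0 (- v1) by rewrite linearN; apply/eqP; rewrite -addr_eq0 addrC Av1.
  by rewrite -[in RHS]AGA !comp_lfunE.
by rewrite Av1 scaler0.
Qed.

(** [g] is the derivative of [f] in the direction [v], built by induction on [f] together with the
    chain rule for all curves with tangent [v]. *)
Lemma polyfun_jet (V : vectType k) (f : V -> k) (v : V) : polyfun (@lin_coord k V) f ->
  exists2 g : V -> k, polyfun (@lin_coord k V) g &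
    forall c x, jet1 c x v -> jet1 (fun t => f (c t) : k^o) (f x) (g x).
Proof.
elim=> [_ [l ->]|a|g h _ [g' pg' gE] _ [h' ph' hE]|g h pg [g' pg' gE] ph [h' ph' hE]].
- exists (fun=> l v); first exact: polyfun_const.
  move=> c x jc; have := jet1_eval (jet1_const l) jc.
  by rewrite zero_lfunE addr0.
- exists (fun=> 0); first exact: polyfun_const.
  by move=> c x jc; apply: (@jet1_const k^o).
- exists (fun x => g' x + h' x); first exact: polyfun_add.
  by move=> c x jc; apply: jet1D; [apply: gE | apply: hE].
exists (fun x => g x * h' x + g' x * h x).
  by apply: polyfun_add; apply: polyfun_mul.
move=> c x jc; exact: (jet1_scale (gE _ _ jc) (hE _ _ jc)).
Qed.

Lemma poly_jet (p : {poly k}) s : jet1 (fun t => p.[s + t] : k^o) p.[s] (p^`()).[s].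
Proof.
elim/poly_ind: p => [|p c IH].
  rewrite deriv0 horner0; apply: (@eq_rect _ _ (fun f => jet1 f _ _) (@jet1_const k^o 0)).
  by apply/funext=> t; rewrite horner0.
have js : jet1 (fun t => s + t : k^o) s 1.
  have := jet1_line (s : k^o) (1 : k^o).
  by case=> r pr rE; exists r => // t; rewrite -rE -[t *: _]/(t * 1) mulr1.
have [r pr rE] := jet1D (jet1_scale IH js) (@jet1_const k^o c).
exists r => // t.
have -> : (p * 'X + c%:P).[s] = p.[s] * s + c by rewrite !hornerE.
have -> : ((p * 'X + c%:P)^`()).[s] = p.[s] * 1 + (p^`()).[s] * s + 0.
  by rewrite derivD derivC !addr0 derivM derivX !hornerE addrC.
have -> : (p * 'X + c%:P).[s + t] = p.[s + t] * (s + t) + c by rewrite !hornerE.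
exact: rE.
Qed.

(** [T] contains, up to finitely many parameters, curves through each of its points in every
    direction of [H], so the derivatives along [H] of a polynomial vanishing on [T] vanish on [T]
    too. By induction on the degree along a line, the restriction of [f] has zero derivative, hence
    is constant in characteristic zero, and it vanishes at the starting point in [T]. *)
Lemma jet_dense (V : vectType k) (H : {vspace V}) (T : set V) (k_char0 : [pchar k] =i pred0)
    (f : V -> k) : T !=set0 -> T `<=` [set v | v \in H] ->
  (forall x v, T x -> v \in H -> exists c q, [/\ jet1 c x v, polyfun crv q, q 0 != 0 &
     forall t, q t != 0 -> T (c t)]) ->
  polyfun (@lin_coord k V) f -> (forall x, T x -> f x = 0) ->
  forall y, y \in H -> f y = 0.
Proof.
move=> [x Tx] TH curves pf f0 y Hy.
(* [g] is generalised because the induction replaces it by its derivative along [v]; [n] bounds the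
   size of its restriction [P] to the line. *)
suff main n : forall g (P : {poly k}) z v, polyfun (@lin_coord k V) g ->
    (forall x, T x -> g x = 0) -> T z -> v \in H ->
    (forall t, g (z + t *: v) = P.[t]) -> (size P <= n)%N -> P = 0.
  have pfl : polyfun crv (fun t => f (x + t *: (y - x))).
    apply: polyfun_polymap => //; exact: jet1_polymap (jet1_line _ _).
  have /polyfun_horner[P PE] := pfl.
  have := PE 1; rewrite scale1r addrC subrK => ->.
  rewrite (main _ f P x (y - x) pf f0 Tx _ PE (leqnn _)) ?horner0 //.
  by rewrite memvB // TH.
elim: n => [|n IH] g P z v pg g0 Tz Hv PE.
  by rewrite leqn0 size_poly_eq0 => /eqP.
move=> sP; have [g' pg' gE] := polyfun_jet v pg.
have g'0 x' : T x' -> g' x' = 0.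
  move=> Tx'; have [c [q [jc pq q0 Tc]]] := curves x' v Tx' Hv.
  have jg := gE _ _ jc.
  have pgc : polyfun crv (fun t => g (c t)).
    by apply: polyfun_polymap => //; apply: jet1_polymap jc.
  have gc0 t : g (c t) = 0.
    apply/eqP/negPn/negP => gct.
    have [u [gcu qu]] := polyfun_crv_irr pgc pq gct q0.
    by rewrite g0 ?eqxx // in gcu; apply: Tc.
  have j0 : jet1 (fun t => g (c t) : k^o) 0 0.
    have -> : (fun t => g (c t)) = fun=> 0 by apply/funext.
    exact: (@jet1_const k^o).
  by have [_ ->] := jet1_inj jg j0.
have pfl : polyfun crv (fun t => g' (z + t *: v)).
  apply: polyfun_polymap => //; exact: jet1_polymap (jet1_line _ _).
have /polyfun_horner[P' P'E] := pfl.
(* The derivative of [g] along [v], restricted to the line, is the derivative of the restriction, by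
   uniqueness of jets. *)
have P'P : P' = P^`().
  apply: poly_ext => s; rewrite -P'E.
  have j1 := gE (fun t => (z + s *: v) + t *: v) (z + s *: v) (jet1_line _ _).
  have j2 := poly_jet P s.
  have j1' : jet1 (fun t => P.[s + t] : k^o) (g (z + s *: v)) (g' (z + s *: v)).
    by case: j1 => r pr rE; exists r => // t; rewrite -rE -addrA -scalerDl PE.
  by have [_ ->] := jet1_inj j1' j2.
have P'0 : P^`() = 0.
  rewrite -P'P; apply: (IH g' P' z v) => //; rewrite P'P.
  by have := lt_size_deriv (p := P); case: (eqVneq P 0) => [->|_ /(_ isT)]; rewrite ?deriv0 ?size_poly0 // => h; rewrite -ltnS (leq_trans h sP).
have P0 : P.[0] = 0 by rewrite -PE scale0r addr0 g0.
apply/polyP=> [[|i]]; rewrite coef0; first by rewrite -horner_coef0.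
have := congr1 (fun p : {poly k} => p`_i) P'0; rewrite coef_deriv coef0 => /eqP.
rewrite -mulr_natr mulf_eq0 => /orP[/eqP //|].
by have /pcharf0P-> := k_char0.
Qed.

(** The line from [x] to [y] stays in [H], which reduces the claim to one variable. *)
Lemma polyfun_irr (V : vectType k) (H : {vspace V}) (f g : V -> k) x y :
  polyfun (@lin_coord k V) f -> polyfun (@lin_coord k V) g ->
  x \in H -> y \in H -> f x != 0 -> g y != 0 ->
  exists z, [/\ z \in H, f z != 0 & g z != 0].
Proof.
move=> pf pg Hx Hy fx gy.
have pl := jet1_polymap (jet1_line x (y - x)).
have pfl := polyfun_polymap pf pl; have pgl := polyfun_polymap pg pl.
have f0 : f (x + 0 *: (y - x)) != 0 by rewrite scale0r addr0.
have g1 : g (x + 1 *: (y - x)) != 0 by rewrite scale1r addrC subrK.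
have [t [ft gt]] := polyfun_crv_irr pfl pgl f0 g1.
by exists (x + t *: (y - x)); split=> //; rewrite memvD // memvZ // memvB.
Qed.

End Curves.

(** * Zariski topology through distinguished open sets *)

Section ZariskiBasics.
Variables (k : fieldType) (X : Type) (crd : set (X -> k)).
Local Notation pf := (polyfun crd).

(** Distinguished open sets form a basis. For the converse, the ambient open set is the union of the
    nonvanishing loci of all polynomial functions whose locus in [A] stays inside [U]. *)
Lemma zopen_inP (A U : set X) : zopen_in crd A U <-> U `<=` A /\
  forall x, U x -> exists f, [/\ pf f, f x != 0 & forall y, A y -> f y != 0 -> U y].
Proof.
split=> [[O [E Epf OE] ->] | [UA Uloc]].
  split=> [x [] //|x [Ax Ox]].
  have : ~ (~` O) x by move=> /(_ Ox).
  rewrite OE /= -existsNE => -[f]; rewrite not_implyE => -[Ef fx].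
  exists f; split; [exact: Epf | exact/eqP |] => y Ay fy; split=> //.
  apply: contrapT => nOy; have : (~` O) y by [].
  by rewrite OE => /(_ f Ef) /eqP; apply/negP.
pose E : set (X -> k) := [set f | pf f /\ forall y, A y -> f y != 0 -> U y].
exists [set x | exists2 f, E f & f x != 0].
  exists E; first by move=> f [].
  apply/seteqP; split=> x /=.
    move=> nx f Ef; apply/eqP/negPn/negP => fx; apply: nx; by exists f.
  by move=> Ex [f Ef /eqP]; rewrite Ex.
apply/seteqP; split=> x /=.
  by move=> Ux; split; [exact: UA | have [f [pff fx fU]] := Uloc x Ux; exists f].
by case=> Ax [f [pff fU] fx]; apply: fU.
Qed.

Lemma generalP (A p : set X) : general crd A p <->
  exists f, [/\ pf f, exists2 x, A x & f x != 0 & forall x, A x -> f x != 0 -> p x].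
Proof.
split=> [[U /zopen_inP[UA Uloc] [[x Ux] Up]] | [f [pff [x Ax fx] fp]]].
  have [f [pff fx fU]] := Uloc x Ux.
  by exists f; split=> //; [exists x => //; apply: UA | move=> y Ay fy; apply/Up/fU].
exists [set x | A x /\ f x != 0]; last first.
  by split; [exists x | move=> y [Ay fy]; apply: fp].
by apply/zopen_inP; split=> [y [] //| y [Ay fy]]; exists f.
Qed.

Lemma zirreducibleP (A : set X) : zirreducible crd A <-> A !=set0 /\
  forall f g x y, pf f -> pf g -> A x -> A y -> f x != 0 -> g y != 0 ->
    exists z, [/\ A z, f z != 0 & g z != 0].
Proof.
split=> -[A0 irrA]; split=> //.
  move=> f g x y pff pfg Ax Ay fx gy; apply: contrapT => noz.
  have clo h : pf h -> zclosed crd [set z | h z = 0].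
    move=> ph; exists [set h] => [_ -> //|]; apply/seteqP; split=> z /=.
      by move=> hz _ ->.
    by apply.
  case: (irrA _ _ (clo _ pff) (clo _ pfg)).
  - move=> z Az; case: (eqVneq (f z) 0) => [|fz]; first by left.
    case: (eqVneq (g z) 0) => [|gz]; first by right.
    by case: noz; exists z.
  - by move=> /(_ x Ax) /eqP; rewrite (negPf fx).
  - by move=> /(_ y Ay) /eqP; rewrite (negPf gy).
move=> F G [E Ep ->] [E' Ep' ->] cov.
apply: contrapT => /not_orP[/existsNP[x /not_implyP[Ax /existsNP[f /not_implyP[Ef /eqP fx]]]]].
move=> /existsNP[y /not_implyP[Ay /existsNP[g /not_implyP[Eg /eqP gy]]]].
have [z [Az fz gz]] := irrA f g x y (Ep _ Ef) (Ep' _ Eg) Ax Ay fx gy.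
by case: (cov z Az) => [/(_ f Ef)|/(_ g Eg)] /eqP; apply/negP.
Qed.

Definition zclosure_in (R O : set X) : set X :=
  [set x | R x /\ forall f, pf f -> (forall y, O y -> f y = 0) -> f x = 0].

(** A nonempty open part of an irreducible set is dense, so a function that vanishes on [O] vanishes
    on [C] too. *)
Lemma irreducible_sub_closure (R O C : set X) : zopen_in crd R O ->
  zirreducible crd C -> C `<=` R -> C `&` O !=set0 -> C `<=` zclosure_in R O.
Proof.
move=> /zopen_inP[OR Oloc] /zirreducibleP[_ irrC] CR [x [Cx Ox]] y Cy; split; first exact: CR.
move=> f pff fO; apply/eqP/negPn/negP => fy.
have [g [pg gx gO]] := Oloc x Ox.
have [z [Cz fz gz]] := irrC f g y x pff pg Cy Cx fy gx.
by move: fz; rewrite fO ?eqxx //; apply: gO => //; apply: CR.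
Qed.

(** Every irreducible subset of [R] that meets [O] stays inside the closure of [O], which gives
    maximality and uniqueness. Two open irreducible sets that meet thus define the same
    component. *)
Lemma component_of_open (R O : set X) : zopen_in crd R O -> zirreducible crd O ->
  [/\ irreducible_component crd R (zclosure_in R O), O `<=` zclosure_in R O &
    forall C, irreducible_component crd R C -> C `&` O !=set0 -> C = zclosure_in R O].
Proof.
move=> oO irrO; have /zopen_inP[OR Oloc] := oO.
have /zirreducibleP[[x0 Ox0] irrO'] := irrO.
have OC : O `<=` zclosure_in R O.
  by move=> x Ox; split; [exact: OR | move=> f _; apply].
have irrC : zirreducible crd (zclosure_in R O).
  apply/zirreducibleP; split; first by exists x0; apply: OC.
  move=> f g x y pff pg [Rx Cx] [Ry Cy] fx gy.
  have [x' Ox' fx'] : exists2 x', O x' & f x' != 0.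
    apply: contrapT => /forall2NP nx; case/negP: fx; apply/eqP/Cx => // z Oz.
    by have [//|/negP/negPn/eqP] := nx z.
  have [y' Oy' gy'] : exists2 y', O y' & g y' != 0.
    apply: contrapT => /forall2NP nx; case/negP: gy; apply/eqP/Cy => // z Oz.
    by have [//|/negP/negPn/eqP] := nx z.
  have [z [Oz fz gz]] := irrO' f g x' y' pff pg Ox' Oy' fx' gy'.
  by exists z; split=> //; apply: OC.
have CR : zclosure_in R O `<=` R by move=> x [].
split=> //.
  split=> // C' irrC' CC' C'R; apply/seteqP; split=> //.
  apply: irreducible_sub_closure => //; exists x0; split=> //; exact/CC'/OC.
move=> C [CR' irrC' Cmax] CO.
by symmetry; apply: Cmax => //; apply: irreducible_sub_closure.
Qed.

End ZariskiBasics.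

(** Clearing denominators: coordinates with denominator [q] pull polynomial functions back to
    functions whose denominator is a power of [q]. *)
Lemma polyfun_rational (k : fieldType) (X Y : Type) (crdX : set (X -> k))
    (crdY : set (Y -> k)) (f : Y -> k) (c : X -> Y) (q : X -> k) :
  polyfun crdY f -> polyfun crdX q ->
  (forall xi, crdY xi -> exists2 p, polyfun crdX p &
     forall x, q x != 0 -> q x * xi (c x) = p x) ->
  exists N p, polyfun crdX p /\ forall x, q x != 0 -> q x ^+ N * f (c x) = p x.
Proof.
move=> pf pq rat.
have pfX N : polyfun crdX (fun x => q x ^+ N).
  elim: N => [|N IH]; first exact: polyfun_const.
  have -> : (fun x => q x ^+ N.+1) = (fun x => q x * q x ^+ N).
    by apply/funext=> x; rewrite exprS.
  exact: polyfun_mul.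
elim: pf => [xi /rat[p pp pE]|a|g h _ [N [p [pp pE]]] _ [M [r [pr rE]]]
            |g h _ [N [p [pp pE]]] _ [M [r [pr rE]]]].
- by exists 1%N, p; split=> // x qx; rewrite expr1 pE.
- by exists 0%N, (fun=> a); split; [exact: polyfun_const | move=> x _; rewrite mul1r].
- exists (N + M)%N, (fun x => q x ^+ M * p x + q x ^+ N * r x); split.
    by apply: polyfun_add; apply: polyfun_mul.
  move=> x qx; rewrite -pE // -rE // mulrDr exprD -!mulrA; congr (_ + _).
  by rewrite mulrCA.
- exists (N + M)%N, (fun x => p x * r x); split; first exact: polyfun_mul.
  by move=> x qx; rewrite -pE // -rE // exprD mulrACA.
Qed.

Lemma polyfun_comp (k : fieldType) (X Y : Type) (crdX : set (X -> k))
    (crdY : set (Y -> k)) (f : Y -> k) (c : X -> Y) :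
  polyfun crdY f -> (forall xi, crdY xi -> polyfun crdX (fun x => xi (c x))) ->
  polyfun crdX (fun x => f (c x)).
Proof.
move=> pf rat; elim: pf => [xi /rat //|a|g h _ pg _ ph|g h _ pg _ ph].
- exact: polyfun_const.
- exact: polyfun_add.
- exact: polyfun_mul.
Qed.

(** * Dimension counts for families of vectors; composition as a linear map *)

Section LinearAlgebra.
Variable k : fieldType.

Lemma lfun_congr (V W : vectType k) (f g : 'Hom(V, W)) v : f = g -> f v = g v.
Proof. by move->. Qed.

Lemma dim_sum_indep (V : vectType k) (I : finType) (Us : I -> {vspace V}) :
  (forall us, (forall i, us i \in Us i) -> \sum_i us i = 0 -> forall i, us i = 0) ->
  \dim (\sum_i Us i)%VS = (\sum_i \dim (Us i))%N.
Proof.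
move=> ind; have /directvP -> // : directv (\sum_i Us i).
apply/directv_sum_independent => us usU us0 i _.
by apply: ind => // j; apply: usU.
Qed.

Lemma dim_limg_inj (V W : vectType k) (f : 'Hom(V, W)) (U : {vspace V}) :
  (forall v, v \in U -> f v = 0 -> v = 0) -> \dim (f @: U) = \dim U.
Proof.
move=> inj; apply: limg_dim_eq; apply/eqP; rewrite -subv0; apply/subvP=> v.
by rewrite memv_cap memv_ker memv0 => /andP[vU /eqP/(inj v vU)->].
Qed.

Lemma dim_limg_sub (V W : vectType k) (f : 'Hom(V, W)) (U U' : {vspace V}) :
  (U' <= U)%VS -> (\dim (f @: U) + \dim U' <= \dim U + \dim (f @: U'))%N.
Proof.
move=> sU; have := limg_ker_dim f U; have := limg_ker_dim f U'.
by have := dimvS (capvS sU (subvv (lker f))); lia.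
Qed.

(** Families whose entry at i lies in [U i]. Writing them as a sum of coordinate images lets the
    dimension follow from independence of the summands. *)
Definition ffunsp (I : finType) (V : vectType k) (U : I -> {vspace V}) :
    {vspace {ffun I -> V}} :=
  (\sum_i (linfun (fun v : V => [ffun j => if j == i then v else 0]) @: U i))%VS.

Lemma ffdelta_linear (I : finType) (V : vectType k) (i : I) :
  linear (fun v : V => [ffun j => if j == i then v else 0]).
Proof.
move=> c v w; apply/ffunP=> j; rewrite !ffunE.
by case: ifP => _ //; rewrite scaler0 addr0.
Qed.

Lemma ffdeltaE (I : finType) (V : vectType k) (i : I) (v : V) j :
  linfun (fun v : V => [ffun j => if j == i then v else 0]) v j = if j == i then v else 0.
Proof. by rewrite (hom_ofE (@ffdelta_linear I V i)) ffunE. Qed.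

Lemma ffun_sum_delta (I : finType) (V : vectType k) (f : {ffun I -> V}) :
  f = \sum_i linfun (fun v : V => [ffun j => if j == i then v else 0]) (f i).
Proof.
apply/ffunP=> j; rewrite sum_ffunE (bigD1 j) //= ffdeltaE eqxx big1 ?addr0 // => i ij.
by rewrite ffdeltaE eq_sym (negPf ij).
Qed.

Lemma mem_ffunsp (I : finType) (V : vectType k) (U : I -> {vspace V})
    (f : {ffun I -> V}) :
  reflect (forall i, f i \in U i) (f \in ffunsp U).
Proof.
apply: (iffP idP) => [/memv_sumP[us usU ->] j|fU].
  rewrite sum_ffunE; apply: memv_suml => i _.
  have /memv_imgP[v vU ->] := usU i isT.
  by rewrite ffdeltaE; case: eqP => [->//|_]; apply: mem0v.
by rewrite [f]ffun_sum_delta; apply: memv_sumr => i _; apply: memv_img.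
Qed.

Lemma dim_ffunsp (I : finType) (V : vectType k) (U : I -> {vspace V}) :
  \dim (ffunsp U) = (\sum_i \dim (U i))%N.
Proof.
rewrite dim_sum_indep => [|us usU us0 i].
  apply: eq_bigr => i _; apply: dim_limg_inj => v vU /ffunP/(_ i).
  by rewrite ffdeltaE eqxx ffunE.
have := congr1 (fun f : {ffun I -> V} => f i) us0; rewrite sum_ffunE ffunE.
rewrite (bigD1 i) //= big1 => [|j ji].
  rewrite addr0; have /memv_imgP[v _ ->] := usU i; rewrite ffdeltaE eqxx => ->.
  by apply/ffunP => j; rewrite ffdeltaE ffunE; case: ifP.
by have /memv_imgP[v _ ->] := usU j; rewrite ffdeltaE eq_sym (negPf ji).
Qed.

Lemma postcomp_linear (U V W : vectType k) (g : 'Hom(V, W)) :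
  linear (fun h : 'Hom(U, V) => (g \o h)%VF).
Proof. by move=> c f h; rewrite comp_lfunDr comp_lfunZr. Qed.

Lemma precomp_linear (U V W : vectType k) (d : 'Hom(U, V)) :
  linear (fun h : 'Hom(V, W) => (h \o d)%VF).
Proof. by move=> c f h; rewrite comp_lfunDl comp_lfunZl. Qed.

Definition postc (U V W : vectType k) (g : 'Hom(V, W)) : 'Hom('Hom(U, V), 'Hom(U, W)) :=
  hom_of (postcomp_linear g).
Definition prec (U V W : vectType k) (d : 'Hom(U, V)) : 'Hom('Hom(V, W), 'Hom(U, W)) :=
  hom_of (precomp_linear d).

Lemma postcE (U V W : vectType k) (g : 'Hom(V, W)) (h : 'Hom(U, V)) :
  postc U g h = (g \o h)%VF.
Proof. exact: hom_ofE. Qed.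
Lemma precE (U V W : vectType k) (d : 'Hom(U, V)) (h : 'Hom(V, W)) :
  prec W d h = (h \o d)%VF.
Proof. exact: hom_ofE. Qed.

End LinearAlgebra.

(** * Submodules, quotients and projective covers *)

Section ModuleBasics.
Variables (k : fieldType) (A : falgType k).
Implicit Types M N X Y P : rmod A.

Lemma ractMv M x y v : ract M (x * y) v = ract M y (ract M x v).
Proof. by rewrite ractM comp_lfunE. Qed.
Lemma ract1v M v : ract M 1 v = v.
Proof. by rewrite ract1 id_lfunE. Qed.
Lemma ract0 M : ract M 0 = 0.
Proof. by rewrite -(scale0r 0) ractZ scale0r. Qed.
Lemma ractDv M x y v : ract M (x + y) v = ract M x v + ract M y v.
Proof. by rewrite ractD add_lfunE. Qed.
Lemma ractZv M c x v : ract M (c *: x) v = c *: ract M x v.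
Proof. by rewrite ractZ scale_lfunE. Qed.
Lemma ractNv M x v : ract M (- x) v = - ract M x v.
Proof. by rewrite -scaleN1r ractZv scaleN1r. Qed.
Lemma ract_sum M I (r : seq I) (P : pred I) (F : I -> A) v :
  ract M (\sum_(i <- r | P i) F i) v = \sum_(i <- r | P i) ract M (F i) v.
Proof.
elim/big_rec2: _ => [|i y z _ <-]; first by rewrite ract0 zero_lfunE.
by rewrite ractDv.
Qed.

Lemma homE M N (f : 'Hom(M, N)) x v : is_hom f -> f (ract M x v) = ract N x (f v).
Proof. by move=> fH; rewrite -!comp_lfunE fH. Qed.

Lemma is_homP M N (f : 'Hom(M, N)) :
  (forall x v, f (ract M x v) = ract N x (f v)) -> is_hom f.
Proof. by move=> fE x; apply/lfunP=> v; rewrite !comp_lfunE. Qed.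

Lemma is_hom_comp M N X (g : 'Hom(N, X)) (f : 'Hom(M, N)) :
  is_hom g -> is_hom f -> is_hom (g \o f)%VF.
Proof. by move=> gH fH; apply: is_homP => x v; rewrite !comp_lfunE !homE. Qed.
Lemma is_hom_id M : is_hom (\1%VF : 'End(M)).
Proof. by apply: is_homP => x v; rewrite !id_lfunE. Qed.
Lemma is_hom0 M N : is_hom (0 : 'Hom(M, N)).
Proof. by apply: is_homP => x v; rewrite !zero_lfunE linear0. Qed.
Lemma is_homD M N (f g : 'Hom(M, N)) : is_hom f -> is_hom g -> is_hom (f + g).
Proof. by move=> fH gH; apply: is_homP => x v; rewrite !add_lfunE !homE // linearD. Qed.
Lemma is_homZ M N c (f : 'Hom(M, N)) : is_hom f -> is_hom (c *: f).
Proof. by move=> fH; apply: is_homP => x v; rewrite !scale_lfunE homE // linearZ. Qed.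
Lemma is_homN M N (f : 'Hom(M, N)) : is_hom f -> is_hom (- f).
Proof. by move=> fH; rewrite -scaleN1r; apply: is_homZ. Qed.
Lemma is_homB M N (f g : 'Hom(M, N)) : is_hom f -> is_hom g -> is_hom (f - g).
Proof. by move=> fH gH; apply: is_homD => //; apply: is_homN. Qed.

(* [lker0_compfV] is only available for endomorphisms. *)
Lemma hom_inverse M N (f : 'Hom(M, N)) : is_hom f -> lker f = 0%VS -> limg f = fullv ->
  exists g : 'Hom(N, M), [/\ is_hom g, (g \o f)%VF = \1%VF & (f \o g)%VF = \1%VF].
Proof.
move=> fH fk fi; have fk0 : lker f == 0%VS by rewrite fk.
have fg : (f \o f^-1)%VF = \1%VF.
  by apply/lfunP=> v; rewrite comp_lfunE limg_lfunVK ?id_lfunE // fi memvf.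
have gf : (f^-1 \o f)%VF = \1%VF := lker0_compVf fk0.
have fgE v : f ((f^-1)%VF v) = v by rewrite -comp_lfunE fg id_lfunE.
have /lker0P finj := fk0.
exists (f^-1)%VF; split=> //; apply: is_homP => x v.
by apply: finj; rewrite fgE homE // fgE.
Qed.

Lemma submodule_full M : submodule (fullv : {vspace M}).
Proof. by move=> x; apply: subvf. Qed.
Lemma submodule_ker M N (f : 'Hom(M, N)) : is_hom f -> submodule (lker f).
Proof.
move=> fH x; apply/subvP=> _ /memv_imgP[v + ->].
by rewrite !memv_ker homE // => /eqP->; rewrite linear0.
Qed.
Lemma submodule_img M N (f : 'Hom(M, N)) (U : {vspace M}) :
  is_hom f -> submodule U -> submodule (f @: U)%VS.
Proof.
move=> fH UM x; apply/subvP=> _ /memv_imgP[_ /memv_imgP[v vU ->] ->].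
rewrite -homE //; apply: memv_img; apply: (subvP (UM x)); exact: memv_img.
Qed.
Lemma submoduleP M (U : {vspace M}) x v : submodule U -> v \in U -> ract M x v \in U.
Proof. by move=> UM vU; apply: (subvP (UM x)); apply: memv_img. Qed.
Lemma submodule_cap M (U V : {vspace M}) : submodule U -> submodule V -> submodule (U :&: V)%VS.
Proof.
move=> UM VM x; apply/subvP=> _ /memv_imgP[v /memv_capP[vU vV] ->].
by rewrite memv_cap !submoduleP.
Qed.

Section Transport.
Variables (M : rmod A) (V : vectType k) (g : 'Hom(V, M)) (h : 'Hom(M, V)).
Hypothesis hg : (h \o g)%VF = \1%VF.
Hypothesis comp : forall x y v, h (ract M y (g (h (ract M x (g v))))) = h (ract M y (ract M x (g v))).
(** A module structure carried to [V] along a retraction; [comp] is multiplicativity of the result.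
    Inclusions give submodules and projections onto a complement give quotients. *)
Definition transp_act x : 'End(V) := (h \o ract M x \o g)%VF.
Fact transp_linear c x y : transp_act (c *: x + y) = c *: transp_act x + transp_act y.
Proof. by rewrite /transp_act ract_linear comp_lfunDr comp_lfunDl -comp_lfunZr -comp_lfunZl. Qed.
Fact transpM x y : transp_act (x * y) = (transp_act y \o transp_act x)%VF.
Proof. by apply/lfunP=> v; rewrite !comp_lfunE comp ractMv. Qed.
Fact transp1 : transp_act 1 = \1%VF.
Proof. by rewrite /transp_act ract1 comp_lfun1r. Qed.
Definition transp_mod := RMod transp_linear transpM transp1.
Lemma transp_modE x v : ract transp_mod x v = h (ract M x (g v)).
Proof. by rewrite /= /transp_act !comp_lfunE. Qed.
End Transport.

Lemma exists_sub M (U : {vspace M}) : submodule U ->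
  exists N (i : 'Hom(N, M)), [/\ is_hom i, lker i = 0%VS & limg i = U].
Proof.
move=> UM; pose g : 'Hom(subvs_of U, M) := linfun (vsval : subvs_of U -> M).
pose h : 'Hom(M, subvs_of U) := linfun (vsproj U).
have gE v : g v = vsval v by rewrite lfunE.
have hE v : h v = vsproj U v by rewrite lfunE.
have hg : (h \o g)%VF = \1%VF.
  by apply/lfunP=> v; rewrite comp_lfunE gE hE vsvalK id_lfunE.
have gh v : v \in U -> g (h v) = v by move=> vU; rewrite gE hE vsprojK.
have cmp x y v : h (ract M y (g (h (ract M x (g v))))) = h (ract M y (ract M x (g v))).
  by rewrite gh // submoduleP // gE subvsP.
exists (transp_mod hg cmp), g; split.
- by apply: is_homP => x v; rewrite transp_modE gh // submoduleP // gE subvsP.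
- by apply/eqP/lker0P => v w; rewrite !gE => /val_inj.
apply/vspaceP=> v; apply/idP/idP => [/memv_imgP[w _ ->]|vU]; first by rewrite gE subvsP.
by rewrite -(gh v vU) memv_img ?memvf.
Qed.

Lemma exists_quot M (U : {vspace M}) : submodule U ->
  exists N (p : 'Hom(M, N)), [/\ is_hom p, limg p = fullv & lker p = U].
Proof.
(* The quotient is modelled on a complement of [U]. *)
move=> UM; pose C := (U^C)%VS.
have CU : (C :&: U = 0)%VS by rewrite capvC capv_compl.
pose g : 'Hom(subvs_of C, M) := linfun (vsval : subvs_of C -> M).
pose pi := daddv_pi C U.
pose h : 'Hom(M, subvs_of C) := (linfun (vsproj C) \o pi)%VF.
have gE v : g v = vsval v by rewrite lfunE.
have hE v : h v = vsproj C (pi v) by rewrite comp_lfunE lfunE.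
have piC v : pi v \in C := memv_pi _ _ _.
have hg : (h \o g)%VF = \1%VF.
  apply/lfunP=> v; rewrite comp_lfunE gE hE id_lfunE /pi daddv_pi_id ?subvsP //.
  exact: vsvalK.
have gh v : g (h v) = pi v by rewrite gE hE vsprojK.
have kerh v : (h v == 0) = (v \in U).
  have vE : v = pi v + daddv_pi U C v.
    rewrite [RHS](daddv_pi_add CU) //; rewrite -[C]/(U^C)%VS addvC addv_complf memvf.
    by [].
  apply/eqP/idP => [h0|vU].
    by rewrite vE -gh h0 linear0 add0r memv_pi.
  rewrite hE (_ : pi v = 0) ?linear0 //.
  have piU : pi v \in U by rewrite -[pi v](addrK (daddv_pi U C v)) -vE memvB ?memv_pi.
  by apply/eqP; rewrite -memv0 -CU memv_cap piU piC.
have cmp' x v : h (ract M x (g (h v))) = h (ract M x v).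
  apply/eqP; rewrite -subr_eq0 -!linearB kerh submoduleP // -kerh linearB /=.
  by rewrite -[h (g _)]comp_lfunE hg id_lfunE subrr.
have cmp x y v := cmp' y (ract M x (g v)).
exists (transp_mod hg cmp), h; split.
- by apply: is_homP => x v; rewrite transp_modE cmp'.
- apply/vspaceP=> v; rewrite memvf; apply/idP.
  by rewrite -[v]id_lfunE -hg comp_lfunE memv_img ?memvf.
by apply/vspaceP=> v; rewrite memv_ker kerh.
Qed.

(** [projective] speaks of surjections only, so both maps are corestricted to the image of [g],
    realised as a module [L]. *)
Lemma projective_lift P M N (g : 'Hom(M, N)) (h : 'Hom(P, N)) :
  projective P -> is_hom g -> is_hom h -> (limg h <= limg g)%VS ->
  exists2 l : 'Hom(P, M), is_hom l & (g \o l)%VF = h.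
Proof.
move=> Pproj gH hH le_img.
have [L [i [iH ik iI]]] := exists_sub (submodule_img gH (@submodule_full M)).
have ik0 : lker i == 0%VS by rewrite ik.
pose r := (i^-1)%VF.
have ri v : r (i v) = v := lker0_lfunK ik0 v.
have ir v : v \in limg g -> i (r v) = v by rewrite -iI; apply: limg_lfunVK.
have rH x v : v \in limg g -> r (ract N x v) = ract L x (r v).
  by move=> vg; rewrite -{1}(ir v vg) -homE // ri.
have gg v : g v \in limg g by rewrite memv_img ?memvf.
have hg v : h v \in limg g by rewrite (subvP le_img) // memv_img ?memvf.
have rgH : is_hom (r \o g)%VF by apply: is_homP => x v; rewrite !comp_lfunE homE // rH.
have rhH : is_hom (r \o h)%VF by apply: is_homP => x v; rewrite !comp_lfunE homE // rH.
have rgI : limg (r \o g)%VF = fullv.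
  apply/vspaceP=> v; rewrite memvf; apply/idP.
  have : i v \in limg g by rewrite -iI memv_img ?memvf.
  case/memv_imgP=> w _ iv; rewrite -(ri v) iv -comp_lfunE; exact: memv_img (memvf _).
have [l lH lE] := Pproj _ _ _ _ rgH rgI rhH.
exists l => //; apply/lfunP=> v; rewrite comp_lfunE.
by have := congr1 i (lfun_congr v lE); rewrite !comp_lfunE !ir.
Qed.

Lemma cover_iso X X' M (d : 'Hom(X, M)) (d' : 'Hom(X', M)) :
  projective X -> projective X' -> is_hom d -> is_hom d' -> limg d = limg d' ->
  superfluous (lker d) -> superfluous (lker d') ->
  exists (f : 'Hom(X, X')) (g : 'Hom(X', X)), [/\ is_hom f, is_hom g,
    (g \o f)%VF = \1%VF, (f \o g)%VF = \1%VF & (d' \o f)%VF = d].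
Proof.
move=> PX PX' dH dH' dI sd sd'.
have surj (X1 X2 : rmod A) (d1 : 'Hom(X1, M)) (d2 : 'Hom(X2, M)) :
    projective X1 -> is_hom d1 -> is_hom d2 -> limg d1 = limg d2 -> superfluous (lker d2) ->
    exists2 f : 'Hom(X1, X2), is_hom f /\ limg f = fullv & (d2 \o f)%VF = d1.
  move=> P1 H1 H2 I12 s2; have [|f fH fE] := projective_lift P1 H2 H1.
    by rewrite I12.
  exists f => //; split=> //; apply: s2; first exact/submodule_img/submodule_full.
  apply/vspaceP=> v; rewrite memvf; apply/idP/memv_addP.
  have : d2 v \in limg d1 by rewrite I12 memv_img ?memvf.
  case/memv_imgP=> w _ dv; exists (f w); first exact: memv_img (memvf _).
  exists (v - f w); last by rewrite addrC subrK.
  by rewrite memv_ker linearB /= dv -fE comp_lfunE subrr.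
have [f [fH fI] fE] := surj _ _ _ _ PX dH dH' dI sd'.
have [g [gH gI] _] := surj _ _ _ _ PX' dH' dH (esym dI) sd.
have dimE : \dim {:X} = \dim {:X'}.
  have := limg_ker_dim g fullv; have := limg_ker_dim f fullv.
  by rewrite fI gI; lia.
have fk : lker f = 0%VS.
  have := limg_ker_dim f fullv; rewrite fI capfv dimE -{2}[\dim {:X'}]add0n => /addIn.
  by move/eqP; rewrite dimv_eq0 => /eqP.
have [h [hH hf fh]] := hom_inverse fH fk fI.
by exists f, h; split.
Qed.

End ModuleBasics.

(** * Modules over an algebra satisfying the axioms [qpa] *)

Section QPA.
Variables (k : fieldType) (A : falgType k) (Vt Ar : finType).
Variables (s t : Ar -> Vt) (e : Vt -> A) (ar : Ar -> A) (dd : Ar -> Ar -> A).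

(* The one-sided half of what is used about a Jacobian algebra: [dd b a] is the
   class of the second cyclic derivative attached to the arrows [a] into and [b]
   out of a vertex. The converse algebra satisfies the same axioms with [s] and
   [t] exchanged. *)
Record qpa : Prop := Qpa {
  q_ee : forall u v, e u * e v = (u == v)%:R *: e u;
  q_e1 : \sum_u e u = 1;
  q_ear : forall a, e (s a) * ar a = ar a;
  q_are : forall a, ar a * e (t a) = ar a;
  q_gen : forall x, exists (c : Vt -> k) (y : Ar -> A),
    x = \sum_u c u *: e u + \sum_a y a * ar a;
  q_nil : exists n, forall w : seq Ar, size w = n -> \prod_(a <- w) ar a = 0;
  q_eps : exists eps : Vt -> A -> k,
    [/\ forall u c x y, eps u (c *: x + y) = c * eps u x + eps u y,
        forall u x y, eps u (x * y) = eps u x * eps u y,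
        forall u v, eps u (e v) = (u == v)%:R &
        forall u a, eps u (ar a) = 0];
  q_ddl : forall a b, e (t b) * dd b a = dd b a;
  q_ddr : forall a b, dd b a * e (s a) = dd b a;
  q_rel : forall b, \sum_(a | t a == s b) dd b a * ar a = 0;
  q_ex : forall u (x : Ar -> A), (forall a, x a * e (s a) = x a) ->
    \sum_(a | t a == u) x a * ar a = 0 ->
    exists2 y : Ar -> A, forall b, y b * e (t b) = y b &
      forall a, t a = u -> x a = \sum_(b | s b == u) y b * dd b a
}.

Hypothesis HA : qpa.
Implicit Types M N X Y P : rmod A.
Local Notation "v '·' x" := (ract _ x v) (at level 39, left associativity).

Lemma e_idem u : e u * e u = e u.
Proof. by rewrite q_ee // eqxx scale1r. Qed.

Definition vsp M u : {vspace M} := limg (ract M (e u)).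

Lemma act_ee M (v : M) u w : v · e u · e w = if u == w then v · e u else 0.
Proof.
rewrite -ractMv q_ee //; case: eqP => _; first by rewrite scale1r.
by rewrite scale0r ract0 zero_lfunE.
Qed.

Lemma mem_vsp M u (v : M) : (v \in vsp M u) = (v · e u == v).
Proof.
apply/idP/eqP => [/memv_imgP[w _ ->]|<-]; first by rewrite act_ee eqxx.
by rewrite memv_img ?memvf.
Qed.

Lemma sum_e M (v : M) : \sum_u v · e u = v.
Proof. by rewrite -ract_sum q_e1 // ract1v. Qed.

Lemma act_ear M (v : M) a : v · e (s a) · ar a = v · ar a.
Proof. by rewrite -ractMv q_ear. Qed.
Lemma act_are M (v : M) a : v · ar a · e (t a) = v · ar a.
Proof. by rewrite -ractMv q_are. Qed.

Definition vpart M (U : {vspace M}) u : {vspace M} := (ract M (e u) @: U)%VS.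

Lemma mem_vpart M (U : {vspace M}) u v : submodule U ->
  (v \in vpart U u) = (v \in U) && (v · e u == v).
Proof.
move=> UM; apply/idP/andP => [/memv_imgP[w wU ->]|[vU /eqP <-]].
  by rewrite act_ee eqxx submoduleP.
by rewrite memv_img.
Qed.

Lemma dim_vparts M (U : {vspace M}) : submodule U ->
  \dim U = (\sum_u \dim (vpart U u))%N.
Proof.
move=> UM; rewrite -dim_sum_indep => [|us usU us0 u].
  congr (\dim _); apply/vspaceP=> v; apply/idP/memv_sumP => [vU|[us usU ->]].
    by exists (fun u => v · e u) => [u _|]; rewrite ?sum_e // memv_img.
  by apply: memv_suml => u _; have := usU u isT; rewrite mem_vpart // => /andP[].
have := congr1 (fun v => v · e u) us0; rewrite linear0 linear_sum (bigD1 u) //=.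
rewrite big1 => [|v vu].
  by have := usU u; rewrite mem_vpart // => /andP[_ /eqP->]; rewrite addr0.
have := usU v; rewrite mem_vpart // => /andP[_ /eqP <-].
by rewrite act_ee (negPf vu).
Qed.

Lemma vpart_img M N (f : 'Hom(M, N)) (U : {vspace M}) u : is_hom f ->
  vpart (f @: U)%VS u = (f @: vpart U u)%VS.
Proof. by move=> fH; rewrite /vpart -!limg_comp fH. Qed.

Lemma dim_vpart_hom M N (f : 'Hom(M, N)) (U : {vspace M}) u : is_hom f -> submodule U ->
  (\dim (vpart (U :&: lker f)%VS u) + \dim (vpart (f @: U)%VS u))%N = \dim (vpart U u).
Proof.
move=> fH UM; rewrite vpart_img // -(limg_ker_dim f (vpart U u)); congr (\dim _ + _)%N.
apply/vspaceP=> v; rewrite mem_vpart; last exact/submodule_cap/submodule_ker.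
by rewrite !memv_cap mem_vpart // andbAC.
Qed.

Lemma vpartS M (U V : {vspace M}) u : (U <= V)%VS -> (vpart U u <= vpart V u)%VS.
Proof. exact: limgS. Qed.

Lemma prod_word_cons a (w : seq Ar) :
  ar a * \prod_(b <- w) ar b = \prod_(b <- a :: w) ar b.
Proof. by rewrite big_cons. Qed.

(** The left ideal generated by the words of length [n]. *)
Inductive left_words n : A -> Prop :=
| left_words0 : left_words n 0
| left_wordsD y (w : seq Ar) x : size w = n -> left_words n x ->
    left_words n (y * \prod_(a <- w) ar a + x).

Lemma left_words_add n x y : left_words n x -> left_words n y -> left_words n (x + y).
Proof.
elim=> [|z w x' sw _ IH] wy; first by rewrite add0r.
by rewrite -addrA; apply: left_wordsD => //; apply: IH.
Qed.

Lemma left_words_sum n (I : Type) (r : seq I) (F : I -> A) :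
  (forall i, left_words n (F i)) -> left_words n (\sum_(i <- r) F i).
Proof.
move=> wF; elim/big_rec: _ => [|i x _ IH]; first exact: left_words0.
exact: left_words_add.
Qed.

(** Iterating [q_gen] writes every element, modulo the left ideal of the words of length n, as an
    expression in idempotents and arrows; by [q_nil] that ideal vanishes for some n. It serves as an
    induction principle that reduces statements on the algebra to its generators. *)
Lemma word_gen (P : A -> Prop) : (forall u, P (e u)) -> (forall a, P (ar a)) ->
  (forall c x y, P x -> P y -> P (c *: x + y)) -> (forall x y, P x -> P y -> P (x * y)) ->
  forall x, P x.
Proof.
move=> Pe Pa PD PM.
(* Without vertices the sum of the idempotents would give 1 = 0. *)
have P0 : P 0.
  have [u _|V0] := pickP (fun _ : Vt => true).
    by have := PD (-1) _ _ (Pe u) (Pe u); rewrite scaleN1r addNr.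
  by have := q_e1 HA; rewrite big_pred0 // => /esym/eqP; rewrite oner_eq0.
have Padd x y : P x -> P y -> P (x + y).
  by move=> Px Py; rewrite -[x]scale1r; apply: PD.
have PZ c x : P x -> P (c *: x) by move=> Px; rewrite -[_ *: _]addr0; apply: PD.
have Psum (I : Type) (r : seq I) (F : I -> A) : (forall i, P (F i)) -> P (\sum_(i <- r) F i).
  by move=> PF; elim/big_rec: _ => // i x _; apply: Padd.
have P1 : P 1 by rewrite -(q_e1 HA); apply: Psum.
have Pw (w : seq Ar) : P (\prod_(a <- w) ar a).
  by elim/big_rec: _ => // a x _; apply: PM.
have main n x : exists2 z, P z & left_words n (x - z).
  elim: n => [|n [z Pz]].
    exists 0 => //; rewrite subr0 -[x]addr0 -{1}[x]mulr1.
    have -> : 1 = \prod_(a <- [::]) ar a by rewrite big_nil.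
    by apply: left_wordsD => //; apply: left_words0.
  rewrite -{2}[x](subrK z); move: (x - z) => y wy.
  suff [z' Pz' wz'] : exists2 z', P z' & left_words n.+1 (y - z').
    by exists (z' + z); [apply: Padd | rewrite opprD addrACA subrr addr0].
  elim: wy => {x z Pz y} [|y w x sw _ [z Pz IH]].
    by exists 0 => //; rewrite subr0; apply: left_words0.
  have [c [yy ->]] := q_gen HA y.
  exists ((\sum_u c u *: e u) * (\prod_(a <- w) ar a) + z).
    by apply: Padd => //; apply: PM => //; apply: Psum => u; apply: PZ.
  have aux (p q x' z' : A) : p + q + x' - (p + z') = q + (x' - z').
    by rewrite opprD addrACA [p + q]addrC addrK.
  rewrite mulrDl aux; apply: left_words_add => //; rewrite mulr_suml.
  apply: left_words_sum => a; rewrite -mulrA prod_word_cons -[_ * _]addr0.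
  by apply: left_wordsD; [rewrite /= sw | apply: left_words0].
move=> x; have [n nil] := q_nil HA; have [z Pz wz] := main n x.
suff x0 : x - z = 0 by rewrite -[x](subrK z) x0 add0r.
by elim: wz => // y w x' sw _ ->; rewrite nil // mulr0 addr0.
Qed.

Definition radv M (U : {vspace M}) : {vspace M} := (\sum_a ract M (ar a) @: U)%VS.

Lemma radvS M (U V : {vspace M}) : (U <= V)%VS -> (radv U <= radv V)%VS.
Proof.
move=> UV; apply/subv_sumP => a _; apply: subv_trans (sumv_sup a _ (subvv _)) => //.
exact: limgS.
Qed.

(** Substituting the hypothesis into itself gives K inside U + rad^n K for every n, and rad^n K
    vanishes once all words of length n do. *)
Lemma nakayama_lemma M (U K : {vspace M}) : submodule U ->
  (K <= U + radv K)%VS -> (K <= U)%VS.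
Proof.
move=> UM KU.
have radU : (radv U <= U)%VS by apply/subv_sumP => a _; apply: UM.
have radD (V V' : {vspace M}) : (radv (V + V') <= radv V + radv V')%VS.
  apply/subv_sumP => a _; rewrite limgD; apply: addvS;
  exact: (sumv_sup a _ (subvv _)).
have Kn n : (K <= U + iter n (@radv M) K)%VS.
  elim: n => [|n IH]; first exact: addvSr.
  apply: (subv_trans KU); rewrite subv_add addvSl /=.
  apply: (subv_trans (radvS IH)); apply: (subv_trans (radD _ _)).
  by apply: addvS.
have [N nil] := q_nil HA.
(* An element of rad^n K is killed by the words of length N - n; at n = N the empty word shows that
   it is zero. *)
have wK n v (w : seq Ar) : v \in iter n (@radv M) K -> (size w + n)%N = N ->
    v · \prod_(a <- w) ar a = 0.
  elim: n v w => [|n IH] v w /=; first by rewrite addn0 => _ /nil ->; rewrite ract0 zero_lfunE.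
  move=> /memv_sumP[us usK ->] sw; rewrite linear_sum big1 //= => a _.
  have /memv_imgP[v' v'K ->] := usK a isT.
  by rewrite -ractMv prod_word_cons IH //= addSnnS.
apply: (subv_trans (Kn N)); rewrite subv_add subvv /=; apply/subvP=> v vK.
by have := wK _ _ [::] vK (add0n N); rewrite big_nil ract1v => ->; apply: mem0v.
Qed.

Lemma superfluous_rad M (K : {vspace M}) : (K <= radv fullv)%VS -> superfluous K.
Proof.
move=> Krad U UM UK; apply/eqP; rewrite eqEsubv subvf.
by apply: nakayama_lemma => //; rewrite -{1}UK addvS.
Qed.

Lemma is_hom_gen M N (f : 'Hom(M, N)) : (forall u v, f (v · e u) = f v · e u) ->
  (forall a v, f (v · ar a) = f v · ar a) -> is_hom f.
Proof.
move=> fe fa; apply: is_homP; apply: word_gen => // [c x y fx fy v|x y fx fy v].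
  by rewrite !ractDv !ractZv linearD linearZ /= fx fy.
by rewrite !ractMv fy fx.
Qed.

(** * Free modules *)

(** [x] exhibits [X] as the direct sum of the e (u i) A. A coefficient [r i] matters only through e
    (u i) * r i, whence the form of the last clause. *)
Definition free_on X (I : finType) (u : I -> Vt) (x : I -> X) : Prop :=
  [/\ forall i, x i · e (u i) = x i,
      forall z, exists r : I -> A, z = \sum_i x i · r i &
      forall r : I -> A, \sum_i x i · r i = 0 -> forall i, e (u i) * r i = 0].

Section FreeOn.
Variables (X : rmod A) (I : finType) (u : I -> Vt) (x : I -> X).
Hypothesis fr : free_on u x.

Lemma free_homP N (n : I -> N) : (forall i, n i · e (u i) = n i) ->
  exists f : 'Hom(X, N), is_hom f /\ forall i, f (x i) = n i.
Proof.
move=> ne; have [xe gen ind] := fr.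
have wd r r' : \sum_i x i · r i = \sum_i x i · r' i ->
    \sum_i n i · r i = \sum_i n i · r' i.
  move=> /eqP; rewrite -subr_eq0 -sumrB => /eqP E.
  have /ind E0 : \sum_i x i · (r i - r' i) = 0.
    by rewrite -[RHS]E; apply: eq_bigr => i _; rewrite ractDv ractNv.
  apply: eq_bigr => i _; rewrite -{1}(ne i) -ractMv -[in RHS](ne i) -ractMv.
  by congr (_ · _); apply/eqP; rewrite -subr_eq0 -mulrBr E0.
have [r rE] := choice gen.
have Flin : linear (fun z => \sum_i n i · r z i).
  move=> c z w; rewrite scaler_sumr -big_split /=.
  have -> : \sum_i (c *: n i · r z i + n i · r w i) =
      \sum_i n i · (c *: r z i + r w i).
    by apply: eq_bigr => i _; rewrite ractDv ractZv.
  apply: wd; rewrite -rE {1}(rE z) {1}(rE w) scaler_sumr -big_split /=.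
  by apply: eq_bigr => i _; rewrite ractDv ractZv.
exists (hom_of Flin); split.
  apply: is_homP => a z; rewrite !hom_ofE linear_sum /=.
  under [RHS]eq_bigr => i _ do rewrite -ractMv.
  apply: wd; rewrite -rE {1}(rE z) linear_sum /=.
  by apply: eq_bigr => i _; rewrite -ractMv.
move=> i; rewrite hom_ofE (wd _ (fun j => if j == i then e (u i) else 0)).
  rewrite (bigD1 i) //= eqxx ne big1 ?addr0 // => j /negPf->.
  by rewrite ract0 zero_lfunE.
rewrite -rE (bigD1 i) //= eqxx xe big1 ?addr0 // => j /negPf->.
by rewrite ract0 zero_lfunE.
Qed.

Lemma free_ext N (f g : 'Hom(X, N)) : is_hom f -> is_hom g ->
  (forall i, f (x i) = g (x i)) -> f = g.
Proof.
move=> fH gH fg; have [_ gen _] := fr; apply/lfunP=> z; have [r ->] := gen z.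
by rewrite !linear_sum /=; apply: eq_bigr => i _; rewrite !homE // fg.
Qed.

Lemma free_projective : projective X.
Proof.
move=> M N g h gH gI hH; have [xe gen ind] := fr.
have /choice[m mE] i : exists m, g m = h (x i) /\ m · e (u i) = m.
  have : h (x i) \in limg g by rewrite gI memvf.
  case/memv_imgP=> m _ hm; exists (m · e (u i)).
  by rewrite homE // -hm -homE // xe act_ee eqxx.
have [i|l [lH lE]] := @free_homP M m; first by case: (mE i).
exists l => //; apply: free_ext => //; first exact: is_hom_comp.
by move=> i; rewrite comp_lfunE lE; case: (mE i).
Qed.

(** Evaluation at the generators identifies the maps killed by [g] with families in the parts of ker
    g at the vertices [u i]. *)
Lemma dim_free_hom N N' (g : 'Hom(N, N')) : is_hom g ->
  \dim (hom_space X N :&: lker (postc X g)) = (\sum_i \dim (vpart (lker g) (u i)))%N.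
Proof.
move=> gH; have [xe gen ind] := fr; rewrite -dim_ffunsp.
have evlin : linear (fun h : 'Hom(X, N) => [ffun i => h (x i)]).
  by move=> c h h'; apply/ffunP => i; rewrite !ffunE add_lfunE scale_lfunE.
pose ev := hom_of evlin.
have evE h i : ev h i = h (x i) by rewrite hom_ofE ffunE.
have kerP h : (h \in (hom_space X N :&: lker (postc X g))%VS) <->
    is_hom h /\ (g \o h)%VF = 0.
  rewrite memv_cap memv_ker postcE; split.
    by move=> /andP[/hom_spaceP hH /eqP].
  by case=> hH ->; rewrite eqxx andbT; apply/hom_spaceP.
rewrite -(@dim_limg_inj _ _ _ ev); last first.
  move=> h /kerP[hH _] eh; apply: free_ext => //; first exact: is_hom0.
  by move=> i; rewrite -evE eh ffunE zero_lfunE.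
congr (\dim _); apply/vspaceP=> n; apply/memv_imgP/mem_ffunsp.
  move=> [h /kerP[hH gh] ->] i; rewrite evE mem_vpart; last exact: submodule_ker.
  by rewrite memv_ker -homE // xe eqxx -comp_lfunE gh zero_lfunE eqxx.
move=> nP; have nE i : g (n i) = 0 /\ n i · e (u i) = n i.
  have := nP i; rewrite mem_vpart; last exact: submodule_ker.
  by rewrite memv_ker => /andP[/eqP ? /eqP ?].
have [i|h [hH hE]] := @free_homP N n; first by case: (nE i).
exists h; last by apply/ffunP=> i; rewrite evE hE.
apply/kerP; split=> //; apply: free_ext.
- exact: is_hom_comp.
- exact: is_hom0.
by move=> i; rewrite comp_lfunE hE zero_lfunE; case: (nE i).
Qed.

Lemma dim_hom_free N : \dim (hom_space X N) = (\sum_i \dim (vsp N (u i)))%N.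
Proof.
have := dim_free_hom (@is_hom0 _ _ N N).
have -> : lker (0 : 'Hom(N, N)) = fullv.
  by apply/vspaceP=> v; rewrite memv_ker zero_lfunE eqxx memvf.
rewrite -/(vsp _ _) => <-; congr (\dim _); apply/esym/capv_idPl.
by apply/subvP=> h _; rewrite memv_ker postcE comp_lfun0l.
Qed.

Lemma free_reindex (J : finType) (f : J -> I) : bijective f -> free_on (u \o f) (x \o f).
Proof.
move=> [g fK gK]; have [xe gen ind] := fr; split=> [j|z|r r0 j] /=; first exact: xe.
  have [r ->] := gen z; exists (r \o f); rewrite (reindex f) //=.
  by exists g => ? _.
have E : \sum_i x i · r (g i) = 0.
  rewrite (reindex f) /=; last by exists g => ? _.
  by rewrite -[RHS]r0; apply: eq_bigr => i _; rewrite fK.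
by have := ind (r \o g) E (f j); rewrite /= fK.
Qed.

Lemma free_iso Y (f : 'Hom(X, Y)) (g : 'Hom(Y, X)) : is_hom f -> is_hom g ->
  (g \o f)%VF = \1%VF -> (f \o g)%VF = \1%VF -> free_on u (f \o x).
Proof.
move=> fH gH gf fg; have [xe gen ind] := fr.
have fgE v : f (g v) = v by rewrite -comp_lfunE fg id_lfunE.
have gfE v : g (f v) = v by rewrite -comp_lfunE gf id_lfunE.
split=> [i|z|r r0 i] /=; first by rewrite -homE // xe.
  have [r rE] := gen (g z); exists r; rewrite -[z in LHS]fgE rE linear_sum /=.
  by apply: eq_bigr => i _; rewrite homE.
have E : f (\sum_i x i · r i) = 0.
  by rewrite linear_sum -[RHS]r0; apply: eq_bigr => j _ /=; rewrite homE.
by apply: ind => //; rewrite -[LHS]gfE E linear0.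
Qed.

End FreeOn.

(** Cut out of the module A^I as the families with entry i in e (u i) A. *)
Lemma exists_free (I : finType) (u : I -> Vt) : exists X (x : I -> X), free_on u x.
Proof.
have mlin (a : A) : linear (fun f : {ffun I -> A} => [ffun i => f i * a]).
  by move=> c f g; apply/ffunP => i; rewrite !ffunE mulrDl scalerAl.
have mE a f i : hom_of (mlin a) f i = f i * a by rewrite hom_ofE ffunE.
have F1 c a b : hom_of (mlin (c *: a + b)) = c *: hom_of (mlin a) + hom_of (mlin b).
  apply/lfunP=> f; apply/ffunP=> i; rewrite add_lfunE scale_lfunE !ffunE !mE.
  by rewrite mulrDr scalerAr.
have F2 a b : hom_of (mlin (a * b)) = (hom_of (mlin b) \o hom_of (mlin a))%VF.
  by apply/lfunP=> f; apply/ffunP=> i; rewrite comp_lfunE !mE mulrA.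
have F3 : hom_of (mlin 1) = \1%VF.
  by apply/lfunP=> f; apply/ffunP=> i; rewrite id_lfunE mE mulr1.
pose F := RMod F1 F2 F3.
have FE (f : F) a i : (f · a : {ffun I -> A}) i = (f : {ffun I -> A}) i * a by rewrite /= mE.
pose U : {vspace F} := ffunsp (fun i => limg (amull (e (u i)))).
have UP (f : F) : reflect (forall i, e (u i) * (f : {ffun I -> A}) i = (f : {ffun I -> A}) i) (f \in U).
  apply: (iffP (mem_ffunsp _ _)) => fU i.
    by have /memv_imgP[a _ ->] := fU i; rewrite lfunE /= mulrA e_idem.
  by rewrite -fU -[_ * _](lfunE (e (u i) \*o idfun)) memv_img ?memvf.
have UM : submodule U.
  move=> a; apply/subvP=> _ /memv_imgP[f /UP fU ->]; apply/UP=> i.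
  by rewrite FE mulrA fU.
have [X [j [jH jk jI]]] := exists_sub UM.
pose d i : F := [ffun l => if l == i then e (u i) else 0].
have /choice[x xE] i : exists x, j x = d i.
  have : d i \in limg j.
    rewrite jI; apply/UP => l; rewrite !ffunE; case: eqP => [->|_]; rewrite ?mulr0 //.
    exact: e_idem.
  by case/memv_imgP=> x _ ->; exists x.
have jinj : injective j by apply/lker0P; rewrite jk.
have sumE (r : I -> A) i : (j (\sum_i x i · r i) : {ffun I -> A}) i = e (u i) * r i.
  rewrite linear_sum /= sum_ffunE (bigD1 i) //= (homE _ _ jH) FE xE ffunE eqxx.
  rewrite big1 ?addr0 // => l li; rewrite (homE _ _ jH) FE xE ffunE eq_sym (negPf li).
  by rewrite mul0r.
exists X, x; split=> [i|z|r r0 i].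
- apply: jinj; rewrite (homE _ _ jH) xE; apply/ffunP=> l; rewrite FE !ffunE.
  by case: ifP; rewrite ?mul0r // => _; rewrite e_idem.
- exists (fun i => (j z : {ffun I -> A}) i); apply: jinj; apply/ffunP=> i.
  rewrite sumE; have : j z \in U by rewrite -jI memv_img ?memvf.
  by move/UP->.
by rewrite -sumE r0 linear0 ffunE.
Qed.

End QPA.

Lemma sum_tagged (I : finType) (b : I -> nat) (F : I -> nat) :
  (\sum_(i : {v : I & 'I_(b v)}) F (tag i) = \sum_v b v * F v)%N.
Proof.
rewrite -(@sig_big_dep _ _ _ I (fun v => 'I_(b v)) predT (fun _ _ => true) (fun v _ => F v)) /=.
by apply: eq_bigr => v _; rewrite sum_nat_const card_ord.
Qed.

Section QPA3.
Variables (k : fieldType) (A : falgType k) (Vt Ar : finType).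
Variables (s t : Ar -> Vt) (e : Vt -> A) (ar : Ar -> A) (dd : Ar -> Ar -> A).
Hypothesis HA : qpa s t e ar dd.
Implicit Types M N X Y P F : rmod A.
Local Notation "v '·' x" := (ract _ x v) (at level 39, left associativity).
Local Notation vsp := (vsp e).
Local Notation vpart := (vpart e).
Local Notation free_on := (free_on e).
Local Notation radv := (radv ar).

(** [X] is isomorphic to P(b), expressed by generators in place of a decomposition into projective
    covers of simples. *)
Definition freeb (b : Vt -> nat) X : Prop :=
  exists x : {v : Vt & 'I_(b v)} -> X, free_on (fun i => tag i) x.

Lemma free_freeb X (I : finType) (u : I -> Vt) (x : I -> X) : free_on u x ->
  freeb (fun v => #|[pred i | u i == v]|) X.
Proof.
move=> fr; pose A_ v := [pred i | u i == v].
pose f (p : {v : Vt & 'I_(#|A_ v|)}) : I := enum_val (tagged p).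
have uf p : u (f p) = tag p by apply/eqP; have := enum_valP (tagged p).
have finj : injective f.
  move=> [v i] [w j] fE; have vw : v = w by rewrite -[v]/(tag (existT (fun v => 'I_(#|A_ v|)) v i)) -uf fE uf.
  subst w; congr (existT _ v _); exact: enum_val_inj fE.
have /choice[g gP] i : exists p, f p = i.
  have iA : i \in A_ (u i) by rewrite inE /=.
  by exists (existT _ (u i) (enum_rank_in iA i)); rewrite /f /= enum_rankK_in.
have bf : bijective f by exists g => // p; apply: finj; rewrite gP.
have := free_reindex fr bf.
have -> : u \o f = (fun p => tag p) by apply/funext => p /=; rewrite uf.
by exists (x \o f).
Qed.

Lemma exists_freeb b : exists X, freeb b X.
Proof. by have [X [x fr]] := exists_free HA (fun i : {v : Vt & 'I_(b v)} => tag i); exists X, x. Qed.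

Lemma freeb_projective b X : freeb b X -> projective X.
Proof. by case=> x fr; have := free_projective HA fr. Qed.

Lemma freeb_iso b X Y (f : 'Hom(X, Y)) (g : 'Hom(Y, X)) : is_hom f -> is_hom g ->
  (g \o f)%VF = \1%VF -> (f \o g)%VF = \1%VF -> freeb b X -> freeb b Y.
Proof. by move=> fH gH gf fg [x fr]; exists (f \o x); exact: (free_iso fr fH gH gf fg). Qed.

Lemma freeb_unique_iso b X Y : freeb b X -> freeb b Y ->
  exists (f : 'Hom(X, Y)) (g : 'Hom(Y, X)), [/\ is_hom f, is_hom g,
    (g \o f)%VF = \1%VF & (f \o g)%VF = \1%VF].
Proof.
move=> [x frx] [y fry]; have [xe _ _] := frx; have [ye _ _] := fry.
have [f [fH fE]] := free_homP frx ye; have [g [gH gE]] := free_homP fry xe.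
exists f, g; split=> //.
  apply: (free_ext frx); [exact: is_hom_comp | exact: is_hom_id |] => i.
  by rewrite comp_lfunE fE gE id_lfunE.
apply: (free_ext fry); [exact: is_hom_comp | exact: is_hom_id |] => i.
by rewrite comp_lfunE gE fE id_lfunE.
Qed.

Lemma dim_freeb_ker b X N N' (g : 'Hom(N, N')) : freeb b X -> is_hom g ->
  \dim (hom_space X N :&: lker (postc X g)) = (\sum_v b v * \dim (vpart (lker g) v))%N.
Proof.
case=> x fr gH; rewrite (dim_free_hom HA fr gH).
exact: (sum_tagged b (fun v => \dim (vpart (lker g) v))).
Qed.

Lemma dim_freeb_hom b X N : freeb b X ->
  \dim (hom_space X N) = (\sum_v b v * \dim (vsp N v))%N.
Proof.
case=> x fr; rewrite (dim_hom_free HA fr).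
exact: (sum_tagged b (fun v => \dim (vsp N v))).
Qed.

Definition gsimple u N : Prop :=
  [/\ \dim {:N} = 1%N, ract N (e u) = \1%VF & forall a, ract N (ar a) = 0].

(** The character [eps u] of the algebra defines a one-dimensional module. *)
Lemma exists_simple u : exists N, gsimple u N.
Proof.
have [eps [epsL epsM epse epsa]] := q_eps HA.
have eps1 : eps u 1 = 1.
  rewrite -(q_e1 HA); have -> : forall F : Vt -> A, eps u (\sum_v F v) = \sum_v eps u (F v).
    move=> F; apply: (big_morph (eps u)) => [x y|].
      by rewrite -[x in LHS]scale1r epsL mul1r.
    by have := epsL u (-1) 0 0; rewrite scaler0 addr0 mulN1r addNr.
  by rewrite (bigD1 u) //= epse eqxx big1 ?addr0 // => v; rewrite epse eq_sym => /negPf->.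
pose act x : 'End(k^o) := eps u x *: \1%VF.
have F1 (c : k) x y : act (c *: x + y) = c *: act x + act y.
  by rewrite /act epsL scalerDl scalerA.
have F2 x y : act (x * y) = (act y \o act x)%VF.
  by rewrite /act epsM -comp_lfunZl -comp_lfunZr comp_lfun1l scalerA mulrC.
have F3 : act 1 = \1%VF by rewrite /act eps1 scale1r.
exists (RMod F1 F2 F3); split=> /= [||a]; first by rewrite dimvf.
  by rewrite /act epse eqxx scale1r.
by rewrite /act epsa scale0r.
Qed.

Lemma dim_vsp_simple u N v : gsimple u N -> \dim (vsp N v) = (v == u).
Proof.
case=> dN eN aN; case: (eqVneq v u) => [->|vu]; first by rewrite /vsp eN lim1g.
have : ract N (e u * e v) = 0 by rewrite (q_ee HA) eq_sym (negPf vu) scale0r ract0.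
rewrite ractM eN comp_lfun1r /vsp => ->.
by rewrite lim0g dimv0.
Qed.

(** The multiplicity at u is the dimension of Hom(X, S_u). *)
Lemma freeb_inj b b' X : freeb b X -> freeb b' X -> b = b'.
Proof.
move=> fb fb'; apply/funext=> u; have [N sN] := exists_simple u.
have cnt c : freeb c X -> \dim (hom_space X N) = c u.
  move=> /(dim_freeb_hom N) ->; rewrite (bigD1 u) //= (dim_vsp_simple _ sN) eqxx muln1.
  by rewrite big1 ?addn0 // => v /negPf vu; rewrite (dim_vsp_simple _ sN) vu muln0.
by rewrite -(cnt b) // -(cnt b').
Qed.

(** * Projective covers *)

(** For a submodule [K] this is the part at [u] of its radical; accordingly [topd] is the
    multiplicity of S_u in the top of [K], and of P_u in its projective cover. *)
Definition radu M (K : {vspace M}) u : {vspace M} := (\sum_(a | t a == u) ract M (ar a) @: K)%VS.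
Definition topd M (K : {vspace M}) u : nat := (\dim (vpart K u) - \dim (radu K u))%N.

Lemma radu_sub M (K : {vspace M}) u : submodule K -> (radu K u <= vpart K u)%VS.
Proof.
move=> KM; apply/subv_sumP => a /eqP <-; apply/subvP=> _ /memv_imgP[v vK ->].
by rewrite (mem_vpart HA) // submoduleP // (act_are HA) eqxx.
Qed.

Lemma radu_img M N (f : 'Hom(M, N)) (K : {vspace M}) u : is_hom f ->
  radu (f @: K)%VS u = (f @: radu K u)%VS.
Proof.
move=> fH; rewrite limg_sum; apply: eq_bigr => a _.
by rewrite -!limg_comp fH.
Qed.

(** Free generators are sent to lifts of a basis of the top of [K]. Nakayama's lemma gives
    surjectivity, and the kernel lies in the radical because these lifts are independent modulo the
    radical of [K]. *)
Lemma exists_cover M (K : {vspace M}) : submodule K ->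
  exists X (d : 'Hom(X, M)), [/\ freeb (topd K) X, is_hom d, limg d = K & superfluous (lker d)].
Proof.
move=> KM; pose U u := (vpart K u :\: radu K u)%VS.
have dimU u : \dim (U u) = topd K u.
  rewrite /topd -(dimv_cap_compl (vpart K u) (radu K u)).
  by rewrite (capv_idPr (radu_sub u KM)) addKn.
pose I := {u : Vt & 'I_(\dim (U u))}.
pose m (i : I) : M := (vbasis (U (tag i)))`_(tagged i).
have mU i : m i \in U (tag i) by rewrite vbasis_mem // mem_nth // size_tuple.
have UK u v : v \in U u -> v \in K /\ v · e u = v.
  move=> vU; have : v \in vpart K u := subvP (diffvSl _ _) _ vU.
  by rewrite (mem_vpart HA) // => /andP[? /eqP].
have mK i : m i \in K by case: (UK _ _ (mU i)).
have me i : m i · e (tag i) = m i by case: (UK _ _ (mU i)).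
have [X [x fr]] := exists_free HA (fun i : I => tag i).
have [d [dH dE]] := free_homP fr me.
have [xe gen ind] := fr.
have dK z : d z \in K.
  have [r ->] := gen z; rewrite linear_sum; apply: memv_suml => i _ /=.
  by rewrite homE // dE submoduleP.
have dI : limg d = K.
  apply/eqP; rewrite eqEsubv; apply/andP; split.
    by apply/subvP=> _ /memv_imgP[z _ ->].
  have dM := submodule_img dH (@submodule_full _ _ X).
  apply: (nakayama_lemma HA dM); apply/subvP => v vK.
  rewrite -(sum_e HA v); apply: memv_suml => u _.
  have : v · e u \in vpart K u by rewrite memv_img.
  rewrite -(addv_diff_cap (vpart K u) (radu K u)) => /memv_addP[w wU [w' + ->]].
  rewrite memv_cap => /andP[_ w'R]; apply: memv_add.
    rewrite (coord_vbasis wU); apply: memv_suml => j _; apply: memvZ.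
    have -> : (vbasis (vpart K u :\: radu K u))`_j = m (existT _ u j) by [].
    by rewrite -dE memv_img ?memvf.
  apply: (subvP _ _ w'R); apply/subv_sumP => a _.
  exact: (sumv_sup a _ (subvv _)).
exists X, d; split=> //.
  have [f bE] : exists f : topd K = fun u => \dim (U u), True.
    by have h : topd K = fun u => \dim (U u) by apply/funext=> u; rewrite dimU.
  by rewrite f; exists x.
apply: (superfluous_rad HA); apply/subvP=> z; rewrite memv_ker => /eqP dz.
have [r zE] := gen z.
(* Each coefficient splits into a part on the idempotents and a part in the left ideal of the
   arrows; only the scalar [c i] at the vertex of generator i could keep [z] out of the radical. *)
have /choice[cy cyE] i : exists cy : (Vt -> k) * (Ar -> A),
    r i = \sum_u cy.1 u *: e u + \sum_a cy.2 a * ar a.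
  by have [c [y ->]] := q_gen HA (r i); exists (c, y).
pose c i := (cy i).1 (tag i); pose y i := (cy i).2.
pose rho := \sum_i \sum_a x i · y i a · ar a.
have zE' : z = \sum_i c i *: x i + rho.
  rewrite zE -big_split /=; apply: eq_bigr => i _; rewrite cyE ractDv !ract_sum.
  congr (_ + _); last by apply: eq_bigr => a _; rewrite ractMv.
  rewrite (bigD1 (tag i)) //= ractZv xe big1 ?addr0 // => u ui.
  by rewrite ractZv -(xe i) (act_ee HA) eq_sym (negPf ui) scaler0.
have rhoR : rho \in radv fullv.
  apply: memv_suml => i _; apply: memv_sumr => a _.
  by rewrite memv_img ?memvf.
suff c0 i : c i = 0.
  by rewrite zE' big1 ?add0r // => i _; rewrite c0 scale0r.
have cm0 : \sum_i c i *: m i + \sum_i \sum_a m i · y i a · ar a = 0.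
  rewrite -[RHS]dz zE' linearD /rho !linear_sum /=; congr (_ + _).
    by apply: eq_bigr => j _; rewrite linearZ /= dE.
  apply: eq_bigr => j _; rewrite linear_sum; apply: eq_bigr => a _ /=.
  by rewrite !(homE _ _ dH) dE.
(* [S] lies in the chosen complement by construction and in the radical by the relation [cm0], hence
   is zero; its coefficients vanish by freeness of the basis. *)
pose w := tag i; pose S := \sum_(j | tag j == w) c j *: m j.
have S1 : S \in U w by apply: memv_suml => j /eqP <-; apply: memvZ.
have S2 : S \in radu K w.
  have SE : S = \sum_j (c j *: m j) · e w.
    rewrite /S big_mkcond; apply: eq_bigr => j _.
    rewrite linearZ /= -[m j in RHS](me j) (act_ee HA) me.
    by case: ifP; rewrite ?scaler0.
  have := congr1 (fun v => v · e w) cm0; rewrite linear0 linearD !linear_sum /= -SE.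
  move/eqP; rewrite addr_eq0 => /eqP ->; rewrite memvN; apply: memv_suml => j _.
  rewrite linear_sum; apply: memv_suml => a _ /=.
  rewrite -(act_are HA) (act_ee HA); case: eqP => [aw|_]; last exact: mem0v.
  rewrite (act_are HA); apply: (subvP (sumv_sup a _ (subvv _))); first by rewrite aw.
  by rewrite memv_img // submoduleP.
have S0 : S = 0.
  by apply/eqP; rewrite -memv0 -(capv_diff (vpart K w) (radu K w)) memv_cap S1 S2.
have S0' : \sum_(j < \dim (U w)) c (existT _ w j) *: (vbasis (U w))`_j = 0.
  rewrite -[RHS]S0 /S; have := @sig_big_dep _ 0 +%R Vt (fun u => 'I_(\dim (U u))) (pred1 w)
    (fun _ _ => true) (fun u j => c (existT _ u j) *: m (existT _ u j)).
  rewrite big_pred1_eq /= => E; apply: (etrans E).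
  by apply: eq_big => [[u j]|[u j] _] //=; rewrite andbT.
have /freeP fU : free (vbasis (U w)) := basis_free (vbasisP _).
case: i @w S S1 S2 S0 S0' fU => w i /= _ _ _ _ S0' fU.
exact: fU (fun j => c (existT _ w j)) S0' i.
Qed.

(** The identity of a projective module is a projective cover, to be compared with the one built by
    [exists_cover]. *)
Lemma proj_freeb X : projective X -> freeb (topd (fullv : {vspace X})) X.
Proof.
move=> PX; have [F [d [fF dH dI sd]]] := exists_cover (@submodule_full _ _ X).
have [||f [g [fH gH gf fg _]]] := cover_iso (freeb_projective fF) PX dH (is_hom_id X) _ sd.
- by rewrite dI lim1g.
- move=> U _; rewrite (_ : lker _ = 0%VS) ?addv0 //.
  by apply/eqP/lker0P => v w; rewrite !id_lfunE.
exact: freeb_iso fH gH gf fg fF.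
Qed.

Lemma freeb_topd b X : freeb b X -> topd (fullv : {vspace X}) = b.
Proof. by move=> fX; apply: (freeb_inj _ fX); exact/proj_freeb/(freeb_projective fX). Qed.

(** A homomorphism maps the radical onto the radical of its image, so the top of the image is a
    quotient of the top of [X]. *)
Lemma surj_topd X M (d : 'Hom(X, M)) u : is_hom d ->
  (topd (limg d) u <= topd (fullv : {vspace X}) u)%N.
Proof.
move=> dH; rewrite /topd vpart_img // radu_img //.
have := dim_limg_sub d (radu_sub u (@submodule_full _ _ X)).
have := dimvS (radu_sub u (@submodule_full _ _ X)).
have := dimvS (limgS d (radu_sub u (@submodule_full _ _ X))).
lia.
Qed.

Lemma cover_freeb X M (d : 'Hom(X, M)) : projective X -> is_hom d ->
  superfluous (lker d) -> freeb (topd (limg d)) X.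
Proof.
move=> PX dH sd.
have [F [d' [fF d'H d'I sd']]] := exists_cover (submodule_img dH (@submodule_full _ _ X)).
have [f [g [fH gH gf fg _]]] := cover_iso (freeb_projective fF) PX d'H dH d'I sd' sd.
exact: freeb_iso fH gH gf fg fF.
Qed.

(** * Weights of presentations *)

Definition indim M u : nat := (\sum_(a | t a == u) \dim (vsp M (s a)))%N.

(** [gamma] is the map M_out -> M_in and [alpha] the map M_in -> M of the triangle at u used in
    mutations of quivers with potential. Here [gamma] is defined on all families of vectors of [M];
    as [dd b a] absorbs e (t b) on the left, only the component of m b at t b counts. *)
Lemma gamma_linear M u : linear (fun m : {ffun Ar -> M} =>
  [ffun a => if t a == u then \sum_(b | s b == u) m b · dd b a else 0]).
Proof.
move=> c m n; apply/ffunP=> a; rewrite !ffunE; case: ifP => _; last by rewrite scaler0 addr0.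
rewrite scaler_sumr -big_split; apply: eq_bigr => b _.
by rewrite !ffunE linearP.
Qed.
Definition gamma M u : 'End({ffun Ar -> M}) := hom_of (@gamma_linear M u).
Lemma gammaE M u (m : {ffun Ar -> M}) a :
  gamma M u m a = if t a == u then \sum_(b | s b == u) m b · dd b a else 0.
Proof. by rewrite hom_ofE ffunE. Qed.

Lemma alpha_linear M u : linear (fun m : {ffun Ar -> M} => \sum_(a | t a == u) m a · ar a).
Proof.
move=> c m n; rewrite scaler_sumr -big_split; apply: eq_bigr => b _.
by rewrite !ffunE linearP.
Qed.
Definition alpha M u : 'Hom({ffun Ar -> M}, M) := hom_of (@alpha_linear M u).
Lemma alphaE M u (m : {ffun Ar -> M}) : alpha M u m = \sum_(a | t a == u) m a · ar a.
Proof. exact: hom_ofE. Qed.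

Definition grk M u : nat := \dim (limg (gamma M u)).

(** Exactness of M_out -> M_in -> M for free modules: [q_ex] is applied to the coefficients of [m]
    on each generator. *)
Lemma free_exact b X u (m : {ffun Ar -> X}) : freeb b X ->
  (forall a, m a · e (s a) = m a) -> alpha X u m = 0 ->
  exists n : {ffun Ar -> X}, forall a, t a = u -> m a = gamma X u n a.
Proof.
case=> x [xe gen ind] me; rewrite alphaE => am0.
have /choice[r rE] a : exists r : {v : Vt & 'I_(b v)} -> A, m a = \sum_i x i · r i.
  exact: gen.
pose R i a := e (tag i) * r a i * e (s a).
have mR a : m a = \sum_i x i · R i a.
  rewrite -me rE linear_sum; apply: eq_bigr => i _ /=.
  by rewrite /R !ractMv xe.
have R0 i : \sum_(a | t a == u) R i a * ar a = 0.
  have E : \sum_i x i · (\sum_(a | t a == u) R i a * ar a) = 0.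
    under eq_bigr do rewrite ract_sum; rewrite exchange_big -[RHS]am0.
    apply: eq_bigr => a _; rewrite mR linear_sum; apply: eq_bigr => j _ /=.
    by rewrite ractMv.
  have := ind _ E i; rewrite mulr_sumr => E'; rewrite -[RHS]E'; apply: eq_bigr => a _.
  by rewrite /R !mulrA (e_idem HA).
have /choice[y yE] i : exists y : Ar -> A, forall a, t a = u ->
    R i a = \sum_(b | s b == u) y b * dd b a.
  have [|y _ yE] := q_ex HA (x := R i) _ (R0 i); last by exists y.
  by move=> a; rewrite /R -!mulrA (e_idem HA).
exists [ffun c => \sum_i x i · y i c] => a tau; rewrite gammaE tau eqxx mR.
under eq_bigr do rewrite (yE _ _ tau) ract_sum; rewrite exchange_big.
apply: eq_bigr => c _; rewrite ffunE linear_sum; apply: eq_bigr => i _ /=.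
by rewrite ractMv.
Qed.

(** On the free module the image of [gamma] is the kernel of [alpha] on F_in, and [alpha] maps F_in
    onto the radical at u. The part of that image killed by [p] is the kernel of [alpha] on K_in,
    for K the kernel of [p]. The rank formulas for [alpha] on F_in and K_in and for [p] on the image
    of [gamma] combine to the claim, [b u] being the top of F at u. *)
Lemma weight_eq b F M (p : 'Hom(F, M)) u : freeb b F -> is_hom p -> limg p = fullv ->
  (b u + indim M u = topd (lker p) u + \dim (vsp M u) + grk M u)%N.
Proof.
move=> fF pH pI; have KM := submodule_ker pH; set K := lker p in KM *.
pose Fin (U : {vspace F}) := ffunsp (fun a => if t a == u then vpart U (s a) else 0%VS).
have dimFin U : \dim (Fin U) = (\sum_(a | t a == u) \dim (vpart U (s a)))%N.
  rewrite dim_ffunsp [RHS]big_mkcond; apply: eq_bigr => a _.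
  by case: ifP; rewrite ?dimv0.
have alphaFin U : submodule U -> (alpha F u @: Fin U)%VS = radu U u.
  move=> UM; apply/vspaceP=> v; apply/memv_imgP/memv_sumP.
    move=> [m /mem_ffunsp mU ->]; rewrite alphaE; exists (fun a => m a · ar a) => // a tau.
    by have := mU a; rewrite tau (mem_vpart HA) // => /andP[? _]; rewrite memv_img.
  move=> [w wU ->]; have /choice[m mE] a : exists m, t a == u -> m \in U /\ w a = m · ar a.
    case: (boolP (t a == u)) => [tau|]; last by exists 0.
    by have /memv_imgP[m mU wE] := wU a tau; exists m.
  exists [ffun a => if t a == u then m a · e (s a) else 0].
    apply/mem_ffunsp => a; rewrite ffunE; case: ifP => [tau|_]; last exact: mem0v.
    by rewrite memv_img //; case: (mE a tau).
  rewrite alphaE; apply: eq_bigr => a tau; rewrite ffunE tau (act_ear HA).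
  by case: (mE a tau).
have FU := @submodule_full _ _ F.
have kerF : (Fin fullv :&: lker (alpha F u))%VS = limg (gamma F u).
  apply/vspaceP=> m; rewrite memv_cap memv_ker; apply/andP/memv_imgP.
    move=> [/mem_ffunsp mF /eqP am0].
    have mF0 a : t a != u -> m a = 0.
      by move=> /negPf tau; apply/eqP; rewrite -memv0; have := mF a; rewrite tau.
    have [||n nE] := @free_exact b F u [ffun a => if t a == u then m a else 0] fF.
    - move=> a; rewrite ffunE; case: ifP => [tau|_]; last by rewrite linear0.
      by have := mF a; rewrite tau (mem_vpart HA) // => /andP[_ /eqP].
    - by rewrite -[RHS]am0 !alphaE; apply: eq_bigr => a tau; rewrite ffunE tau.
    exists n; first exact: memvf.
    apply/ffunP=> a; case: (boolP (t a == u)) => [tau|tau]; last first.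
      by rewrite mF0 // gammaE (negPf tau).
    by rewrite -nE ?(eqP tau) // ffunE tau.
  move=> [n _ ->]; split.
    apply/mem_ffunsp => a; rewrite gammaE; case: ifP => [tau|_]; last exact: mem0v.
    rewrite (mem_vpart HA) // memvf /= linear_sum; apply/eqP/eq_bigr => c _ /=.
    by rewrite -ractMv (q_ddr HA).
  apply/eqP; rewrite alphaE.
  under eq_bigr => a tau do rewrite gammaE tau linear_sum /=.
  rewrite exchange_big big1 // => c /eqP sc.
  under eq_bigr => a tau do rewrite -ractMv.
  rewrite -ract_sum -sc (eq_bigl (fun a => t a == s c)) ?(q_rel HA) ?ract0 ?zero_lfunE //.
pose P : 'Hom({ffun Ar -> F}, {ffun Ar -> M}) := linfun (fun m : {ffun Ar -> F} => [ffun a => p (m a)]).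
have Plin : linear (fun m : {ffun Ar -> F} => [ffun a => p (m a)]).
  by move=> c m n; apply/ffunP=> a; rewrite !ffunE linearP.
have PE m a : P m a = p (m a) by rewrite (hom_ofE Plin) ffunE.
have Pg m : P (gamma F u m) = gamma M u (P m).
  apply/ffunP=> a; rewrite PE !gammaE; case: ifP => _; last by rewrite linear0.
  by rewrite linear_sum; apply: eq_bigr => c _ /=; rewrite homE // PE.
have PgI : (P @: limg (gamma F u))%VS = limg (gamma M u).
  apply/vspaceP=> m; apply/memv_imgP/memv_imgP => [[_ /memv_imgP[n _ ->] ->]|[n _ ->]].
    by exists (P n); rewrite ?memvf.
  have /choice[n' n'E] a : exists n', p n' = n a.
    have : n a \in limg p by rewrite pI memvf.
    by case/memv_imgP=> n' _ ->; exists n'.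
  have -> : n = P [ffun a => n' a] by apply/ffunP => a; rewrite PE ffunE.
  by exists (gamma F u [ffun a => n' a]); rewrite ?memv_img ?memvf.
have kerPg : (limg (gamma F u) :&: lker P)%VS = (Fin K :&: lker (alpha F u))%VS.
  rewrite -kerF; apply/vspaceP=> m; rewrite !memv_cap andbAC; congr (_ && _).
  apply/andP/mem_ffunsp => [[/mem_ffunsp mF]|mK].
    rewrite memv_ker => /eqP Pm a; have := mF a; case: ifP => // _.
    rewrite !(mem_vpart HA) // memvf /= => ->; rewrite andbT memv_ker -PE Pm.
    by rewrite ffunE.
  split.
    apply/mem_ffunsp=> a; have := mK a; case: ifP => // _; apply: subvP.
    exact/vpartS/subvf.
  rewrite memv_ker; apply/eqP/ffunP => a; rewrite PE ffunE; have := mK a.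
  case: ifP => _; last by rewrite memv0 => /eqP->; rewrite linear0.
  by rewrite (mem_vpart HA) // => /andP[]; rewrite memv_ker => /eqP.
have D1 := limg_ker_dim (alpha F u) (Fin fullv).
rewrite kerF alphaFin // in D1.
have D2 := limg_ker_dim (alpha F u) (Fin K); rewrite alphaFin // in D2.
have D3 := limg_ker_dim P (limg (gamma F u)); rewrite kerPg PgI in D3.
have D4 v := dim_vpart_hom HA v pH FU.
have D5 : (\dim (Fin K) + indim M u)%N = \dim (Fin fullv).
  rewrite !dimFin -big_split /=; apply: eq_bigr => a _; rewrite -D4 pI capfv.
  by [].
have D6 := D4 u; rewrite pI capfv -/K in D6.
rewrite (_ : vpart (fullv : {vspace M}) u = vsp M u) // in D6.
have bE : b u = topd (fullv : {vspace F}) u by rewrite (freeb_topd fF).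
have := dimvS (radu_sub u FU); have := dimvS (radu_sub u KM).
rewrite bE /topd /grk => h1 h2; move: D1 D2 D3 D5 D6 h1 h2; clear.
move: (\dim (vpart K u)) (\dim (radu K u)) (\dim (vsp M u)) (\dim (limg (gamma M u)))
  (\dim (Fin fullv)) (\dim (Fin K)) (indim M u) (\dim (radu fullv u))
  (\dim (vpart fullv u)) (\dim (limg (gamma F u))) (\dim (Fin K :&: lker (alpha F u))).
lia.
Qed.

(** [d] merely surjects onto ker p, so its source has at least the top of ker p; the next lemma is
    the case of equality. *)
Lemma presentation_weight b1 b0 Y1 Y0 M (d : 'Hom(Y1, Y0)) (p : 'Hom(Y0, M)) u :
  freeb b1 Y1 -> freeb b0 Y0 -> is_hom d -> is_hom p -> limg p = fullv -> lker p = limg d ->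
  (b0 u + indim M u <= b1 u + \dim (vsp M u) + grk M u)%N.
Proof.
move=> f1 f0 dH pH pI pk; rewrite (weight_eq u f0 pH pI) pk leq_add2r leq_add2r.
by rewrite -(freeb_topd f1); apply: surj_topd.
Qed.

Lemma min_presentation_weight b1 b0 Y1 Y0 M (d : 'Hom(Y1, Y0)) (p : 'Hom(Y0, M)) u :
  freeb b1 Y1 -> freeb b0 Y0 -> is_hom d -> is_hom p -> limg p = fullv -> lker p = limg d ->
  superfluous (lker d) ->
  (b0 u + indim M u = b1 u + \dim (vsp M u) + grk M u)%N.
Proof.
move=> f1 f0 dH pH pI pk sd; rewrite (weight_eq u f0 pH pI) pk.
by have := freeb_inj f1 (cover_freeb (freeb_projective f1) dH sd) => ->.
Qed.

Lemma exists_min_presentation M :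
  exists b1 b0 Y1 Y0 (d : 'Hom(Y1, Y0)) (p : 'Hom(Y0, M)),
    [/\ freeb b1 Y1, freeb b0 Y0, proj_cover p & [/\ is_hom d, limg d = lker p & superfluous (lker d)]].
Proof.
have [Y0 [p [f0 pH pI sp]]] := exists_cover (@submodule_full _ _ M).
have [Y1 [d [f1 dH dI sd]]] := exists_cover (submodule_ker pH).
exists (topd (lker p)), (topd (fullv : {vspace M})), Y1, Y0, d, p; split=> //.
by split=> //; apply: freeb_projective f0.
Qed.

End QPA3.

(** * Sums of indecomposable projectives as free modules *)

Section QPA4.
Variables (k : fieldType) (A : falgType k) (Vt Ar : finType).
Variables (s t : Ar -> Vt) (e : Vt -> A) (ar : Ar -> A) (dd : Ar -> Ar -> A).
Hypothesis HA : qpa s t e ar dd.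
Implicit Types M N X Y P : rmod A.
Local Notation "v '·' x" := (ract _ x v) (at level 39, left associativity).
Local Notation vsp := (vsp e).
Local Notation vpart := (vpart e).
Local Notation free_on := (free_on e).
Local Notation freeb := (freeb e).
Local Notation gsimple := (gsimple e ar).

Definition gis_P u X : Prop :=
  exists N (p : 'Hom(X, N)), gsimple u N /\ proj_cover p.

Definition gis_Psum beta X : Prop :=
  exists (Y : {u : Vt & 'I_(beta u)} -> rmod A)
         (inj : forall i, 'Hom(Y i, X)) (prj : forall i, 'Hom(X, Y i)),
    (forall i, gis_P (tag i) (Y i)) /\ biproduct inj prj.

Lemma superfluous_iso X Y M (f : 'Hom(X, Y)) (g : 'Hom(Y, X)) (d : 'Hom(Y, M)) :
  is_hom f -> is_hom g -> (g \o f)%VF = \1%VF -> (f \o g)%VF = \1%VF ->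
  superfluous (lker d) -> superfluous (lker (d \o f)%VF).
Proof.
move=> fH gH gf fg sd U UM Ufull.
have gfE v : g (f v) = v by rewrite -comp_lfunE gf id_lfunE.
have fgE v : f (g v) = v by rewrite -comp_lfunE fg id_lfunE.
have fU : (f @: U)%VS = fullv.
  apply: sd; first exact: submodule_img.
  apply/vspaceP=> v; rewrite memvf; apply/idP.
  have : g v \in (U + lker (d \o f)%VF)%VS by rewrite Ufull memvf.
  case/memv_addP=> u uU [w]; rewrite memv_ker comp_lfunE => wk gv.
  rewrite -(fgE v) gv linearD memv_add ?memv_img //; by rewrite memv_ker.
apply/vspaceP=> v; rewrite memvf; apply/idP.
have : f v \in (f @: U)%VS by rewrite fU memvf.
by case/memv_imgP=> w wU /(congr1 g); rewrite !gfE => ->.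
Qed.

Lemma topd_simple u N : gsimple u N -> topd t e ar (fullv : {vspace N}) = (fun v => (v == u) : nat).
Proof.
move=> sN; apply/funext=> v; rewrite /topd -/(vsp N v) (dim_vsp_simple HA _ sN).
case: sN => _ _ aN; rewrite (_ : radu _ _ _ v = 0%VS) ?dimv0 ?subn0 //.
by apply: big1 => a _; rewrite aN lim0g.
Qed.

Lemma gis_P_freeb u X : gis_P u X <-> freeb (fun v => (v == u) : nat) X.
Proof.
split=> [[N [p [sN [pH PX pI sp]]]]|fX].
  by have := cover_freeb HA PX pH sp; rewrite pI (topd_simple sN).
have [N sN] := exists_simple HA u.
have [F [d [fF dH dI sd]]] := exists_cover HA (@submodule_full _ _ N).
rewrite (topd_simple sN) in fF.
have [f [g [fH gH gf fg]]] := freeb_unique_iso fX fF.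
exists N, (d \o f)%VF; split=> //; split.
- exact: is_hom_comp.
- exact: (freeb_projective HA fX).
- apply/vspaceP=> v; rewrite memvf; apply/idP.
  have : v \in limg d by rewrite dI memvf.
  case/memv_imgP=> w _ ->.
  have wE : w = f (g w) by rewrite -comp_lfunE fg id_lfunE.
  by rewrite wE -comp_lfunE memv_img ?memvf.
exact: (superfluous_iso fH gH gf fg sd).
Qed.

Lemma biproduct_freeb (J : finType) (Y : J -> rmod A) X (inj : forall j, 'Hom(Y j, X))
    (prj : forall j, 'Hom(X, Y j)) (b : J -> Vt -> nat) : biproduct inj prj ->
  (forall j, freeb (b j) (Y j)) -> freeb (fun v => (\sum_j b j v)%N) X.
Proof.
move=> [ipH pi1 pi0 ip1] fY.
pose y j := sval (cid (fY j)); have yf j : free_on (fun p => tag p) (y j) := svalP (cid (fY j)).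
pose I := {j : J & {v : Vt & 'I_(b j v)}}.
pose u (i : I) := tag (tagged i); pose x (i : I) := inj (tag i) (y (tag i) (tagged i)).
have pi1E j v : prj j (inj j v) = v by rewrite -comp_lfunE pi1 id_lfunE.
have pi0E i j v : i != j -> prj j (inj i v) = 0.
  by move=> ij; rewrite -comp_lfunE pi0 // zero_lfunE.
have ipE v : \sum_j inj j (prj j v) = v.
  by rewrite -[RHS]id_lfunE -ip1 sum_lfunE; apply: eq_bigr => j _; rewrite comp_lfunE.
have sumI (F : I -> X) : \sum_i F i = \sum_j \sum_(p : {v : Vt & 'I_(b j v)}) F (existT _ j p).
  have := @sig_big_dep _ 0 +%R J (fun j => {v : Vt & 'I_(b j v)}) predT
    (fun _ _ => true) (fun j p => F (existT _ j p)).
  by move=> /= ->; apply: eq_bigr => -[j p].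
have fr : free_on u x.
  split=> [[j p]|z|r r0 [j p]].
  - rewrite /u /x /=; have [ye _ _] := yf j; have [iH _] := ipH j.
    by rewrite -homE // ye.
  - have rex j : exists r : {v : Vt & 'I_(b j v)} -> A, prj j z = \sum_p y j p · r p.
      by have [_ + _] := yf j; apply.
    pose r j := sval (cid (rex j)); have rE j : prj j z = \sum_p y j p · r j p := svalP (cid (rex j)).
    exists (fun i : I => r (tag i) (tagged i)).
    rewrite sumI -[LHS]ipE; apply: eq_bigr => j _; rewrite rE linear_sum.
    by apply: eq_bigr => p _ /=; have [iH _] := ipH j; rewrite homE.
  have [_ _ ind] := yf j; apply: (ind (fun p => r (existT _ j p))).
  have := congr1 (prj j) r0; rewrite linear0 sumI linear_sum (bigD1 j) //=.
  rewrite [X in _ + X]big1 ?addr0 => [E|l lj].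
    rewrite -[RHS]E linear_sum; apply: eq_bigr => q _ /=.
    have [_ pH] := ipH j; by rewrite homE // /x /= pi1E.
  rewrite linear_sum big1 //= => q _; have [_ pH] := ipH j.
  by rewrite homE // /x /= pi0E // linear0.
have := free_freeb fr; congr freeb; apply/funext=> v.
rewrite -sum1_card big_mkcond /=.
have := @sig_big_dep _ 0%N addn J (fun j => {v : Vt & 'I_(b j v)}) predT
    (fun _ _ => true) (fun j p => if u (existT _ j p) == v then 1%N else 0%N).
move=> /= E; transitivity (\sum_j \sum_(p : {w : Vt & 'I_(b j w)}) (if tag p == v then 1 else 0))%N.
  by rewrite E; apply: eq_bigr => -[j p] _; rewrite inE.
apply: eq_bigr => j _; rewrite (sum_tagged (b j) (fun w => if w == v then 1 else 0)%N).
rewrite (bigD1 v) //= eqxx muln1 big1 ?addn0 // => w /negPf->; by rewrite muln0.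
Qed.

(** A decomposition into projective covers of simples and a system of free generators are
    interchangeable; later arguments use generators only. *)
Lemma gis_PsumP b X : gis_Psum b X <-> freeb b X.
Proof.
split=> [[Y [inj [prj [YP bip]]]]|[x fr]].
  have fY i : freeb (fun v => (v == tag i) : nat) (Y i) by apply/gis_P_freeb.
  have := biproduct_freeb bip fY; congr freeb; apply/funext=> v.
  rewrite (sum_tagged b (fun w => (v == w) : nat)) (bigD1 v) //= eqxx muln1.
  by rewrite big1 ?addn0 // => w; rewrite eq_sym => /negPf->; rewrite muln0.
have Yex (i : {v : Vt & 'I_(b v)}) : {Y : rmod A & {y : Y | free_on (fun _ : unit => tag i) (fun _ => y)}}.
  have [Y] := cid (exists_free HA (fun _ : unit => tag i)).
  case/cid=> y fy; exists Y, (y tt).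
  by rewrite (_ : (fun _ => y tt) = y) //; apply/funext; case.
pose Y i := projT1 (Yex i); pose y i : Y i := sval (projT2 (Yex i)).
have yf i : free_on (fun _ : unit => tag i) (fun _ => y i) := svalP (projT2 (Yex i)).
have [xe _ _] := fr.
have injP i : {f : 'Hom(Y i, X) | is_hom f /\ f (y i) = x i}.
  have [f [fH fE]] := cid (free_homP (yf i) (fun _ => xe i)).
  by exists f; split=> //; apply: (fE tt).
have ye i : y i · e (tag i) = y i by have [+ _ _] := yf i; apply.
have prjP i : {f : 'Hom(X, Y i) | is_hom f /\ forall j, f (x j) =
    if i == j then y i else 0}.
  have nP j : (if i == j then y i else 0) · e (tag j) = (if i == j then y i else 0).
    by case: eqP => [<-|_]; rewrite ?ye ?linear0.
  exact: (cid (free_homP fr nP)).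
pose inj i := sval (injP i); pose prj i := sval (prjP i).
have [injH injE] : (forall i, is_hom (inj i)) /\ forall i, inj i (y i) = x i.
  by split=> i; have [] := svalP (injP i).
have [prjH prjE] : (forall i, is_hom (prj i)) /\
    forall i j, prj i (x j) = if i == j then y i else 0.
  by split=> i; have [] := svalP (prjP i).
exists Y, inj, prj; split.
  move=> i; apply/gis_P_freeb; have := free_freeb (yf i); congr freeb.
  apply/funext=> v; rewrite eq_sym; case: eqP => _ /=.
    by apply: (etrans _ card_unit); apply: eq_card => -[].
  by rewrite eq_card0.
split=> [//|i|i j ij|].
- apply: (free_ext (yf i)); [exact: is_hom_comp | exact: is_hom_id |] => _.
  by rewrite comp_lfunE injE prjE eqxx id_lfunE.
- apply: (free_ext (yf i)); [exact: is_hom_comp | exact: is_hom0 |] => _.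
  by rewrite comp_lfunE injE prjE eq_sym (negPf ij) zero_lfunE.
apply: (free_ext fr); last first.
- move=> j; rewrite sum_lfunE id_lfunE (bigD1 j) //= comp_lfunE prjE eqxx injE.
  by rewrite big1 ?addr0 // => i /negPf ij; rewrite comp_lfunE prjE ij linear0.
- exact: is_hom_id.
elim/big_rec: _ => [|i f _ fH]; first exact: is_hom0.
by apply: is_homD => //; apply: is_hom_comp.
Qed.

End QPA4.

(** * The converse algebra and dual modules *)

Section Converse.
Variables (k : fieldType) (A : falgType k).
HB.instance Definition _ := Vector.copy A^c A.
Fact converse_scalerAl (c : k) (u v : A^c) :
  c *: (u * v) = @GRing.mul A^c (c *: u) v.
Proof. exact: (@scalerAr k A c v u). Qed.
Fact converse_scalerAr (c : k) (u v : A^c) :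
  c *: (u * v) = @GRing.mul A^c u (c *: v).
Proof. exact: (@scalerAl k A c v u). Qed.
HB.instance Definition _ := GRing.Lmodule_isLalgebra.Build k A^c converse_scalerAl.
HB.instance Definition _ := GRing.Lalgebra_isAlgebra.Build k A^c converse_scalerAr.
Definition conv_alg : falgType k := A^c.
End Converse.

Section DualSpace.
Variable k : fieldType.
Implicit Types U V W : vectType k.

Lemma dim_hom_dual V : \dim {:'Hom(V, k^o)} = \dim {:V}.
Proof. by rewrite !dimvf /dim /= muln1. Qed.

Lemma functional_sep V (U : {vspace V}) v : v \notin U ->
  exists2 l : 'Hom(V, k^o), (forall u, u \in U -> l u = 0) & l v != 0.
Proof.
move=> vU; pose w := projv (U^C)%VS v.
pose p : 'Hom(V, V) := daddv_pi (U^C)%VS U.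
have CU : ((U^C) :&: U = 0)%VS by rewrite capvC capv_compl.
have pU u : u \in U -> p u = 0.
  move=> uU; have := daddv_pi_add CU (w := u).
  rewrite addvC addv_complf memvf => /(_ isT) E.
  have puU : p u \in U.
    by rewrite -[p u](addrK (daddv_pi U (U^C)%VS u)) E memvB ?memv_pi.
  by apply/eqP; rewrite -memv0 -CU memv_cap puU memv_pi.
have pv : p v != 0.
  apply: contraNneq vU => pv0; have := daddv_pi_add CU (w := v).
  rewrite addvC addv_complf memvf => /(_ isT); rewrite -/p pv0 add0r => <-.
  exact: memv_pi.
have [i ci] : exists i, coord (vbasis {:V}) i (p v) != 0.
  apply: contrapT => /forallNP nc; case/negP: pv; apply/eqP.
  rewrite (coord_vbasis (memvf (p v))) big1 // => i _.
  by have /negP/negPn/eqP-> := nc i; rewrite scale0r.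
have lE x : linfun (coord (vbasis {:V}) i : V -> k^o) x = coord (vbasis {:V}) i x.
  by rewrite lfunE.
exists (linfun (coord (vbasis {:V}) i : V -> k^o) \o p)%VF.
  by move=> u uU; rewrite comp_lfunE pU // linear0.
by rewrite comp_lfunE lE.
Qed.

Definition dmap V W (f : 'Hom(V, W)) : 'Hom('Hom(W, k^o), 'Hom(V, k^o)) := prec k^o f.
Lemma dmapE V W (f : 'Hom(V, W)) phi : dmap f phi = (phi \o f)%VF.
Proof. exact: precE. Qed.
Lemma dmap_comp U V W (g : 'Hom(V, W)) (f : 'Hom(U, V)) :
  dmap (g \o f)%VF = (dmap f \o dmap g)%VF.
Proof. by apply/lfunP=> phi; rewrite comp_lfunE !dmapE comp_lfunA. Qed.
Lemma dmap_id V : dmap (\1%VF : 'End(V)) = \1%VF.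
Proof. by apply/lfunP=> phi; rewrite dmapE comp_lfun1r id_lfunE. Qed.
Lemma dmap_linear V W : linear (@dmap V W).
Proof.
move=> c f g; apply/lfunP=> phi.
by rewrite add_lfunE scale_lfunE !dmapE comp_lfunDr -comp_lfunZr.
Qed.
Lemma dmapP V W c (f g : 'Hom(V, W)) : dmap (c *: f + g) = c *: dmap f + dmap g.
Proof. exact: dmap_linear. Qed.
Lemma dmapD V W (f g : 'Hom(V, W)) : dmap (f + g) = dmap f + dmap g.
Proof. by rewrite -[f]scale1r dmapP !scale1r. Qed.
Lemma dmap0 V W : dmap (0 : 'Hom(V, W)) = 0.
Proof. by apply/lfunP=> phi; rewrite dmapE comp_lfun0r zero_lfunE. Qed.

(** Exchange of the two arguments of a bilinear form: the adjunction from which the duality of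
    modules is derived. *)
Definition tr U V (w : 'Hom(U, 'Hom(V, k^o))) : 'Hom(V, 'Hom(U, k^o)) :=
  linfun (fun v => linfun (fun u => w u v : k^o)).
Lemma trE U V (w : 'Hom(U, 'Hom(V, k^o))) u v : tr w v u = w u v.
Proof.
have l1 v' : linear (fun u => w u v' : k^o).
  by move=> c x y; rewrite linearP add_lfunE scale_lfunE.
have l2 : linear (fun v' => linfun (fun u => w u v' : k^o)).
  move=> c x y; apply/lfunP=> z.
  by rewrite add_lfunE scale_lfunE !(hom_ofE (l1 _)) linearP.
by rewrite (hom_ofE l2) (hom_ofE (l1 _)).
Qed.
Lemma trK U V (w : 'Hom(U, 'Hom(V, k^o))) : tr (tr w) = w.
Proof. by apply/lfunP=> u; apply/lfunP=> v; rewrite !trE. Qed.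
Lemma tr_linear U V : linear (@tr U V).
Proof.
move=> c f g; apply/lfunP=> v; apply/lfunP=> u.
by rewrite !(add_lfunE, scale_lfunE) !trE add_lfunE scale_lfunE add_lfunE scale_lfunE.
Qed.
Lemma tr_comp_r U U' V (w : 'Hom(U, 'Hom(V, k^o))) (d : 'Hom(U', U)) :
  tr (w \o d)%VF = (dmap d \o tr w)%VF.
Proof. by apply/lfunP=> v; apply/lfunP=> u; rewrite trE !comp_lfunE dmapE comp_lfunE trE. Qed.
Lemma tr_comp_l U V V' (w : 'Hom(U, 'Hom(V, k^o))) (d : 'Hom(V', V)) :
  tr (dmap d \o w)%VF = (tr w \o d)%VF.
Proof. by apply/lfunP=> v; apply/lfunP=> u; rewrite trE !comp_lfunE dmapE comp_lfunE trE. Qed.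

Definition ev V : 'Hom(V, 'Hom('Hom(V, k^o), k^o)) := tr (\1%VF : 'End('Hom(V, k^o))).
Lemma evE V v (phi : 'Hom(V, k^o)) : ev V v phi = phi v.
Proof. by rewrite trE id_lfunE. Qed.
Lemma lker_ev V : lker (ev V) = 0%VS.
Proof.
apply/eqP/lker0P => v w vw; apply/eqP; rewrite -subr_eq0; apply/negPn/negP => vw0.
have /functional_sep[l _] : v - w \notin (0 : {vspace V})%VS by rewrite memv0.
by rewrite linearB /= -(evE v) vw evE subrr eqxx.
Qed.
Lemma limg_ev V : limg (ev V) = fullv.
Proof.
apply/eqP; rewrite eqEdim subvf limg_dim_eq ?lker_ev ?capv0 //.
by rewrite /= !dim_hom_dual.
Qed.
Lemma dmap_dmap V W (f : 'Hom(V, W)) : (dmap (dmap f) \o ev V = ev W \o f)%VF.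
Proof.
by apply/lfunP=> v; apply/lfunP=> phi; rewrite !comp_lfunE dmapE comp_lfunE !evE dmapE comp_lfunE.
Qed.

Lemma lker_dmapP V W (f : 'Hom(V, W)) (phi : 'Hom(W, k^o)) :
  reflect (forall w, w \in limg f -> phi w = 0) (phi \in lker (dmap f)).
Proof.
rewrite memv_ker dmapE; apply: (iffP eqP) => [E _ /memv_imgP[v _ ->]|f0].
  by rewrite -comp_lfunE E zero_lfunE.
by apply/lfunP=> v; rewrite comp_lfunE zero_lfunE f0 ?memv_img ?memvf.
Qed.

(** Factoring through the image bounds the rank of the dual map; the reverse bound is the same one
    for the dual map, read through the bidual. *)
Lemma rank_dmap V W (f : 'Hom(V, W)) : \dim (limg (dmap f)) = \dim (limg f).
Proof.
have le_rank V' W' (g : 'Hom(V', W')) : (\dim (limg (dmap g)) <= \dim (limg g))%N.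
  pose i : 'Hom(subvs_of (limg g), W') := linfun (vsval : subvs_of (limg g) -> W').
  pose p : 'Hom(V', subvs_of (limg g)) := (linfun (vsproj (limg g)) \o g)%VF.
  have E : g = (i \o p)%VF.
    by apply/lfunP=> v; rewrite !comp_lfunE !lfunE /= vsprojK ?memv_img ?memvf.
  rewrite {1}E dmap_comp limg_comp.
  have le1 : (\dim (dmap p @: limg (dmap i)) <= \dim (limg (dmap i)))%N.
    by rewrite -[X in (_ <= X)%N](limg_ker_dim (dmap p)) leq_addl.
  apply: (leq_trans le1); apply: leq_trans (dimvS (subvf _)) _.
  have dS : \dim {:subvs_of (limg g)} = \dim (limg g) by rewrite dimvf.
  by rewrite dim_hom_dual -dS; apply: dimvS (subvf _).
apply/eqP; rewrite eqn_leq le_rank /=.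
apply: leq_trans (le_rank _ _ (dmap f)).
have <- : \dim (limg (ev W \o f)%VF) = \dim (limg f).
  by rewrite limg_comp limg_dim_eq // lker_ev capv0.
by rewrite -dmap_dmap limg_comp; apply/dimvS/limgS/subvf.
Qed.

Lemma dmap_exact U V W (f : 'Hom(U, V)) (g : 'Hom(V, W)) :
  lker g = limg f -> lker (dmap f) = limg (dmap g).
Proof.
move=> E; apply/eqP; rewrite eq_sym eqEdim; apply/andP; split.
  apply/subvP=> _ /memv_imgP[phi _ ->]; apply/lker_dmapP => w; rewrite -E memv_ker dmapE.
  by rewrite comp_lfunE => /eqP->; rewrite linear0.
have := limg_ker_dim (dmap f) fullv; have := limg_ker_dim g fullv.
rewrite !capfv !rank_dmap dim_hom_dual E.
by move: (\dim (lker (dmap f))) (\dim (limg f)) (\dim (limg g)) (\dim fullv); lia.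
Qed.

Lemma dmap_surj_inj V W (f : 'Hom(V, W)) : limg f = fullv -> lker (dmap f) = 0%VS.
Proof.
move=> fI; apply/eqP; rewrite -subv0; apply/subvP=> phi /lker_dmapP phi0.
by rewrite memv0; apply/eqP/lfunP => w; rewrite zero_lfunE phi0 // fI memvf.
Qed.

Lemma dmap_inj_surj V W (f : 'Hom(V, W)) : lker f = 0%VS -> limg (dmap f) = fullv.
Proof.
move=> fk; apply/eqP; rewrite eqEdim subvf rank_dmap dim_hom_dual.
by rewrite limg_dim_eq ?fk ?capv0 //=.
Qed.

End DualSpace.

Lemma evK (k : fieldType) (V : vectType k) (v : V) : ((ev V)^-1)%VF (ev V v) = v.
Proof. by apply: lker0_lfunK; rewrite lker_ev. Qed.
Lemma evVK (k : fieldType) (V : vectType k) w : ev V (((ev V)^-1)%VF w) = w.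
Proof. by rewrite limg_lfunVK // limg_ev memvf. Qed.

Lemma evV_eval (k : fieldType) (V : vectType k) w (phi : 'Hom(V, k^o)) :
  phi (((ev V)^-1)%VF w) = w phi.
Proof. by rewrite -evE evVK. Qed.
Lemma functional_ext (k : fieldType) (V : vectType k) (v w : V) :
  (forall phi : 'Hom(V, k^o), phi v = phi w) -> v = w.
Proof.
move=> E; rewrite -[v]evK -[w]evK; congr (_ _); apply/lfunP=> phi.
by rewrite !evE E.
Qed.

(** * Annihilators in the dual space *)

Section Ann.
Variables (k : fieldType) (V : vectType k).

Definition annv (U : {vspace V}) : {vspace 'Hom(V, k^o)} := lker (dmap (projv U)).
Lemma annvP (U : {vspace V}) (phi : 'Hom(V, k^o)) :
  reflect (forall v, v \in U -> phi v = 0) (phi \in annv U).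
Proof. by rewrite /annv; have := lker_dmapP (projv U) phi; rewrite limg_proj. Qed.

Lemma lker_dmap (W : vectType k) (f : 'Hom(W, V)) : lker (dmap f) = annv (limg f).
Proof. by apply/vspaceP=> phi; apply/lker_dmapP/annvP. Qed.

Lemma limg_dmap (W : vectType k) (f : 'Hom(V, W)) : limg (dmap f) = annv (lker f).
Proof.
apply/vspaceP=> phi; apply/memv_imgP/annvP => [[psi _ ->] v|phi0].
  by rewrite memv_ker dmapE comp_lfunE => /eqP->; rewrite linear0.
exists (phi \o f^-1)%VF; first exact: memvf.
apply/lfunP=> v; rewrite dmapE !comp_lfunE; apply/eqP; rewrite -subr_eq0 -linearB.
apply/eqP/phi0; rewrite memv_ker linearB /= limg_lfunVK ?subrr //.
by rewrite memv_img ?memvf.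
Qed.

Definition perpv (U : {vspace 'Hom(V, k^o)}) : {vspace V} := lker (dmap (projv U) \o ev V)%VF.
Lemma perpvP (U : {vspace 'Hom(V, k^o)}) (v : V) : reflect (forall phi : 'Hom(V, k^o), phi \in U -> phi v = 0) (v \in perpv U).
Proof.
rewrite memv_ker comp_lfunE -memv_ker; apply: (iffP (lker_dmapP _ _)).
  by rewrite limg_proj => E phi /E; rewrite evE.
by rewrite limg_proj => E phi /E; rewrite evE.
Qed.

Lemma annv_perpv (U : {vspace 'Hom(V, k^o)}) : annv (perpv U) = U.
Proof.
apply/vspaceP=> phi; apply/annvP/idP => [phi0|phiU v /perpvP]; last by apply.
apply/negPn/negP => /functional_sep[l lU l0].
have : l \in limg (ev V) by rewrite limg_ev memvf.
case/memv_imgP=> v _ lE; case/negP: l0; rewrite lE evE phi0 //.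
by apply/perpvP => psi /lU; rewrite lE evE.
Qed.

Lemma annv_eq0 (U : {vspace V}) : annv U = 0%VS -> U = fullv.
Proof.
move=> aU; apply/eqP; rewrite eqEsubv subvf; apply/subvP => v _; apply/negPn/negP.
case/functional_sep=> l lU; have : l \in annv U by apply/annvP.
by rewrite aU memv0 => /eqP->; rewrite zero_lfunE eqxx.
Qed.

Lemma annv0 : annv (0 : {vspace V})%VS = fullv.
Proof.
apply/vspaceP=> phi; rewrite memvf; apply/annvP => v.
by rewrite memv0 => /eqP->; rewrite linear0.
Qed.

Lemma annvf : annv (fullv : {vspace V}) = 0%VS.
Proof.
apply/eqP; rewrite -subv0; apply/subvP=> phi /annvP phi0.
by rewrite memv0; apply/eqP/lfunP => v; rewrite zero_lfunE phi0 ?memvf.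
Qed.

End Ann.

(** * Duality of modules along an anti-isomorphism of algebras *)

Section DualModule.
Variables (k : fieldType) (A B : falgType k) (tau : B -> A).

Definition is_anti := [/\ forall (c : k) x y, tau (c *: x + y) = c *: tau x + tau y,
  forall x y, tau (x * y) = tau y * tau x & tau 1 = 1].
Hypothesis Htau : is_anti.

Definition dual_act (M : rmod A) (y : B) : 'End('Hom(M, k^o)) := dmap (ract M (tau y)).
Fact dual_linear M c x y : dual_act M (c *: x + y) = c *: dual_act M x + dual_act M y.
Proof. by have [tL _ _] := Htau; rewrite /dual_act tL ract_linear dmapP. Qed.
Fact dualM M x y : dual_act M (x * y) = (dual_act M y \o dual_act M x)%VF.
Proof. by have [_ tM _] := Htau; rewrite /dual_act tM ractM dmap_comp. Qed.
Fact dual1 M : dual_act M 1 = \1%VF.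
Proof. by have [_ _ t1] := Htau; rewrite /dual_act t1 ract1 dmap_id. Qed.
Definition dual (M : rmod A) : rmod B := RMod (@dual_linear M) (@dualM M) (@dual1 M).

Lemma dualE M y : ract (dual M) y = dmap (ract M (tau y)).
Proof. by []. Qed.
Lemma dualvE (M : rmod A) y (phi : dual M) (v : M) :
  ((ract (dual M) y phi : 'Hom(M, k^o)) v) = (phi : 'Hom(M, k^o)) (ract M (tau y) v).
Proof. by rewrite dualE dmapE comp_lfunE. Qed.

Lemma dmap_hom (M N : rmod A) (f : 'Hom(M, N)) :
  is_hom f -> @is_hom _ _ (dual N) (dual M) (dmap f).
Proof. by move=> fH y; rewrite !dualE -!dmap_comp fH. Qed.

Lemma submodule_perp (M : rmod A) (U : {vspace dual M}) : 
  (forall x, exists y, tau y = x) -> submodule U -> submodule (perpv U).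
Proof.
move=> tsurj UM x; apply/subvP=> _ /memv_imgP[v /perpvP vU ->]; apply/perpvP=> phi phiU.
have [y <-] := tsurj x; rewrite -dualvE; apply: vU.
exact: (@submoduleP _ _ (dual M) U y phi UM phiU).
Qed.

End DualModule.

Section TwoWay.
Variables (k : fieldType) (A B : falgType k) (tau : B -> A) (sigma : A -> B).
Hypotheses (Ht : is_anti tau) (Hs : is_anti sigma).
Hypotheses (ts : cancel sigma tau) (st : cancel tau sigma).
Local Notation D := (dual Ht).
Local Notation D' := (dual Hs).

Lemma tr_hom (M : rmod A) (P : rmod B) (w : 'Hom(M, D' P)) :
  is_hom w -> @is_hom _ _ P (D M) (tr w).
Proof.
move=> wH; apply: is_homP => y p; apply/lfunP=> m.
by rewrite dualvE !trE (homE _ _ wH) dualvE st.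
Qed.

Lemma ev_hom (M : rmod A) : @is_hom _ _ M (D' (D M)) (ev M).
Proof.
apply: is_homP => x m; apply/lfunP=> phi.
by rewrite dualvE !evE dualvE ts.
Qed.

(** Transposition turns the extension problem into lifting a map from the projective [P] along the
    dual of [g]; the inclusion of kernels becomes the inclusion of images that the lift requires. *)
Lemma injective_ext (P : rmod B) (M N : rmod A) (g : 'Hom(M, N)) (h : 'Hom(M, D' P)) :
  projective P -> is_hom g -> (lker g <= lker h)%VS -> is_hom h ->
  exists2 l : 'Hom(N, D' P), is_hom l & (l \o g)%VF = h.
Proof.
move=> PP gH le_ker hH.
have [|l lH lE] := projective_lift PP (dmap_hom Ht gH) (tr_hom hH).
  apply/subvP=> _ /memv_imgP[p _ ->]; rewrite limg_dmap; apply/annvP => v vk.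
  rewrite trE; have := subvP le_ker _ vk; rewrite memv_ker => /eqP->.
  by rewrite zero_lfunE.
exists (tr l); last by rewrite -tr_comp_l lE trK.
apply: is_homP => x n; apply/lfunP=> p.
by rewrite dualvE !trE (homE _ _ lH) dualvE ts.
Qed.

Lemma injective_dual (P : rmod B) : projective P -> injective_mod (D' P).
Proof.
move=> PP M N g h gH gk hH; apply: injective_ext => //.
by rewrite gk sub0v.
Qed.

Lemma evV_hom (M : rmod A) : @is_hom _ _ (D' (D M)) M ((ev M)^-1)%VF.
Proof.
have [i [iH i1 i2]] := hom_inverse (@ev_hom M) (lker_ev M) (limg_ev M).
rewrite (_ : (ev M)^-1%VF = i) //; apply/lfunP=> w.
by rewrite -[w in LHS]id_lfunE -i2 comp_lfunE evK.
Qed.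

End TwoWay.

Section TwoWay2.
Variables (k : fieldType) (A B : falgType k) (tau : B -> A) (sigma : A -> B).
Hypotheses (Ht : is_anti tau) (Hs : is_anti sigma).
Hypotheses (ts : cancel sigma tau) (st : cancel tau sigma).
Local Notation D := (dual Ht).
Local Notation D' := (dual Hs).

(** A lifting problem for the dual of [E] dualises to an extension problem for [E], up to the
    evaluation isomorphisms. *)
Lemma projective_dual (E : rmod A) : injective_mod E -> projective (D E).
Proof.
move=> EI M N g h gH gI hH.
pose h' : 'Hom(D' N, E) := ((ev E)^-1 \o dmap h)%VF.
have h'H : is_hom h'.
  exact: (@is_hom_comp _ _ _ (D' (D E)) _ _ _ (evV_hom Ht Hs ts E) (dmap_hom Hs hH)).
have [l lH lE] := EI _ _ _ _ (dmap_hom Hs gH) (dmap_surj_inj gI) h'H.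
exists ((ev M)^-1 \o dmap l)%VF.
  exact: (@is_hom_comp _ _ _ (D (D' M)) _ _ _ (evV_hom Hs Ht st M) (dmap_hom Ht lH)).
apply/lfunP=> phi; apply: functional_ext => psi; rewrite !comp_lfunE.
transitivity (dmap g psi ((ev M)^-1%VF (dmap l phi))); first by rewrite dmapE comp_lfunE.
rewrite evV_eval dmapE comp_lfunE.
transitivity ((phi : 'Hom(E, k^o)) (h' psi)); first by rewrite -lE comp_lfunE.
by rewrite comp_lfunE evV_eval dmapE comp_lfunE.
Qed.

Let tsurj x : exists y, tau y = x. Proof. by exists (sigma x); rewrite ts. Qed.

Lemma dual_superfluous (M : rmod A) (L : {vspace M}) : essential L ->
  @superfluous _ _ (D M) (annv L).
Proof.
move=> eL U UM Ufull; rewrite -[U](annv_perpv U) (_ : perpv U = 0%VS) ?annv0 //.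
apply: eL; first exact: (submodule_perp tsurj).
apply/eqP; rewrite -subv0; apply/subvP=> v /memv_capP[/perpvP vU vL].
rewrite memv0; apply/negPn/negP => v0.
have /functional_sep[l _] : v \notin (0 : {vspace M})%VS by rewrite memv0.
have : l \in (U + annv L)%VS by rewrite Ufull memvf.
case/memv_addP=> phi /vU phi0 [psi /annvP psi0 ->].
by rewrite add_lfunE phi0 psi0 // addr0 eqxx.
Qed.

Lemma dual_essential (M : rmod A) (K : {vspace M}) : superfluous K ->
  @essential _ _ (D M) (annv K).
Proof.
move=> sK U UM UK; rewrite -[U](annv_perpv U) (_ : perpv U = fullv) ?annvf //.
apply: sK; first exact: (submodule_perp tsurj).
apply: annv_eq0; apply/eqP; rewrite -subv0 -UK; apply/subvP => phi /annvP phi0.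
rewrite memv_cap; apply/andP; split.
  by rewrite -[U](annv_perpv U); apply/annvP => v vU; apply: phi0; rewrite memvE (subv_trans _ (addvSl _ _)).
by apply/annvP => v vK; apply: phi0; rewrite memvE (subv_trans _ (addvSr _ _)).
Qed.

Lemma inj_envelope_dual (N X : rmod A) (i : 'Hom(N, X)) : inj_envelope i ->
  @proj_cover _ _ (D X) (D N) (dmap i).
Proof.
move=> [iH XI ik ei]; split; [exact: dmap_hom | exact: projective_dual | exact: dmap_inj_surj |].
by rewrite lker_dmap; apply: dual_superfluous.
Qed.

Lemma min_inj_dual (N X0 X1 : rmod A) (d : 'Hom(X0, X1)) : min_inj_pres N d ->
  @min_proj_pres _ _ (D N) (D X1) (D X0) (dmap d).
Proof.
move=> [i [ii [dH X1I dk ed]]]; exists (dmap i); split; first exact: inj_envelope_dual.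
split; [exact: dmap_hom | exact: projective_dual | exact/esym/dmap_exact |].
by rewrite lker_dmap; apply: dual_superfluous.
Qed.

Lemma biproduct_dual (I : finType) (Y : I -> rmod A) X inj prj : @biproduct _ _ I Y X inj prj ->
  @biproduct _ _ I (fun i => D (Y i)) (D X) (fun i => dmap (prj i)) (fun i => dmap (inj i)).
Proof.
move=> [H1 H2 H3 H4]; split.
- by move=> i; have [iH pH] := H1 i; split; apply: dmap_hom.
- by move=> i; rewrite -dmap_comp H2 dmap_id.
- by move=> i j ij; rewrite -dmap_comp H3 ?dmap0 // eq_sym.
rewrite -(dmap_id X) -H4; elim/big_rec2: _ => [|i x y _ ->]; first by rewrite dmap0.
by rewrite dmapD dmap_comp.
Qed.

Lemma coker_dual (X0 X1 N : rmod A) (d : 'Hom(X0, X1)) : is_ker d N ->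
  @is_coker _ _ (D X1) (D X0) (dmap d) (D N).
Proof.
move=> [i [iH ik iI]]; exists (dmap i); split; first exact: dmap_hom.
  exact: dmap_inj_surj.
exact/dmap_exact/esym.
Qed.

Lemma ker_dual (X1 X0 N : rmod A) (d : 'Hom(X1, X0)) : is_coker d N ->
  @is_ker _ _ (D X0) (D X1) (dmap d) (D N).
Proof.
move=> [p [pH pI pk]]; exists (dmap p); split; first exact: dmap_hom.
  exact: dmap_surj_inj.
exact/esym/dmap_exact.
Qed.

Lemma homotopy_dual (X1 X0 Y1 Y0 : rmod A) (d : 'Hom(X1, X0)) (d' : 'Hom(Y1, Y0)) :
  homotopy_equiv d d' ->
  @homotopy_equiv _ _ (D X0) (D X1) (dmap d) (D Y0) (D Y1) (dmap d').
Proof.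
move=> [f1 [f0 [g1 [g0 [h [h' [[f1H f0H g1H g0H] [hH h'H] [C1 C2] [E1 E2] [E3 E4]]]]]]]].
exists (dmap g0), (dmap g1), (dmap f0), (dmap f1), (dmap h), (dmap h').
split.
- by split; apply: dmap_hom.
- by split; apply: dmap_hom.
- by rewrite -!dmap_comp C1 C2.
- by rewrite -!dmap_comp E1 E2 !dmapD !dmap_comp !dmap_id.
- by rewrite -!dmap_comp E3 E4 !dmapD !dmap_comp !dmap_id.
Qed.

End TwoWay2.

Lemma biproduct_iso (k : fieldType) (A : falgType k) (I : finType) (Y : I -> rmod A)
    (X X' : rmod A) (inj : forall i, 'Hom(Y i, X)) (prj : forall i, 'Hom(X, Y i))
    (f : 'Hom(X, X')) (g : 'Hom(X', X)) : is_hom f -> is_hom g ->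
  (g \o f)%VF = \1%VF -> (f \o g)%VF = \1%VF -> biproduct inj prj ->
  biproduct (fun i => f \o inj i)%VF (fun i => prj i \o g)%VF.
Proof.
move=> fH gH gf fg [H1 H2 H3 H4]; have E i j : ((prj j \o g) \o (f \o inj i) = prj j \o inj i)%VF.
  by rewrite -comp_lfunA [(g \o _)%VF]comp_lfunA gf comp_lfun1l.
split.
- by move=> i; have [iH pH] := H1 i; split; apply: is_hom_comp.
- by move=> i; rewrite E H2.
- by move=> i j ij; rewrite E H3.
have -> : (\1%VF : 'End(X')) = (f \o (\sum_i (inj i \o prj i)) \o g)%VF.
  by rewrite H4 comp_lfun1r fg.
elim/big_rec2: _ => [|i x y _ ->]; first by rewrite comp_lfun0r comp_lfun0l.
by rewrite comp_lfunDr comp_lfunDl !comp_lfunA.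
Qed.

(** * Injective modules as duals of projectives over the converse algebra *)

Section Injectives.
Variables (k : fieldType) (A B : falgType k) (tau : B -> A) (sigma : A -> B).
Hypotheses (Ht : is_anti tau) (Hs : is_anti sigma).
Hypotheses (ts : cancel sigma tau) (st : cancel tau sigma).
Local Notation D := (dual Ht).
Local Notation D' := (dual Hs).
Variables (Vt Ar : finType) (s t : Ar -> Vt) (e : Vt -> A) (ar : Ar -> A) (dd : Ar -> Ar -> A).
Variables (e' : Vt -> B) (ar' : Ar -> B) (dd' : Ar -> Ar -> B).
Hypothesis HA : qpa s t e ar dd.
Hypothesis HB : qpa t s e' ar' dd'.
Hypothesis te : forall u, tau (e' u) = e u.
Hypothesis ta : forall a, tau (ar' a) = ar a.
Hypothesis tdd : forall a b, tau (dd' a b) = dd b a.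

Implicit Types M N X : rmod A.

Definition gis_I u (X : rmod A) : Prop :=
  exists N (i : 'Hom(N, X)), gsimple e ar u N /\ inj_envelope i.

Definition gis_Isum beta (X : rmod A) : Prop :=
  exists (Y : {u : Vt & 'I_(beta u)} -> rmod A)
         (inj : forall i, 'Hom(Y i, X)) (prj : forall i, 'Hom(X, Y i)),
    (forall i, gis_I (tag i) (Y i)) /\ biproduct inj prj.

Lemma gsimple_dual u N : gsimple e ar u N -> gsimple e' ar' u (D N).
Proof.
move=> [dN eN aN]; split; first by rewrite dim_hom_dual.
  by rewrite dualE te eN dmap_id.
by move=> a; rewrite dualE ta aN dmap0.
Qed.

Lemma gis_I_dual u X : gis_I u X -> gis_P e' ar' u (D X).
Proof.
move=> [N [i [sN ii]]]; exists (D N), (dmap i); split; first exact: gsimple_dual.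
exact: (inj_envelope_dual Ht Hs ts st).
Qed.

Lemma vsp_dual_dim M u : \dim (vsp e' (D M) u) = \dim (vsp e M u).
Proof. by rewrite /vsp dualE te rank_dmap. Qed.

Lemma indim_dual M u : indim t s e' (D M) u = (\sum_(a | s a == u) \dim (vsp e M (t a)))%N.
Proof. by apply: eq_bigr => a _; rewrite vsp_dual_dim. Qed.

(** The pairing [Psi] identifies families of functionals with functionals on families. Under it
    [gamma] of the dual module is the transpose of [gamma] of [M], because [tdd] exchanges the two
    arrows of a second derivative. *)
Lemma grk_dual M u : grk t s dd' (D M) u = grk s t dd M u.
Proof.
pose Psi0 (m : {ffun Ar -> 'Hom(M, k^o)}) (v : {ffun Ar -> M}) : k^o := \sum_a m a (v a).
have l1 m : linear (Psi0 m).
  move=> c x y; rewrite /Psi0 scaler_sumr -big_split; apply: eq_bigr => a _.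
  by rewrite !ffunE linearP.
have l2 : linear (fun m => hom_of (l1 m)).
  move=> c x y; apply/lfunP=> v; rewrite add_lfunE scale_lfunE !hom_ofE.
  rewrite /Psi0 scaler_sumr -big_split; apply: eq_bigr => a _.
  by rewrite !ffunE add_lfunE scale_lfunE.
pose Psi := hom_of l2; have PsiE m v : Psi m v = \sum_a m a (v a) by rewrite !hom_ofE.
have Psi_inj : lker Psi = 0%VS.
  apply/eqP/lker0P => m n mn; apply/ffunP=> a; apply/lfunP=> v.
  have := lfun_congr [ffun b => if b == a then v else 0] mn; rewrite !PsiE.
  rewrite (bigD1 a) //= [RHS](bigD1 a) //= !ffunE eqxx.
  rewrite !big1 ?addr0 // => b /negPf ba; by rewrite ffunE ba linear0.
have Psi_surj : limg Psi = fullv.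
  apply/eqP; rewrite eqEdim subvf limg_dim_eq ?Psi_inj ?capv0 //=.
  have dff (V : vectType k) : \dim {:{ffun Ar -> V}} = (#|Ar| * \dim {:V})%N by rewrite !dimvf.
  by rewrite dim_hom_dual !dff dim_hom_dual.
have E : (Psi \o gamma t s dd' (D M) u = dmap (gamma s t dd M u) \o Psi)%VF.
  apply/lfunP=> m; apply/lfunP=> v; rewrite !comp_lfunE PsiE dmapE comp_lfunE PsiE.
  transitivity (\sum_(a | s a == u) \sum_(b | t b == u) m b (ract M (dd a b) (v a))).
    rewrite [RHS]big_mkcond; apply: eq_bigr => a _.
    have gE := @gammaE _ B _ _ t s dd' (D M) u m a.
    rewrite (lfun_congr (v a) gE); case: ifP => _; last by rewrite zero_lfunE.
    rewrite sum_lfunE; apply: eq_bigr => b _.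
    by have E := @dualvE _ _ _ _ Ht M (dd' b a) (m b) (v a); rewrite tdd in E.
  rewrite exchange_big big_mkcond; apply: eq_bigr => b _; rewrite gammaE.
  case: ifP => _; last by rewrite linear0.
  by rewrite linear_sum.
rewrite /grk -(rank_dmap (gamma s t dd M u)).
have <- : \dim (limg (Psi \o gamma t s dd' (D M) u)) = \dim (limg (gamma t s dd' (D M) u)).
  by rewrite limg_comp limg_dim_eq // Psi_inj capv0.
by rewrite E limg_comp Psi_surj.
Qed.

Lemma gis_Isum_dual b X : gis_Isum b X -> freeb e' b (D X).
Proof.
move=> [Y [inj [prj [YI bip]]]]; apply/(gis_PsumP HB).
exists (fun i => D (Y i)), (fun i => dmap (prj i)), (fun i => dmap (inj i)); split.
  by move=> i; apply: gis_I_dual.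
exact: biproduct_dual.
Qed.

End Injectives.

Section Injectives2.
Variables (k : fieldType) (A B : falgType k) (tau : B -> A) (sigma : A -> B).
Hypotheses (Ht : is_anti tau) (Hs : is_anti sigma).
Hypotheses (ts : cancel sigma tau) (st : cancel tau sigma).
Local Notation D := (dual Ht).
Local Notation D' := (dual Hs).
Implicit Types M N X : rmod A.

Lemma proj_cover_dual (P N : rmod B) (p : 'Hom(P, N)) : proj_cover p ->
  @inj_envelope _ _ (D' N) (D' P) (dmap p).
Proof.
move=> [pH PP pI sp]; split.
- exact: dmap_hom.
- exact: (injective_dual Ht ts st).
- exact: dmap_surj_inj.
by rewrite limg_dmap; apply: (dual_essential st).
Qed.

Lemma min_proj_dual (M X1 X0 : rmod B) (d : 'Hom(X1, X0)) : min_proj_pres M d ->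
  @min_inj_pres _ _ (D' M) (D' X0) (D' X1) (dmap d).
Proof.
move=> [p [pp [dH PX1 dI sd]]]; exists (dmap p); split; first exact: proj_cover_dual.
split; [exact: dmap_hom | exact: (injective_dual Ht ts st) | exact/dmap_exact/esym |].
by rewrite limg_dmap; apply: (dual_essential st).
Qed.

Lemma biproduct_bidual (I : finType) (Y : I -> rmod B) X
    (inj : forall i, 'Hom(Y i, D X)) (prj : forall i, 'Hom(D X, Y i)) :
  biproduct inj prj ->
  exists (inj' : forall i, 'Hom(D' (Y i), X)) (prj' : forall i, 'Hom(X, D' (Y i))),
    biproduct inj' prj'.
Proof.
move=> /(biproduct_dual Hs) bip.
exists (fun i => (ev X)^-1 \o dmap (prj i))%VF, (fun i => dmap (inj i) \o ev X)%VF.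
apply: (@biproduct_iso _ _ _ (fun i => D' (Y i)) (D' (D X)) X _ _ (ev X)^-1%VF (ev X)) => //.
- exact: (evV_hom Ht Hs ts).
- exact: (ev_hom Ht Hs ts).
- by apply/lfunP=> v; rewrite comp_lfunE evVK id_lfunE.
by apply/lfunP=> v; rewrite comp_lfunE evK id_lfunE.
Qed.

Variables (Vt Ar : finType) (s t : Ar -> Vt) (e : Vt -> A) (ar : Ar -> A) (dd : Ar -> Ar -> A).
Variables (e' : Vt -> B) (ar' : Ar -> B) (dd' : Ar -> Ar -> B).
Hypothesis HA : qpa s t e ar dd.
Hypothesis HB : qpa t s e' ar' dd'.
Hypothesis te : forall u, tau (e' u) = e u.
Hypothesis ta : forall a, tau (ar' a) = ar a.

Let se u : sigma (e u) = e' u. Proof. by rewrite -te st. Qed.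
Let sa a : sigma (ar a) = ar' a. Proof. by rewrite -ta st. Qed.

Lemma gis_P_dual u (P : rmod B) : gis_P e' ar' u P -> gis_I e ar u (D' P).
Proof.
move=> [N [p [sN pp]]]; exists (D' N), (dmap p); split; last exact: proj_cover_dual.
exact: (gsimple_dual Hs se sa).
Qed.

Lemma gis_IsumP b X : gis_Isum e ar b X <-> freeb e' b (D X).
Proof.
split; first exact: (gis_Isum_dual Ht Hs ts st HB te ta).
move=> /(gis_PsumP HB)[Y [inj [prj [YP bip]]]].
have [inj' [prj' bip']] := biproduct_bidual bip.
exists (fun i => D' (Y i)), inj', prj'; split=> // i.
exact: gis_P_dual.
Qed.

End Injectives2.

(** * Homotopy equivalence of two-term complexes *)

Section Homotopy.
Variables (k : fieldType) (A : falgType k).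
Implicit Types X Y Z N M : rmod A.

Lemma homotopy_sym X1 X0 (d : 'Hom(X1, X0)) Y1 Y0 (d' : 'Hom(Y1, Y0)) :
  homotopy_equiv d d' -> homotopy_equiv d' d.
Proof.
by move=> [f1 [f0 [g1 [g0 [h [h' [[? ? ? ?] [? ?] [? ?] [? ?] [? ?]]]]]]]]; exists g1, g0, f1, f0, h', h.
Qed.

Lemma homotopy_trans X1 X0 (d : 'Hom(X1, X0)) Y1 Y0 (d' : 'Hom(Y1, Y0))
    Z1 Z0 (d2 : 'Hom(Z1, Z0)) :
  is_hom d -> is_hom d' -> is_hom d2 ->
  homotopy_equiv d d' -> homotopy_equiv d' d2 -> homotopy_equiv d d2.
Proof.
move=> dH d'H d2H [f1 [f0 [g1 [g0 [h [h' [[f1H f0H g1H g0H] [hH h'H] [C1 C2] [E1 E2] [E3 E4]]]]]]]].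
move=> [F1 [F0 [G1 [G0 [K [K' [[F1H F0H G1H G0H] [KH K'H] [C3 C4] [E5 E6] [E7 E8]]]]]]]].
have aux (U V : rmod A) (f : 'Hom(U, V)) (g : 'Hom(V, U)) (x : 'End(V)) (y : 'End(U)) :
    (g \o f = \1 + y)%VF -> (g \o (\1 + x) \o f)%VF = (\1 + (y + (g \o x \o f)))%VF.
  by move=> E; rewrite comp_lfunDr comp_lfun1r comp_lfunDl E addrA.
exists (F1 \o f1)%VF, (F0 \o f0)%VF, (g1 \o G1)%VF, (g0 \o G0)%VF.
exists (h + (g1 \o K \o f0))%VF, (K' + (F1 \o h' \o G0))%VF; split.
- by split; apply: is_hom_comp.
- by split; apply: is_homD => //; do 2!apply: is_hom_comp => //.
- by split; [rewrite comp_lfunA C3 -!comp_lfunA C1 | rewrite comp_lfunA C2 -!comp_lfunA C4].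
- rewrite !comp_lfunDl !comp_lfunDr; split.
    have -> : ((g1 \o G1) \o (F1 \o f1) = g1 \o (G1 \o F1) \o f1)%VF by rewrite !comp_lfunA.
    by rewrite E5 (aux _ _ _ _ _ _ E1) -!comp_lfunA C1.
  have -> : ((g0 \o G0) \o (F0 \o f0) = g0 \o (G0 \o F0) \o f0)%VF by rewrite !comp_lfunA.
  by rewrite E6 (aux _ _ _ _ _ _ E2) !comp_lfunA C2.
rewrite !comp_lfunDl !comp_lfunDr; split.
  have -> : ((F1 \o f1) \o (g1 \o G1) = F1 \o (f1 \o g1) \o G1)%VF by rewrite !comp_lfunA.
  by rewrite E3 (aux _ _ _ _ _ _ E7) -!comp_lfunA C4.
have -> : ((F0 \o f0) \o (g0 \o G0) = F0 \o (f0 \o g0) \o G0)%VF by rewrite !comp_lfunA.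
by rewrite E4 (aux _ _ _ _ _ _ E8) !comp_lfunA C3.
Qed.

Lemma homotopy_iso X1 X0 (d : 'Hom(X1, X0)) Y1 Y0 (d' : 'Hom(Y1, Y0)) f1 g1 f0 g0 :
  is_hom f1 -> is_hom f0 -> is_hom g1 -> is_hom g0 ->
  (d' \o f1 = f0 \o d)%VF ->
  (g1 \o f1 = \1)%VF -> (f1 \o g1 = \1)%VF -> (g0 \o f0 = \1)%VF -> (f0 \o g0 = \1)%VF ->
  homotopy_equiv d d'.
Proof.
move=> f1H f0H g1H g0H C E1 E2 E3 E4; exists f1, f0, g1, g0, 0, 0; split=> //.
- by split; apply: is_hom0.
- split=> //; rewrite -[LHS]comp_lfun1l -E3 -!comp_lfunA [(f0 \o (d \o _))%VF]comp_lfunA -C.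
  by rewrite -comp_lfunA E2 comp_lfun1r.
- by rewrite !comp_lfun0l !comp_lfun0r !addr0.
by rewrite !comp_lfun0l !comp_lfun0r !addr0.
Qed.

Lemma homotopy_ker X1 X0 (d : 'Hom(X1, X0)) Y1 Y0 (d' : 'Hom(Y1, Y0)) N :
  homotopy_equiv d d' -> is_ker d N -> is_ker d' N.
Proof.
move=> [f1 [f0 [g1 [g0 [h [h' [[f1H f0H g1H g0H] [hH h'H] [C1 C2] [E1 E2] [E3 E4]]]]]]]].
move=> [i [iH ik iI]]; have di v : d (i v) = 0.
  by apply/eqP; rewrite -memv_ker -iI memv_img ?memvf.
have CE v : d' (f1 v) = f0 (d v) by have := lfun_congr v C1; rewrite !comp_lfunE.
have CE2 v : d (g1 v) = g0 (d' v) by have := lfun_congr v C2; rewrite !comp_lfunE.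
have E1v v : g1 (f1 v) = v + h (d v).
  by have := lfun_congr v E1; rewrite add_lfunE !comp_lfunE id_lfunE.
have E3v v : f1 (g1 v) = v + h' (d' v).
  by have := lfun_congr v E3; rewrite add_lfunE !comp_lfunE id_lfunE.
exists (f1 \o i)%VF; split; first exact: is_hom_comp.
  apply/eqP/lker0P => v w; rewrite !comp_lfunE => /(congr1 g1).
  rewrite !E1v !di !linear0 !addr0; apply/lker0P; by rewrite ik.
apply/vspaceP=> v; rewrite memv_ker; apply/memv_imgP/eqP => [[w _ ->]|dv].
  by rewrite comp_lfunE CE di linear0.
have : g1 v \in limg i by rewrite iI memv_ker CE2 dv linear0.
case/memv_imgP=> w _ gv; exists w; first exact: memvf.
by rewrite comp_lfunE -gv E3v dv linear0 addr0.
Qed.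

Lemma homotopy_coker X1 X0 (d : 'Hom(X1, X0)) Y1 Y0 (d' : 'Hom(Y1, Y0)) N :
  homotopy_equiv d d' -> is_coker d N -> is_coker d' N.
Proof.
move=> [f1 [f0 [g1 [g0 [h [h' [[f1H f0H g1H g0H] [hH h'H] [C1 C2] [E1 E2] [E3 E4]]]]]]]].
move=> [p [pH pI pk]]; have pd v : p (d v) = 0.
  by apply/eqP; rewrite -memv_ker pk memv_img ?memvf.
have CE v : d' (f1 v) = f0 (d v) by have := lfun_congr v C1; rewrite !comp_lfunE.
have CE2 v : d (g1 v) = g0 (d' v) by have := lfun_congr v C2; rewrite !comp_lfunE.
have E2v v : g0 (f0 v) = v + d (h v).
  by have := lfun_congr v E2; rewrite add_lfunE !comp_lfunE id_lfunE.
have E4v v : f0 (g0 v) = v + d' (h' v).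
  by have := lfun_congr v E4; rewrite add_lfunE !comp_lfunE id_lfunE.
exists (p \o g0)%VF; split; first exact: is_hom_comp.
  apply/vspaceP=> v; rewrite memvf; apply/idP.
  have : v \in limg p by rewrite pI memvf.
  case/memv_imgP=> w _ ->; apply/memv_imgP; exists (f0 w); first exact: memvf.
  by rewrite comp_lfunE E2v linearD /= pd addr0.
apply/vspaceP=> v; rewrite memv_ker comp_lfunE; apply/eqP/memv_imgP => [pv|[w _ ->]].
  have : g0 v \in limg d by rewrite -pk memv_ker pv.
  case/memv_imgP=> w _ gv; exists (f1 w - h' v); first exact: memvf.
  by rewrite linearB /= CE -gv E4v addrK.
by rewrite -CE2 pd.
Qed.

End Homotopy.

(** * Exact sequences of four terms *)

Section CurveFacts.
Variable k : closedFieldType.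
Local Notation crv := [set (@id k)].

Lemma polymap_curve_eq0 (V : vectType k) (c : k -> V) q : polymap crv c -> polyfun crv q ->
  q 0 != 0 -> (forall t, q t != 0 -> c t = 0) -> forall t, c t = 0.
Proof.
move=> pc pq q0 cq t; apply: hom_sep => l; apply/eqP/negPn/negP => lt.
have [u [lu qu]] := polyfun_crv_irr (pc l) pq lt q0.
by rewrite cq // linear0 eqxx in lu.
Qed.

Lemma rank_curve (V W : vectType k) (A : k -> 'Hom(V, W)) : polymap crv A ->
  exists q, [/\ polyfun crv q, q 0 = 1 &
    forall t, q t != 0 -> (\dim (lker (A t)) <= \dim (lker (A 0%R)))%N].
Proof.
move=> pA; have [q [S [T [G [[pq _ _ q0] _ _ sol]]]]] := kernel_solver 0 pA.
by exists q; split=> // t /sol[].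
Qed.

(** A vector of ker i extends to a polynomial curve in the kernels of i + t phi, since the nullity
    of [i] is minimal on this line; the first-order term of the equation is phi v + i c1 = 0. *)
Lemma max_rank_tangent (V W : vectType k) (i phi : 'Hom(V, W)) v :
  (forall t, (\dim (lker i) <= \dim (lker (i + t *: phi)%R))%N) ->
  i v = 0 -> phi v \in limg i.
Proof.
move=> max_i iv; have jA := jet1_line i phi; have pA := jet1_polymap jA.
have [q [S [T [G [[pq pT _ q0] [_ _ T0 _] _ sol]]]]] := kernel_solver 0 pA.
rewrite scale0r addr0 in T0 sol.
have pc : polymap crv (fun t => T t v).
  by apply: polymap_eval => //; apply: polymap_const.
have [c0 [c1 jc]] := polymap_jet pc.
have c0E := jet1_at0 jc; rewrite T0 id_lfunE in c0E; rewrite -{c0}c0E in jc.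
have jic := jet1_eval jA jc.
have ic0 : (fun t => (i + t *: phi) (T t v)) = fun=> 0.
  apply/funext; apply: (polymap_curve_eq0 (jet1_polymap jic) pq); first by rewrite q0 oner_neq0.
  by move=> t qt; have [_ ->] := sol t qt; rewrite ?memv_ker ?iv.
rewrite ic0 in jic; have [_ E] := jet1_inj jic (jet1_const 0).
have -> : phi v = i (- c1) by apply/eqP; rewrite linearN -addr_eq0 addrC E.
by rewrite memv_img ?memvf.
Qed.

Definition subincl (V : vectType k) (U : {vspace V}) : 'Hom(subvs_of U, V) := linfun vsval.
Lemma subinclE (V : vectType k) (U : {vspace V}) v : subincl U v = vsval v.
Proof. by rewrite lfunE. Qed.

Lemma dim_subvs_ker (V W : vectType k) (U : {vspace V}) (f : 'Hom(V, W)) :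
  \dim (lker (f \o subincl U)) = \dim (U :&: lker f).
Proof.
pose i := subincl U; have iE v : i v = vsval v := subinclE v.
rewrite -(@dim_limg_inj _ _ _ i) => [|v _ v0]; last by apply/val_inj; rewrite /= -iE v0.
congr (\dim _); apply/vspaceP=> v; apply/memv_imgP/memv_capP.
  by move=> [w + ->]; rewrite !memv_ker comp_lfunE iE subvsP.
move=> [vU vf]; exists (vsproj U v); last by rewrite iE vsprojK.
by rewrite memv_ker comp_lfunE iE vsprojK // -memv_ker.
Qed.

(** The form of [curve_solver] used for modules: [U] will be a space of homomorphisms and [B]
    composition with a moving homomorphism. *)
Lemma curve_solver_in (V W Z : vectType k) (U : {vspace V}) (B : 'Hom(Z, 'Hom(V, W)))
    (f : k -> Z) f0 f1 v0 v1 :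
  jet1 f f0 f1 -> v0 \in U -> v1 \in U -> B f0 v0 = 0 -> B f0 v1 + B f1 v0 = 0 ->
  exists c q, [/\ polyfun crv q, q 0 = 1, jet1 c v0 v1, forall t, c t \in U &
    forall t, q t != 0 ->
      (\dim (U :&: lker (B f0)) <= \dim (U :&: lker (B (f t))))%N -> B (f t) (c t) = 0].
Proof.
move=> jf v0U v1U E0 E1; pose i := subincl U; have iE v : i v = vsval v := subinclE v.
have jA : jet1 (fun t => B (f t) \o i)%VF (B f0 \o i)%VF (B f1 \o i)%VF.
  have := jet1_comp (jet1_eval (jet1_const B) jf) (jet1_const i).
  by rewrite zero_lfunE addr0 comp_lfun0r add0r.
have [||c [q [pq q0 jc sol]]] := curve_solver jA (v0 := vsproj U v0) (v1 := vsproj U v1).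
- by rewrite comp_lfunE iE vsprojK.
- by rewrite !comp_lfunE !iE !vsprojK.
exists (fun t => i (c t)), q; split=> //.
- have := jet1_eval (jet1_const i) jc; rewrite zero_lfunE addr0 !iE !vsprojK //.
- by move=> t; rewrite iE subvsP.
by move=> t qt le_dim; rewrite -comp_lfunE sol // !dim_subvs_ker.
Qed.

End CurveFacts.

Section Key.
Variables (k : closedFieldType) (A B : falgType k) (tau : B -> A) (sigma : A -> B).
Hypotheses (Ht : is_anti tau) (Hs : is_anti sigma).
Hypotheses (ts : cancel sigma tau) (st : cancel tau sigma).
Local Notation D := (dual Ht).
Local Notation D' := (dual Hs).
Variables (Vt Ar : finType) (s t : Ar -> Vt) (e : Vt -> A) (ar : Ar -> A) (dd : Ar -> Ar -> A).
Variables (e' : Vt -> B) (ar' : Ar -> B) (dd' : Ar -> Ar -> B).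
Hypothesis HA : qpa s t e ar dd.
Hypothesis HB : qpa t s e' ar' dd'.
Hypothesis te : forall u, tau (e' u) = e u.
Local Notation crv := [set (@id k)].

Lemma dim_vpart_lker_dmap (M N : rmod A) (f : 'Hom(M, N)) u : is_hom f ->
  (\dim (vpart e' (lker (dmap f) : {vspace D N}) u) + \dim (vpart e (limg f) u))%N = \dim (vsp e N u).
Proof.
move=> fH; have := dim_vpart_hom HB u (dmap_hom Ht fH) (@submodule_full _ _ (D N)).
rewrite capfv -[vpart e' fullv u]/(vsp e' (D N) u) (vsp_dual_dim Ht te) => <-.
congr (_ + _)%N.
have -> : vpart e' (limg (dmap f) : {vspace D M}) u = limg (dmap (f \o ract M (e u))%VF).
  by rewrite dmap_comp limg_comp /vpart dualE te.
by rewrite rank_dmap limg_comp vpart_img.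
Qed.

(** Transposing turns the maps that kill [z] into maps from the free module [P] to the kernel of the
    dual of [z], which is the dual of coker z; these are counted on generators. *)
Lemma dim_hom_annihilating (b : Vt -> nat) (P : rmod B) (M N : rmod A) (z : 'Hom(M, N)) :
  freeb e' b P -> is_hom z ->
  \dim (hom_space N (D' P) :&: lker (prec (D' P) z)) =
    (\sum_u b u * (\dim (vsp e N u) - \dim (vpart e (limg z) u)))%N.
Proof.
move=> fP zH; have zzH := dmap_hom Ht zH.
transitivity (\dim (hom_space P (D N) :&: lker (postc P (dmap z)))); last first.
  rewrite (dim_freeb_ker HB fP zzH); apply: eq_bigr => u _; congr (_ * _)%N.
  by rewrite -(dim_vpart_lker_dmap u zH) addnK.
pose Tr := hom_of (@tr_linear k N P).
have TrE w : Tr w = tr w := hom_ofE _ w.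
rewrite -(@dim_limg_inj _ _ _ Tr) => [|w _]; last first.
  rewrite TrE => w0; rewrite -[w]trK w0.
  by apply/lfunP=> n; apply/lfunP=> p; rewrite trE !zero_lfunE.
congr (\dim _); apply/vspaceP=> w; apply/memv_imgP/memv_capP.
  move=> [h /memv_capP[hS hk] ->]; rewrite TrE.
  have hH := (@hom_spaceP _ _ N (D' P) h).1 hS.
  have hz0 : prec (D' P) z h = 0 by apply/eqP; rewrite -memv_ker.
  have hz : (h \o z)%VF = 0 := etrans (esym (precE z h)) hz0.
  split; first exact/(@hom_spaceP _ _ P (D N))/(tr_hom Ht st hH).
  have E : postc P (dmap z) (tr h) = 0.
    rewrite postcE -tr_comp_r hz.
    by apply/lfunP=> v; apply/lfunP=> p; rewrite trE !zero_lfunE.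
  by rewrite memv_ker; apply/eqP.
move=> [wS wk]; exists (tr w); last by rewrite TrE trK.
have wH := (@hom_spaceP _ _ P (D N) w).1 wS.
have zw0 : postc P (dmap z) w = 0 by apply/eqP; rewrite -memv_ker.
have zw : (dmap z \o w)%VF = 0 := etrans (esym (postcE (dmap z) w)) zw0.
rewrite memv_cap; apply/andP; split.
  exact/(@hom_spaceP _ _ N (D' P))/(tr_hom Hs ts wH).
have E : prec (D' P) z (tr w) = 0.
  apply: (etrans (precE z (tr w))); rewrite -tr_comp_l zw.
  by apply/lfunP=> v; apply/lfunP=> p; rewrite trE !zero_lfunE.
by rewrite memv_ker; apply/eqP.
Qed.

Variables (b1 b0 c1 c0 alpha : Vt -> nat) (P1 P0 : rmod B) (Y1 Y0 : rmod A).
Hypotheses (fP1 : freeb e' b1 P1) (fP0 : freeb e' b0 P0).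
Hypotheses (fY1 : freeb e c1 Y1) (fY0 : freeb e c0 Y0).
Hypothesis wt : (\sum_u b0 u * alpha u + \sum_u c1 u * alpha u =
                 \sum_u c0 u * alpha u + \sum_u b1 u * alpha u)%N.
Local Notation I0 := (D' P0).
Local Notation I1 := (D' P1).
Hypothesis generic : forall i : 'Hom(I0, I1), is_hom i ->
  forall u, (alpha u <= \dim (vpart e (lker i) u))%N.

(** In such a sequence coker z and ker i are one module, the image of [g], of dimension vector
    [alpha]. *)
Definition four_term (z : 'Hom(Y1, Y0)) (g : 'Hom(Y0, I0)) (i : 'Hom(I0, I1)) : Prop :=
  [/\ is_hom z, is_hom g & is_hom i] /\
  [/\ lker g = limg z, lker i = limg g & forall u, \dim (vpart e (limg g) u) = alpha u].

(* Linear algebra solves g psi + g1 z = 0 and i g1 + phi g = 0: by [wt], the maps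
   h with i h z = 0 are just numerous enough for their composites with z to exhaust
   the maps killed by i. *)
Lemma four_term_tangent z g i (psi : 'Hom(Y1, Y0)) : four_term z g i -> is_hom psi ->
  exists (g1 : 'Hom(Y0, I0)) (phi : 'Hom(I0, I1)),
    [/\ is_hom g1, is_hom phi, ((g \o psi) + (g1 \o z))%VF = 0 & ((i \o g1) + (phi \o g))%VF = 0].
Proof.
move=> [[zH gH iH] [gk ik ga]] psiH.
have dimker : \dim (lker i) = (\sum_u alpha u)%N.
  rewrite ik (dim_vparts HA (submodule_img gH (@submodule_full _ _ _))).
  by apply: eq_bigr => u _; rewrite ga.
have YP0 := freeb_projective HA fY0.
have ig : (i \o g)%VF = 0.
  apply/lfunP=> v; rewrite comp_lfunE zero_lfunE; apply/eqP.
  by rewrite -memv_ker ik memv_img ?memvf.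
have gz : (g \o z)%VF = 0.
  apply/lfunP=> v; rewrite comp_lfunE zero_lfunE; apply/eqP.
  by rewrite -memv_ker gk memv_img ?memvf.
(* A map that kills the image of [z] kills ker g, hence factors through [g] by injectivity of the
   target. *)
have factor (P : rmod B) b (w : 'Hom(Y0, D' P)) : freeb e' b P -> is_hom w -> (w \o z)%VF = 0 ->
    exists2 phi : 'Hom(I0, D' P), is_hom phi & (phi \o g)%VF = w.
  move=> fP wH wz; apply: (injective_ext Ht ts st (freeb_projective HB fP) gH _ wH).
  rewrite gk; apply/subvP=> _ /memv_imgP[v _ ->]; rewrite memv_ker -comp_lfunE wz.
  by rewrite zero_lfunE.
have coker_dim u : (\dim (vsp e Y0 u) - \dim (vpart e (limg z) u))%N = alpha u.
  have := dim_vpart_hom HA u gH (@submodule_full _ _ Y0).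
  by rewrite capfv ga gk -[vpart e fullv u]/(vsp e Y0 u) => <-; rewrite addKn.
pose L := (hom_space Y0 I0 :&: lker (prec I1 z \o postc Y0 i))%VS.
have LP h : reflect (is_hom h /\ (i \o h \o z)%VF = 0) (h \in L).
  rewrite memv_cap memv_ker comp_lfunE postcE precE.
  by apply: (iffP andP) => -[/hom_spaceP hH /eqP E].
(* The composites i h exhaust the maps Y0 -> I1 that kill [z]: such a map is phi g, maximality of
   the rank of [i] puts phi (ker i) inside the image of [i], and projectivity of Y0 lifts it along
   [i]. *)
have dimW : \dim (postc Y0 i @: L) = (\sum_u b1 u * alpha u)%N.
  have <- : \dim (hom_space Y0 I1 :&: lker (prec I1 z)) = (\sum_u b1 u * alpha u)%N.
    by rewrite (dim_hom_annihilating fP1 zH); apply: eq_bigr => u _; rewrite coker_dim.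
  congr (\dim _); apply/vspaceP=> w; apply/memv_imgP/memv_capP.
    move=> [h /LP[hH E] ->]; rewrite postcE; split; first by apply/hom_spaceP; apply: is_hom_comp.
    by rewrite memv_ker precE E.
  move=> [/hom_spaceP wH]; rewrite memv_ker precE => /eqP wz.
  have [phi phiH phiE] := factor _ _ _ fP1 wH wz.
  have [|h hH hE] := @projective_lift _ _ Y0 I0 I1 i w YP0 iH wH.
    rewrite -phiE limg_comp; apply/subvP=> _ /memv_imgP[v vg ->].
    apply: max_rank_tangent => [t'|]; last by apply/eqP; rewrite -memv_ker ik.
    have itH : is_hom (i + t' *: phi) by apply: is_homD => //; apply: is_homZ.
    rewrite dimker (dim_vparts HA (submodule_ker itH)); apply: leq_sum => u _.
    exact: generic.
  by exists h; [apply/LP; rewrite hE | rewrite postcE hE].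
have dimK1 : \dim (L :&: lker (postc Y0 i)) = (\sum_u c0 u * alpha u)%N.
  transitivity (\dim (hom_space Y0 I0 :&: lker (postc Y0 i))).
    congr (\dim _); apply/vspaceP=> h; rewrite !memv_cap !memv_ker comp_lfunE precE !postcE.
    by case: (eqVneq (i \o h)%VF 0) => [->|_]; rewrite ?andbF // comp_lfun0l eqxx !andbT.
  rewrite (dim_freeb_ker HA fY0 iH); apply: eq_bigr => u _.
  by rewrite ik ga.
have dimK2 : \dim (L :&: lker (prec I0 z)) = (\sum_u b0 u * alpha u)%N.
  transitivity (\dim (hom_space Y0 I0 :&: lker (prec I0 z))).
    congr (\dim _); apply/vspaceP=> h; rewrite !memv_cap !memv_ker comp_lfunE !precE !postcE.
    by case: (eqVneq (h \o z)%VF 0) => [E|_]; rewrite ?andbF // -comp_lfunA E comp_lfun0r eqxx !andbT.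
  by rewrite (dim_hom_annihilating fP0 zH); apply: eq_bigr => u _; rewrite coker_dim.
have dimU : \dim (hom_space Y1 I0 :&: lker (postc Y1 i)) = (\sum_u c1 u * alpha u)%N.
  by rewrite (dim_freeb_ker HA fY1 iH); apply: eq_bigr => u _; rewrite ik ga.
(* The dimension of [L] is computed through h -> i h and through h -> h z; comparing the two results
   by [wt] leaves exactly the dimension of the space on the right. *)
have onto : (prec I0 z @: L)%VS = (hom_space Y1 I0 :&: lker (postc Y1 i))%VS.
  apply/eqP; rewrite eqEdim; apply/andP; split.
    apply/subvP=> _ /memv_imgP[h /LP[hH E] ->]; rewrite precE memv_cap memv_ker postcE comp_lfunA E.
    by rewrite eqxx andbT; apply/hom_spaceP; apply: is_hom_comp.
  have := limg_ker_dim (postc Y0 i) L; have := limg_ker_dim (prec I0 z) L.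
  rewrite dimU dimW dimK1 dimK2; move: wt.
  move: (\dim (prec _ z @: L)) (\dim L) => x y.
  by lia.
have : (g \o psi)%VF \in (prec I0 z @: L)%VS.
  rewrite onto memv_cap memv_ker postcE comp_lfunA ig comp_lfun0l eqxx andbT.
  by apply/hom_spaceP; apply: is_hom_comp.
case/memv_imgP=> h /LP[hH E]; rewrite precE => gpsi.
have [||phi phiH phiE] := factor _ _ (i \o h)%VF fP1 => //; first exact: is_hom_comp.
exists (- h), phi; split=> //; first exact: is_homN.
  by rewrite gpsi comp_lfunNl subrr.
by rewrite comp_lfunNr phiE addNr.
Qed.

(** [i] moves on the line i + x phi, then [g], then [z] follow by solving the composition equations
    with tangents [g1] and [psi]. Genericity keeps the relevant kernels from shrinking, as the
    solver requires, and semicontinuity of ranks preserves exactness. *)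
Lemma four_term_curve z g i (psi : 'Hom(Y1, Y0)) : four_term z g i -> is_hom psi ->
  exists c q, [/\ jet1 c z psi, polyfun crv q, q 0 != 0 &
    forall t, q t != 0 -> exists g' i', four_term (c t) g' i'].
Proof.
move=> ft psiH; have [g1 [phi [g1H phiH E1 E2]]] := four_term_tangent ft psiH.
have [[zH gH iH] [gk ik ga]] := ft.
have ig : (i \o g)%VF = 0.
  apply/lfunP=> v; rewrite comp_lfunE zero_lfunE; apply/eqP.
  by rewrite -memv_ker ik memv_img ?memvf.
have gz : (g \o z)%VF = 0.
  apply/lfunP=> v; rewrite comp_lfunE zero_lfunE; apply/eqP.
  by rewrite -memv_ker gk memv_img ?memvf.
have dimker : \dim (lker i) = (\sum_u alpha u)%N.
  rewrite ik (dim_vparts HA (submodule_img gH (@submodule_full _ _ _))).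
  by apply: eq_bigr => u _; rewrite ga.
pose it x := i + x *: phi; have jit : jet1 it i phi := jet1_line i phi.
have itH x : is_hom (it x) by apply: is_homD => //; apply: is_homZ.
have [q3 [pq3 q30 rk3]] := rank_curve (jet1_polymap jit).
have it0 : it 0 = i by rewrite /it scale0r addr0.
rewrite it0 dimker in rk3.
(* Each part is at least [alpha u] by [generic] while the total is at most the sum, so equality
   holds at every vertex. *)
have ker_it x : q3 x != 0 -> forall u, \dim (vpart e (lker (it x)) u) = alpha u.
  move=> qx; have le1 u : (alpha u <= \dim (vpart e (lker (it x)) u))%N by apply: generic.
  have : (\sum_u \dim (vpart e (lker (it x)) u) <= \sum_u alpha u)%N.
    by rewrite -(dim_vparts HA (submodule_ker (itH x))); apply: rk3.
  move=> le2 u; apply/eqP; rewrite eqn_leq le1 andbT leqNgt; apply/negP => lt.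
  move: le2; rewrite leqNgt => /negP; apply.
  by rewrite (bigD1 u) //= [X in (_ < X)%N](bigD1 u) //= -addSn leq_add ?leq_sum.
have Bpost (U V W : vectType k) : linear (fun f : 'Hom(V, W) => postc U f).
  move=> x f f'; apply/lfunP=> h.
  by rewrite add_lfunE scale_lfunE !postcE comp_lfunDl comp_lfunZl.
pose Bp U V W := hom_of (Bpost U V W).
have BpE U V W f h : Bp U V W f h = (f \o h)%VF by rewrite hom_ofE postcE.
have BpE' U V W f : Bp U V W f = postc U f by rewrite hom_ofE.
have gS : g \in hom_space Y0 I0 by apply/hom_spaceP.
have g1S : g1 \in hom_space Y0 I0 by apply/hom_spaceP.
have [||gt [q1 [pq1 q10 jg gtS solg]]] := curve_solver_in (B := Bp Y0 I0 I1) jit gS g1S.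
- by rewrite BpE ig.
- by rewrite !BpE.
have gtH x : is_hom (gt x) by apply/hom_spaceP.
have igt x : q1 x != 0 -> (it x \o gt x)%VF = 0.
  move=> qx; rewrite -BpE; apply: solg => //; rewrite !BpE'.
  rewrite (dim_freeb_ker HA fY0 iH) (dim_freeb_ker HA fY0 (itH x)).
  apply: leq_sum => u _; rewrite leq_mul2l; apply/orP; right.
  by rewrite ik ga; apply: generic.
have zS : z \in hom_space Y1 Y0 by apply/hom_spaceP.
have psiS : psi \in hom_space Y1 Y0 by apply/hom_spaceP.
have [||zt [q2 [pq2 q20 jz ztS solz]]] := curve_solver_in (B := Bp Y1 Y0 I0) jg zS psiS.
- by rewrite BpE gz.
- by rewrite !BpE.
have ztH x : is_hom (zt x) by apply/hom_spaceP.
have [q4 [pq4 q40 rk4]] := rank_curve (jet1_polymap jg).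
have [q5 [pq5 q50 rk5]] := rank_curve (jet1_polymap jz).
have YU := @submodule_full _ _ Y0.
exists zt, (fun x => q1 x * q2 x * q3 x * q4 x * q5 x); split=> //.
- by do 4!(apply: polyfun_mul => //).
- by rewrite q10 q20 q30 q40 q50 !mulr1 oner_neq0.
move=> x; rewrite !mulf_eq0 !negb_or -!andbA => /and5P[qx1 qx2 qx3 qx4 qx5].
have gt_sub : (limg (gt x) <= lker (it x))%VS.
  by apply/subvP=> _ /memv_imgP[v _ ->]; rewrite memv_ker -comp_lfunE igt // zero_lfunE.
have rk_g u : (\dim (vpart e (limg (gt x)) u) <= alpha u)%N.
  by rewrite -(ker_it x qx3 u) dimvS // vpartS.
(* The image of [gt x] lies in ker (it x), of dimension [alpha u] at u; so the kernel of [gt x] is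
   at every vertex at least as large as that of [g], and the solver applies. *)
have gzt : (gt x \o zt x)%VF = 0.
  rewrite -BpE; apply: solz => //; rewrite !BpE'.
  rewrite (dim_freeb_ker HA fY1 gH) (dim_freeb_ker HA fY1 (gtH x)).
  apply: leq_sum => u _; rewrite leq_mul2l; apply/orP; right.
  have := dim_vpart_hom HA u gH YU; have := dim_vpart_hom HA u (gtH x) YU.
  have := rk_g u; rewrite !capfv ga.
  move: (\dim (vpart e (lker g) u)) (\dim (vpart e (lker (gt x)) u)) (\dim (vpart e (limg (gt x)) u)) (\dim (vpart e fullv u)) ; clear=> *; lia.
have gt_exact : limg (gt x) = lker (it x).
  apply/eqP; rewrite eqEdim gt_sub /=.
  have -> : \dim (lker (it x)) = \dim (limg g).
    rewrite (dim_vparts HA (submodule_ker (itH x))) -ik dimker.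
    by apply: eq_bigr => u _; rewrite ker_it.
  have := rk4 _ qx4; rewrite (jet1_at0 jg).
  have := limg_ker_dim g fullv; have := limg_ker_dim (gt x) fullv; rewrite !capfv.
  move: (\dim (limg g)) (\dim (limg (gt x))) (\dim (lker g)) (\dim (lker (gt x))) (\dim fullv) ; clear=> *; lia.
exists (gt x), (it x); split=> //; split=> //.
  apply/eqP; rewrite eq_sym eqEdim; apply/andP; split.
    by apply/subvP=> _ /memv_imgP[v _ ->]; rewrite memv_ker -comp_lfunE gzt zero_lfunE.
  have e1 : \dim (limg (gt x)) = \dim (limg g).
    rewrite gt_exact (dim_vparts HA (submodule_ker (itH x))) -ik dimker.
    by apply: eq_bigr => u _; rewrite ker_it.
  have := rk5 _ qx5; rewrite (jet1_at0 jz).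
  have := limg_ker_dim g fullv; have := limg_ker_dim (gt x) fullv; rewrite !capfv gk e1.
  have := limg_ker_dim z fullv; have := limg_ker_dim (zt x) fullv; rewrite !capfv.
  move: (\dim (limg g)) (\dim (limg z)) (\dim (limg (zt x))) (\dim (lker z)) (\dim (lker (zt x))) (\dim (lker (gt x))).
  move: (\dim {:Y0}) (\dim {:Y1}) ; clear=> *; lia.
by move=> u; rewrite gt_exact ker_it.
Qed.

Lemma four_term_dense (k_char0 : [pchar k] =i pred0) (f : 'Hom(Y1, Y0) -> k) :
  (exists z g i, four_term z g i) ->
  polyfun (@lin_coord k 'Hom(Y1, Y0)) f ->
  (forall z g i, four_term z g i -> f z = 0) -> forall z, is_hom z -> f z = 0.
Proof.
move=> [z0 [g0 [i0 ft0]]] pf f0 z zH.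
pose T : set 'Hom(Y1, Y0) := [set z | exists g i, four_term z g i].
apply: (@jet_dense k _ (hom_space Y1 Y0) T k_char0 f _ _ _ pf) => [|z' [g [i [[z'H _ _] _]]]|z' psi|z' |].
- by exists z0, g0, i0.
- exact/hom_spaceP.
- move=> [g [i ft]] /hom_spaceP psiH.
  by have [c [q [? ? ? ?]]] := four_term_curve ft psiH; exists c, q.
- by move=> [g [i ft]]; apply: f0 ft.
exact/hom_spaceP.
Qed.

End Key.

(** * Cokernels in the representation variety *)

Section PolymapExtra.
Variables (k : fieldType) (X : Type) (crd : set (X -> k)).

Lemma polymap_hom (V W : vectType k) (F : X -> 'Hom(V, W)) :
  (forall v, polymap crd (fun x => F x v)) -> polymap crd F.
Proof.
move=> pF; pose b := vbasis {:V}.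
have lin0 (i : 'I_(\dim {:V})) (w : W) : linear (fun v => coord b i v *: w).
  by move=> c u v; rewrite linearP scalerDl scalerA.
have lin (i : 'I_(\dim {:V})) : linear (fun w => hom_of (lin0 i w)).
  move=> c u v; apply/lfunP=> z; rewrite add_lfunE scale_lfunE !hom_ofE.
  by rewrite scalerDr !scalerA mulrC.
have -> : F = fun x => \sum_i hom_of (lin i) (F x b`_i).
  apply/funext=> x; apply/lfunP=> v; rewrite sum_lfunE {1}(coord_vbasis (memvf v)).
  by rewrite linear_sum; apply: eq_bigr => i _; rewrite linearZ !hom_ofE.
by apply: polymap_sum => i; apply: polymap_app.
Qed.

Lemma polymap_ffun (I : finType) (V : vectType k) (F : X -> {ffun I -> V}) :
  (forall i, polymap crd (fun x => F x i)) -> polymap crd F.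
Proof.
move=> pF.
have -> : F = fun x => \sum_i linfun (fun v : V => [ffun j => if j == i then v else 0]) (F x i).
  by apply/funext=> x; apply: ffun_sum_delta.
by apply: polymap_sum => i; apply: polymap_app.
Qed.

Lemma polymap_mx m n (F : X -> 'M[k]_(m, n)) :
  (forall i j, polyfun crd (fun x => F x i j)) -> polymap crd F.
Proof.
move=> pF; have -> : F = fun x => \sum_i \sum_j F x i j *: delta_mx i j.
  by apply/funext=> x; apply: matrix_sum_delta.
apply: polymap_sum => i; apply: polymap_sum => j.
by apply: polymapZ => //; apply: polymap_const.
Qed.

End PolymapExtra.

Section Rep.
Variables (k : closedFieldType) (A : falgType k) (Vt Ar : finType).
Variables (s t : Ar -> Vt) (e : Vt -> A) (ar : Ar -> A) (dd : Ar -> Ar -> A).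
Hypothesis HA : qpa s t e ar dd.
Implicit Types M N X Y P : rmod A.
Local Notation "v '·' x" := (ract _ x v) (at level 39, left associativity).
Local Notation vsp := (vsp e).
Local Notation vpart := (vpart e).
Local Notation freeb := (freeb e).
Variable alpha : Vt -> nat.

Definition grep := forall a, 'M[k]_(alpha (s a), alpha (t a)).
Definition grep_coord : set (grep -> k) :=
  [set f | exists a i j, f = fun x : grep => x a i j].

Definition grealizes (x : grep) N : Prop :=
  exists f : forall u, 'Hom('rV[k]_(alpha u), N),
    (forall u, lker (f u) = 0%VS /\ limg (f u) = limg (ract N (e u))) /\
    (forall a (w : 'rV[k]_(alpha (s a))),
      f (t a) (w *m x a) = ract N (ar a) (f (s a) w)).

Definition grepvar : set grep := [set x | exists N, grealizes x N].

(** A decomposition of [V] into row spaces of sizes [alpha u]. With one frame fixed, all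
    representations of dimension vector [alpha] act on the same space. *)
Definition is_frame (V : vectType k) (f : forall u, 'Hom('rV[k]_(alpha u), V))
    (g : forall u, 'Hom(V, 'rV[k]_(alpha u))) : Prop :=
  [/\ forall u w, g u (f u w) = w, forall u v w, u != v -> g u (f v w) = 0 &
      forall v, \sum_u f u (g u v) = v].

Definition framed (x : grep) N (f : forall u, 'Hom('rV[k]_(alpha u), N))
    (g : forall u, 'Hom(N, 'rV[k]_(alpha u))) : Prop :=
  [/\ is_frame f g, forall u v, f u (g u v) = v · e u &
      forall a (w : 'rV[k]_(alpha (s a))), f (t a) (w *m x a) = f (s a) w · ar a].

Lemma realizes_framed x N : grealizes x N -> exists f g, @framed x N f g.
Proof.
move=> [f [fP fa]]; exists f, (fun u => (f u)^-1 \o ract N (e u))%VF.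
have fi u w : ((f u)^-1)%VF (f u w) = w.
  by apply: lker0_lfunK; have [-> _] := fP u.
have fe u w : f u w · e u = f u w.
  apply/eqP; rewrite -(mem_vsp HA) -[vsp N u]/(limg (ract N (e u))); have [_ <-] := fP u.
  by rewrite memv_img ?memvf.
have fg u v : f u (((f u)^-1 \o ract N (e u))%VF v) = v · e u.
  by rewrite comp_lfunE limg_lfunVK //; have [_ ->] := fP u; rewrite memv_img ?memvf.
split=> //; split.
- by move=> u w; rewrite comp_lfunE fe fi.
- by move=> u v w uv; rewrite comp_lfunE -fe (act_ee HA) eq_sym (negPf uv) linear0.
by move=> v; under eq_bigr do rewrite fg; rewrite (sum_e HA).
Qed.

Lemma framed_realizes x N f g : @framed x N f g -> grealizes x N.
Proof.
move=> [[gf gf0 fg] fe fa]; exists f; split=> // u; split.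
  by apply/eqP/lker0P => v w /(congr1 (g u)); rewrite !gf.
apply/vspaceP=> v; apply/memv_imgP/memv_imgP => -[w _ ->].
  by exists (f u w); rewrite ?memvf // -fe gf.
by exists (g u w); rewrite ?memvf // fe.
Qed.

Lemma framed_dim x N f g u : @framed x N f g -> \dim (vsp N u) = alpha u.
Proof.
move=> [[gf gf0 fg] fe fa].
have -> : vsp N u = limg (f u).
  apply/vspaceP=> v; apply/memv_imgP/memv_imgP => -[w _ ->].
    by exists (g u w); rewrite ?memvf // fe.
  by exists (f u w); rewrite ?memvf // -fe gf.
rewrite limg_dim_eq; first by rewrite dimvf /dim /= mul1n.
apply/eqP; rewrite capfv; apply/lker0P => v w /(congr1 (g u)); by rewrite !gf.
Qed.

Lemma framed_total x N f g : @framed x N f g -> \dim {:N} = (\sum_u alpha u)%N.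
Proof.
move=> fr; rewrite (dim_vparts HA (@submodule_full _ _ N)); apply: eq_bigr => u _.
exact: framed_dim fr.
Qed.

Lemma grealizes_dim x N u : grealizes x N -> \dim (vsp N u) = alpha u.
Proof. by move=> /realizes_framed[f [g fr]]; apply: framed_dim fr. Qed.

Lemma grealizes_iso x N N' (f : 'Hom(N, N')) : is_hom f -> lker f = 0%VS -> limg f = fullv ->
  grealizes x N -> grealizes x N'.
Proof.
move=> fH fk fI [h [hP ha]]; exists (fun u => f \o h u)%VF; split=> [u|a w].
  have [hk hI] := hP u; split.
    apply/eqP/lker0P => v w; rewrite !comp_lfunE.
    have /lker0P finj : lker f == 0%VS by rewrite fk.
    have /lker0P hinj : lker (h u) == 0%VS by rewrite hk.
    by move=> /finj/hinj.
  by rewrite limg_comp hI -limg_comp fH limg_comp fI.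
by rewrite !comp_lfunE ha homE.
Qed.

Lemma frame_iso (V V' : vectType k) f g f' g' : @is_frame V f g -> @is_frame V' f' g' ->
  exists (phi : 'Hom(V, V')) (psi : 'Hom(V', V)),
    [/\ forall u v, g' u (phi v) = g u v, forall u v, g u (psi v) = g' u v,
        forall v, psi (phi v) = v, forall v, phi (psi v) = v & forall u w, phi (f u w) = f' u w].
Proof.
move=> [gf gf0 fg] [gf' gf0' fg'].
pose phi : 'Hom(V, V') := \sum_u (f' u \o g u)%VF.
pose psi : 'Hom(V', V) := \sum_u (f u \o g' u)%VF.
have phiE v : phi v = \sum_u f' u (g u v).
  by rewrite sum_lfunE; apply: eq_bigr => u _; rewrite comp_lfunE.
have psiE v : psi v = \sum_u f u (g' u v).
  by rewrite sum_lfunE; apply: eq_bigr => u _; rewrite comp_lfunE.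
have g'phi u v : g' u (phi v) = g u v.
  rewrite phiE linear_sum (bigD1 u) //= gf' big1 ?addr0 // => w wu.
  by rewrite gf0' // eq_sym.
have gpsi u v : g u (psi v) = g' u v.
  rewrite psiE linear_sum (bigD1 u) //= gf big1 ?addr0 // => w wu.
  by rewrite gf0 // eq_sym.
have psiphi v : psi (phi v) = v by rewrite psiE; under eq_bigr do rewrite g'phi; rewrite fg.
have phipsi v : phi (psi v) = v by rewrite phiE; under eq_bigr do rewrite gpsi; rewrite fg'.
exists phi, psi; split=> // u w.
by rewrite phiE (bigD1 u) //= gf big1 ?addr0 // => v vu; rewrite gf0 // linear0.
Qed.

(** Two frames differ by an isomorphism, along which a module realizing [x] is carried to [V]; only
    the action then depends on [x]. *)
Lemma frame_module x (V : vectType k) f g : @is_frame V f g -> grepvar x ->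
  exists r H1 H2 H3, let N := @RMod k A V r H1 H2 H3 in @framed x N f g.
Proof.
move=> fr [N' /realizes_framed[f' [g' [fr' fe' fa']]]].
have [gf gf0 fg] := fr; have [gf' gf0' fg'] := fr'.
have [phi [psi [g'phi gpsi psiphi phipsi phif]]] := frame_iso fr fr'.
have hg : (psi \o phi)%VF = \1%VF by apply/lfunP=> v; rewrite comp_lfunE psiphi id_lfunE.
have cmp a b v : psi (phi (psi (phi v · a)) · b) = psi (phi v · a · b) by rewrite phipsi.
have psif' u w : psi (f' u w) = f u w by rewrite -phif psiphi.
exists (transp_act phi psi), (transp_linear phi psi), (transpM cmp), (transp1 hg).
have actE y v : ract (RMod (transp_linear phi psi) (transpM cmp) (transp1 hg)) y v =
  psi (phi v · y) by rewrite /= /transp_act !comp_lfunE.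
split=> // [u v|a w].
  by rewrite actE -fe' psif' g'phi.
by rewrite actE phif -fa' psif'.
Qed.

Variables (c1 c0 : Vt -> nat) (Y1 Y0 : rmod A).
Hypotheses (fY1 : freeb c1 Y1) (fY0 : freeb c0 Y0).
Variable S : set 'Hom(Y1, Y0).
Hypothesis S_open : forall z, is_hom z -> S z -> exists F, [/\ polyfun (@lin_coord k 'Hom(Y1, Y0)) F,
  F z != 0 & forall z', is_hom z' -> F z' != 0 -> S z'].

Definition coker_set : set grep :=
  [set x | exists z N, [/\ is_hom z, S z, is_coker z N & grealizes x N]].

(** All points of the variety act on the space of [N]. Homomorphisms from the free module Y0 form
    the kernel of a system polynomial in x and of constant nullity, so [p0] extends to a polynomial
    family [px]; likewise [z0] extends to [zx] with px zx = 0. Surjectivity of [px] and exactness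
    are then open rank conditions. *)
Lemma coker_set_open : zopen_in grep_coord grepvar coker_set.
Proof.
apply/zopen_inP; split=> [x [z [N [_ _ _ xN]]]|x0]; first by exists N.
move=> [z0 [N [z0H Sz0 [p0 [p0H p0I p0k]] /realizes_framed[f [g fr]]]]].
have [frVg fe fa] := fr.
pose rho (x : grep) a : 'End(N) := linfun (fun v => f (t a) (g (s a) v *m x a)).
have rho_lin x a : linear (fun v => f (t a) (g (s a) v *m x a)).
  by move=> c u v; rewrite linearP mulmxDl -scalemxAl linearP.
have rhoE x a v : rho x a v = f (t a) (g (s a) v *m x a) := hom_ofE (rho_lin x a) v.
(* The homomorphism equations on the generators of the algebra; only those for the arrows involve
   [x]. *)
pose sys (x : grep) (p : 'Hom(Y0, N)) : {ffun Vt + Ar -> 'Hom(Y0, N)} :=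
  [ffun i => match i with
    | inl u => (p \o ract Y0 (e u)) - (ract N (e u) \o p)
    | inr a => (p \o ract Y0 (ar a)) - (rho x a \o p)
    end]%VF.
have sys_lin x : linear (sys x).
  move=> c p p'; apply/ffunP=> i; rewrite !ffunE.
  by case: i => [u|a]; rewrite comp_lfunDl comp_lfunDr -comp_lfunZl -comp_lfunZr
    scalerBr opprD addrACA.
pose Asys x := hom_of (sys_lin x).
have AsysE x p : Asys x p = sys x p := hom_ofE _ p.
have pcoord a i j : polyfun grep_coord (fun x : grep => x a i j).
  by apply: polyfun_coord; exists a, i, j.
have prho a : polymap grep_coord (fun x => rho x a).
  apply: polymap_hom => v.
  have l1 : linear (fun m : 'M[k]_(alpha (s a), alpha (t a)) => f (t a) (g (s a) v *m m)).
    by move=> c m m'; rewrite mulmxDr -scalemxAr linearP.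
  have -> : (fun x => rho x a v) = fun x => hom_of l1 (x a).
    by apply/funext=> x; rewrite rhoE hom_ofE.
  by apply: polymap_app; apply: polymap_mx.
have pA : polymap grep_coord Asys.
  apply: polymap_hom => p; apply: polymap_ffun => i.
  have -> : (fun x => Asys x p i) = fun x => sys x p i by apply/funext => x; rewrite AsysE.
  case: i => [u|a].
    have -> : (fun x => sys x p (inl u)) = fun x => ((p \o ract Y0 (e u)) - (ract N (e u) \o p))%VF.
      by apply/funext=> x; rewrite ffunE.
    exact: polymap_const.
  have -> : (fun x => sys x p (inr a)) = fun x => ((p \o ract Y0 (ar a)) - (rho x a \o p))%VF.
    by apply/funext=> x; rewrite ffunE.
  apply: polymapB; first exact: polymap_const.
  by apply: polymap_comp => //; apply: polymap_const.
have kerA x r H1 H2 H3 : let Nx := @RMod k A N r H1 H2 H3 in @framed x Nx f g ->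
    lker (Asys x) = hom_space Y0 Nx.
  move=> Nx [_ feN faN]; apply/vspaceP=> p; rewrite memv_ker AsysE.
  have eE u (v : N) : ract Nx (e u) v = ract N (e u) v.
    exact: (etrans (esym (feN u v)) (fe u v)).
  have aE a (v : N) : ract Nx (ar a) v = rho x a v.
    rewrite rhoE; apply: (etrans _ (esym (faN a (g (s a) v)))).
    by rewrite (feN (s a) v) (act_ear HA).
  apply/eqP/idP => [p0E|/(@hom_spaceP _ _ Y0 Nx p).1 pH].
    apply/(@hom_spaceP _ _ Y0 Nx p); apply: (@is_hom_gen _ _ _ _ _ _ _ _ _ HA Y0 Nx) => [u v|a v].
      have := congr1 (fun F : {ffun Vt + Ar -> 'Hom(Y0, N)} => F (inl u) v) p0E.
      rewrite !ffunE add_lfunE opp_lfunE !comp_lfunE zero_lfunE => /eqP.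
      by rewrite subr_eq0 => /eqP->; exact: (esym (eE u (p v))).
    have := congr1 (fun F : {ffun Vt + Ar -> 'Hom(Y0, N)} => F (inr a) v) p0E.
    rewrite !ffunE add_lfunE opp_lfunE !comp_lfunE zero_lfunE => /eqP.
    by rewrite subr_eq0 => /eqP->; exact: (esym (aE a (p v))).
  apply/ffunP=> -[u|a]; rewrite !ffunE; apply/eqP; rewrite subr_eq0; apply/eqP/lfunP=> v.
    by rewrite !comp_lfunE; apply: (etrans (@homE _ _ Y0 Nx p _ v pH)); apply: eE.
  by rewrite !comp_lfunE; apply: (etrans (@homE _ _ Y0 Nx p _ v pH)); apply: aE.
have dimA x : grepvar x -> \dim (lker (Asys x)) = (\sum_u c0 u * alpha u)%N.
  move=> /(frame_module frVg)[r [H1 [H2 [H3 frx]]]]; rewrite (kerA _ _ _ _ _ frx).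
  apply: (etrans (dim_freeb_hom HA (@RMod k A N r H1 H2 H3) fY0)).
  apply: eq_bigr => u _; congr (_ * _)%N.
  exact: (framed_dim u frx).
have x0R : grepvar x0 by exists N; apply: framed_realizes fr.
have p0S : p0 \in lker (Asys x0).
  have E : N = @RMod k A N (ract N) (@ract_linear _ _ N) (@ractM _ _ N) (ract1 N) by case: (N).
  rewrite (kerA x0 (ract N) (@ract_linear _ _ N) (@ractM _ _ N) (ract1 N)).
    exact/(@hom_spaceP _ _ Y0 _ p0).
  exact: fr.
have [q1 [_ [T1 [_ [[pq1 pT1 _ q10] [_ _ T10 _] _ sol1]]]]] := kernel_solver x0 pA.
pose px x := T1 x p0; have ppx : polymap grep_coord px.
  by apply: polymap_eval => //; apply: polymap_const.
have px0 : px x0 = p0 by rewrite /px T10 id_lfunE.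
have Apx x : grepvar x -> q1 x != 0 -> px x \in lker (Asys x).
  move=> xR qx; have [_ sol] := sol1 x qx; rewrite memv_ker sol //.
  by rewrite !dimA.
pose U := hom_space Y1 Y0; pose j := subincl U.
pose A2 x := (postc Y1 (px x) \o j)%VF.
have pA2 : polymap grep_coord A2.
  apply: polymap_hom => z.
  have -> : (fun x => A2 x z) = fun x => (px x \o vsval z)%VF.
    by apply/funext=> x; rewrite comp_lfunE postcE subinclE.
  by apply: polymap_comp => //; apply: polymap_const.
have [q2 [_ [T2 [_ [[pq2 pT2 _ q20] [_ _ T20 _] _ sol2]]]]] := kernel_solver x0 pA2.
pose zx x := j (T2 x (vsproj U z0)); have pzx : polymap grep_coord zx.
  by apply: polymap_app; apply: polymap_eval => //; apply: polymap_const.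
have zxH x : is_hom (zx x) by apply/hom_spaceP; rewrite /zx subinclE subvsP.
have z0U : z0 \in U by apply/hom_spaceP.
have zx0 : zx x0 = z0 by rewrite /zx T20 id_lfunE subinclE vsprojK.
have [q3 [S3 [T3 [G3 [[pq3 _ _ q30] _ _ sol3]]]]] := kernel_solver x0 ppx.
have [q4 [S4 [T4 [G4 [[pq4 _ _ q40] _ _ sol4]]]]] := kernel_solver x0 pzx.
have [F [pF Fz0 FS]] := S_open z0H Sz0.
exists (fun x => q1 x * q2 x * q3 x * q4 x * F (zx x)); split.
- apply: polyfun_mul; last exact: (polyfun_polymap pF pzx).
  by do 3!(apply: polyfun_mul => //).
- by rewrite q10 q20 q30 q40 !mul1r zx0.
move=> x xR; rewrite !mulf_eq0 !negb_or -!andbA => /and5P[qx1 qx2 qx3 qx4 Fx].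
have [r [H1 [H2 [H3 frx]]]] := frame_module frVg xR.
pose Nx := @RMod k A N r H1 H2 H3.
have pxH : @is_hom _ _ Y0 Nx (px x).
  by apply/(@hom_spaceP _ _ Y0 Nx); rewrite -(kerA _ _ _ _ _ frx); apply: Apx.
have dimN := framed_dim _ fr; have dimNx := framed_dim _ frx.
have YU := @submodule_full _ _ Y0.
have dim0 u : (\dim (vpart (lker p0) u) + alpha u)%N = \dim (vpart fullv u :> {vspace Y0}).
  rewrite -(dim_vpart_hom HA u p0H YU) capfv; congr (_ + _)%N.
  by rewrite p0I -(dimN u).
have dimx u : (\dim (vpart fullv u :> {vspace Y0}) <= \dim (vpart (lker (px x)) u) + alpha u)%N.
  rewrite -(dim_vpart_hom HA u pxH YU) capfv leq_add2l -(dimNx u).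
  by apply: dimvS; apply: vpartS; apply: subvf.
(* The space of maps killed by [px x] does not shrink: at each vertex its kernel is at least as
   large as that of the surjection [p0], both targets having dimension vector [alpha]. *)
have pzx0 : (px x \o zx x)%VF = 0.
  have [_ sol] := sol2 x qx2.
  have := sol _ (vsproj U z0); rewrite comp_lfunE postcE; apply.
    rewrite !dim_subvs_ker px0 (dim_freeb_ker HA fY1 p0H).
    rewrite (@dim_freeb_ker _ _ _ _ _ _ _ _ _ HA c1 Y1 Y0 Nx (px x) fY1 pxH).
    apply: leq_sum => u _; rewrite leq_mul2l; apply/orP; right.
    by have := dim0 u; have := dimx u; move: (\dim _) (\dim _) (\dim _) ; clear=> *; lia.
  rewrite memv_ker comp_lfunE postcE subinclE vsprojK // px0.
  apply/eqP/lfunP=> v; rewrite comp_lfunE zero_lfunE; apply/eqP.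
  by rewrite -memv_ker p0k memv_img ?memvf.
have [le3 _] := sol3 x qx3; have [le4 _] := sol4 x qx4; rewrite px0 in le3; rewrite zx0 in le4.
have rp := limg_ker_dim (px x) fullv; have rp0 := limg_ker_dim p0 fullv.
have rz := limg_ker_dim (zx x) fullv; have rz0 := limg_ker_dim z0 fullv.
rewrite !capfv in rp rp0 rz rz0; rewrite p0I p0k in rp0.
have pxI : limg (px x) = fullv.
  apply/eqP; rewrite eqEdim subvf /=; rewrite p0k in le3.
  by move: rp rp0 le3; move: (\dim _) (\dim _) (\dim _) (\dim _) (\dim _) ; clear=> *; lia.
exists (zx x), Nx; split=> //; first exact: FS.
  exists (px x); split=> //.
  apply/eqP; rewrite eq_sym eqEdim; apply/andP; split.
    by apply/subvP=> _ /memv_imgP[v _ ->]; rewrite memv_ker -comp_lfunE pzx0 zero_lfunE.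
  rewrite pxI in rp; rewrite p0k in le3.
  move: rp rp0 rz rz0 le3 le4; move: (\dim (lker (px x))) (\dim (limg z0)) (\dim (limg (zx x))) (\dim (lker z0)) (\dim (lker (zx x))) (\dim {:Y0}) (\dim {:Y1}) (\dim {:N}) ; clear=> *; lia.
exact: framed_realizes frx.
Qed.

End Rep.

Lemma lin1_mxE (k : fieldType) m n (f : 'rV[k]_m -> 'rV[k]_n) : linear f ->
  forall w, w *m lin1_mx f = f w.
Proof.
move=> linf w; rewrite -(hom_ofE linf w) [w in RHS]row_sum_delta linear_sum.
rewrite [w in LHS]row_sum_delta mulmx_suml; apply: eq_bigr => i _.
rewrite linearZ -scalemxAl -rowE /= hom_ofE; congr (_ *: _).
by apply/rowP=> j; rewrite !mxE.
Qed.

(** * Irreducibility of the set of general cokernels *)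

Section Irr.
Variables (k : closedFieldType) (A : falgType k) (Vt Ar : finType).
Variables (s t : Ar -> Vt) (e : Vt -> A) (ar : Ar -> A) (dd : Ar -> Ar -> A).
Hypothesis HA : qpa s t e ar dd.
Implicit Types M N X Y P : rmod A.
Local Notation "v '·' x" := (ract _ x v) (at level 39, left associativity).
Variable alpha : Vt -> nat.
Local Notation grep := (grep k s t alpha).
Local Notation grep_coord := (@grep_coord k Vt Ar s t alpha).
Local Notation grealizes := (grealizes e ar).
Variables (Y1 Y0 : rmod A).
Variable S : set 'Hom(Y1, Y0).
Hypothesis S_open : forall z, is_hom z -> S z -> exists F, [/\ polyfun (@lin_coord k 'Hom(Y1, Y0)) F,
  F z != 0 & forall z', is_hom z' -> F z' != 0 -> S z'].
Hypothesis max_rank : forall z : 'Hom(Y1, Y0), is_hom z ->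
  (\dim (limg z) + \sum_u alpha u <= \dim {:Y0})%N.

Section Chart.
Variables (V : vectType k) (f : forall u, 'Hom('rV[k]_(alpha u), V)).
Variable g : forall u, 'Hom(V, 'rV[k]_(alpha u)).
Hypothesis fr : is_frame f g.

Definition graded (b : 'Hom(V, Y0)) := forall u v, b (f u (g u v)) = b v · e u.

Definition chart (z : 'Hom(Y1, Y0)) (b : 'Hom(V, Y0)) (p : 'Hom(Y0, V)) (x : grep) : Prop :=
  [/\ lker p = limg z, (p \o b)%VF = \1%VF &
      forall a (w : 'rV[k]_(alpha (s a))), w *m x a = g (t a) (p (b (f (s a) w) · ar a))].

Lemma chart_coker z b p x : is_hom z -> graded b -> chart z b p x ->
  exists2 N, is_coker z N & grealizes x N.
Proof.
move=> zH gb [pk pb xE]; have [gf gf0 fg] := fr.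
have pbE v : p (b v) = v by rewrite -comp_lfunE pb id_lfunE.
have KM : submodule (lker p) by rewrite pk; apply: submodule_img zH (@submodule_full _ _ _).
have pbp x' w : p (b (p w) · x') = p (w · x').
  apply/eqP; rewrite -subr_eq0 -!linearB -memv_ker; apply: submoduleP => //.
  by rewrite memv_ker linearB /= pbE subrr.
have cmp x' y v : p (b (p (b v · x')) · y) = p (b v · x' · y) by rewrite pbp.
pose N := transp_mod pb cmp; have NE y v : ract N y v = p (b v · y) by rewrite transp_modE.
have pH : @is_hom _ _ Y0 N p by apply: is_homP => y w; rewrite NE pbp.
have Ne u (v : N) : ract N (e u) v = f u (g u v) by rewrite NE -gb pbE.
exists N.
  exists p; split=> //; apply/vspaceP=> v; rewrite memvf; apply/idP.
  by rewrite -(pbE v) memv_img ?memvf.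
apply: (@framed_realizes _ _ _ _ _ _ _ _ alpha x N f g); split=> // a w.
rewrite xE; apply: (etrans (esym (Ne _ _))); rewrite -(NE (ar a)).
by rewrite -ractMv (q_are HA).
Qed.

Lemma chart_unique z b p p' x x' : is_hom z -> chart z b p x -> chart z b p' x' -> x = x'.
Proof.
move=> zH [pk pb xE] [pk' pb' xE'].
have pbE v : p (b v) = v by rewrite -comp_lfunE pb id_lfunE.
have pbE' v : p' (b v) = v by rewrite -comp_lfunE pb' id_lfunE.
have pp' v : p v = p' v.
  have : v - b (p v) \in lker p' by rewrite pk' -pk memv_ker linearB /= pbE subrr.
  by rewrite memv_ker linearB /= pbE' subr_eq0 => /eqP.
apply: functional_extensionality_dep => a; apply/row_matrixP => i.
by rewrite !rowE xE xE' pp'.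
Qed.

(** Any linear section becomes graded when, on the piece of [V] at u, only its component at u is
    kept. *)
Lemma chart_lift x : \dim {:V} = (\sum_u alpha u)%N -> coker_set e ar S x ->
  exists z b p, [/\ is_hom z, S z, graded b & chart z b p x].
Proof.
move=> dV [z [N [zH Sz [p0 [p0H p0I p0k]] /(realizes_framed HA)[f' [g' [fr' fe' fa']]]]]].
have [gf gf0 fg] := fr; have [gf' gf0' fg'] := fr'.
have [phi [psi [g'phi gpsi psiphi phipsi phif]]] := frame_iso fr fr'.
pose p := (psi \o p0)%VF; pose b0 := ((p0^-1) \o phi)%VF.
pose b : 'Hom(V, Y0) := (\sum_u (ract Y0 (e u) \o b0 \o (f u \o g u)))%VF.
have bE v : b v = \sum_u b0 (f u (g u v)) · e u.
  by rewrite sum_lfunE; apply: eq_bigr => u _; rewrite !comp_lfunE.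
have p0b0 v : p0 (b0 v) = phi v by rewrite comp_lfunE limg_lfunVK // p0I memvf.
have p0b v : p0 (b v) = phi v.
  rewrite bE linear_sum -[RHS]fg'; apply: eq_bigr => u _ /=.
  by rewrite homE // p0b0 phif -fe' gf' g'phi.
have pb v : p (b v) = v by rewrite comp_lfunE p0b psiphi.
have gb : graded b.
  move=> u v; rewrite !bE linear_sum (bigD1 u) //= gf [RHS](bigD1 u) //= (act_ee HA) eqxx.
  rewrite !big1 // => w wu; first by rewrite (act_ee HA) (negPf wu).
  by rewrite gf0 // !linear0.
exists z, b, p; split=> //; split.
- rewrite -p0k; apply/vspaceP=> v; rewrite !memv_ker comp_lfunE.
  apply/eqP/eqP => [E|->]; last exact: linear0.
  by rewrite -[LHS]phipsi E linear0.
- by apply/lfunP=> v; rewrite comp_lfunE pb id_lfunE.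
move=> a w; rewrite comp_lfunE homE // p0b gpsi phif -fa'.
by rewrite gf'.
Qed.

Local Notation E := ('Hom(Y1, Y0) * 'Hom(V, Y0))%type.

(** The map z G + b ps is the identity at (zs, bs), sends ker ps into the image of z, and bs v to b
    v. Where it is invertible, [ps] after its inverse is the projection for (z, b); the adjugate
    replaces the inverse, whence the factor [q]. By [max_rank], ker ps is mapped onto the whole
    image of z. *)
Lemma chart_local zs bs ps xs : \dim {:V} = (\sum_u alpha u)%N -> is_hom zs -> chart zs bs ps xs ->
  exists (q : E -> k) (P : E -> 'Hom(Y0, V)),
    [/\ polyfun (@lin_coord k E) q, polymap (@lin_coord k E) P, q (zs, bs) = 1 &
      forall ez, is_hom ez.1 -> q ez != 0 ->
        lker (P ez) = limg ez.1 /\ (P ez \o ez.2)%VF = q ez *: \1%VF].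
Proof.
move=> dV zsH [pk pb _].
have pbE v : ps (bs v) = v by rewrite -comp_lfunE pb id_lfunE.
pose G := (zs^-1 \o (\1 - (bs \o ps)))%VF.
have GE v : G v = (zs^-1)%VF (v - bs (ps v)).
  by rewrite comp_lfunE add_lfunE opp_lfunE id_lfunE comp_lfunE.
have zG v : zs (G v) = v - bs (ps v).
  by rewrite GE limg_lfunVK // -pk memv_ker linearB /= pbE subrr.
have Gb v : G (bs v) = 0 by rewrite GE pbE subrr linear0.
have p1 : polymap (@lin_coord k E) (fun ez => ez.1).
  move=> l; apply: polyfun_coord.
  have ll : linear (fun ez : E => l ez.1) by move=> c u v; rewrite linearP.
  by exists (hom_of ll); apply/funext=> ez; rewrite hom_ofE.
have p2 : polymap (@lin_coord k E) (fun ez => ez.2).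
  move=> l; apply: polyfun_coord.
  have ll : linear (fun ez : E => l ez.2) by move=> c u v; rewrite linearP.
  by exists (hom_of ll); apply/funext=> ez; rewrite hom_ofE.
pose Sx (ez : E) : 'End(Y0) := ((ez.1 \o G) + (ez.2 \o ps))%VF.
have SE ez v : Sx ez v = ez.1 (G v) + ez.2 (ps v) by rewrite add_lfunE !comp_lfunE.
have pS : polymap (@lin_coord k E) Sx.
  by apply: polymapD; apply: polymap_comp => //; apply: polymap_const.
have [q [T [pq pT _ TS q1]]] := polymap_adj pS.
exists q, (fun ez => ps \o T ez)%VF; split=> //.
- by apply: polymap_comp => //; apply: polymap_const.
- by apply: q1; apply/lfunP=> v; rewrite SE /= zG id_lfunE subrK.
move=> [z b] /= zH qz; have TSE v : T (z, b) (Sx (z, b) v) = q (z, b) *: v.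
  by rewrite -comp_lfunE TS scale_lfunE id_lfunE.
have Pb : ((ps \o T (z, b)) \o b)%VF = q (z, b) *: \1%VF.
  apply/lfunP=> v; rewrite !comp_lfunE scale_lfunE id_lfunE.
  have -> : b v = Sx (z, b) (bs v) by rewrite SE /= Gb linear0 add0r pbE.
  by rewrite TSE linearZ /= pbE.
split=> //; have psI : limg ps = fullv.
  by apply/vspaceP=> v; rewrite memvf -(pbE v) memv_img ?memvf.
have dk : (\dim (lker ps) + \dim {:V})%N = \dim {:Y0}.
  by rewrite -(limg_ker_dim ps fullv) capfv psI.
have SK : (Sx (z, b) @: lker ps <= limg z)%VS.
  apply/subvP=> _ /memv_imgP[v vk ->]; rewrite SE /=.
  by move: vk; rewrite memv_ker => /eqP->; rewrite linear0 addr0 memv_img ?memvf.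
have dSK : \dim (Sx (z, b) @: lker ps) = \dim (lker ps).
  apply: dim_limg_inj => v _ /(congr1 (T (z, b))); rewrite TSE linear0 => /eqP.
  by rewrite scaler_eq0 (negPf qz) => /eqP.
have SKE : (Sx (z, b) @: lker ps)%VS = limg z.
  apply/eqP; rewrite eqEdim SK dSK /=; have := max_rank zH; rewrite -dV -dk.
  by rewrite leq_add2r.
have zk : (limg z <= lker (ps \o T (z, b))%VF)%VS.
  rewrite -SKE; apply/subvP=> _ /memv_imgP[v vk ->]; rewrite memv_ker comp_lfunE TSE linearZ /=.
  by move: vk; rewrite memv_ker => /eqP->; rewrite scaler0.
apply/eqP; rewrite eq_sym eqEdim zk /=.
have PI : limg (ps \o T (z, b))%VF = fullv.
  apply/vspaceP=> v; rewrite memvf; apply/idP.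
  have -> : v = (ps \o T (z, b))%VF (b ((q (z, b))^-1 *: v)).
    by rewrite -comp_lfunE Pb scale_lfunE id_lfunE scalerA mulfV // scale1r.
  by rewrite memv_img ?memvf.
have := limg_ker_dim (ps \o T (z, b))%VF fullv; rewrite capfv PI -dk -SKE dSK.
by move/addIn => ->.
Qed.

End Chart.

Local Notation cokers := (@coker_set k A Vt Ar s t e ar alpha Y1 Y0 S).

(** Pairs of a homomorphism and a graded section form a vector space, and the representation is a
    rational function of them near each point. Two functions nonzero somewhere on the set pull back,
    after clearing denominators, to nonzero polynomials on that space; at a common non-root both
    charts describe the same representation. *)
Lemma coker_set_irr : cokers !=set0 -> zirreducible grep_coord cokers.
Proof.
move=> [x0 x0O]; have [_ [V [_ _ _ /(realizes_framed HA)[f [g frV]]]]] := x0O.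
have [fr _ _] := frV; have dV := framed_total HA frV.
apply/zirreducibleP; split; first by exists x0.
move=> F F' x x' pF pF' xO x'O Fx F'x'.
pose Gr : {vspace 'Hom(V, Y0)} := (\bigcap_(u : Vt) lker (prec Y0 (f u \o g u)%VF - postc V (ract Y0 (e u))))%VS.
have GrP b : reflect (graded f g b) (b \in Gr).
  rewrite memvE; apply: (iffP subv_bigcapP) => [bG u v|bG u _].
    have := bG u isT; rewrite -memvE memv_ker add_lfunE opp_lfunE precE postcE subr_eq0.
    by move=> /eqP/(lfun_congr v); rewrite !comp_lfunE.
  rewrite -memvE memv_ker add_lfunE opp_lfunE precE postcE subr_eq0.
  by apply/eqP/lfunP=> v; rewrite !comp_lfunE bG.
pose E := ('Hom(Y1, Y0) * 'Hom(V, Y0))%type.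
pose E' := (subvs_of (hom_space Y1 Y0) * subvs_of Gr)%type.
pose inc (ez : E') : E := (vsval ez.1, vsval ez.2).
have inc_lin : linear inc by move=> c u v; congr (_, _); exact: linearP.
have pinc : polymap (@lin_coord k E') (inc : E' -> E).
  move=> l; apply: polyfun_coord.
  have ll : linear (fun ez : E' => l (inc ez)) by move=> c u v; rewrite inc_lin linearP.
  by exists (hom_of ll); apply/funext=> ez; rewrite hom_ofE.
have incH ez : is_hom (inc ez).1 by apply/hom_spaceP; apply: subvsP.
have incG ez : graded f g (inc ez).2 by apply/GrP; apply: subvsP.
have local (G : grep -> k) y : polyfun grep_coord G -> coker_set e ar S y -> G y != 0 ->
    exists (Th : E' -> k) (ez0 : E'), [/\ polyfun (@lin_coord k E') Th, Th ez0 != 0 &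
      forall ez, Th ez != 0 -> S (inc ez).1 /\
        exists p y', chart f g (inc ez).1 (inc ez).2 p y' /\ G y' != 0].
  move=> pG /(chart_lift fr dV)[z [b [p [zH Sz gb ch]]]] Gy.
  have [q [P [pq pP q1 PE]]] := chart_local dV zH ch.
  have [FS [pFS FSz FSS]] := S_open zH Sz.
  pose ez0 : E' := (vsproj _ z, vsproj _ b).
  have ez0E : inc ez0 = (z, b).
    by rewrite /inc /= !vsprojK //; [apply/GrP | apply/hom_spaceP].
  pose q' ez := q (inc ez); have pq' : polyfun (@lin_coord k E') q' := polyfun_polymap pq pinc.
  pose M (ez : E') a (w : 'rV[k]_(alpha (s a))) : 'rV[k]_(alpha (t a)) :=
    g (t a) (P (inc ez) ((inc ez).2 (f (s a) w) · ar a)).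
  have Mlin ez a : linear (M ez a) by move=> c u v; rewrite /M !linearP.
  pose c (ez : E') : grep := fun a => (q' ez)^-1 *: lin1_mx (M ez a).
  have cE ez : q' ez != 0 -> chart f g (inc ez).1 (inc ez).2 ((q' ez)^-1 *: P (inc ez)) (c ez).
    move=> qz; have [Pk Pb] := PE _ (incH ez) qz; split.
    - rewrite -Pk; apply/vspaceP=> v; rewrite !memv_ker scale_lfunE scaler_eq0 invr_eq0.
      by rewrite (negPf qz).
    - by rewrite -comp_lfunZl Pb scalerA mulVf // scale1r.
    move=> a w; rewrite /c -scalemxAr (lin1_mxE (Mlin ez a)) /M scale_lfunE.
    by rewrite [RHS]linearZ.
  have [n [num [pnum numE]]] : exists n num, polyfun (@lin_coord k E') num /\
      forall ez, q' ez != 0 -> q' ez ^+ n * G (c ez) = num ez.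
    apply: (polyfun_rational pG pq') => xi [a [i [j ->]]].
    exists (fun ez => (lin1_mx (M ez a)) i j); last first.
      by move=> ez qz; rewrite /c mxE mulrA mulfV // mul1r.
    pose r := delta_mx 0 i : 'rV[k]_(alpha (s a)).
    have l1 : linear (fun w : 'rV[k]_(alpha (t a)) => w 0 j : k^o).
      by move=> a' u v; rewrite !mxE.
    have -> : (fun ez => (lin1_mx (M ez a)) i j) = fun ez => hom_of l1 (M ez a r).
      by apply/funext=> ez; rewrite hom_ofE mxE.
    have pb2 : polymap (@lin_coord k E') (fun ez => (inc ez).2).
      move=> l; apply: polyfun_coord.
      have ll : linear (fun ez : E' => l (inc ez).2) by move=> a' u v; rewrite /= !linearP.
      by exists (hom_of ll); apply/funext=> ez; rewrite hom_ofE.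
    suff pM : polymap (@lin_coord k E') (fun ez => M ez a r) by apply: pM.
    apply: polymap_app; apply: polymap_eval.
      by move=> l; apply: (polyfun_polymap (pP l) pinc).
    by apply: polymap_app; apply: polymap_eval => //; apply: polymap_const.
  exists (fun ez => q' ez * num ez * FS (inc ez).1), ez0; split.
  - apply: polyfun_mul; first exact: polyfun_mul.
    apply: (polyfun_polymap pFS) => l; apply: polyfun_coord.
    have ll : linear (fun ez : E' => l (inc ez).1) by move=> a' u v; rewrite /= !linearP.
    by exists (hom_of ll); apply/funext=> ez; rewrite hom_ofE.
  - have q'0 : q' ez0 = 1 by rewrite /q' ez0E q1.
    have q'00 : q' ez0 != 0 by rewrite q'0 oner_neq0.
    rewrite -numE // q'0 expr1n !mul1r ez0E /= mulf_neq0 //.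
    have := cE ez0 q'00; rewrite ez0E => ch'.
    by rewrite (chart_unique zH ch' ch).
  move=> ez; rewrite !mulf_eq0 !negb_or -!andbA => /and3P[qz nz FSz'].
  split; first exact: FSS.
  exists ((q' ez)^-1 *: P (inc ez)), (c ez); split; first exact: cE.
  by apply: contraNneq nz => G0; rewrite -numE // G0 mulr0.
have [Th [ez0 [pTh Th0 ThP]]] := local F x pF xO Fx.
have [Th' [ez1 [pTh' Th'1 Th'P]]] := local F' x' pF' x'O F'x'.
have [ez [_ Tz T'z]] := polyfun_irr pTh pTh' (memvf ez0) (memvf ez1) Th0 Th'1.
have [Sz [p [y [ch Fy]]]] := ThP _ Tz; have [_ [p' [y' [ch' F'y']]]] := Th'P _ T'z.
have yy' := chart_unique (incH ez) ch ch'; exists y; split=> //; last by rewrite yy'.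
have [N cN yN] := chart_coker fr (incH ez) (incG ez) ch.
by exists (inc ez).1, N.
Qed.

End Irr.

(** * General cokernels *)

Section GenericCokernel.
Variables (k : closedFieldType) (A : falgType k) (Vt Ar : finType).
Variables (s t : Ar -> Vt) (e : Vt -> A) (ar : Ar -> A) (dd : Ar -> Ar -> A).
Hypothesis HA : qpa s t e ar dd.
Implicit Types M N X Y P : rmod A.
Local Notation "v '·' x" := (ract _ x v) (at level 39, left associativity).
Local Notation vsp := (vsp e).
Local Notation vpart := (vpart e).
Local Notation freeb := (freeb e).

Lemma coker_dim_vsp X Y N (d : 'Hom(X, Y)) u : is_hom d -> is_coker d N ->
  (\dim (vsp N u) + \dim (vpart (limg d) u))%N = \dim (vsp Y u).
Proof.
move=> dH [p [pH pI pk]].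
have := dim_vpart_hom HA u pH (@submodule_full _ _ Y).
by rewrite capfv pk pI addnC.
Qed.

Lemma exists_coker X Y (d : 'Hom(X, Y)) : is_hom d -> exists N, is_coker d N.
Proof.
move=> dH; have [N [p [pH pI pk]]] := exists_quot (submodule_img dH (@submodule_full _ _ X)).
by exists N, p.
Qed.

Lemma rank_generic (U V W : vectType k) (H : {vspace U}) (L : 'Hom(U, 'Hom(V, W))) z :
  exists f, [/\ polyfun (@lin_coord k U) f, f z != 0 &
    forall z', f z' != 0 -> (\dim (limg (L z)) <= \dim (limg (L z')))%N].
Proof.
have pL : polymap (@lin_coord k U) (fun z => L z) by apply: polymap_app; apply: polymap_id.
have [q [S0 [T0 [G0 [[pq _ _ q1] _ _ qP]]]]] := kernel_solver z pL.
exists q; split=> // [|z' /qP[le _]]; first by rewrite q1 oner_neq0.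
have := limg_ker_dim (L z) fullv; have := limg_ker_dim (L z') fullv; rewrite !capfv.
move: le; move: (\dim (lker _)) (\dim (lker _)) (\dim (limg _)) (\dim (limg _)) => *; lia.
Qed.

(* alpha is the pointwise minimal dimension vector of a cokernel. *)
Definition generic_coker (alpha : Vt -> nat) Y1 Y0 : Prop :=
  (forall z : 'Hom(Y1, Y0), is_hom z ->
     forall u, (alpha u + \dim (vpart (limg z) u) <= \dim (vsp Y0 u))%N) /\
  (exists2 z : 'Hom(Y1, Y0), is_hom z &
     forall u, (alpha u + \dim (vpart (limg z) u))%N = \dim (vsp Y0 u)).

Definition minimal_coker (alpha : Vt -> nat) Y1 Y0 (z : 'Hom(Y1, Y0)) : Prop :=
  forall u, (alpha u + \dim (vpart (limg z) u))%N = \dim (vsp Y0 u).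

Lemma vpart_rank_generic Y1 Y0 (z : 'Hom(Y1, Y0)) u :
  exists f, [/\ polyfun (@lin_coord k 'Hom(Y1, Y0)) f, f z != 0 &
    forall z', f z' != 0 -> (\dim (vpart (limg z) u) <= \dim (vpart (limg z') u))%N].
Proof.
have [f [pf fz fP]] := rank_generic fullv (postc Y1 (ract Y0 (e u))) z.
exists f; split=> // z' /fP; rewrite !postcE /vpart.
by rewrite !limg_comp.
Qed.

(** The total rank does not drop near [z], and at each vertex the rank is bounded by its value at
    [z]; a drop at one vertex could not be compensated at another. *)
Lemma minimal_coker_open alpha Y1 Y0 : generic_coker alpha Y1 Y0 ->
  forall z : 'Hom(Y1, Y0), is_hom z -> minimal_coker alpha z ->
  exists F, [/\ polyfun (@lin_coord k 'Hom(Y1, Y0)) F, F z != 0 &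
    forall z', is_hom z' -> F z' != 0 -> minimal_coker alpha z'].
Proof.
move=> [le _] z zH zm; have [f [pf fz fP]] := rank_generic fullv (\1%VF : 'End('Hom(Y1, Y0))) z.
exists f; split=> // z' z'H /fP; rewrite !id_lfunE => rk u.
apply/eqP; rewrite eqn_leq le //= leqNgt; apply/negP => lt.
move: rk; rewrite leqNgt => /negP; apply.
rewrite !(dim_vparts HA (submodule_img _ (@submodule_full _ _ Y1))) //.
rewrite (bigD1 u) //= [X in (_ < X)%N](bigD1 u) //= -addSn leq_add ?leq_sum //.
  by rewrite -(ltn_add2l (alpha u)) zm.
by move=> v _; rewrite -(leq_add2l (alpha v)) zm le.
Qed.

Lemma minimal_coker_max_rank alpha Y1 Y0 : generic_coker alpha Y1 Y0 ->
  forall z : 'Hom(Y1, Y0), is_hom z -> (\dim (limg z) + \sum_u alpha u <= \dim {:Y0})%N.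
Proof.
move=> [le _] z zH.
rewrite (dim_vparts HA (submodule_img zH (@submodule_full _ _ Y1))).
rewrite (dim_vparts HA (@submodule_full _ _ Y0)) -big_split /=.
by apply: leq_sum => u _; rewrite addnC le.
Qed.

Lemma coker_minimal_coker alpha Y1 Y0 N (z : 'Hom(Y1, Y0)) : is_hom z -> is_coker z N ->
  minimal_coker alpha z <-> forall u, \dim (vsp N u) = alpha u.
Proof.
move=> zH zN; split=> E u; have := coker_dim_vsp u zH zN; last by rewrite E.
by rewrite -E => /addIn.
Qed.

(** The open set where the cokernel has dimension vector [alpha] meets the open set where the rank
    at u is at least that of a given map, so no map has larger rank. *)
Lemma general_generic_coker alpha Y1 Y0 :
  general (@lin_coord k 'Hom(Y1, Y0)) [set d | is_hom d]
    (fun d => exists2 N, is_coker d N & forall u, \dim (vsp N u) = alpha u) ->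
  generic_coker alpha Y1 Y0.
Proof.
move=> /generalP[f [pf [d dH fd] fP]].
have min z : is_hom z -> f z != 0 -> minimal_coker alpha z.
  by move=> zH /(fP z zH)[N zN /(coker_minimal_coker _ zH zN)].
split=> [z zH u|]; last by exists d => //; apply: min.
have [q [pq qz qP]] := vpart_rank_generic z u.
have [|| z' [/hom_spaceP z'H fz' qz']] := @polyfun_irr _ _ (hom_space Y1 Y0) _ _ d z pf pq _ _ fd qz.
- exact/hom_spaceP.
- exact/hom_spaceP.
by rewrite -(min z' z'H fz' u) leq_add2l qP.
Qed.

Lemma generic_coker_general alpha Y1 Y0 (R : 'Hom(Y1, Y0) -> Prop) :
  generic_coker alpha Y1 Y0 -> (forall z, is_hom z -> minimal_coker alpha z -> R z) ->
  general (@lin_coord k 'Hom(Y1, Y0)) [set d | is_hom d] R.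
Proof.
move=> gc zR; have [z zH zm] := gc.2; apply/generalP.
have [F [pF Fz FP]] := minimal_coker_open gc zH zm.
by exists F; split=> // [|z' z'H Fz']; [exists z | apply: zR => //; apply: FP].
Qed.

(** The first generators at each vertex follow a projective cover of [K]; the surplus ones go to 0,
    the default when [insub] fails. *)
Lemma cover_ge c X M (K : {vspace M}) : freeb c X -> submodule K ->
  (forall u, topd t e ar K u <= c u)%N -> exists2 d : 'Hom(X, M), is_hom d & limg d = K.
Proof.
move=> [x fx] KM le; have [X' [d' [[x' fx'] d'H d'I _]]] := exists_cover HA KM.
pose T := {v : Vt & 'I_(c v)}; pose T' := {v : Vt & 'I_(topd t e ar K v)}.
pose n (i : T) : M := if insub (val (tagged i)) is Some j
  then d' (x' (Tagged (fun v => 'I_(topd t e ar K v)) (j : 'I_(topd t e ar K (tag i))))) else 0.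
have ne i : n i · e (tag i) = n i.
  rewrite /n; case: insub => [j|]; last exact: linear0.
  have [xe _ _] := fx'; rewrite -(homE _ _ d'H); congr (d' _).
  exact: (xe (Tagged (fun v => 'I_(topd t e ar K v)) j)).
have [d [dH dx]] := free_homP fx ne; exists d => //.
have d'K v : d' v \in K by rewrite -d'I memv_img ?memvf.
have nK i : n i \in K by rewrite /n; case: insub => [j|]; rewrite ?mem0v ?d'K.
apply/eqP; rewrite eqEsubv; apply/andP; split.
  apply/subvP=> _ /memv_imgP[v _ ->]; have [_ gen _] := fx; have [r ->] := gen v.
  rewrite linear_sum memv_suml // => i _ /=; rewrite (homE _ _ dH) dx.
  by apply: submoduleP.
rewrite -[X in (X <= _)%VS]d'I; apply/subvP=> _ /memv_imgP[v _ ->]; have [_ gen _] := fx'; have [r ->] := gen v.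
rewrite linear_sum memv_suml // => -[u j] _ /=; rewrite (homE _ _ d'H).
apply: submoduleP; first exact: submodule_img dH (@submodule_full _ _ X).
have -> : x' (existT _ u j) = x' (Tagged (fun v => 'I_(topd t e ar K v)) j) by [].
have -> : d' (x' (Tagged (fun v => 'I_(topd t e ar K v)) j)) =
    d (x (Tagged (fun v => 'I_(c v)) (widen_ord (le u) j))).
  by rewrite dx /n /= valK.
by rewrite memv_img ?memvf.
Qed.

Lemma freeb_split c x B Y X : freeb (fun v => c v + x v)%N B -> freeb c Y -> freeb x X ->
  exists (i : 'Hom(Y, B)) (q : 'Hom(B, Y)) (j : 'Hom(X, B)) (r : 'Hom(B, X)),
    [/\ [/\ is_hom i, is_hom q, is_hom j & is_hom r],
        (forall v, q (i v) = v) /\ (forall v, r (j v) = v),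
        (forall v, q (j v) = 0) /\ (forall v, r (i v) = 0) &
        forall v, i (q v) + j (r v) = v].
Proof.
move=> [b fb] [y fy] [w fw].
pose TB := {v : Vt & 'I_(c v + x v)}; pose TY := {v : Vt & 'I_(c v)}; pose TX := {v : Vt & 'I_(x v)}.
pose toB1 (l : TY) : TB := Tagged (fun v => 'I_(c v + x v)) (lshift (x (tag l)) (tagged l)).
pose toB2 (l : TX) : TB := Tagged (fun v => 'I_(c v + x v)) (rshift (c (tag l)) (tagged l)).
pose nq (l : TB) : Y := if split (tagged l) is inl j then y (Tagged (fun v => 'I_(c v)) j) else 0.
pose nr (l : TB) : X := if split (tagged l) is inr j then w (Tagged (fun v => 'I_(x v)) j) else 0.
have [be _ _] := fb; have [ye _ _] := fy; have [we _ _] := fw.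
have nqe l : nq l · e (tag l) = nq l.
  rewrite /nq; case: split => [j|_]; last exact: linear0.
  exact: (ye (Tagged (fun v => 'I_(c v)) j)).
have nre l : nr l · e (tag l) = nr l.
  rewrite /nr; case: split => [_|j]; first exact: linear0.
  exact: (we (Tagged (fun v => 'I_(x v)) j)).
have [q [qH qE]] := free_homP fb nqe; have [r [rH rE]] := free_homP fb nre.
have [i [iH iE]] := @free_homP _ _ _ _ _ _ _ _ fy B (b \o toB1) (fun l => be (toB1 l)).
have [j [jH jE]] := @free_homP _ _ _ _ _ _ _ _ fw B (b \o toB2) (fun l => be (toB2 l)).
have nq1 l : nq (toB1 l) = y l.
  rewrite /nq /= (unsplitK (inl (tagged l))); by case: l.
have nq2 l : nq (toB2 l) = 0 by rewrite /nq /= (unsplitK (inr (tagged l))).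
have nr2 l : nr (toB2 l) = w l.
  rewrite /nr /= (unsplitK (inr (tagged l))); by case: l.
have nr1 l : nr (toB1 l) = 0 by rewrite /nr /= (unsplitK (inl (tagged l))).
exists i, q, j, r; split=> //.
- split=> v.
    rewrite -[RHS]id_lfunE -comp_lfunE; congr (fun_of_lfun _ v).
    apply: (free_ext fy) => [|| l]; [exact: is_hom_comp | exact: is_hom_id |].
    by rewrite comp_lfunE iE /= qE nq1 id_lfunE.
  rewrite -[RHS]id_lfunE -comp_lfunE; congr (fun_of_lfun _ v).
  apply: (free_ext fw) => [|| l]; [exact: is_hom_comp | exact: is_hom_id |].
  by rewrite comp_lfunE jE /= rE nr2 id_lfunE.
- have qj : (q \o j)%VF = 0.
    apply: (free_ext fw) => [|| l]; [exact: is_hom_comp | exact: is_hom0 |].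
    by rewrite comp_lfunE jE /= qE nq2 zero_lfunE.
  have ri : (r \o i)%VF = 0.
    apply: (free_ext fy) => [|| l]; [exact: is_hom_comp | exact: is_hom0 |].
    by rewrite comp_lfunE iE /= rE nr1 zero_lfunE.
  by split=> v; rewrite -comp_lfunE ?qj ?ri zero_lfunE.
move=> v; rewrite -[RHS]id_lfunE -!comp_lfunE -add_lfunE; congr (fun_of_lfun _ v).
apply: (free_ext fb) => [|| l]; [by apply: is_homD; apply: is_hom_comp | exact: is_hom_id |].
rewrite add_lfunE !comp_lfunE qE rE id_lfunE /nq /nr.
case: l => u l /=; case: splitP => j' E /=.
  rewrite linear0 addr0 iE /=; congr (b _); congr existT; exact: val_inj.
rewrite linear0 add0r jE /=; congr (b _); congr existT; exact: val_inj.
Qed.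

End GenericCokernel.

(** * Adding the same projective to both terms of a presentation *)

Section Stabilization.
Variables (k : closedFieldType) (A : falgType k) (Vt Ar : finType).
Variables (s t : Ar -> Vt) (e : Vt -> A) (ar : Ar -> A) (dd : Ar -> Ar -> A).
Hypothesis HA : qpa s t e ar dd.
Implicit Types M N X Y P : rmod A.
Local Notation vsp := (vsp e).
Local Notation vpart := (vpart e).
Local Notation freeb := (freeb e).
Variables (c1 c0 x : Vt -> nat) (Y1 Y0 X B1 B0 : rmod A).
Hypotheses (fY1 : freeb c1 Y1) (fY0 : freeb c0 Y0) (fX : freeb x X).
Hypotheses (fB1 : freeb (fun v => c1 v + x v)%N B1) (fB0 : freeb (fun v => c0 v + x v)%N B0).

Lemma coker_stab_up (d : 'Hom(Y1, Y0)) N : is_hom d -> is_coker d N ->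
  exists2 z : 'Hom(B1, B0), is_hom z & is_coker z N.
Proof.
have [i1 [q1 [j1 [r1 [[i1H q1H j1H r1H] [qi1 rj1] [qj1 ri1] sum1]]]]] := freeb_split fB1 fY1 fX.
have [i0 [q0 [j0 [r0 [[i0H q0H j0H r0H] [qi0 rj0] [qj0 ri0] sum0]]]]] := freeb_split fB0 fY0 fX.
move=> dH [p [pH pI pk]]; pose z := ((i0 \o d \o q1) + (j0 \o r1))%VF.
have zE v : z v = i0 (d (q1 v)) + j0 (r1 v) by rewrite add_lfunE !comp_lfunE.
exists z; first by apply: is_homD; apply: is_hom_comp => //; apply: is_hom_comp.
have pd v : p (d v) = 0 by apply/eqP; rewrite -memv_ker pk memv_img ?memvf.
exists (p \o q0)%VF; split; first exact: is_hom_comp.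
  by apply/vspaceP=> v; rewrite memvf -(limg_lfunVK (_ : v \in limg p)) ?pI ?memvf // -[X in p X]qi0 -comp_lfunE memv_img ?memvf.
apply/vspaceP=> v; rewrite memv_ker comp_lfunE; apply/eqP/memv_imgP => [pq|[w _ ->]].
  have : q0 v \in limg d by rewrite -pk memv_ker pq.
  case/memv_imgP=> w _ qv; exists (i1 w + j1 (r0 v)); rewrite ?memvf //.
  by rewrite zE !linearD /= qi1 qj1 ri1 rj1 !linear0 addr0 add0r -qv sum0.
by rewrite zE linearD /= qi0 qj0 addr0 pd.
Qed.

(* If the X-block of z is invertible, eliminate it. *)
Lemma coker_stab_down : exists r : 'Hom(B1, B0) -> k,
  [/\ polyfun (@lin_coord k 'Hom(B1, B0)) r, exists2 z, is_hom z & r z != 0 &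
    forall z, is_hom z -> r z != 0 ->
      exists2 d : 'Hom(Y1, Y0), is_hom d & forall N, is_coker z N -> is_coker d N].
Proof.
have [i1 [q1 [j1 [r1 [[i1H q1H j1H r1H] [qi1 rj1] [qj1 ri1] sum1]]]]] := freeb_split fB1 fY1 fX.
have [i0 [q0 [j0 [r0 [[i0H q0H j0H r0H] [qi0 rj0] [qj0 ri0] sum0]]]]] := freeb_split fB0 fY0 fX.
have pS : polymap (@lin_coord k 'Hom(B1, B0)) (fun z => r0 \o z \o j1)%VF.
  do 2?apply: polymap_comp; try exact: polymap_const; exact: polymap_id.
have [q [T [pq pT ST TS q1E]]] := polymap_adj pS.
exists q; split=> //.
  exists (j0 \o r1)%VF; first exact: is_hom_comp.
  rewrite q1E ?oner_neq0 //; apply/lfunP=> v.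
  by rewrite !comp_lfunE rj1 rj0 id_lfunE.
move=> z zH qz; pose s0 := (r0 \o z \o j1)%VF.
have sH : is_hom s0 by do 2?apply: is_hom_comp.
pose E := (q z)^-1 *: T z.
have Es v : E (s0 v) = v.
  by rewrite scale_lfunE -comp_lfunE TS scale_lfunE id_lfunE scalerA mulVf // scale1r.
have sE v : s0 (E v) = v.
  by rewrite scale_lfunE linearZ /= -comp_lfunE ST scale_lfunE id_lfunE scalerA mulVf // scale1r.
have s0E v : s0 v = r0 (z (j1 v)) by rewrite !comp_lfunE.
have EH : is_hom E.
  apply: is_homP => y v; rewrite -{1}[v]sE -(homE _ _ sH) Es.
  by [].
pose y v := z v - z (j1 (E (r0 (z v)))).
have r0y v : r0 (y v) = 0 by rewrite linearB /= -s0E sE subrr.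
pose d := (q0 \o (z - (z \o j1 \o E \o r0 \o z)) \o i1)%VF.
have dE v : d v = q0 (y (i1 v)) by rewrite !comp_lfunE add_lfunE opp_lfunE !comp_lfunE.
have idE v : i0 (d v) = y (i1 v) by rewrite dE -[RHS]sum0 r0y linear0 addr0.
exists d.
  do 2?apply: is_hom_comp => //; apply: is_homB => //.
  by do 4?apply: is_hom_comp => //.
move=> N [p [pH pI pk]].
have pz v : p (z v) = 0 by apply/eqP; rewrite -memv_ker pk memv_img ?memvf.
exists (p \o i0)%VF; split; first exact: is_hom_comp.
  apply/vspaceP=> v; rewrite memvf; apply/idP.
  have [b _ ->] : exists2 b, b \in fullv & v = p b by apply/memv_imgP; rewrite pI memvf.
  pose b' := b - z (j1 (E (r0 b))).
  have -> : p b = (p \o i0)%VF (q0 b').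
    have -> : p b = p b' by rewrite /b' linearB /= pz subr0.
    rewrite comp_lfunE; congr (p _); rewrite -[LHS]sum0.
    by rewrite [r0 b']linearB /= -s0E sE subrr linear0 addr0.
  by rewrite memv_img ?memvf.
apply/vspaceP=> v; rewrite memv_ker comp_lfunE; apply/eqP/memv_imgP => [pi|[w _ ->]]; last first.
  by rewrite idE /y linearB /= !pz subrr.
have : i0 v \in limg z by rewrite -pk memv_ker pi.
case/memv_imgP=> w _ ivE; exists (q1 w); rewrite ?memvf // dE.
have zw : z w = y (i1 (q1 w)).
  have : r0 (z w) = 0 by rewrite -ivE ri0.
  rewrite -{1}[w]sum1 !linearD /= -s0E => /eqP; rewrite addrC addr_eq0 => /eqP sw.
  have r1w : r1 w = - E (r0 (z (i1 (q1 w)))) by rewrite -[LHS]Es sw linearN.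
  by rewrite /y -{1}[w]sum1 linearD /= r1w !linearN.
by rewrite -zw -ivE qi0.
Qed.

(** Some map B1 -> B0 has both a minimal cokernel and an invertible X-block, and eliminating the
    block keeps the cokernel. Conversely, extending a map Y1 -> Y0 by the identity of X shows that
    its cokernel is not smaller. *)
Lemma generic_coker_stab alpha : generic_coker e alpha B1 B0 -> generic_coker e alpha Y1 Y0.
Proof.
move=> gc; have [leB [z0 z0H z0m]] := gc; split=> [z zH u|].
  have [N zN] := exists_coker zH; have [z' z'H z'N] := coker_stab_up zH zN.
  have := leB z' z'H u; rewrite -(coker_dim_vsp HA u z'H z'N) leq_add2r.
  by rewrite -(coker_dim_vsp HA u zH zN) leq_add2r.
have [F [pF Fz FP]] := minimal_coker_open HA gc z0H z0m.
have [r [pr [z1 z1H rz1] rP]] := coker_stab_down.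
have [|| z [/hom_spaceP zH Fz' rz']] := @polyfun_irr _ _ (hom_space B1 B0) _ _ _ _ pF pr _ _ Fz rz1.
- exact/hom_spaceP.
- exact/hom_spaceP.
have [d dH dN] := rP z zH rz'; have [N zN] := exists_coker zH.
exists d => //; have zm : minimal_coker e alpha z := FP z zH Fz'.
have dm : minimal_coker e alpha d by apply/(coker_minimal_coker HA alpha dH (dN _ zN))/(coker_minimal_coker HA alpha zH zN).
exact: dm.
Qed.

End Stabilization.

Lemma sum_arrows (Vt Ar : finType) (f : Ar -> Vt) (c : Vt -> nat) (F : Ar -> nat) :
  (\sum_u c u * \sum_(a | f a == u) F a = \sum_a c (f a) * F a)%N.
Proof.
rewrite [RHS](partition_big f xpredT) //=; apply: eq_bigr => u _.
by rewrite big_distrr; apply: eq_bigr => a /eqP<-.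
Qed.

(** * A module that is general for projective and injective presentations at once *)

Section Core.
Variables (k : closedFieldType) (A B : falgType k) (tau : B -> A) (sigma : A -> B).
Hypotheses (Ht : is_anti tau) (Hs : is_anti sigma).
Hypotheses (ts : cancel sigma tau) (st : cancel tau sigma).
Local Notation D := (dual Ht).
Local Notation D' := (dual Hs).
Variables (Vt Ar : finType) (s t : Ar -> Vt) (e : Vt -> A) (ar : Ar -> A) (dd : Ar -> Ar -> A).
Variables (e' : Vt -> B) (ar' : Ar -> B) (dd' : Ar -> Ar -> B).
Hypothesis HA : qpa s t e ar dd.
Hypothesis HB : qpa t s e' ar' dd'.
Hypothesis te : forall u, tau (e' u) = e u.
Hypothesis tdd : forall a b, tau (dd' a b) = dd b a.
Hypothesis k_char0 : [pchar k] =i pred0.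

Lemma dual_hom_lift (P1 P0 : rmod B) (i : 'Hom(D' P0, D' P1)) : is_hom i ->
  exists2 d : 'Hom(P1, P0), is_hom d & dmap d = i.
Proof.
move=> iH; have wH := tr_hom Ht st iH.
exists ((ev P0)^-1 \o tr i)%VF.
  exact: (@is_hom_comp _ _ P1 (D (D' P0)) P0 _ _ (evV_hom Hs Ht st P0) wH).
apply/lfunP=> phi; apply/lfunP=> v.
by rewrite dmapE !comp_lfunE evV_eval trE.
Qed.

Variables (b1 b0 c1 c0 alpha : Vt -> nat) (P1 P0 : rmod B) (Y1 Y0 : rmod A).
Hypotheses (fP1 : freeb e' b1 P1) (fP0 : freeb e' b0 P0).
Hypotheses (fY1 : freeb e c1 Y1) (fY0 : freeb e c0 Y0).
Hypothesis wt : forall u, (c0 u + b1 u + \sum_(a | t a == u) alpha (s a) =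
                           c1 u + b0 u + \sum_(a | s a == u) alpha (t a))%N.
Hypothesis gcB : generic_coker e' alpha P1 P0.

Let se u : sigma (e u) = e' u. Proof. by rewrite -te st. Qed.
Let sdd b a : sigma (dd b a) = dd' a b. Proof. by rewrite -tdd st. Qed.

(** A four-term sequence is built, after stabilization, around the dual of a general cokernel over
    [B]. Density makes [alpha] generic over [A] and provides a sequence in which the stabilizing
    summand can be split off again. *)
Lemma dual_generic_coker : generic_coker e alpha Y1 Y0 /\
  exists (z : 'Hom(Y1, Y0)) (d : 'Hom(P1, P0)) M,
    [/\ is_hom z /\ is_hom d, is_coker d M, is_coker z (D' M) & forall u, \dim (vsp e' M u) = alpha u].
Proof.
have [leB [d0 d0H d0m]] := gcB.
have [M0 M0c] := exists_coker d0H; have [p0 [p0H p0I p0k]] := M0c.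
have M0d u : \dim (vsp e' M0 u) = alpha u by apply: (coker_minimal_coker HB alpha d0H M0c).1.
pose N0 := D' M0; have N0d u : \dim (vsp e N0 u) = alpha u by rewrite (vsp_dual_dim Hs se).
(* Enough copies for a surjection from B0 onto N0. *)
pose x := topd t e ar (fullv : {vspace N0}).
have [X fX] := exists_freeb HA x.
have [B1 fB1] := exists_freeb HA (fun v => c1 v + x v)%N.
have [B0 fB0] := exists_freeb HA (fun v => c0 v + x v)%N.
have [pi piH piI] := cover_ge HA fB0 (@submodule_full _ _ N0) (fun u => leq_addl (c0 u) (x u)).
(* The rank formulas for [pi] over [A] and for [d0] over [B] contain the same rank, by [grk_dual];
   combined with [wt] they bound the top of ker pi by the multiplicities of B1. *)
have le1 u : (topd t e ar (lker pi) u <= c1 u + x u)%N.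
  have := weight_eq HA u fB0 piH piI.
  have := presentation_weight HB u fP1 fP0 d0H p0H p0I p0k.
  rewrite (grk_dual Hs t s sdd) /N0 (vsp_dual_dim Hs se) /indim.
  under eq_bigr do rewrite M0d; under [in X in _ -> X]eq_bigr do rewrite (vsp_dual_dim Hs se) M0d.
  have := wt u; move: (grk _ _ _ _ _) (\dim _) (topd _ _ _ _ _) (\sum_(a | t a == u) _)%N (\sum_(a | s a == u) _)%N (x u) => *; lia.
have [z0 z0H z0I] := cover_ge HA fB1 (submodule_ker piH) le1.
have dp0k : lker (dmap p0) = 0%VS := dmap_surj_inj p0I.
have dp0H := dmap_hom Hs p0H.
pose g0 : 'Hom(B0, D' P0) := (dmap p0 \o pi)%VF.
have g0I : limg g0 = limg (dmap p0) by rewrite limg_comp piI.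
have ft0 : four_term (Hs := Hs) e alpha z0 g0 (dmap d0).
  split; first by split=> //; [exact: (@is_hom_comp _ _ B0 N0 (D' P0)) | exact: (dmap_hom Hs d0H)].
  split.
  - rewrite z0I; apply/vspaceP=> v; rewrite !memv_ker comp_lfunE.
    apply/eqP/eqP => [E|->]; last exact: linear0.
    have /lker0P inj : lker (dmap p0) == 0%VS by rewrite dp0k.
    by apply: inj; rewrite E linear0.
  - by rewrite g0I; apply: dmap_exact.
  move=> u; rewrite g0I.
  have := dim_vpart_hom HA u dp0H (@submodule_full _ _ N0); rewrite capfv dp0k.
  by rewrite /vpart limg0 dimv0 add0n => ->; rewrite -[RHS]N0d.
(* Maps between the duals are duals of maps P1 -> P0, whose cokernels have dimension at least
   [alpha u] at u by [gcB]. *)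
have gen (i : 'Hom(D' P0, D' P1)) : is_hom i -> forall u, (alpha u <= \dim (vpart e (lker i) u))%N.
  move=> /dual_hom_lift[d dH <-] u.
  have := dim_vpart_lker_dmap Hs HA se u dH; have := leB d dH u.
  move: (\dim _) (\dim _) (\dim _) => *; lia.
(* [wt] is paired with [alpha]. The sum over the arrows of alpha (s a) * alpha (t a) appears on both
   sides, which is skew-symmetry of the exchange matrix, and the terms with [x] cancel. *)
have wtB : (\sum_u b0 u * alpha u + \sum_u (c1 u + x u) * alpha u =
            \sum_u (c0 u + x u) * alpha u + \sum_u b1 u * alpha u)%N.
  have E : (\sum_u alpha u * \sum_(a | t a == u) alpha (s a) = \sum_u alpha u * \sum_(a | s a == u) alpha (t a))%N.
    rewrite !sum_arrows; apply: eq_bigr => a _; exact: mulnC.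
  have : (\sum_u (c0 u + b1 u + \sum_(a | t a == u) alpha (s a)) * alpha u =
          \sum_u (c1 u + b0 u + \sum_(a | s a == u) alpha (t a)) * alpha u)%N.
    by apply: eq_bigr => u _; rewrite wt.
  have sC f : (\sum_u alpha u * f u = \sum_u f u * alpha u)%N.
    by apply: eq_bigr => u _; rewrite mulnC.
  rewrite !sC in E; have sD (f g : Vt -> nat) : (\sum_u (f u + g u) * alpha u =
      \sum_u f u * alpha u + \sum_u g u * alpha u)%N.
    by rewrite -big_split; apply: eq_bigr => u _; rewrite mulnDl.
  rewrite !sD E => /addIn; move: (\sum_u c0 u * _)%N (\sum_u c1 u * _)%N (\sum_u b1 u * _)%N (\sum_u b0 u * _)%N (\sum_u x u * _)%N => *; lia.
have ft_dim z g i u : four_term (Hs := Hs) e alpha (P1 := P1) (P0 := P0) (Y1 := B1) (Y0 := B0) z g i ->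
    (alpha u + \dim (vpart e (limg z) u))%N = \dim (vsp e B0 u).
  move=> [[zH gH iH] [gk ik ga]].
  have := dim_vpart_hom HA u gH (@submodule_full _ _ B0).
  by rewrite capfv gk ga addnC.
have dense := four_term_dense Ht ts st HA HB te fP1 fP0 fB1 fB0 wtB gen k_char0 (ex_intro _ z0 (ex_intro _ g0 (ex_intro _ (dmap d0) ft0))).
have dense' f z : polyfun (@lin_coord k 'Hom(B1, B0)) f -> is_hom z -> f z != 0 ->
    exists z' g i, four_term (Hs := Hs) e alpha (P1 := P1) (P0 := P0) (Y1 := B1) (Y0 := B0) z' g i /\ f z' != 0.
  move=> pf zH fz; apply: contrapT => no; move/eqP: fz; apply; apply: dense => // z' g i ft.
  by apply/eqP/negPn/negP => fz'; apply: no; exists z', g, i.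
have gcB1 : generic_coker e alpha B1 B0.
  split; last first.
    by exists z0 => // u; apply: ft_dim ft0.
  move=> z zH u; have [f [pf fz fP]] := vpart_rank_generic e z u.
  have [z' [g [i [ft fz']]]] := dense' f z pf zH fz.
  by rewrite -(ft_dim z' g i u ft) leq_add2l; apply: fP.
split; first exact: (generic_coker_stab HA fY1 fY0 fX fB1 fB0 gcB1).
have [r [pr [z1 z1H rz1] rP]] := coker_stab_down fY1 fY0 fX fB1 fB0.
(* By density some four-term sequence has a map [z] with invertible X-block. *)
have [z [g [i [ft rz]]]] := dense' r z1 pr z1H rz1.
have zm := ft_dim z g i ^~ ft; have [[zH gH iH] [gk ik ga]] := ft.
have [dz dzH dzN] := rP z zH rz; have [d dH dE] := dual_hom_lift iH.
have [M Mc] := exists_coker dH; have [p [pH pI pk]] := Mc.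
have dpH := dmap_hom Hs pH; have dpk : lker (dmap p) = 0%VS := dmap_surj_inj pI.
have gI : limg g = limg (dmap p) by rewrite -ik -dE; apply: dmap_exact.
(* [g] and the dual of [p] have the same image, namely ker i, so [g] factors through the dual of
   [M]; the factor [l] is a cokernel map of [z]. *)
have [|l lH lE] := @projective_lift _ _ B0 (D' M) (D' P0) (dmap p) g (freeb_projective HA fB0) dpH gH.
  by rewrite gI.
have zM : is_coker z (D' M).
  exists l; have /lker0P inj : lker (dmap p) == 0%VS by rewrite dpk.
  split=> //.
    apply/vspaceP=> v; rewrite memvf; apply/idP.
    have : dmap p v \in limg g by rewrite gI memv_img ?memvf.
    case/memv_imgP=> w _; rewrite -lE comp_lfunE => /inj ->.
    by rewrite memv_img ?memvf.
  rewrite -gk; apply/vspaceP=> v; rewrite !memv_ker -lE comp_lfunE.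
  by apply/eqP/eqP => [->|E]; [exact: linear0 | apply: inj; rewrite E linear0].
exists dz, d, M; split=> //; first exact: dzN.
have zm' : minimal_coker e alpha z by [].
by move=> u; rewrite -(vsp_dual_dim Hs se); apply: ((coker_minimal_coker HA alpha zH zM).1 zm' u).
Qed.

End Core.

(** * Jacobian algebras *)

Section Series.
Variables (k : closedFieldType) (Q : quiver).
Implicit Types (x y : cpa k Q) (u v : vert Q) (a b : arr Q) (p : seq (arr Q)).
Local Notation "x '**' y" := (cpa_mul x y) (at level 40, left associativity).

Lemma walk_cat u p p' : walk u (p ++ p') = walk u p && walk (wend u p) p'.
Proof. by elim: p u => [|a p IH] u //=; rewrite IH andbA. Qed.

Lemma wend_cat u p p' : wend u (p ++ p') = wend (wend u p) p'.
Proof. by rewrite /wend map_cat last_cat. Qed.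

Lemma walk_rcons u p a : walk u (rcons p a) = walk u p && (src a == wend u p).
Proof. by rewrite -cats1 walk_cat /= andbT. Qed.

Lemma wend_rcons u p a : wend u (rcons p a) = tgt a.
Proof. by rewrite -cats1 wend_cat. Qed.

Lemma pcoef_val x (q : qpath Q) : pcoef x (sval q).1 (sval q).2 = x q.
Proof. by rewrite /pcoef -surjective_pairing valK. Qed.

Lemma pcoef0 x u p : ~~ walk u p -> pcoef x u p = 0.
Proof. by move=> np; rewrite /pcoef insubN. Qed.

Lemma pcoefE (F : vert Q -> seq (arr Q) -> k) u p :
  pcoef (fun q : qpath Q => F (sval q).1 (sval q).2) u p = if walk u p then F u p else 0.
Proof.
rewrite /pcoef; case: insubP => [q /= w E|/negPf /= ->] //.
by rewrite w E.
Qed.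

Lemma cpa_ext x y : (forall u p, walk u p -> pcoef x u p = pcoef y u p) -> x = y.
Proof.
move=> E; apply/funext=> q; rewrite -!pcoef_val; apply: E.
exact: (svalP q).
Qed.

Lemma pcoef_mul x y u p : walk u p -> pcoef (x ** y) u p =
  \sum_(i < (size p).+1) pcoef x u (take i p) * pcoef y (wend u (take i p)) (drop i p).
Proof.
move=> w; have := pcoefE (fun u p => \sum_(i < (size p).+1)
  pcoef x u (take i p) * pcoef y (wend u (take i p)) (drop i p)) u p.
rewrite w => <-; congr pcoef; apply/funext=> q; rewrite /cpa_mul.
by case: (sval q).
Qed.

Lemma pcoef_vert u v p : pcoef (@cpa_vert k Q u) v p = ((v, p) == (u, [::]))%:R.
Proof.
have := pcoefE (fun v p => ((v, p) == (u, [::]))%:R) v p.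
have -> : (fun q : qpath Q => (((sval q).1, (sval q).2) == (u, [::]))%:R) = @cpa_vert k Q u.
  by apply/funext=> q; rewrite -surjective_pairing.
by move->; case: ifP => // nw; case: eqP nw => // -[_ ->].
Qed.

Lemma pcoef_arr a v p : pcoef (@cpa_arr k Q a) v p = ((v, p) == (src a, [:: a]))%:R.
Proof.
have := pcoefE (fun v p => ((v, p) == (src a, [:: a]))%:R) v p.
have -> : (fun q : qpath Q => (((sval q).1, (sval q).2) == (src a, [:: a]))%:R) = @cpa_arr k Q a.
  by apply/funext=> q; rewrite -surjective_pairing.
by move->; case: ifP => // nw; case: eqP nw => // -[-> ->]; rewrite /= eqxx.
Qed.

Lemma pcoef_lin (c : k) x y u p :
  pcoef (fun q => c * x q + y q) u p = c * pcoef x u p + pcoef y u p.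
Proof. by rewrite /pcoef; case: insub => [q|] //=; rewrite mulr0 addr0. Qed.

Lemma pcoefZ (c : k) x u p : pcoef (fun q => c * x q) u p = c * pcoef x u p.
Proof. by rewrite /pcoef; case: insub => [q|] //=; rewrite mulr0. Qed.

Lemma pcoef_cst0 u p : pcoef (fun q : qpath Q => 0 : k) u p = 0.
Proof. by rewrite /pcoef; case: insub. Qed.

Lemma pcoef_sum (I : Type) (r : seq I) (P : pred I) (F : I -> cpa k Q) u p :
  pcoef (fun q => \sum_(i <- r | P i) F i q) u p = \sum_(i <- r | P i) pcoef (F i) u p.
Proof. by rewrite /pcoef; case: insub => [q|] //=; rewrite big1. Qed.

Lemma mul_vertl u x v p : pcoef (cpa_vert k u ** x) v p = (v == u)%:R * pcoef x v p.
Proof.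
case: (boolP (walk v p)) => [w|w]; last by rewrite !pcoef0 ?mulr0.
rewrite pcoef_mul // big_ord_recl big1 ?addr0 => [|i _].
  by rewrite take0 drop0 pcoef_vert xpair_eqE eqxx andbT.
rewrite pcoef_vert xpair_eqE -size_eq0 size_takel ?andbF ?mul0r //.
exact: (ltn_ord i).
Qed.

Lemma mul_vertr u x v p : pcoef (x ** cpa_vert k u) v p = pcoef x v p * (wend v p == u)%:R.
Proof.
case: (boolP (walk v p)) => [w|w]; last by rewrite !pcoef0 ?mul0r.
rewrite pcoef_mul // big_ord_recr /= big1 ?add0r => [|i _].
  by rewrite take_size drop_size pcoef_vert xpair_eqE eqxx andbT.
rewrite pcoef_vert xpair_eqE -size_eq0 size_drop subn_eq0 leqNgt ltn_ord /=.
by rewrite andbF mulr0.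
Qed.

Lemma pcoef_mul0 x y u : pcoef (x ** y) u [::] = pcoef x u [::] * pcoef y u [::].
Proof. by rewrite pcoef_mul // big_ord_recl big_ord0 addr0. Qed.

(** The quotient on the left of [a] when a series is written as its constant part plus a sum of
    multiples of its last arrows; [lstrip] does the same for first arrows, so its paths must start
    at [tgt b]. *)
Definition rstrip a x : cpa k Q := fun q => pcoef x (sval q).1 (rcons (sval q).2 a).
Definition lstrip b x : cpa k Q := fun q =>
  if (sval q).1 == tgt b then pcoef x (src b) (b :: (sval q).2) else 0.

Lemma pcoef_rstrip a x u p : pcoef (rstrip a x) u p = pcoef x u (rcons p a).
Proof.
rewrite (pcoefE (fun u p => pcoef x u (rcons p a))); case: ifP => // w.
by rewrite pcoef0 // walk_rcons w.
Qed.

Lemma pcoef_lstrip b x u p : pcoef (lstrip b x) u p =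
  if u == tgt b then pcoef x (src b) (b :: p) else 0.
Proof.
rewrite (pcoefE (fun u p => if u == tgt b then pcoef x (src b) (b :: p) else 0)).
case: ifP => // w; case: eqP => // E.
by rewrite pcoef0 //= eqxx -E w.
Qed.

Lemma cpa_ext_r x y : (forall u, pcoef x u [::] = pcoef y u [::]) ->
  (forall a, rstrip a x = rstrip a y) -> x = y.
Proof.
move=> E0 E; apply: cpa_ext => u p _; case/lastP: p => // p a.
by rewrite -!pcoef_rstrip E.
Qed.

(** A twisted Leibniz rule: the last arrow belongs to the second factor unless that factor
    contributes a constant term. *)
Lemma rstrip_mul a x y : rstrip a (x ** y) =
  fun q => pcoef y (tgt a) [::] * rstrip a x q + (x ** rstrip a y) q.
Proof.
apply: cpa_ext => u p w; rewrite pcoef_lin !pcoef_rstrip.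
case: (boolP (walk u (rcons p a))) => [w'|w']; last first.
  rewrite (pcoef0 _ w') (pcoef0 x w') mulr0 add0r pcoef_mul // big1 // => i _.
  rewrite pcoef_rstrip [X in _ * X]pcoef0 ?mulr0 //.
  rewrite -{1}(cat_take_drop i p) in w'; move: w'; rewrite rcons_cat walk_cat negb_and.
  case/orP=> // nw; by move: w; rewrite -{1}(cat_take_drop i p) walk_cat (negPf nw).
rewrite !pcoef_mul // size_rcons big_ord_recr /= addrC; congr (_ + _).
  rewrite -(size_rcons p a) take_size drop_size wend_rcons mulrC //.
apply: eq_bigr => i _.
have le : (i <= size p)%N by rewrite -ltnS.
rewrite pcoef_rstrip -!cats1 take_cat drop_cat; case: ltngtP le => // E _; rewrite ?E ?subnn ?take0 ?drop0 ?cats0 //.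
by rewrite take_size drop_size.
Qed.

Lemma lstrip_mul a x y : lstrip a (x ** y) =
  fun q => pcoef x (src a) [::] * lstrip a y q + (lstrip a x ** y) q.
Proof.
apply: cpa_ext => u p w; rewrite pcoef_lin !pcoef_lstrip; case: eqP => [E|E]; last first.
  rewrite mulr0 add0r pcoef_mul // big1 // => i _.
  by rewrite pcoef_lstrip; case: eqP => // _; rewrite mul0r.
rewrite !pcoef_mul //= ?eqxx -?E // big_ord_recl /=; congr (_ + _).
by apply: eq_bigr => i _; rewrite pcoef_lstrip E eqxx.
Qed.

Lemma rstrip_arr a b : rstrip b (cpa_arr k a) = fun q => (a == b)%:R * cpa_vert k (src a) q.
Proof.
apply: cpa_ext => u p _; rewrite pcoef_rstrip pcoef_arr.
rewrite pcoefZ pcoef_vert.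
rewrite -natrM mulnb !xpair_eqE -[[:: a]]/(rcons [::] a) eqseq_rcons; congr ((_ : bool)%:R).
by rewrite (eq_sym b); case: (a == b); rewrite ?andbT ?andbF.
Qed.

Lemma rstrip_vert u b : rstrip b (cpa_vert k u) = fun q => 0.
Proof.
apply: cpa_ext => v p _; rewrite pcoef_rstrip pcoef_vert xpair_eqE -size_eq0 size_rcons andbF.
by rewrite pcoef_cst0.
Qed.

Lemma lstrip_arr a b : lstrip b (cpa_arr k a) = fun q => (a == b)%:R * cpa_vert k (tgt a) q.
Proof.
apply: cpa_ext => u p w; rewrite pcoef_lstrip pcoef_arr.
rewrite pcoefZ pcoef_vert.
rewrite !xpair_eqE eqseq_cons (eq_sym b); case: (eqVneq a b) => [->|ab]; last first.
  by rewrite andbF mul0r; case: ifP.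
by rewrite eqxx mul1r /=; case: eqP.
Qed.

Lemma lstrip_vert u b : lstrip b (cpa_vert k u) = fun q => 0.
Proof.
apply: cpa_ext => v p w; rewrite pcoef_lstrip pcoef_vert xpair_eqE andbF.
by rewrite pcoef_cst0; case: ifP.
Qed.

Lemma pcoef_one u p : pcoef (@cpa_one k Q) u p = (p == [::])%:R.
Proof.
have := pcoefE (fun u p => (p == [::])%:R) u p.
have -> : (fun q : qpath Q => ((sval q).2 == [::])%:R) = @cpa_one k Q.
  by apply/funext=> q; rewrite /cpa_one /plen size_eq0.
by move->; case: ifP => // nw; case: eqP nw => // ->.
Qed.

Variable W : potential k Q.
Hypothesis Q_loopless : loopless Q.

Lemma pcoef_deriv a u p : pcoef (cyc_deriv W a) u p =
  if [&& walk u p, u == tgt a & wend u p == src a]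
  then \sum_(i < (size p).+1) W (drop i p ++ a :: take i p) else 0.
Proof.
have := pcoefE (fun u p => if (u == tgt a) && (wend u p == src a) then
  \sum_(i < (size p).+1) W (drop i p ++ a :: take i p) else 0) u p.
have -> : (fun q : qpath Q => if ((sval q).1 == tgt a) && (wend (sval q).1 (sval q).2 == src a) then
  \sum_(i < (size (sval q).2).+1) W (drop i (sval q).2 ++ a :: take i (sval q).2) else 0) = cyc_deriv W a.
  by apply/funext=> q; rewrite /cyc_deriv; case: (sval q).
by move->; case: (walk u p).
Qed.

(** A constant term would be a path of length 0 from [tgt a] to [src a], and there are no loops. *)
Lemma deriv_const a u : pcoef (cyc_deriv W a) u [::] = 0.
Proof.
rewrite pcoef_deriv /=; case: ifP => // /andP[/eqP-> /eqP E].
by have := Q_loopless a; rewrite -E eqxx.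
Qed.

(** At the path p both sides add up the potential over all rotations of the cyclic word a p b,
    enumerated from different starting points. *)
Lemma strip_deriv a b : lstrip a (cyc_deriv W b) = rstrip b (cyc_deriv W a).
Proof.
apply: cpa_ext => u p w; rewrite pcoef_lstrip pcoef_rstrip !pcoef_deriv /= eqxx /=.
rewrite walk_rcons w wend_rcons -[wend (src a) (a :: p)]/(wend (tgt a) p) size_rcons /=.
case: eqP => [uE|]; last by rewrite andbF.
rewrite -uE w /= [src b == _]eq_sym [tgt b == _]eq_sym andbC; case: ifP => // _.
(* The first rotation on the left is the last one on the right; the others match after a shift by
   one. *)
rewrite [LHS]big_ord_recl [RHS]big_ord_recr /= addrC; congr (_ + _).
  by rewrite -(size_rcons p b) drop_size take_size cats1.
apply: eq_bigr => i _; rewrite -!cats1 drop_cat take_cat /=.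
have := ltn_ord i; rewrite ltnS leq_eqVlt => /orP[/eqP->|->].
  by rewrite ltnn subnn drop0 take0 drop_size take_size cats0.
by rewrite -catA.
Qed.

End Series.

(** Vectors of [U] are adjoined one at a time to a subspace; the induction is on its codimension. *)
Lemma vspace_of_pred (k : fieldType) (V : vectType k) (U : V -> Prop) : U 0 ->
  (forall (c : k) x y, U x -> U y -> U (c *: x + y)) -> exists W : {vspace V}, forall z, z \in W <-> U z.
Proof.
move=> U0 UL.
suff ex n (W : {vspace V}) : (forall z, z \in W -> U z) -> (\dim {:V} - \dim W <= n)%N ->
    exists W' : {vspace V}, forall z, z \in W' <-> U z.
  by apply: (ex _ 0%VS) (leqnn _) => z; rewrite memv0 => /eqP->.
elim: n W => [|n IH] W WU dW.
  exists W => z; split=> [/WU //|_].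
  suff -> : W = fullv by rewrite memvf.
  by apply/eqP; rewrite eqEdim subvf /=; move: dW; rewrite leqn0 subn_eq0.
case: (pselect (exists2 z, U z & z \notin W)) => [[z Uz zW]|no]; last first.
  exists W => z; split=> [/WU //|Uz]; apply/negPn/negP => zW; apply: no; exists z => //.
apply: (IH (W + <[z]>)%VS) => [v /memv_addP[w wW [_ /vlineP[c ->] ->]]|].
  by rewrite addrC; apply: UL => //; apply: WU.
have : (\dim W < \dim (W + <[z]>))%N.
  rewrite ltn_neqAle dimvS ?addvSl // andbT; apply: contraNneq zW => E.
  have : (W == W + <[z]>)%VS by rewrite eqEdim addvSl E /=.
  by move=> /eqP->; rewrite memvE addvSr.
by move: dW; move: (\dim W) (\dim _) (\dim _) => *; lia.
Qed.

Section Jacobian.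
Variables (k : closedFieldType) (Q : quiver) (W : potential k Q).
Hypothesis Q_loopless : loopless Q.
Variable J : jacobian_algebra W.
Implicit Types (x y : cpa k Q) (u v : vert Q) (a b : arr Q) (p : seq (arr Q)).
Local Notation "x '**' y" := (cpa_mul x y) (at level 40, left associativity).
Local Notation pi := (jproj J).
Local Notation e := (jvert J).
Local Notation ar := (jarr J).

Definition jdd b a : J := pi (rstrip a (cyc_deriv W b)).

Lemma pi0 : pi (fun=> 0) = 0.
Proof.
have := jprojD J (-1) (fun=> 0) (fun=> 0); rewrite scaleN1r addNr => <-.
by congr pi; apply/funext=> q; rewrite mulr0 addr0.
Qed.

Lemma piZ c x : pi (fun q => c * x q) = c *: pi x.
Proof.
have := jprojD J c x (fun=> 0); rewrite pi0 addr0 => <-.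
by congr pi; apply/funext=> q; rewrite addr0.
Qed.

Lemma piD x y : pi (fun q => x q + y q) = pi x + pi y.
Proof.
have := jprojD J 1 x y; rewrite scale1r => <-.
by congr pi; apply/funext=> q; rewrite mul1r.
Qed.

Lemma piB x y : pi (fun q => x q - y q) = pi x - pi y.
Proof.
rewrite -scaleN1r addrC -jprojD.
by congr pi; apply/funext=> q; rewrite mulN1r addrC.
Qed.

Lemma pi_sum (I : Type) (r : seq I) (P : pred I) (F : I -> cpa k Q) :
  pi (fun q => \sum_(i <- r | P i) F i q) = \sum_(i <- r | P i) pi (F i).
Proof.
elim: r => [|i r IH]; first by under eq_fun do rewrite big_nil; rewrite pi0 big_nil.
rewrite big_cons -IH; case: (boolP (P i)) => Pi.
  by rewrite -piD; congr pi; apply/funext=> q; rewrite big_cons Pi.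
by congr pi; apply/funext=> q; rewrite big_cons (negPf Pi).
Qed.

Lemma mul1_cpa x : @cpa_one k Q ** x = x.
Proof.
apply: cpa_ext => u p w; rewrite pcoef_mul // big_ord_recl big1 ?addr0 => [|i _].
  by rewrite take0 drop0 pcoef_one eqxx mul1r.
by rewrite pcoef_one -size_eq0 size_takel ?mul0r //; apply: (ltn_ord i).
Qed.

Lemma mulr1_cpa x : x ** @cpa_one k Q = x.
Proof.
apply: cpa_ext => u p w; rewrite pcoef_mul // big_ord_recr /= big1 ?add0r => [|i _].
  by rewrite take_size drop_size pcoef_one eqxx mulr1.
by rewrite pcoef_one -size_eq0 size_drop subn_eq0 leqNgt ltn_ord mulr0.
Qed.

Lemma pi_deriv b : pi (cyc_deriv W b) = 0.
Proof.
apply/(jproj_ker J) => n; exists (cyc_deriv W b) => //.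
exists [:: (@cpa_one k Q, b, @cpa_one k Q)] => q.
by rewrite big_seq1 /= mul1_cpa mulr1_cpa.
Qed.

Definition ordge n x : Prop := forall q, (plen q < n)%N -> x q = 0.

Lemma ordge_pcoef n x : ordge n x <-> forall u p, (size p < n)%N -> pcoef x u p = 0.
Proof.
split=> [xn u p pn|E q qn]; last by rewrite -pcoef_val E.
by rewrite /pcoef; case: insubP => // q _ E; apply: xn; rewrite /plen E.
Qed.

(* The images of the series of order at least n decrease, hence are stationary;
   an element of all of them vanishes because the ideal is closed. *)
Lemma pi_ordge : exists n, forall x, ordge n x -> pi x = 0.
Proof.
have vs n : exists V : {vspace J}, forall z, z \in V <-> exists2 x, ordge n x & pi x = z.
  apply: vspace_of_pred; first by exists (fun=> 0); rewrite ?pi0.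
  move=> c _ _ [x xn <-] [y yn <-]; exists (fun q => c * x q + y q); last exact: jprojD.
  by move=> q qn; rewrite xn // yn // mulr0 addr0.
have [V VP] := boolp.choice vs.
have Vdec m n : (n <= m)%N -> (V m <= V n)%VS.
  move=> nm; apply/subvP=> z /VP[x xm <-]; apply/VP; exists x => // q qn.
  by apply: xm; apply: leq_trans nm.
have [n nmin] : exists n, forall m, (\dim (V n) <= \dim (V m))%N.
  have : exists d, `[<exists n, \dim (V n) = d>] by exists (\dim (V 0%N)); apply/asboolP; exists 0%N.
  move=> ex; have [d /asboolP[n nd] dmin] := ex_minnP ex.
  by exists n => m; rewrite nd; apply: dmin; apply/asboolP; exists m.
exists n => x xn; apply/(jproj_ker J) => m.
have : pi x \in V (maxn n m).
  have -> : V (maxn n m) = V n by apply/eqP; rewrite eqEdim Vdec ?leq_maxl //= nmin.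
  by apply/VP; exists x.
case/VP=> y ym yx; have : pi (fun q => x q - y q) = 0 by rewrite piB yx subrr.
move/(jproj_ker J)/(_ m) => [z zI zE]; exists z => // q qm.
rewrite -zE // ym ?subr0 //; apply: leq_trans qm _; exact: leq_maxr.
Qed.

(** Approximation to order 1 already determines constant terms, and those of the cyclic derivatives
    are zero. *)
Lemma ideal_const x u : closed_jacobian_ideal W x -> pcoef x u [::] = 0.
Proof.
move=> /(_ 1%N)[y [s yE] xy].
have -> : pcoef x u [::] = pcoef y u [::].
  by rewrite /pcoef; case: insubP => // q _ E; apply: xy; rewrite /plen E.
have -> : y = fun q => \sum_(t <- s) cpa_mul (cpa_mul t.1.1 (cyc_deriv W t.1.2)) t.2 q by apply/funext.
rewrite pcoef_sum big1 // => t _.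
by rewrite !pcoef_mul0 deriv_const // mulr0 mul0r.
Qed.

Lemma j_ee u v : e u * e v = (u == v)%:R *: e u.
Proof.
rewrite -jprojM -piZ; congr pi; apply: cpa_ext => w p wp.
rewrite mul_vertl pcoefZ !pcoef_vert !xpair_eqE -!natrM !mulnb; congr ((_ : bool)%:R).
case: (eqVneq w u) => [->|]; rewrite ?andbA //=.
by rewrite !andbF.
Qed.

Lemma j_e1 : \sum_u e u = 1.
Proof.
rewrite -jproj1 -pi_sum; congr pi; apply: cpa_ext => w p wp.
rewrite pcoef_sum pcoef_one (bigD1 w) //= pcoef_vert xpair_eqE eqxx big1 ?addr0 // => u uw.
by rewrite pcoef_vert xpair_eqE eq_sym (negPf uw).
Qed.

Lemma j_ear a : e (src a) * ar a = ar a.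
Proof.
rewrite -jprojM; congr pi; apply: cpa_ext => w p wp.
by rewrite mul_vertl pcoef_arr xpair_eqE -natrM mulnb andbA andbb.
Qed.

Lemma j_are a : ar a * e (tgt a) = ar a.
Proof.
rewrite -jprojM; congr pi; apply: cpa_ext => w p wp.
rewrite mul_vertr pcoef_arr xpair_eqE -natrM mulnb; congr ((_ : bool)%:R).
by case: eqP => //= ->; case: eqP => //= ->; rewrite /wend /= eqxx.
Qed.

Lemma dec_r x : x = fun q => \sum_u pcoef x u [::] * cpa_vert k u q +
  \sum_a (rstrip a x ** cpa_arr k a) q.
Proof.
set y := fun q => _ : k.
have yE u p : pcoef y u p = \sum_v pcoef x v [::] * pcoef (cpa_vert k v) u p +
    \sum_a pcoef (rstrip a x ** cpa_arr k a) u p.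
  rewrite /y; have := pcoef_lin 1 (fun q => \sum_v pcoef x v [::] * cpa_vert k v q) (fun q => \sum_a (rstrip a x ** cpa_arr k a) q) u p.
  under eq_fun do rewrite mul1r; move->; rewrite mul1r !pcoef_sum.
  by under eq_bigr do rewrite pcoefZ.
apply: cpa_ext_r => [u|b].
  rewrite yE (bigD1 u) //= pcoef_vert eqxx mulr1 !big1 ?addr0 // => [a _|v vu].
    by rewrite pcoef_mul0 pcoef_arr xpair_eqE andbF mulr0.
  by rewrite pcoef_vert xpair_eqE eq_sym (negPf vu) mulr0.
apply: cpa_ext => u p w; rewrite !pcoef_rstrip yE big1 ?add0r => [|v _]; last first.
  by rewrite -pcoef_rstrip rstrip_vert pcoef_cst0 mulr0.
have R z : pcoef z u (rcons p b) = pcoef (rstrip b z) u p by rewrite pcoef_rstrip.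
rewrite (bigD1 b) //= big1 ?addr0 => [|a ab]; rewrite R ?[in RHS]R rstrip_mul pcoef_lin.
  rewrite pcoef_arr xpair_eqE andbF mul0r add0r rstrip_arr eqxx.
  under [X in _ ** X]eq_fun do rewrite mul1r.
  rewrite mul_vertr; case: eqP => [|nw]; first by rewrite mulr1.
  by rewrite mulr0 pcoef_rstrip pcoef0 // walk_rcons w /= eq_sym; apply/eqP.
rewrite pcoef_arr xpair_eqE andbF mul0r add0r rstrip_arr (negPf ab).
rewrite pcoef_mul // big1 // => i _; rewrite pcoefZ mul0r mulr0 //.
Qed.

Lemma dec_l x : x = fun q => \sum_u pcoef x u [::] * cpa_vert k u q +
  \sum_a (cpa_arr k a ** lstrip a x) q.
Proof.
set y := fun q => _ : k.
have yE u p : pcoef y u p = \sum_v pcoef x v [::] * pcoef (cpa_vert k v) u p +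
    \sum_a pcoef (cpa_arr k a ** lstrip a x) u p.
  rewrite /y; have := pcoef_lin 1 (fun q => \sum_v pcoef x v [::] * cpa_vert k v q) (fun q => \sum_a (cpa_arr k a ** lstrip a x) q) u p.
  under eq_fun do rewrite mul1r; move->; rewrite mul1r !pcoef_sum.
  by under eq_bigr do rewrite pcoefZ.
apply: cpa_ext => u [|b p] w.
  rewrite yE (bigD1 u) //= pcoef_vert eqxx mulr1 !big1 ?addr0 // => [a _|v vu].
    by rewrite pcoef_mul0 pcoef_arr xpair_eqE andbF mul0r.
  by rewrite pcoef_vert xpair_eqE eq_sym (negPf vu) mulr0.
move: (w) => /= /andP[/eqP<- w'].
have L z : pcoef z (src b) (b :: p) = pcoef (lstrip b z) (tgt b) p.
  by rewrite pcoef_lstrip eqxx.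
rewrite yE !L big1 ?add0r => [|v _]; last by rewrite L lstrip_vert pcoef_cst0 mulr0.
rewrite (bigD1 b) //= big1 ?addr0 => [|a ab]; rewrite L lstrip_mul pcoef_lin.
  rewrite pcoef_arr xpair_eqE andbF mul0r add0r lstrip_arr eqxx.
  under [X in X ** _]eq_fun do rewrite mul1r.
  by rewrite mul_vertl eqxx mul1r.
rewrite pcoef_arr xpair_eqE andbF mul0r add0r lstrip_arr (negPf ab).
rewrite pcoef_mul // big1 // => i _; rewrite pcoefZ mul0r mul0r //.
Qed.

Lemma j_dec_r x : pi x = \sum_u pcoef x u [::] *: e u + \sum_a pi (rstrip a x) * ar a.
Proof.
rewrite {1}[x]dec_r piD !pi_sum; congr (_ + _); apply: eq_bigr => i _; first exact: piZ.
by rewrite jprojM.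
Qed.

Lemma j_dec_l x : pi x = \sum_u pcoef x u [::] *: e u + \sum_a ar a * pi (lstrip a x).
Proof.
rewrite {1}[x]dec_l piD !pi_sum; congr (_ + _); apply: eq_bigr => i _; first exact: piZ.
by rewrite jprojM.
Qed.

Lemma j_ddl a b : e (tgt b) * jdd b a = jdd b a.
Proof.
rewrite -jprojM; congr pi; apply: cpa_ext => u p w.
rewrite mul_vertl pcoef_rstrip pcoef_deriv; case: ifP => [/and3P[_ -> _]|_].
  by rewrite mul1r.
by rewrite mulr0.
Qed.

Lemma j_ddr a b : jdd b a * e (src a) = jdd b a.
Proof.
rewrite -jprojM; congr pi; apply: cpa_ext => u p w.
rewrite mul_vertr pcoef_rstrip; case: (boolP (walk u (rcons p a))) => w'.
  by move: w'; rewrite walk_rcons eq_sym => /andP[_ ->]; rewrite mulr1.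
by rewrite pcoef0 // mul0r.
Qed.

Lemma j_dd0 a b : tgt a != src b -> jdd b a = 0.
Proof.
move=> ab; rewrite -pi0; congr pi; apply: cpa_ext => u p w.
rewrite pcoef_rstrip pcoef_deriv pcoef_cst0 wend_rcons (negPf ab).
by rewrite !andbF.
Qed.

(** The class of the derivative by [b] is zero; this is its decomposition by last arrows. *)
Lemma j_rel b : \sum_(a | tgt a == src b) jdd b a * ar a = 0.
Proof.
have := j_dec_r (cyc_deriv W b); rewrite pi_deriv big1 ?add0r => [/esym|u _]; last first.
  by rewrite deriv_const // scale0r.
apply: etrans; rewrite big_mkcond; apply: eq_bigr => a _; case: eqVneq => // ab.
by rewrite -/(jdd b a) j_dd0 // mul0r.
Qed.

(** Decomposition by first arrows; [strip_deriv] shows that the quotients are the same elements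
    [jdd]. *)
Lemma j_rel_l a : \sum_(b | src b == tgt a) ar b * jdd b a = 0.
Proof.
have := j_dec_l (cyc_deriv W a); rewrite pi_deriv big1 ?add0r => [/esym|u _]; last first.
  by rewrite deriv_const // scale0r.
apply: etrans; rewrite big_mkcond; apply: eq_bigr => b _; rewrite strip_deriv // -/(jdd b a).
by case: eqVneq => // ab; rewrite j_dd0 ?mulr0 // eq_sym.
Qed.

End Jacobian.

Section JacobianQPA.
Variables (k : closedFieldType) (Q : quiver) (W : potential k Q).
Hypothesis Q_loopless : loopless Q.
Variable J : jacobian_algebra W.
Implicit Types (x y : cpa k Q) (u v : vert Q) (a b : arr Q) (p : seq (arr Q)).
Local Notation "x '**' y" := (cpa_mul x y) (at level 40, left associativity).
Local Notation pi := (jproj J).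
Local Notation e := (jvert J).
Local Notation ar := (jarr J).

Lemma ordge_mul n m x y : ordge n x -> ordge m y -> ordge (n + m) (x ** y).
Proof.
move=> /ordge_pcoef xn /ordge_pcoef ym; apply/ordge_pcoef => u p pnm.
case: (boolP (walk u p)) => w; last by rewrite pcoef0.
rewrite pcoef_mul // big1 // => i _; have ip : (i <= size p)%N by rewrite -ltnS.
case: (ltnP i n) => [lt|ge]; first by rewrite xn ?mul0r // size_takel.
by rewrite [X in _ * X]ym ?mulr0 // size_drop; move: pnm ge ip; move: (size p) (nat_of_ord i) => *; lia.
Qed.

Definition word_series (w : seq (arr Q)) : cpa k Q :=
  foldr (fun a x => cpa_arr k a ** x) (@cpa_one k Q) w.

Lemma word_seriesE w : pi (word_series w) = \prod_(a <- w) ar a.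
Proof.
elim: w => [|a w IH]; first by rewrite big_nil jproj1.
by rewrite big_cons -IH /= jprojM.
Qed.

Lemma word_series_ordge w : ordge (size w) (word_series w).
Proof.
elim: w => [//|a w IH] /=; rewrite -add1n; apply: ordge_mul IH.
by apply/ordge_pcoef => u [|] //= _; rewrite pcoef_arr xpair_eqE andbF.
Qed.

Lemma j_nil : exists n, forall w : seq (arr Q), size w = n -> \prod_(a <- w) ar a = 0.
Proof.
have [n nP] := pi_ordge J; exists n => w wn.
by rewrite -word_seriesE; apply: nP; rewrite -wn; apply: word_series_ordge.
Qed.

Lemma j_const : exists eps : vert Q -> J -> k, forall u x, eps u (pi x) = pcoef x u [::].
Proof.
have [r rP] := boolp.choice (@jproj_surj _ _ _ J).
exists (fun u z => pcoef (r z) u [::]) => u x.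
have : pi (fun q => (-1) * x q + r (pi x) q) = 0 by rewrite jprojD rP scaleN1r addNr.
move=> /(jproj_ker J) /(ideal_const Q_loopless u).
by rewrite pcoef_lin mulN1r addrC => /eqP; rewrite subr_eq0 => /eqP.
Qed.

Lemma j_eps : exists eps : vert Q -> J -> k,
  [/\ forall u (c : k) (x y : J), eps u (c *: x + y) = c * eps u x + eps u y,
      forall u (x y : J), eps u (x * y) = eps u x * eps u y,
      forall u v, eps u (e v) = (u == v)%:R &
      forall u a, eps u (ar a) = 0].
Proof.
have [eps E] := j_const; exists eps; split.
- move=> u c x y; have [x' <-] := @jproj_surj _ _ _ J x; have [y' <-] := @jproj_surj _ _ _ J y.
  by rewrite -jprojD !E pcoef_lin.
- move=> u x y; have [x' <-] := @jproj_surj _ _ _ J x; have [y' <-] := @jproj_surj _ _ _ J y.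
  by rewrite -jprojM !E pcoef_mul0.
- by move=> u v; rewrite E pcoef_vert xpair_eqE andbT.
by move=> u a; rewrite E pcoef_arr xpair_eqE andbF.
Qed.

Lemma rstrip_mul_arr x a b u p :
  pcoef (x ** cpa_arr k a) u (rcons p b) = (a == b)%:R * pcoef (x ** cpa_vert k (src a)) u p.
Proof.
rewrite -pcoef_rstrip rstrip_mul pcoef_lin pcoef_arr xpair_eqE andbF mul0r add0r rstrip_arr.
case: eqP => _; first by under [X in _ ** X]eq_fun do rewrite mul1r; rewrite mul1r.
case: (boolP (walk u p)) => w; last by rewrite pcoef0 ?mul0r.
by rewrite pcoef_mul // mul0r big1 // => i _; rewrite pcoefZ mul0r mulr0.
Qed.

Lemma lstrip_mul_arr x a b p :
  pcoef (cpa_arr k a ** x) (src b) (b :: p) = (a == b)%:R * pcoef (cpa_vert k (tgt a) ** x) (tgt b) p.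
Proof.
have -> : pcoef (cpa_arr k a ** x) (src b) (b :: p) = pcoef (lstrip b (cpa_arr k a ** x)) (tgt b) p.
  by rewrite pcoef_lstrip eqxx.
rewrite lstrip_mul pcoef_lin pcoef_arr xpair_eqE andbF mul0r add0r lstrip_arr.
case: eqP => _; first by under [X in X ** _]eq_fun do rewrite mul1r; rewrite mul1r.
case: (boolP (walk (tgt b) p)) => w; last by rewrite pcoef0 ?mul0r.
by rewrite pcoef_mul // mul0r big1 // => i _; rewrite pcoefZ !mul0r.
Qed.

Lemma sum_fibre (I : Type) (r : seq I) (f : I -> arr Q) (F : I -> J) :
  \sum_b \sum_(t <- r | f t == b) F t = \sum_(t <- r) F t.
Proof.
rewrite (exchange_big_dep xpredT) //=; apply: eq_bigr => t _.
by rewrite (big_pred1 (f t)) // => b; rewrite eq_sym.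
Qed.

Lemma pi_eq n x y : (forall z, ordge n z -> pi z = 0) ->
  (forall u p, walk u p -> (size p < n)%N -> pcoef x u p = pcoef y u p) -> pi x = pi y.
Proof.
move=> nP E; apply/eqP; rewrite -subr_eq0 -piB; apply/eqP/nP => q qn.
by rewrite -!pcoef_val E ?subrr //; apply: (svalP q).
Qed.

(** A lift of the relation lies in the closed ideal, so it agrees up to a given order with a finite
    sum of products l D r, with D a cyclic derivative. Removing the last arrow [a] from such a
    product leaves, modulo the ideal, the constant term of r at u times l times the second
    derivative. These scalar multiples of l, collected by the arrow of D, give the [ys]. *)
Lemma j_ex_r u (xs : arr Q -> J) : (forall a, xs a * e (src a) = xs a) ->
  \sum_(a | tgt a == u) xs a * ar a = 0 ->
  exists2 ys : arr Q -> J, forall b, ys b * e (tgt b) = ys b &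
    forall a, tgt a = u -> xs a = \sum_(b | src b == u) ys b * jdd J b a.
Proof.
move=> xe x0; have [X XE] := boolp.choice (fun a => @jproj_surj _ _ _ J (xs a)).
pose Z : cpa k Q := fun q => \sum_(a | tgt a == u) (X a ** cpa_arr k a) q.
have piZ0 : pi Z = 0.
  by rewrite pi_sum -[RHS]x0; apply: eq_bigr => a _; rewrite jprojM XE.
have [n nP] := pi_ordge J.
(* One order more than [n], because removing an arrow lowers the order by one. *)
have [y [r yE] Zy] := (jproj_ker J Z).1 piZ0 n.+1.
exists (fun b => \sum_(t <- r | t.1.2 == b) pcoef t.2 u [::] *: (pi t.1.1 * e (tgt b))) => [b|a au].
  rewrite big_distrl; apply: eq_bigr => t _.
  by rewrite /= -scalerAl -mulrA j_ee eqxx scale1r.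
transitivity (pi (rstrip a y)).
  rewrite -xe -XE -jprojM; apply: (pi_eq nP) => v p w pn.
  rewrite pcoef_rstrip.
  have -> : pcoef y v (rcons p a) = pcoef Z v (rcons p a).
    rewrite /pcoef; case: insubP => // q _ qE; rewrite Zy // /plen qE.
    by rewrite size_rcons.
  rewrite pcoef_sum (bigD1 a) ?au //= rstrip_mul_arr eqxx mul1r big1 ?addr0 //.
  by move=> b /andP[_ ba]; rewrite rstrip_mul_arr (negPf ba) mul0r.
have -> : rstrip a y = fun q => \sum_(t <- r) rstrip a (cpa_mul (cpa_mul t.1.1 (cyc_deriv W t.1.2)) t.2) q.
  apply: cpa_ext => v p w; rewrite pcoef_sum pcoef_rstrip.
  have -> : y = fun q => \sum_(t <- r) cpa_mul (cpa_mul t.1.1 (cyc_deriv W t.1.2)) t.2 q by apply/funext.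
  by rewrite pcoef_sum; under [RHS]eq_bigr do rewrite pcoef_rstrip.
rewrite pi_sum.
have -> : \sum_(b | src b == u) (\sum_(t <- r | t.1.2 == b) pcoef t.2 u [::] *: (pi t.1.1 * e (tgt b))) * jdd J b a =
    \sum_b \sum_(t <- r | t.1.2 == b) pcoef t.2 u [::] *: (pi t.1.1 * jdd J t.1.2 a).
  rewrite big_mkcond; apply: eq_bigr => b _; case: eqP => [_|/eqP bu].
    rewrite big_distrl; apply: eq_bigr => t /eqP->.
    by rewrite /= -scalerAl -mulrA j_ddl.
  rewrite big1 // => t /eqP->; rewrite j_dd0 ?mulr0 ?scaler0 //.
  by rewrite au eq_sym.
rewrite sum_fibre; apply: eq_bigr => t _.
rewrite rstrip_mul jprojD !jprojM pi_deriv mulr0 mul0r addr0 au; congr (_ *: _).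
by rewrite rstrip_mul deriv_const // jprojD scale0r add0r jprojM.
Qed.

Lemma j_ex_l u (xs : arr Q -> J) : (forall a, e (tgt a) * xs a = xs a) ->
  \sum_(a | src a == u) ar a * xs a = 0 ->
  exists2 ys : arr Q -> J, forall b, e (src b) * ys b = ys b &
    forall a, src a = u -> xs a = \sum_(b | tgt b == u) jdd J a b * ys b.
Proof.
move=> xe x0; have [X XE] := boolp.choice (fun a => @jproj_surj _ _ _ J (xs a)).
pose Z : cpa k Q := fun q => \sum_(a | src a == u) (cpa_arr k a ** X a) q.
have piZ0 : pi Z = 0.
  by rewrite pi_sum -[RHS]x0; apply: eq_bigr => a _; rewrite jprojM XE.
have [n nP] := pi_ordge J.
have [y [r yE] Zy] := (jproj_ker J Z).1 piZ0 n.+1.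
exists (fun b => \sum_(t <- r | t.1.2 == b) pcoef t.1.1 u [::] *: (e (src b) * pi t.2)) => [b|a au].
  rewrite big_distrr; apply: eq_bigr => t _.
  by rewrite /= -scalerAr mulrA j_ee eqxx scale1r.
transitivity (pi (lstrip a y)).
  rewrite -xe -XE -jprojM; apply: (pi_eq nP) => v p w pn.
  rewrite pcoef_lstrip; case: eqP => [->|/eqP/negPf E]; last by rewrite mul_vertl E mul0r.
  have -> : pcoef y (src a) (a :: p) = pcoef Z (src a) (a :: p).
    by rewrite /pcoef; case: insubP => // q _ qE; rewrite Zy // /plen qE.
  rewrite pcoef_sum (bigD1 a) ?au //= -au lstrip_mul_arr eqxx mul1r big1 ?addr0 //.
  by move=> b /andP[_ ba]; rewrite lstrip_mul_arr (negPf ba) mul0r.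
have -> : lstrip a y = fun q => \sum_(t <- r) lstrip a (cpa_mul (cpa_mul t.1.1 (cyc_deriv W t.1.2)) t.2) q.
  apply: cpa_ext => v p w; rewrite pcoef_sum pcoef_lstrip.
  have -> : y = fun q => \sum_(t <- r) cpa_mul (cpa_mul t.1.1 (cyc_deriv W t.1.2)) t.2 q by apply/funext.
  under [RHS]eq_bigr do rewrite pcoef_lstrip.
  by case: eqP => _; rewrite ?pcoef_sum // big1.
rewrite pi_sum.
have -> : \sum_(b | tgt b == u) jdd J a b * (\sum_(t <- r | t.1.2 == b) pcoef t.1.1 u [::] *: (e (src b) * pi t.2)) =
    \sum_b \sum_(t <- r | t.1.2 == b) pcoef t.1.1 u [::] *: (jdd J a t.1.2 * pi t.2).
  rewrite big_mkcond; apply: eq_bigr => b _; case: eqP => [_|/eqP bu].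
    rewrite big_distrr; apply: eq_bigr => t /eqP->.
    by rewrite /= -scalerAr mulrA j_ddr.
  rewrite big1 // => t /eqP->; rewrite j_dd0 ?mul0r ?scaler0 //.
  by rewrite au.
rewrite sum_fibre; apply: eq_bigr => t _.
rewrite lstrip_mul jprojD pcoef_mul0 deriv_const // mulr0 scale0r add0r jprojM.
rewrite lstrip_mul jprojD jprojM pi_deriv mulr0 addr0 -scalerAl au.
by rewrite strip_deriv.
Qed.

Lemma jacobian_qpa : qpa (@src Q) (@tgt Q) e ar (jdd J).
Proof.
split.
- exact: j_ee.
- exact: j_e1.
- exact: j_ear.
- exact: j_are.
- move=> z; have [x <-] := @jproj_surj _ _ _ J z; rewrite j_dec_r.
  by exists (fun u => pcoef x u [::]), (fun a => pi (rstrip a x)).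
- exact: j_nil.
- exact: j_eps.
- exact: j_ddl.
- exact: j_ddr.
- exact: j_rel.
exact: j_ex_r.
Qed.

Lemma prod_rev (w : seq (arr Q)) :
  \prod_(a <- w) (ar a : conv_alg J) = \prod_(a <- rev w) ar a :> J.
Proof.
elim: w => [|a w IH]; first by rewrite !big_nil.
by rewrite big_cons rev_cons -cats1 big_cat big_seq1 /= -IH.
Qed.

(** The left-handed statements, read as right-handed ones over the converse algebra, with the two
    indices of [jdd] exchanged. *)
Lemma jacobian_qpa_conv : qpa (A := conv_alg J) (@tgt Q) (@src Q) e ar (fun a b => jdd J b a).
Proof.
split.
- move=> u v; apply: (etrans (j_ee J v u)); rewrite eq_sym.
  by case: (eqVneq u v) => [->|uv]; rewrite ?scale1r // !scale0r.
- exact: j_e1.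
- exact: j_are.
- exact: j_ear.
- move=> z; have [x <-] := @jproj_surj _ _ _ J z; rewrite j_dec_l.
  by exists (fun u => pcoef x u [::]), (fun a => pi (lstrip a x)).
- have [n nP] := j_nil; exists n => w wn; apply: (etrans (prod_rev w)).
  by apply: nP; rewrite size_rev.
- have [eps [e1 e2 e3 e4]] := j_eps; exists eps; split=> // u x y.
  by rewrite -[x * y]/((y : J) * x) e2 mulrC.
- by move=> a b; apply: j_ddr.
- by move=> a b; apply: j_ddl.
- exact: j_rel_l.
exact: j_ex_l.
Qed.

End JacobianQPA.

(** * Matrices realizing a module, and transposition *)

Lemma parametrize (k : fieldType) (V : vectType k) (U : {vspace V}) n : \dim U = n ->
  exists f : 'Hom('rV[k]_n, V), lker f = 0%VS /\ limg f = U.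
Proof.
move=> <-{n}; pose n := \dim U.
have lin0 : linear (fun w : 'rV[k]_n => \sum_(i < n) w 0 i *: (vbasis U)`_i).
  move=> c w w'; rewrite scaler_sumr -big_split; apply: eq_bigr => i _ /=.
  by rewrite !mxE scalerDl scalerA.
pose f := hom_of lin0; have fE w : f w = \sum_(i < n) w 0 i *: (vbasis U)`_i := hom_ofE lin0 w.
have fS : (limg f <= U)%VS.
  apply/subvP=> _ /memv_imgP[w _ ->]; rewrite fE memv_suml // => i _.
  by rewrite memvZ // vbasis_mem // mem_nth // size_tuple.
have fI : limg f = U.
  apply/eqP; rewrite eqEsubv fS /=; apply/subvP=> v vU.
  rewrite (coord_vbasis vU); apply/memv_imgP.
  exists (\row_i coord (vbasis U) i v); rewrite ?memvf // fE.
  by apply: eq_bigr => i _; rewrite mxE.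
exists f; split=> //; apply/eqP; rewrite -dimv_eq0.
have := limg_ker_dim f fullv; rewrite capfv fI [RHS]dimvf /dim /= mul1n -/n.
by move: (\dim (lker f)) => d; lia.
Qed.

Section Realization.
Variables (k : closedFieldType) (A : falgType k) (Vt Ar : finType).
Variables (s t : Ar -> Vt) (e : Vt -> A) (ar : Ar -> A) (dd : Ar -> Ar -> A).
Hypothesis HA : qpa s t e ar dd.
Implicit Types M N X Y P : rmod A.
Local Notation "v '·' x" := (ract _ x v) (at level 39, left associativity).
Local Notation vsp := (vsp e).
Variable alpha : Vt -> nat.

Lemma exists_realization N : (forall u, \dim (vsp N u) = alpha u) ->
  exists x : grep k s t alpha, grealizes e ar x N.
Proof.
move=> dN.
have fP u := parametrize (dN u).
pose f u := projT1 (cid (fP u)).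
have fE u : lker (f u) = 0%VS /\ limg (f u) = vsp N u := projT2 (cid (fP u)).
have fi u w : ((f u)^-1)%VF (f u w) = w by apply: lker0_lfunK; have [-> _] := fE u.
have inv u v : v \in vsp N u -> f u (((f u)^-1)%VF v) = v.
  by move=> vU; rewrite limg_lfunVK //; have [_ ->] := fE u.
pose F a (w : 'rV[k]_(alpha (s a))) : 'rV[k]_(alpha (t a)) := ((f (t a))^-1)%VF (f (s a) w · ar a).
have Fl a : linear (F a) by move=> c w w'; rewrite /F !linearP.
exists (fun a => lin1_mx (F a)), f; split=> // a w.
rewrite (lin1_mxE (Fl a)) /F inv //.
by rewrite (mem_vsp HA) (act_are HA).
Qed.

End Realization.

Section Transpose.
Variables (k : closedFieldType) (Vt Ar : finType) (s t : Ar -> Vt) (alpha : Vt -> nat).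

Definition grepT (x : grep k s t alpha) : grep k t s alpha := fun a => (x a)^T.

Lemma polyfun_grepT (f : grep k t s alpha -> k) :
  polyfun (@grep_coord k Vt Ar t s alpha) f ->
  polyfun (@grep_coord k Vt Ar s t alpha) (fun x => f (grepT x)).
Proof.
move=> pf; apply: (polyfun_comp pf) => xi [a [i [j ->]]].
have -> : (fun x : grep k s t alpha => grepT x a i j) = fun x => x a j i.
  by apply/funext=> x; rewrite mxE.
by apply: polyfun_coord; exists a, j, i.
Qed.

End Transpose.

Lemma grepTK (k : closedFieldType) (Vt Ar : finType) (s t : Ar -> Vt) alpha
  (x : grep k s t alpha) : grepT (grepT x) = x.
Proof. by apply: functional_extensionality_dep => a; rewrite /grepT trmxK. Qed.

Section DualRealization.
Variables (k : closedFieldType) (A B : falgType k) (tau : B -> A).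
Hypotheses (Ht : is_anti tau).
Local Notation D := (dual Ht).
Variables (Vt Ar : finType) (s t : Ar -> Vt) (e : Vt -> A) (ar : Ar -> A) (dd : Ar -> Ar -> A).
Variables (e' : Vt -> B) (ar' : Ar -> B) (alpha : Vt -> nat).
Hypothesis HA : qpa s t e ar dd.
Hypothesis te : forall u, tau (e' u) = e u.
Hypothesis ta : forall a, tau (ar' a) = ar a.

(** In the dual frame, with row vectors paired by the standard bilinear form, the arrows act by the
    transposed matrices. *)
Lemma grealizes_dual (x : grep k s t alpha) (N : rmod A) :
  grealizes e ar x N -> grealizes e' ar' (grepT x) (D N).
Proof.
move=> /(realizes_framed HA)[f [g [[gf gf0 fg] fe fa]]].
have l1 u (w : 'rV[k]_(alpha u)) : linear (fun v : N => (g u v *m w^T) 0 0 : k^o).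
  by move=> c v v'; rewrite linearP mulmxDl -scalemxAl !mxE.
have l2 u : linear (fun w : 'rV[k]_(alpha u) => hom_of (l1 u w)).
  move=> c w w'; apply/lfunP=> v; rewrite add_lfunE scale_lfunE !hom_ofE.
  by rewrite linearP mulmxDr -scalemxAr !mxE.
have l3 u : linear (fun phi : 'Hom(N, k^o) => \row_i phi (f u (delta_mx 0 i))).
  by move=> c p p'; apply/rowP=> i; rewrite !mxE add_lfunE scale_lfunE.
pose f' u : 'Hom('rV[k]_(alpha u), D N) := hom_of (l2 u).
pose g' u : 'Hom(D N, 'rV[k]_(alpha u)) := hom_of (l3 u).
have f'E u w v : (f' u w : 'Hom(N, k^o)) v = (g u v *m w^T) 0 0 by rewrite hom_ofE hom_ofE.
have g'E u (phi : D N) : g' u phi = \row_i (phi : 'Hom(N, k^o)) (f u (delta_mx 0 i)) by rewrite hom_ofE.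
have mulg' u (phi : D N) (w : 'rV[k]_(alpha u)) : (w *m (g' u phi)^T) 0 0 = (phi : 'Hom(N, k^o)) (f u w).
  rewrite [w in RHS]row_sum_delta !linear_sum /= !mxE; apply: eq_bigr => i _.
  by rewrite linearZ linearZ /= g'E !mxE.
have dE y phi v : (ract (D N) y phi : 'Hom(N, k^o)) v = (phi : 'Hom(N, k^o)) (ract N (tau y) v) by exact: dualvE.
have ga a v : g (t a) (ract N (ar a) v) = g (s a) v *m x a.
  by rewrite -[RHS]gf fa fe -ractMv (q_ear HA).
have f'g' u phi : f' u (g' u phi) = ract (D N) (e' u) phi.
  by apply/lfunP=> v; rewrite f'E mulg' dE te fe.
apply: (@framed_realizes _ _ _ _ _ _ _ _ _ (grepT x) (D N) f' g'); split=> //; first split.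
- move=> u w; rewrite g'E; apply/rowP=> i; rewrite mxE f'E gf -rowE mxE mxE //.
- move=> u v w uv; rewrite g'E; apply/rowP=> i; rewrite mxE f'E gf0 1?eq_sym // mul0mx !mxE //.
- move=> phi; apply/lfunP=> v; rewrite sum_lfunE -[v in RHS]fg linear_sum.
  by apply: eq_bigr => u _; rewrite f'E mulg'.
move=> a w; apply/lfunP=> v; rewrite dE ta !f'E ga /grepT trmx_mul trmxK mulmxA //.
Qed.

End DualRealization.

Section FreeTransport.
Variables (k : closedFieldType) (A : falgType k) (Vt Ar : finType).
Variables (s t : Ar -> Vt) (e : Vt -> A) (ar : Ar -> A) (dd : Ar -> Ar -> A).
Hypothesis HA : qpa s t e ar dd.
Implicit Types M N X Y P : rmod A.
Local Notation freeb := (freeb e).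
Variables (c1 c0 alpha : Vt -> nat).

(** The modules P(c) are unique up to isomorphism, so generic notions do not depend on the chosen
    terms. *)
Lemma presentation_transport X1 X0 Y1 Y0 (d : 'Hom(X1, X0)) :
  freeb c1 X1 -> freeb c0 X0 -> freeb c1 Y1 -> freeb c0 Y0 -> is_hom d ->
  exists d' : 'Hom(Y1, Y0), [/\ is_hom d', homotopy_equiv d d' & forall N, is_coker d N -> is_coker d' N].
Proof.
move=> fX1 fX0 fY1 fY0 dH; have [f1 [g1 [f1H g1H gf1 fg1]]] := freeb_unique_iso fX1 fY1.
have [f0 [g0 [f0H g0H gf0 fg0]]] := freeb_unique_iso fX0 fY0.
have d'H : is_hom (f0 \o d \o g1)%VF by do 2?apply: is_hom_comp.
have he : homotopy_equiv d (f0 \o d \o g1)%VF.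
  by apply: (homotopy_iso f1H f0H g1H g0H); rewrite // -!comp_lfunA gf1 comp_lfun1r.
exists (f0 \o d \o g1)%VF; split=> // N; exact: homotopy_coker he.
Qed.

Lemma generic_coker_transport X1 X0 Y1 Y0 :
  freeb c1 X1 -> freeb c0 X0 -> freeb c1 Y1 -> freeb c0 Y0 ->
  generic_coker e alpha X1 X0 -> generic_coker e alpha Y1 Y0.
Proof.
move=> fX1 fX0 fY1 fY0 [leX [d dH dm]]; split=> [z zH u|].
  have [z' [z'H _ z'N]] := presentation_transport fY1 fY0 fX1 fX0 zH.
  have [N zN] := exists_coker zH.
  have := leX z' z'H u; rewrite -(coker_dim_vsp HA u z'H (z'N _ zN)) leq_add2r.
  by rewrite -(coker_dim_vsp HA u zH zN) leq_add2r.
have [d' [d'H _ d'N]] := presentation_transport fX1 fX0 fY1 fY0 dH.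
have [N dN] := exists_coker dH; exists d' => //.
have d'm : minimal_coker e alpha d'.
  by apply/(coker_minimal_coker HA alpha d'H (d'N _ dN))/(coker_minimal_coker HA alpha dH dN); apply: dm.
exact: d'm.
Qed.

Local Notation cokers Y1 Y0 := (@coker_set k A Vt Ar s t e ar alpha Y1 Y0 (@minimal_coker k A Vt e alpha Y1 Y0)).

Lemma cokers_transport X1 X0 Y1 Y0 :
  freeb c1 X1 -> freeb c0 X0 -> freeb c1 Y1 -> freeb c0 Y0 -> cokers X1 X0 `<=` cokers Y1 Y0.
Proof.
move=> fX1 fX0 fY1 fY0 x [d [N [dH dm dN xN]]].
have [d' [d'H _ d'N]] := presentation_transport fX1 fX0 fY1 fY0 dH.
exists d', N; split=> //; last exact: d'N.
by apply/(coker_minimal_coker HA alpha d'H (d'N _ dN))/(coker_minimal_coker HA alpha dH dN).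
Qed.

Lemma cokers_open Y1 Y0 : freeb c1 Y1 -> freeb c0 Y0 -> generic_coker e alpha Y1 Y0 ->
  zopen_in (@grep_coord k Vt Ar s t alpha) (@grepvar k A Vt Ar s t e ar alpha) (cokers Y1 Y0).
Proof.
move=> fY1 fY0 gc.
exact: (@coker_set_open _ _ _ _ _ _ _ _ _ HA alpha _ _ _ _ fY1 fY0 _ (minimal_coker_open HA gc)).
Qed.

Lemma cokers_irr Y1 Y0 : generic_coker e alpha Y1 Y0 ->
  zirreducible (@grep_coord k Vt Ar s t alpha) (cokers Y1 Y0).
Proof.
move=> gc; apply: (@coker_set_irr _ _ _ _ _ _ _ _ _ HA alpha _ _ _ (minimal_coker_open HA gc) (minimal_coker_max_rank HA gc)).
have [_ [d dH dm]] := gc; have [N dN] := exists_coker dH.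
have dm' : minimal_coker e alpha d by [].
have [x xN] := exists_realization HA ((coker_minimal_coker HA alpha dH dN).1 dm').
by exists x, d, N.
Qed.

Lemma minimal_coker_exists Y1 Y0 (d : 'Hom(Y1, Y0)) : is_hom d -> minimal_coker e alpha d ->
  exists N x, [/\ is_coker d N, grealizes e ar x N & cokers Y1 Y0 x].
Proof.
move=> dH dm; have [N dN] := exists_coker dH.
have [x xN] := exists_realization HA ((coker_minimal_coker HA alpha dH dN).1 dm).
by exists N, x; split=> //; exists d, N.
Qed.

Lemma general_meets_minimal_coker X1 X0 (f : 'Hom(X1, X0) -> Prop) : generic_coker e alpha X1 X0 ->
  general (@lin_coord k 'Hom(X1, X0)) [set d | is_hom d] f ->
  exists d : 'Hom(X1, X0), [/\ is_hom d, minimal_coker e alpha d & f d].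
Proof.
move=> gc /generalP[F [pF [d dH Fd] FP]]; have [_ [d0 d0H d0m]] := gc.
have [G [pG Gd0 GP]] := minimal_coker_open HA gc d0H d0m.
have [|| z [/hom_spaceP zH Fz Gz]] := @polyfun_irr _ _ (hom_space X1 X0) _ _ _ _ pF pG _ _ Fd Gd0.
- exact/hom_spaceP.
- exact/hom_spaceP.
by exists z; split=> //; [apply: GP | apply: FP].
Qed.

End FreeTransport.

(** * The common closure of general cokernels and general kernels *)

Section Components.
Variables (k : closedFieldType) (A B : falgType k) (tau : B -> A) (sigma : A -> B).
Hypotheses (Ht : is_anti tau) (Hs : is_anti sigma).
Hypotheses (ts : cancel sigma tau) (st : cancel tau sigma).
Local Notation D := (dual Ht).
Local Notation D' := (dual Hs).
Variables (Vt Ar : finType) (s t : Ar -> Vt) (e : Vt -> A) (ar : Ar -> A) (dd : Ar -> Ar -> A).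
Variables (e' : Vt -> B) (ar' : Ar -> B) (dd' : Ar -> Ar -> B).
Hypothesis HA : qpa s t e ar dd.
Hypothesis HB : qpa t s e' ar' dd'.
Hypothesis te : forall u, tau (e' u) = e u.
Hypothesis ta : forall a, tau (ar' a) = ar a.
Hypothesis tdd : forall a b, tau (dd' a b) = dd b a.
Hypothesis k_char0 : [pchar k] =i pred0.

Let se u : sigma (e u) = e' u. Proof. by rewrite -te st. Qed.
Let sa a : sigma (ar a) = ar' a. Proof. by rewrite -ta st. Qed.

Variables (b1 b0 c1 c0 alpha : Vt -> nat).
Hypothesis wt : forall u, (c0 u + b1 u + \sum_(a | t a == u) alpha (s a) =
                           c1 u + b0 u + \sum_(a | s a == u) alpha (t a))%N.
Local Notation R := (@grepvar k A Vt Ar s t e ar alpha).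
Local Notation R' := (@grepvar k B Vt Ar t s e' ar' alpha).
Local Notation crd := (@grep_coord k Vt Ar s t alpha).
Local Notation cokers Y1 Y0 := (@coker_set k A Vt Ar s t e ar alpha Y1 Y0 (@minimal_coker k A Vt e alpha Y1 Y0)).
Local Notation cokers' P1 P0 := (@coker_set k B Vt Ar t s e' ar' alpha P1 P0 (@minimal_coker k B Vt e' alpha P1 P0)).

Lemma grepvarT x : R x <-> R' (grepT x).
Proof.
split=> -[N xN]; first by exists (D N); apply: (grealizes_dual Ht HA te ta xN).
exists (D' N); rewrite -[x]grepTK; exact: (grealizes_dual Hs HB se sa xN).
Qed.

Lemma transpose_open O' : zopen_in (@grep_coord k Vt Ar t s alpha) R' O' ->
  zopen_in crd R [set x | O' (grepT x)].
Proof.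
move=> /zopen_inP[sub opn]; apply/zopen_inP; split=> [x /sub/grepvarT //|x xK].
have [f [pf fx fP]] := opn _ xK; exists (fun x => f (grepT x)); split=> //.
  exact: polyfun_grepT.
by move=> y /grepvarT yR fy; apply: fP.
Qed.

Variables (P1 P0 : rmod B).
Hypotheses (fP1 : freeb e' b1 P1) (fP0 : freeb e' b0 P0) (gcB : generic_coker e' alpha P1 P0).
(** These are the kernels of general maps D' P0 -> D' P1: duality turns kernels into cokernels over
    [B] and matrices into their transposes. *)
Definition kers : set (grep k s t alpha) := [set x | cokers' P1 P0 (grepT x)].

Lemma kers_open : zopen_in crd R kers.
Proof. exact: transpose_open (cokers_open (ar := ar') HB fP1 fP0 gcB). Qed.

Lemma kers_irr : zirreducible crd kers.
Proof.
have /zirreducibleP[[x0 x0K] irr] := cokers_irr (ar := ar') HB gcB.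
apply/zirreducibleP; split; first by exists (grepT x0); rewrite /kers /= grepTK.
move=> f g x y pf pg xK yK fx gy.
have [||||||z [zK fz gz]] := irr (fun x => f (grepT x)) (fun x => g (grepT x)) (grepT x) (grepT y) => //.
- exact: polyfun_grepT.
- exact: polyfun_grepT.
- by rewrite grepTK.
- by rewrite grepTK.
by exists (grepT z); split=> //; rewrite /kers /= grepTK.
Qed.

Variables (Y1 Y0 : rmod A).
Hypotheses (fY1 : freeb e c1 Y1) (fY0 : freeb e c0 Y0).

(** The common point is the module D' M of [dual_generic_coker]; its dual is M up to the evaluation
    isomorphism. *)
Lemma cokers_meet_kers : cokers Y1 Y0 `&` kers !=set0.
Proof.
have [gcA [z [d [M [[zH dH] dM zM Md]]]]] := dual_generic_coker Ht Hs ts st HA HB te tdd k_char0 fP1 fP0 fY1 fY0 wt gcB.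
have DMd u : \dim (vsp e (D' M) u) = alpha u by rewrite (vsp_dual_dim Hs se).
have [x xN] := exists_realization HA DMd; exists x; split.
  by exists z, (D' M); split=> //; apply/(coker_minimal_coker HA alpha zH zM).
exists d, M; split=> //; first exact/(coker_minimal_coker HB alpha dH dM).
have := grealizes_dual Ht HA te ta xN.
apply: grealizes_iso (evV_hom Hs Ht st M) _ _.
  by apply/eqP/lker0P => v w /(congr1 (ev M)); rewrite !evVK.
by apply/vspaceP=> v; rewrite memvf -[v]evK memv_img ?memvf.
Qed.

Definition cokers_closure := zclosure_in crd R (cokers Y1 Y0).

Lemma cokers_closure_component : irreducible_component crd R cokers_closure /\ cokers Y1 Y0 `<=` cokers_closure.
Proof.
have [gcA _] := dual_generic_coker Ht Hs ts st HA HB te tdd k_char0 fP1 fP0 fY1 fY0 wt gcB.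
by have [? ? _] := component_of_open (cokers_open (ar := ar) HA fY1 fY0 gcA) (cokers_irr (ar := ar) HA gcA).
Qed.

Lemma cokers_closure_unique C : irreducible_component crd R C -> C `&` cokers Y1 Y0 !=set0 -> C = cokers_closure.
Proof.
have [gcA _] := dual_generic_coker Ht Hs ts st HA HB te tdd k_char0 fP1 fP0 fY1 fY0 wt gcB.
by have [_ _ uni] := component_of_open (cokers_open (ar := ar) HA fY1 fY0 gcA) (cokers_irr (ar := ar) HA gcA); apply: uni.
Qed.

Lemma cokers_closure_kers : cokers_closure = zclosure_in crd R kers.
Proof.
have [c1' sub] := cokers_closure_component.
have [_ _ uni] := component_of_open kers_open kers_irr; apply: uni => //.
by have [x [xc xk]] := cokers_meet_kers; exists x; split=> //; apply: sub.
Qed.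

Lemma kers_sub : kers `<=` cokers_closure.
Proof. by rewrite cokers_closure_kers; have [_ ? _] := component_of_open kers_open kers_irr. Qed.

Lemma cokers_closure_unique_kers C : irreducible_component crd R C -> C `&` kers !=set0 -> C = cokers_closure.
Proof. by rewrite cokers_closure_kers; have [_ _ uni] := component_of_open kers_open kers_irr; apply: uni. Qed.

End Components.

(** * Schanuel's lemma for presentations *)

Section Schanuel.
Variables (k : closedFieldType) (A : falgType k) (Vt Ar : finType).
Variables (s t : Ar -> Vt) (e : Vt -> A) (ar : Ar -> A) (dd : Ar -> Ar -> A).
Hypothesis HA : qpa s t e ar dd.
Implicit Types M N X Y P : rmod A.
Local Notation freeb := (freeb e).

Lemma stab_homotopy (X1 X0 P1 B1 B0 : rmod A) (d : 'Hom(X1, X0))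
  (i1 : 'Hom(X1, B1)) (q1 : 'Hom(B1, X1)) (j1 : 'Hom(P1, B1)) (r1 : 'Hom(B1, P1))
  (i0 : 'Hom(X0, B0)) (q0 : 'Hom(B0, X0)) (j0 : 'Hom(P1, B0)) (r0 : 'Hom(B0, P1)) :
  [/\ is_hom i1, is_hom q1, is_hom j1 & is_hom r1] ->
  [/\ is_hom i0, is_hom q0, is_hom j0 & is_hom r0] ->
  [/\ forall v, q1 (i1 v) = v, forall v, r1 (j1 v) = v, forall v, q1 (j1 v) = 0, forall v, r1 (i1 v) = 0 &
    forall v, i1 (q1 v) + j1 (r1 v) = v] ->
  [/\ forall v, q0 (i0 v) = v, forall v, r0 (j0 v) = v, forall v, q0 (j0 v) = 0, forall v, r0 (i0 v) = 0 &
    forall v, i0 (q0 v) + j0 (r0 v) = v] ->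
  homotopy_equiv d ((i0 \o d \o q1) + (j0 \o r1))%VF.
Proof.
move=> [i1H q1H j1H r1H] [i0H q0H j0H r0H] [qi1 rj1 qj1 ri1 sum1] [qi0 rj0 qj0 ri0 sum0].
exists i1, i0, q1, q0, 0, (- (j1 \o r0))%VF; split=> //.
- by split; [exact: is_hom0 | apply: is_homN; apply: is_hom_comp].
- split; apply/lfunP=> v.
    by rewrite !comp_lfunE add_lfunE !comp_lfunE qi1 ri1 linear0 addr0.
  by rewrite !comp_lfunE add_lfunE !comp_lfunE linearD /= qi0 qj0 addr0.
- split; apply/lfunP=> v; rewrite ?comp_lfun0l ?comp_lfun0r addr0 comp_lfunE id_lfunE //.
- split; apply/lfunP=> v; rewrite add_lfunE !comp_lfunE id_lfunE.
    rewrite opp_lfunE add_lfunE !comp_lfunE linearD /= ri0 rj0 add0r -[X in X - _]sum1 addrK //.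
  rewrite opp_lfunE linearN /= add_lfunE !comp_lfunE qj1 rj1 !linear0 add0r -[X in X - _]sum0 addrK //.
Qed.

Lemma cover_split (X Y N : rmod A) (p : 'Hom(X, N)) (q : 'Hom(Y, N)) :
  projective X -> proj_cover q -> is_hom p -> limg p = limg q ->
  exists (a : 'Hom(X, Y)) (b : 'Hom(Y, X)),
    [/\ is_hom a, is_hom b, (a \o b)%VF = \1%VF, (q \o a)%VF = p & (p \o b)%VF = q].
Proof.
move=> prX [qH prY qI qs] pH pI.
have [|a aH aE] := projective_lift prX qH pH; first by rewrite pI.
have [|b bH bE] := projective_lift prY pH qH; first by rewrite pI.
pose c := (a \o b)%VF; have cH : is_hom c := is_hom_comp aH bH.
have qc : (q \o c)%VF = q by rewrite /c comp_lfunA aE bE.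
have cI : limg c = fullv.
  apply: (qs _ (submodule_img cH (@submodule_full _ _ Y))).
  apply/vspaceP=> v; rewrite memvf; apply/idP; rewrite -(subrK (c v) v) addrC.
  apply: memv_add; first by rewrite memv_img ?memvf.
  by rewrite memv_ker linearB /= -[q (c v)]comp_lfunE qc subrr.
have ck : lker c = 0%VS.
  apply/eqP; rewrite -dimv_eq0; have := limg_ker_dim c fullv; rewrite capfv cI.
  by move: (\dim (lker c)) (\dim _) => *; lia.
have [c' [c'H c'c cc']] := hom_inverse cH ck cI.
exists a, (b \o c')%VF; split=> //; first exact: is_hom_comp.
  by rewrite comp_lfunA cc'.
by rewrite comp_lfunA bE -{1}qc -comp_lfunA cc' comp_lfun1r.
Qed.

Lemma summand_projective X Y (a : 'Hom(X, Y)) (b : 'Hom(Y, X)) :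
  projective X -> is_hom a -> is_hom b -> (a \o b)%VF = \1%VF -> projective Y.
Proof.
move=> prX aH bH ab M N g h gH gI hH.
have [l lH lE] := prX M N g (h \o a)%VF gH gI (is_hom_comp hH aH).
exists (l \o b)%VF; first exact: is_hom_comp.
by rewrite comp_lfunA lE -comp_lfunA ab comp_lfun1r.
Qed.

Lemma freeb_complement c c' (X Y Kr : rmod A) (i : 'Hom(Y, X)) (q : 'Hom(X, Y)) (j : 'Hom(Kr, X)) (r : 'Hom(X, Kr)) :
  freeb c X -> freeb c' Y -> [/\ is_hom i, is_hom q, is_hom j & is_hom r] ->
  [/\ forall v, q (i v) = v, forall v, r (j v) = v, forall v, q (j v) = 0, forall v, r (i v) = 0 &
    forall v, i (q v) + j (r v) = v] ->
  exists2 x, freeb x Kr & forall v, (c v = c' v + x v)%N.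
Proof.
move=> fX fY [iH qH jH rH] [qi rj qj ri sum].
have prK : projective Kr.
  apply: (summand_projective (freeb_projective HA fX) rH jH).
  by apply/lfunP=> v; rewrite comp_lfunE rj id_lfunE.
pose x := topd t e ar (fullv : {vspace Kr}); have fK : freeb x Kr := proj_freeb HA prK.
exists x => //; pose Yb (b : bool) := if b then Y else Kr.
pose inj (b : bool) : 'Hom(Yb b, X) := if b return 'Hom(Yb b, X) then i else j.
pose prj (b : bool) : 'Hom(X, Yb b) := if b return 'Hom(X, Yb b) then q else r.
have bp : biproduct inj prj.
  split.
  - by case.
  - by case; apply/lfunP=> v; rewrite comp_lfunE id_lfunE /= ?qi ?rj.
  - by case; case=> // _; apply/lfunP=> v; rewrite comp_lfunE zero_lfunE /= ?ri ?qj.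
  rewrite big_bool /=; apply/lfunP=> v.
  by rewrite add_lfunE !comp_lfunE id_lfunE sum.
move=> v; have -> : c = fun v => (\sum_(b : bool) (if b then c' else x) v)%N.
  by apply: (freeb_inj HA fX); apply: biproduct_freeb bp _; case.
by rewrite big_bool.
Qed.

(** Each map splits as a projective cover of the common image plus a complement on which it
    vanishes. The complements have equal multiplicities, hence are isomorphic, and the two
    splittings can be matched. *)
Lemma surjection_unique c (X X' M : rmod A) (d : 'Hom(X, M)) (d' : 'Hom(X', M)) :
  freeb c X -> freeb c X' -> is_hom d -> is_hom d' -> limg d = limg d' ->
  exists (f : 'Hom(X, X')) (g : 'Hom(X', X)),
    [/\ is_hom f, is_hom g, (g \o f)%VF = \1%VF, (f \o g)%VF = \1%VF & (d' \o f)%VF = d].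
Proof.
move=> fX fX' dH d'H dd'.
have [L [l [lH lk lI]]] := exists_sub (submodule_img dH (@submodule_full _ _ X)).
have linj : injective l by apply/lker0P/eqP.
have corestrict (Z : rmod A) (z : 'Hom(Z, M)) c' : freeb c' Z -> is_hom z -> limg z = limg d ->
    exists z' : 'Hom(Z, L), [/\ is_hom z', limg z' = fullv & (l \o z')%VF = z].
  move=> fZ zH zI; have [|z' z'H z'E] := projective_lift (freeb_projective HA fZ) lH zH.
    by rewrite lI zI.
  exists z'; split=> //; apply/vspaceP=> v; rewrite memvf; apply/idP.
  have : l v \in limg z by rewrite zI -lI memv_img ?memvf.
  by case/memv_imgP=> w _; rewrite -z'E comp_lfunE => /linj->; rewrite memv_img ?memvf.
have [d1 [d1H d1I d1E]] := corestrict X d c fX dH erefl.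
have [d2 [d2H d2I d2E]] := corestrict X' d' c fX' d'H (esym dd').
have [Y [q [fY qH qI qs]]] := exists_cover HA (@submodule_full _ _ L).
have qc : proj_cover q by split=> //; apply: (freeb_projective HA fY).
have split_ (Z : rmod A) (z : 'Hom(Z, L)) : freeb c Z -> is_hom z -> limg z = fullv ->
    exists (Kr : rmod A) (i : 'Hom(Y, Z)) (a : 'Hom(Z, Y)) (j : 'Hom(Kr, Z)) (r : 'Hom(Z, Kr)),
    [/\ [/\ is_hom i, is_hom a, is_hom j & is_hom r],
      [/\ forall v, a (i v) = v, forall v, r (j v) = v, forall v, a (j v) = 0, forall v, r (i v) = 0 &
       forall v, i (a v) + j (r v) = v] & [/\ (q \o a)%VF = z, (z \o i)%VF = q & (z \o j)%VF = 0]].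
  move=> fZ zH zI.
  have [|a [i [aH iH ai qa zi]]] := cover_split (freeb_projective HA fZ) qc zH; first by rewrite zI.
  have aiE v : a (i v) = v by rewrite -comp_lfunE ai id_lfunE.
  have [Kr [j [jH jk jI]]] := exists_sub (submodule_ker aH).
  have jinj : injective j by apply/lker0P/eqP.
  pose w := (\1 - (i \o a))%VF; have wE v : w v = v - i (a v).
    by rewrite add_lfunE opp_lfunE id_lfunE comp_lfunE.
  have ji v : j ((j^-1)%VF (w v)) = w v.
    by rewrite limg_lfunVK // jI memv_ker wE linearB /= aiE subrr.
  pose r := (j^-1 \o w)%VF; have jr v : j (r v) = v - i (a v) by rewrite comp_lfunE ji wE.
  have aj v : a (j v) = 0 by apply/eqP; rewrite -memv_ker -jI memv_img ?memvf.
  exists Kr, i, a, j, r; split; split=> //.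
  - apply: is_homP => y v; apply: jinj.
    by rewrite (homE _ _ jH) !jr linearB /= (homE _ _ aH) (homE _ _ iH).
  - by move=> v; apply: jinj; rewrite jr aj linear0 subr0.
  - by move=> v; apply: jinj; rewrite jr aiE subrr linear0.
  - by move=> v; rewrite jr addrC subrK.
  by apply/lfunP=> v; rewrite -qa !comp_lfunE aj linear0 zero_lfunE.
have [K1 [i1 [a1 [j1 [r1 [[i1H a1H j1H r1H] [ai1 rj1 aj1 ri1 sum1] [qa1 di1 dj1]]]]]]] := split_ X d1 fX d1H d1I.
have [K2 [i2 [a2 [j2 [r2 [[i2H a2H j2H r2H] [ai2 rj2 aj2 ri2 sum2] [qa2 di2 dj2]]]]]]] := split_ X' d2 fX' d2H d2I.
have [x1 fK1 x1E] := freeb_complement (i := i1) (q := a1) (j := j1) (r := r1) fX fY (And4 i1H a1H j1H r1H) (And5 ai1 rj1 aj1 ri1 sum1).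
have [x2 fK2 x2E] := freeb_complement (i := i2) (q := a2) (j := j2) (r := r2) fX' fY (And4 i2H a2H j2H r2H) (And5 ai2 rj2 aj2 ri2 sum2).
have x12 : x1 = x2 by apply/funext=> v; apply: (@addnI (topd t e ar (fullv : {vspace L}) v)); rewrite -x1E -x2E.
rewrite -x12 in fK2; have [h [h' [hH h'H h'h hh']]] := freeb_unique_iso fK1 fK2.
have hE v : h' (h v) = v by rewrite -comp_lfunE h'h id_lfunE.
have h'E v : h (h' v) = v by rewrite -comp_lfunE hh' id_lfunE.
pose f := ((i2 \o a1) + (j2 \o h \o r1))%VF; pose g := ((i1 \o a2) + (j1 \o h' \o r2))%VF.
have fE v : f v = i2 (a1 v) + j2 (h (r1 v)) by rewrite add_lfunE !comp_lfunE.
have gE v : g v = i1 (a2 v) + j1 (h' (r2 v)) by rewrite add_lfunE !comp_lfunE.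
exists f, g; split.
- by apply: is_homD; do ?apply: is_hom_comp.
- by apply: is_homD; do ?apply: is_hom_comp.
- apply/lfunP=> v; rewrite comp_lfunE gE fE id_lfunE !linearD /= ai2 aj2 ri2 rj2 !linear0 addr0 add0r.
  by rewrite hE sum1.
- apply/lfunP=> v; rewrite comp_lfunE gE fE id_lfunE !linearD /= ai1 aj1 ri1 rj1 !linear0 addr0 add0r.
  by rewrite h'E sum2.
rewrite -d1E -d2E -comp_lfunA; congr (_ \o _)%VF; apply/lfunP=> v; rewrite comp_lfunE fE linearD /=.
have -> : d2 (i2 (a1 v)) = d1 v by rewrite -[LHS]comp_lfunE di2 -[LHS]comp_lfunE qa1.
by rewrite -[d2 (j2 _)]comp_lfunE dj2 zero_lfunE addr0.
Qed.

(* Schanuel's trick: after adding trivial summands, the two surjections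
   X0 + X0' -> N differ by an automorphism [E2 E1]. *)
Lemma schanuel c1 c0 c1' c0' (X1 X0 X1' X0' N : rmod A) (d : 'Hom(X1, X0)) (d' : 'Hom(X1', X0')) :
  freeb c1 X1 -> freeb c0 X0 -> freeb c1' X1' -> freeb c0' X0' ->
  (forall u, c0 u + c1' u = c0' u + c1 u)%N ->
  is_hom d -> is_hom d' -> is_coker d N -> is_coker d' N -> homotopy_equiv d d'.
Proof.
move=> fX1 fX0 fX1' fX0' wt dH d'H [p [pH pI pk]] [p' [p'H p'I p'k]].
have [B1 fB1] := exists_freeb HA (fun v => c1 v + c0' v)%N.
have fB1' : freeb (fun v => c1' v + c0 v)%N B1.
  have -> : (fun v => c1' v + c0 v)%N = (fun v => c1 v + c0' v)%N by apply/funext=> v; rewrite addnC wt addnC.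
  by [].
have [B0 fB0] := exists_freeb HA (fun v => c0 v + c0' v)%N.
have [i1 [q1 [j1 [r1 [H1 [qi1 rj1] [qj1 ri1] sum1]]]]] := freeb_split fB1 fX1 fX0'.
have [i1' [q1' [j1' [r1' [H1' [qi1' rj1'] [qj1' ri1'] sum1']]]]] := freeb_split fB1' fX1' fX0.
have [i0 [q0 [j0 [r0 [H0 [qi0 rj0] [qj0 ri0] sum0]]]]] := freeb_split fB0 fX0 fX0'.
have [i0H q0H j0H r0H] := H0; have [i1H q1H j1H r1H] := H1; have [i1'H q1'H j1'H r1'H] := H1'.
have sum0' v : j0 (r0 v) + i0 (q0 v) = v by rewrite addrC.
pose z := ((i0 \o d \o q1) + (j0 \o r1))%VF; pose z' := ((j0 \o d' \o q1') + (i0 \o r1'))%VF.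
have zh : homotopy_equiv d z by apply: stab_homotopy; split.
have zh' : homotopy_equiv d' z' by apply: stab_homotopy; split.
have zH : is_hom z by apply: is_homD; do ?apply: is_hom_comp.
have z'H : is_hom z' by apply: is_homD; do ?apply: is_hom_comp.
have zE v : z v = i0 (d (q1 v)) + j0 (r1 v) by rewrite add_lfunE !comp_lfunE.
have z'E v : z' v = j0 (d' (q1' v)) + i0 (r1' v) by rewrite add_lfunE !comp_lfunE.
have [|l lH lE] := projective_lift (freeb_projective HA fX0') pH p'H; first by rewrite pI subvf.
have [|l' l'H l'E] := projective_lift (freeb_projective HA fX0) p'H pH; first by rewrite p'I subvf.
have plE v : p (l v) = p' v by rewrite -comp_lfunE lE.
have pl'E v : p' (l' v) = p v by rewrite -comp_lfunE l'E.
pose E1 := (\1 - (i0 \o l \o r0))%VF; pose F1 := (\1 + (i0 \o l \o r0))%VF.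
pose E2 := (\1 + (j0 \o l' \o q0))%VF; pose F2 := (\1 - (j0 \o l' \o q0))%VF.
have E1E v : E1 v = v - i0 (l (r0 v)) by rewrite add_lfunE opp_lfunE id_lfunE !comp_lfunE.
have F1E v : F1 v = v + i0 (l (r0 v)) by rewrite add_lfunE id_lfunE !comp_lfunE.
have E2E v : E2 v = v + j0 (l' (q0 v)) by rewrite add_lfunE id_lfunE !comp_lfunE.
have F2E v : F2 v = v - j0 (l' (q0 v)) by rewrite add_lfunE opp_lfunE id_lfunE !comp_lfunE.
have r0E1 v : r0 (E1 v) = r0 v by rewrite E1E linearB /= ri0 subr0.
have r0F1 v : r0 (F1 v) = r0 v by rewrite F1E linearD /= ri0 addr0.
have q0E2 v : q0 (E2 v) = q0 v by rewrite E2E linearD /= qj0 addr0.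
have q0F2 v : q0 (F2 v) = q0 v by rewrite F2E linearB /= qj0 subr0.
have E1F1 v : E1 (F1 v) = v by rewrite E1E r0F1 F1E addrK.
have F1E1 v : F1 (E1 v) = v by rewrite F1E r0E1 E1E subrK.
have E2F2 v : E2 (F2 v) = v by rewrite E2E q0F2 F2E subrK.
have F2E2 v : F2 (E2 v) = v by rewrite F2E q0E2 E2E addrK.
have E1H : is_hom E1 by apply: is_homB; [exact: is_hom_id | do ?apply: is_hom_comp].
have F1H : is_hom F1 by apply: is_homD; [exact: is_hom_id | do ?apply: is_hom_comp].
have E2H : is_hom E2 by apply: is_homD; [exact: is_hom_id | do ?apply: is_hom_comp].
have F2H : is_hom F2 by apply: is_homB; [exact: is_hom_id | do ?apply: is_hom_comp].
pose Th := (E2 \o E1)%VF; pose Th' := (F1 \o F2)%VF.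
have ThH : is_hom Th by apply: is_hom_comp.
have Th'H : is_hom Th' by apply: is_hom_comp.
have piE2 v : p' (r0 (E2 v)) = p (q0 v) + p' (r0 v).
  by rewrite E2E linearD linearD /= rj0 pl'E addrC.
have piE1 v : p (q0 (E1 v)) = p (q0 v) - p' (r0 v).
  by rewrite E1E linearB linearB /= qi0 plE.
have piTh v : p' (r0 (Th v)) = p (q0 v).
  by rewrite comp_lfunE piE2 piE1 r0E1 subrK.
have memz v : (v \in limg z) = (p (q0 v) == 0).
  apply/memv_imgP/eqP => [[w _ ->]|pq].
    rewrite zE linearD /= qi0 qj0 addr0; apply/eqP; by rewrite -memv_ker pk memv_img ?memvf.
  have : q0 v \in limg d by rewrite -pk memv_ker pq.
  case/memv_imgP=> w _ qv; exists (i1 w + j1 (r0 v)); rewrite ?memvf //.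
  by rewrite zE !linearD /= qi1 qj1 ri1 rj1 !linear0 addr0 add0r -qv sum0.
have memz' v : (v \in limg z') = (p' (r0 v) == 0).
  apply/memv_imgP/eqP => [[w _ ->]|pq].
    rewrite z'E linearD /= rj0 ri0 addr0; apply/eqP; by rewrite -memv_ker p'k memv_img ?memvf.
  have : r0 v \in limg d' by rewrite -p'k memv_ker pq.
  case/memv_imgP=> w _ qv; exists (i1' w + j1' (q0 v)); rewrite ?memvf //.
  by rewrite z'E !linearD /= qi1' qj1' ri1' rj1' !linear0 addr0 add0r -qv sum0'.
have TzI : limg (Th \o z)%VF = limg z'.
  apply/vspaceP=> v; rewrite memz' limg_comp; apply/memv_imgP/eqP => [[w wz ->]|E].
    by apply/eqP; rewrite piTh -memz.
  have ThTh' : Th (Th' v) = v by rewrite !comp_lfunE E1F1 E2F2.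
  by exists (Th' v) => //; rewrite memz -piTh ThTh' E.
have [f [g [fH gH gf fg zf]]] := surjection_unique fB1 fB1 (is_hom_comp ThH zH) z'H TzI.
have zz' : homotopy_equiv z z'.
  apply: (homotopy_iso fH ThH gH Th'H) => //; apply/lfunP=> v; rewrite !comp_lfunE id_lfunE.
    by rewrite F2E2 F1E1.
  by rewrite E1F1 E2F2.
exact: (homotopy_trans dH zH d'H zh (homotopy_trans zH z'H d'H zz' (homotopy_sym zh'))).
Qed.

End Schanuel.

(** * The Nakayama functor *)

Lemma regularE (k : fieldType) (A : falgType k) (x v : A) : ract (regular_mod A) x v = v * x.
Proof. by rewrite /= lfunE. Qed.

Section Vee.
Variables (k : closedFieldType) (A : falgType k).
Local Notation B := (conv_alg A).
Implicit Types M N X Y : rmod A.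

Fact vee_linear M (c : k) (x y : B) :
  homA_act M (c *: x + y : A) = c *: homA_act M (x : A) + homA_act M (y : A).
Proof.
apply/lfunP=> f; apply/val_inj; rewrite /= homA_actE.
rewrite add_lfunE scale_lfunE linearP /= !homA_actE.
by rewrite comp_lfunZl -comp_lfunDl.
Qed.

Fact veeM M (x y : B) : homA_act M (x * y : B) = (homA_act M (y : A) \o homA_act M (x : A))%VF.
Proof.
apply/lfunP=> f; apply/val_inj; rewrite /= comp_lfunE !homA_actE.
by apply/lfunP=> v; rewrite !comp_lfunE !lfunE /= mulrA.
Qed.

Fact vee1 M : homA_act M (1 : A) = \1%VF.
Proof.
apply/lfunP=> f; apply/val_inj; rewrite /= homA_actE id_lfunE.
by apply/lfunP=> v; rewrite comp_lfunE lfunE /= mul1r.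
Qed.

(* Hom(M, A) as a right module over the converse algebra; the Nakayama functor
   is its dual. *)
Definition vee M : rmod B := @RMod k B (homA M) (fun x : B => homA_act M (x : A))
  (@vee_linear M) (@veeM M) (@vee1 M).

Definition vfun M (g : vee M) : 'Hom(M, regular_mod A) := vsval (g : homA M).

Lemma vfun_hom M (g : vee M) : is_hom (vfun g).
Proof. by apply/hom_spaceP; apply: subvsP. Qed.

Lemma vfun_act M (g : vee M) (x : B) v : vfun (ract (vee M) x g) v = (x : A) * vfun g v.
Proof. by rewrite /vfun /= homA_actE comp_lfunE lfunE. Qed.

Lemma vfun_ext M (g h : vee M) : (forall v, vfun g v = vfun h v) -> g = h.
Proof. by move=> E; apply/val_inj/lfunP. Qed.

Lemma vfun_lift M (f : 'Hom(M, regular_mod A)) : is_hom f ->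
  exists g : vee M, forall v, vfun g v = f v.
Proof.
move=> fH; exists (vsproj (hom_space M (regular_mod A)) f) => v.
by rewrite /vfun vsprojK //; apply/hom_spaceP.
Qed.

Lemma vfunP M (c : k) (g h : vee M) v : vfun (c *: g + h) v = c *: vfun g v + vfun h v.
Proof. by rewrite /vfun linearP add_lfunE scale_lfunE. Qed.

Lemma vfun0 M v : vfun (0 : vee M) v = 0.
Proof. by have := vfunP (-1) (0 : vee M) 0 v; rewrite scaler0 addr0 scaleN1r addNr. Qed.

Lemma vfun_sum M (I : finType) (F : I -> vee M) v : vfun (\sum_i F i) v = \sum_i vfun (F i) v.
Proof. by rewrite /vfun linear_sum sum_lfunE. Qed.

Definition vee_map X Y (d : 'Hom(X, Y)) : 'Hom(vee Y, vee X) := linfun (precomp d).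

Lemma vee_mapE X Y (d : 'Hom(X, Y)) g v : is_hom d -> vfun (vee_map d g) v = vfun g (d v).
Proof.
move=> dH; have gdS : (vfun g \o d)%VF \in hom_space X (regular_mod A).
  by apply/hom_spaceP; apply: is_hom_comp => //; apply: vfun_hom.
rewrite -comp_lfunE /vfun /vee_map [X in vsval X](lfunE _ g) /=.
by congr (fun_of_lfun _ v); apply: vsprojK.
Qed.

Lemma vee_map_linear X Y : linear (fun d : 'Hom(X, Y) => vee_map d).
Proof.
move=> c d d'; apply/lfunP=> g; rewrite add_lfunE scale_lfunE /vee_map.
rewrite (lfunE (precomp _) g) (lfunE (precomp d) g) (lfunE (precomp d') g) /= /precomp.
by rewrite -linearP; congr vsproj; rewrite comp_lfunDr -comp_lfunZr.
Qed.

Lemma vee_map_hom X Y (d : 'Hom(X, Y)) : is_hom d -> is_hom (vee_map d).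
Proof.
move=> dH; apply: is_homP => x g; apply: vfun_ext => v.
by rewrite vee_mapE // !vfun_act vee_mapE.
Qed.

Lemma vee_map_comp X Y N (d : 'Hom(X, Y)) (d' : 'Hom(Y, N)) : is_hom d -> is_hom d' ->
  vee_map (d' \o d)%VF = (vee_map d \o vee_map d')%VF.
Proof.
move=> dH d'H; apply/lfunP=> g; apply: vfun_ext => v.
by rewrite comp_lfunE !vee_mapE ?comp_lfunE //; apply: is_hom_comp.
Qed.

Lemma vee_map1 X : vee_map (\1%VF : 'End(X)) = \1%VF.
Proof.
apply/lfunP=> g; apply: vfun_ext => v.
by rewrite vee_mapE ?id_lfunE //; apply: is_hom_id.
Qed.

Lemma vee_homotopy X1 X0 Y1 Y0 (d : 'Hom(X1, X0)) (d' : 'Hom(Y1, Y0)) :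
  is_hom d -> is_hom d' -> homotopy_equiv d d' -> homotopy_equiv (vee_map d) (vee_map d').
Proof.
move=> dH d'H [f1 [f0 [g1 [g0 [h [h' [[f1H f0H g1H g0H] [hH h'H] [E1 E2] [E3 E4] [E5 E6]]]]]]]].
have D (V V' : rmod A) (a b : 'Hom(V, V')) : vee_map (a + b) = vee_map a + vee_map b.
  by have := vee_map_linear 1 a b; rewrite !scale1r.
exists (vee_map g0), (vee_map g1), (vee_map f0), (vee_map f1), (vee_map h), (vee_map h').
split; first by split; apply: vee_map_hom.
- by split; apply: vee_map_hom.
- by split; rewrite -!vee_map_comp // ?E1 ?E2.
- by split; rewrite -!vee_map_comp // ?E3 ?E4 D vee_map1.
by split; rewrite -!vee_map_comp // ?E5 ?E6 D vee_map1.
Qed.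

Variable sigma : A -> B.
Hypothesis sigmaE : forall x, sigma x = x.
Hypothesis Hs : is_anti sigma.
Local Notation D' := (dual Hs).

(** Both modules live on the functionals on Hom(X, A), and the actions agree because [sigma] is the
    identity on elements. *)
Lemma nakayama_dual_hom X : @is_hom _ _ (nakayama X) (D' (vee X)) (\1%VF : 'End('Hom(homA X, k^o))).
Proof.
move=> x; rewrite comp_lfun1r comp_lfun1l; apply/lfunP=> phi.
apply: (etrans _ (esym (dmapE (ract (vee X) (sigma x)) phi))).
by rewrite sigmaE; apply: nak_actE.
Qed.

Lemma dual_nakayama_hom X : @is_hom _ _ (D' (vee X)) (nakayama X) (\1%VF : 'End('Hom(homA X, k^o))).
Proof.
move=> x; have E := @nakayama_dual_hom X x; rewrite comp_lfun1r comp_lfun1l in E.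
exact: (etrans (comp_lfun1l _) (etrans (esym E) (esym (comp_lfun1r _)))).
Qed.

Lemma nakayama_mapE X Y (d : 'Hom(X, Y)) : nakayama_map d = dmap (vee_map d).
Proof. by apply/lfunP=> phi; rewrite dmapE. Qed.

Lemma nakayama_homotopy X Y (d : 'Hom(X, Y)) :
  @homotopy_equiv _ _ _ _ (nakayama_map d) (D' (vee X)) (D' (vee Y)) (dmap (vee_map d)).
Proof.
have sq : (dmap (vee_map d) \o \1 = \1 \o nakayama_map d)%VF.
  by rewrite nakayama_mapE comp_lfun1r comp_lfun1l.
exact: (@homotopy_iso _ _ (nakayama X) (nakayama Y) (nakayama_map d) (D' (vee X)) (D' (vee Y))
  (dmap (vee_map d)) _ _ _ _ (@nakayama_dual_hom X) (@nakayama_dual_hom Y) (@dual_nakayama_hom X)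
  (@dual_nakayama_hom Y) sq (comp_lfun1l _) (comp_lfun1l _) (comp_lfun1l _) (comp_lfun1l _)).
Qed.

End Vee.

Section VeeFree.
Variables (k : closedFieldType) (A : falgType k) (Vt Ar : finType).
Local Notation B := (conv_alg A).
Variables (s t : Ar -> Vt) (e : Vt -> A) (ar : Ar -> A) (dd : Ar -> Ar -> A).
Hypothesis HA : qpa s t e ar dd.
Local Notation "v '·' x" := (ract _ x v) (at level 39, left associativity).

Section Basis.
Variables (X : rmod A) (I : finType) (u : I -> Vt) (x : I -> X).
Hypothesis fr : free_on e u x.

(** Hom(e_u A, A) is A e_u: the system dual to the free generators expands every homomorphism by its
    values on them. *)
Lemma dual_basis : exists g : I -> vee X,
  (forall j i, vfun (g j) (x i) = if i == j then e (u j) else 0) /\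
  forall h : vee X, h = \sum_j ract (vee X) (vfun h (x j) : B) (g j).
Proof.
have gP j : exists g : vee X, forall i, vfun g (x i) = if i == j then e (u j) else 0.
  pose n i : regular_mod A := if i == j then e (u j) else 0.
  have ne i : n i · e (u i) = n i.
    rewrite regularE /n; case: eqP => [->|_]; last exact: mul0r.
    by rewrite (q_ee HA) eqxx scale1r.
  have [f [fH fE]] := free_homP fr ne; have [g gE] := vfun_lift fH.
  by exists g => i; rewrite gE fE.
pose g j := projT1 (cid (gP j)).
have gE j i : vfun (g j) (x i) = if i == j then e (u j) else 0 := projT2 (cid (gP j)) i.
have [xe _ _] := fr.
exists g; split=> // h; apply: vfun_ext => v.
have lin1 : vfun h = vfun (\sum_j ract (vee X) (vfun h (x j) : B) (g j)).
  apply: (free_ext fr) => [||i]; [exact: vfun_hom | exact: vfun_hom |].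
  rewrite vfun_sum (bigD1 i) //= big1 ?addr0 => [|j ji].
    by rewrite vfun_act gE eqxx -[in LHS]xe (homE _ _ (vfun_hom h)) regularE.
  by rewrite vfun_act gE eq_sym (negPf ji) mulr0.
exact: (congr1 (fun f : 'Hom(X, regular_mod A) => f v) lin1).
Qed.

Lemma vee_free_on : exists g : I -> vee X, free_on (A := B) e u g.
Proof.
have [g [gE gen]] := dual_basis; exists g; have [xe xgen _] := fr; split.
- move=> j; rewrite [RHS]gen (bigD1 j) //= gE eqxx big1 ?addr0 // => i ij.
  have z0 h : ract (vee X) (0 : B) h = 0 by rewrite ract0 zero_lfunE.
  by rewrite gE (negPf ij); apply: z0.
- by move=> h; exists (fun j => vfun h (x j)); apply: gen.
move=> r r0 i; have := congr1 (fun h => vfun h (x i)) r0.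
rewrite vfun_sum (bigD1 i) //= big1 ?addr0 => [|j ji]; last first.
  by rewrite vfun_act gE eq_sym (negPf ji) mulr0.
rewrite vfun_act gE eqxx => E; apply: (etrans E).
exact: vfun0.
Qed.

(** The dual basis separates the points of [X]. *)
Lemma vee_map_inj (Y : rmod A) (d d' : 'Hom(Y, X)) : is_hom d -> is_hom d' -> vee_map d = vee_map d' -> d = d'.
Proof.
move=> dH d'H E; have [g [gE _]] := dual_basis; have [xe gen ind] := fr.
suff inj v w : (forall j, vfun (g j) v = vfun (g j) w) -> v = w.
  apply/lfunP=> y; apply: inj => j.
  by rewrite -!vee_mapE // E.
move=> vw; apply/eqP; rewrite -subr_eq0; apply/eqP; have [r rE] := gen (v - w).
rewrite rE big1 // => i _; rewrite -xe -ractMv.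
have -> : e (u i) * r i = vfun (g i) (v - w); last by rewrite linearB /= vw subrr ract0 zero_lfunE.
rewrite rE linear_sum (bigD1 i) //= big1 ?addr0 => [|j ji].
  by rewrite (homE _ _ (vfun_hom _)) gE eqxx regularE.
by rewrite (homE _ _ (vfun_hom _)) gE (negPf ji) regularE mul0r.
Qed.

End Basis.

Lemma vee_freeb c X : freeb e c X -> freeb (A := B) e c (vee X).
Proof. by move=> [x fx]; have [g fg] := vee_free_on fx; exists g. Qed.

(** The values of [h] on the dual basis prescribe the images of the generators of X1. With
    [vee_map_inj], this is full faithfulness of Hom(-, A) on sums of projectives. *)
Lemma vee_map_full c1 c0 X1 X0 (h : 'Hom(vee X0, vee X1)) : freeb e c1 X1 -> freeb e c0 X0 ->
  is_hom h -> exists2 d : 'Hom(X1, X0), is_hom d & vee_map d = h.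
Proof.
move=> [x1 f1] [x0 f0] hH; have [g [gE gen]] := dual_basis f0; have [xe1 _ _] := f1.
have [xe0 _ _] := f0.
pose w i : X0 := \sum_j x0 j · (vfun (h (g j)) (x1 i) : A).
have we i : w i · e (tag i) = w i.
  rewrite linear_sum; apply: eq_bigr => j _ /=.
  by rewrite -ractMv -[_ * _]regularE -(homE _ _ (vfun_hom _)) xe1.
have [d [dH dE]] := free_homP f1 we; exists d => //.
apply/lfunP=> f; apply: vfun_ext => v.
have : vfun (vee_map d f) = vfun (h f).
  apply: (free_ext f1) => [||i]; [exact: vfun_hom | exact: vfun_hom |].
  rewrite vee_mapE // dE /w linear_sum.
  rewrite {2}(gen f) linear_sum vfun_sum; apply: eq_bigr => j _ /=.
  by rewrite (homE _ _ hH) vfun_act (homE _ _ (vfun_hom _)) regularE.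
by move=> ->.
Qed.

End VeeFree.

(** * Generic dimension vectors and invariance under homotopy equivalence *)

Section Generic.
Variables (k : closedFieldType) (A : falgType k) (Vt Ar : finType).
Variables (s t : Ar -> Vt) (e : Vt -> A) (ar : Ar -> A) (dd : Ar -> Ar -> A).
Hypothesis HA : qpa s t e ar dd.
Implicit Types M N X Y P : rmod A.
Local Notation freeb := (freeb e).
Local Notation vsp := (vsp e).
Local Notation vpart := (vpart e).

(** The maximal rank at one vertex is attained on a nonempty open set; the induction along the list
    of vertices intersects these sets. *)
Lemma exists_generic_coker (Y1 Y0 : rmod A) : exists alpha, generic_coker e alpha Y1 Y0.
Proof.
pose rk (z : 'Hom(Y1, Y0)) u := \dim (vpart (limg z) u).
have rkle z u : (rk z u <= \dim (vsp Y0 u))%N by apply: dimvS; apply: vpartS; apply: subvf.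
have max1 u : exists2 z, is_hom z & forall z', is_hom z' -> (rk z' u <= rk z u)%N.
  have ex : exists n, `[<exists2 z, is_hom z & rk z u = n>].
    by exists (rk 0 u); apply/asboolP; exists 0 => //; apply: is_hom0.
  have bd n : `[<exists2 z, is_hom z & rk z u = n>] -> (n <= \dim (vsp Y0 u))%N.
    by move=> /asboolP[z _ <-].
  have [n /asboolP[z zH zn] nmax] := ex_maxnP ex bd; exists z => // z' z'H.
  by rewrite zn; apply: nmax; apply/asboolP; exists z'.
suff [z zH zmax] : exists2 z, is_hom z & forall u, u \in enum Vt -> forall z', is_hom z' -> (rk z' u <= rk z u)%N.
  exists (fun u => \dim (vsp Y0 u) - rk z u)%N; split=> [z' z'H u|].
    have := zmax u; rewrite mem_enum => /(_ isT z' z'H); have := rkle z u.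
    by rewrite -/(rk z' u); move: (rk z' u) (rk z u) (\dim _) => *; lia.
  by exists z => // u; rewrite -/(rk z u) subnK.
elim: (enum Vt) => [|u l [z zH zmax]]; first by exists 0 => //; apply: is_hom0.
have [z1 z1H z1max] := max1 u.
have [f1 [pf1 f1z f1P]] := vpart_rank_generic e z1 u.
have [f [pf fz fP]] : exists f, [/\ polyfun (@lin_coord k 'Hom(Y1, Y0)) f, f z != 0 &
    forall z', f z' != 0 -> forall u, u \in l -> (rk z u <= rk z' u)%N].
  elim: l {zmax} => [|v l [f [pf fz fP]]]; first by exists (fun=> 1); split=> //; [exact: polyfun_const | exact: oner_neq0].
  have [g [pg gz gP]] := vpart_rank_generic e z v.
  exists (fun x => g x * f x); split; [exact: polyfun_mul | exact: mulf_neq0 |].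
  move=> z'; rewrite mulf_eq0 negb_or => /andP[gz' fz'] w.
  by rewrite inE => /orP[/eqP->|]; [apply: gP | apply: fP].
have [|| z2 [/hom_spaceP z2H f1z2 fz2]] := @polyfun_irr _ _ (hom_space Y1 Y0) _ _ _ _ pf1 pf _ _ f1z fz.
- exact/hom_spaceP.
- exact/hom_spaceP.
exists z2 => // w; rewrite inE => /orP[/eqP->|wl] z' z'H.
  exact: leq_trans (z1max _ z'H) (f1P _ f1z2).
exact: leq_trans (zmax w wl _ z'H) (fP _ fz2 w wl).
Qed.

Lemma generic_coker_unique alpha alpha' Y1 Y0 : generic_coker e alpha Y1 Y0 -> generic_coker e alpha' Y1 Y0 -> alpha = alpha'.
Proof.
move=> [le1 [z1 z1H z1m]] [le2 [z2 z2H z2m]]; apply/funext=> u; apply/eqP; rewrite eqn_leq.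
have := le1 z2 z2H u; rewrite -z2m leq_add2r => ->.
by have := le2 z1 z1H u; rewrite -z1m leq_add2r.
Qed.

(* The kernel and the cokernel of Hom(d, S) have invariant dimensions for S simple. *)
Lemma homotopy_weight c1 c0 c1' c0' (X1 X0 X1' X0' : rmod A) (d : 'Hom(X1, X0)) (d' : 'Hom(X1', X0')) :
  freeb c1 X1 -> freeb c0 X0 -> freeb c1' X1' -> freeb c0' X0' -> is_hom d -> is_hom d' ->
  homotopy_equiv d d' -> forall u, (c0 u + c1' u = c0' u + c1 u)%N.
Proof.
move=> fX1 fX0 fX1' fX0' dH d'H he u; have [S Ss] := exists_simple HA u.
have dimS (c : Vt -> nat) X : freeb c X -> \dim (hom_space X S) = c u.
  move=> fX; rewrite (dim_freeb_hom HA S fX) (bigD1 u) //= big1 ?addn0 => [|v vu].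
    by rewrite (dim_vsp_simple HA _ Ss) eqxx muln1.
  by rewrite (dim_vsp_simple HA _ Ss) (negPf vu) muln0.
pose im (Z1 Z0 : rmod A) (z : 'Hom(Z1, Z0)) := (prec S z @: hom_space Z0 S)%VS.
pose ke (Z1 Z0 : rmod A) (z : 'Hom(Z1, Z0)) := (hom_space Z0 S :&: lker (prec S z))%VS.
have rkE (Z1 Z0 : rmod A) (z : 'Hom(Z1, Z0)) : (\dim (ke _ _ z) + \dim (im _ _ z))%N = \dim (hom_space Z0 S).
  exact: limg_ker_dim.
have imS (Z1 Z0 : rmod A) (z : 'Hom(Z1, Z0)) : is_hom z -> (im _ _ z <= hom_space Z1 S)%VS.
  move=> zH; apply/subvP=> _ /memv_imgP[w /hom_spaceP wH ->]; rewrite precE.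
  by apply/hom_spaceP; apply: is_hom_comp.
have le (Z1 Z0 Z1' Z0' : rmod A) (z : 'Hom(Z1, Z0)) (z' : 'Hom(Z1', Z0')) : is_hom z -> is_hom z' -> homotopy_equiv z z' ->
   (\dim (ke _ _ z) <= \dim (ke _ _ z'))%N /\
   (\dim (hom_space Z1 S) + \dim (im _ _ z') <= \dim (hom_space Z1' S) + \dim (im _ _ z))%N.
  move=> zH z'H [f1 [f0 [g1 [g0 [h [h' [[f1H f0H g1H g0H] [hH h'H] [E1 E2] [E3 E4] _]]]]]]]; split.
    rewrite -(@dim_limg_inj _ _ _ (prec S g0) (ke _ _ z)) => [|w].
      apply: dimvS; apply/subvP=> _ /memv_imgP[w + ->].
      rewrite !memv_cap !memv_ker !precE => /andP[/hom_spaceP wH /eqP wz].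
      apply/andP; split; first by apply/hom_spaceP; apply: is_hom_comp.
      by rewrite -comp_lfunA -E2 comp_lfunA wz comp_lfun0l.
    rewrite memv_cap memv_ker !precE => /andP[_ /eqP wz] wg.
    have : (w \o (g0 \o f0))%VF = w by rewrite E4 comp_lfunDr comp_lfun1r comp_lfunA wz comp_lfun0l addr0.
    by rewrite comp_lfunA wg comp_lfun0l => <-.
  pose H1 := hom_space Z1 S; pose phi := prec S g1.
  have phiI : (phi @: H1 <= hom_space Z1' S)%VS.
    apply/subvP=> _ /memv_imgP[w /hom_spaceP wH ->]; rewrite precE.
    by apply/hom_spaceP; apply: is_hom_comp.
  have pre w : w \in H1 -> phi w \in im _ _ z' -> w \in im _ _ z.
    move=> wH /memv_imgP[w' /hom_spaceP w'H]; rewrite !precE => wg.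
    have E : w = (((w' \o f0) - (w \o h)) \o z)%VF.
      rewrite comp_lfunDl comp_lfunNl -!comp_lfunA -E1 [(w' \o _)%VF]comp_lfunA -wg -comp_lfunA E3.
      by rewrite comp_lfunDr comp_lfun1r comp_lfunA addrK.
    rewrite E -precE; apply: memv_img; apply/hom_spaceP.
    by apply: is_homB; apply: is_hom_comp => //; apply/hom_spaceP.
  have imphi w : w \in im _ _ z -> phi w \in im _ _ z'.
    case/memv_imgP=> w' /hom_spaceP w'H ->; rewrite !precE -comp_lfunA E2 comp_lfunA -precE.
    by apply: memv_img; apply/hom_spaceP; apply: is_hom_comp.
  have kphi : (H1 :&: lker phi <= im _ _ z)%VS.
    apply/subvP=> w; rewrite memv_cap memv_ker => /andP[wH /eqP w0].
    by apply: pre => //; rewrite w0 mem0v.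
  have dI : \dim (im _ _ z) = (\dim (H1 :&: lker phi) + \dim ((phi @: H1) :&: im _ _ z'))%N.
    rewrite -(limg_ker_dim phi (im _ _ z)); congr addn; congr (\dim _).
      apply/eqP; rewrite eqEsubv; apply/andP; split; apply/subvP=> w; rewrite !memv_cap => /andP[w1 w2].
        by rewrite w2 andbT; apply: (subvP (imS _ _ _ zH)).
      by rewrite w2 andbT; apply: (subvP kphi); rewrite memv_cap w1.
    apply/eqP; rewrite eqEsubv; apply/andP; split; apply/subvP=> w.
      case/memv_imgP=> w' w'I ->; rewrite memv_cap imphi // andbT memv_img //.
      exact: (subvP (imS _ _ _ zH)).
    rewrite memv_cap => /andP[/memv_imgP[w' w'H ->] wI].
    by apply: memv_img; apply: pre.
  have := limg_ker_dim phi H1.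
  have sub : (phi @: H1 + im _ _ z' <= hom_space Z1' S)%VS by rewrite subv_add phiI imS.
  have := dimvS sub; have := dimv_sum_cap (phi @: H1)%VS (im _ _ z').
  rewrite dI -/H1; move: (\dim (phi @: H1)) (\dim (_ :&: im _ _ z')) (\dim (H1 :&: _)) (\dim H1) (\dim (im _ _ z')) (\dim (_ + _)) (\dim (hom_space Z1' S)) => *; lia.
have [k1 m1] := le _ _ _ _ _ _ dH d'H he; have [k2 m2] := le _ _ _ _ _ _ d'H dH (homotopy_sym he).
have := rkE _ _ d; have := rkE _ _ d'; move: k1 k2 m1 m2.
rewrite (dimS _ _ fX1) (dimS _ _ fX0) (dimS _ _ fX1') (dimS _ _ fX0').
move: (\dim _) (\dim _) (\dim _) (\dim _) => *; lia.
Qed.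

Lemma realizes_iso alpha (x : grep k s t alpha) (N N' : rmod A) : grealizes e ar x N -> grealizes e ar x N' ->
  exists f : 'Hom(N, N'), [/\ is_hom f, lker f = 0%VS & limg f = fullv].
Proof.
move=> /(realizes_framed HA)[f [g [fr fe fa]]] /(realizes_framed HA)[f' [g' [fr' fe' fa']]].
have [phi [psi [g'phi gpsi psiphi phipsi phif]]] := frame_iso fr fr'.
exists phi; split.
- apply: (is_hom_gen HA) => [u v|a v].
    by rewrite -fe phif -fe' g'phi.
  by rewrite -(act_ear HA v) -fe -fa phif fa' -(act_ear HA (phi v)) -fe' g'phi.
- by apply/eqP/lker0P => v w /(congr1 psi); rewrite !psiphi.
by apply/vspaceP=> v; rewrite memvf -(phipsi v) memv_img ?memvf.
Qed.

Lemma coker_iso (X Y N N' : rmod A) (d : 'Hom(X, Y)) (f : 'Hom(N, N')) :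
  is_hom f -> lker f = 0%VS -> limg f = fullv -> is_coker d N -> is_coker d N'.
Proof.
move=> fH fk fI [p [pH pI pk]]; exists (f \o p)%VF; split; first exact: is_hom_comp.
  by rewrite limg_comp pI.
have finj : injective f by apply/lker0P/eqP.
rewrite -pk; apply/vspaceP=> v; rewrite !memv_ker comp_lfunE.
by apply/eqP/eqP => [E|->]; [apply: finj; rewrite E linear0 | exact: linear0].
Qed.

Lemma ker_iso (X Y N N' : rmod A) (d : 'Hom(X, Y)) (f : 'Hom(N', N)) :
  is_hom f -> lker f = 0%VS -> limg f = fullv -> is_ker d N -> is_ker d N'.
Proof.
move=> fH fk fI [i [iH ik iI]]; exists (i \o f)%VF; split; first exact: is_hom_comp.
  apply/eqP/lker0P => v w; rewrite !comp_lfunE.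
  have finj : injective f by apply/lker0P/eqP.
  have iinj : injective i by apply/lker0P/eqP.
  by move=> /iinj/finj.
by rewrite limg_comp fI.
Qed.

(** Fullness lifts the maps and the homotopies; faithfulness lets their identities be checked after
    applying Hom(-, A). *)
Lemma vee_homotopy_reflect c1 c0 c1' c0' (X1 X0 Y1 Y0 : rmod A) (d : 'Hom(X1, X0)) (d' : 'Hom(Y1, Y0)) :
  freeb c1 X1 -> freeb c0 X0 -> freeb c1' Y1 -> freeb c0' Y0 -> is_hom d -> is_hom d' ->
  homotopy_equiv (vee_map d) (vee_map d') -> homotopy_equiv d d'.
Proof.
move=> fX1 fX0 fY1 fY0 dH d'H [F1 [F0 [G1 [G0 [H [H' [[F1H F0H G1H G0H] [HH H'H] [E1 E2] [E3 E4] [E5 E6]]]]]]]].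
have D (V V' : rmod A) (a b : 'Hom(V, V')) : vee_map (a + b) = vee_map a + vee_map b.
  by have := vee_map_linear 1 a b; rewrite !scale1r.
have [g0 g0H gE0] := vee_map_full HA fY0 fX0 F1H.
have [g1 g1H gE1] := vee_map_full HA fY1 fX1 F0H.
have [f0 f0H fE0] := vee_map_full HA fX0 fY0 G1H.
have [f1 f1H fE1] := vee_map_full HA fX1 fY1 G0H.
have [h hH hE] := vee_map_full HA fX0 fX1 HH.
have [h' h'H hE'] := vee_map_full HA fY0 fY1 H'H.
have inj c (X Y : rmod A) (a b : 'Hom(Y, X)) : freeb c X -> is_hom a -> is_hom b -> vee_map a = vee_map b -> a = b.
  by move=> [x fx]; apply: (vee_map_inj HA fx).
have cH (X Y Z : rmod A) (a : 'Hom(X, Y)) (b : 'Hom(Y, Z)) : is_hom a -> is_hom b -> is_hom (b \o a)%VF.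
  by move=> ? ?; apply: is_hom_comp.
have pH (X : rmod A) (a : 'End(X)) : is_hom a -> is_hom (\1 + a)%VF by move=> ?; apply: is_homD => //; apply: is_hom_id.
exists f1, f0, g1, g0, h, h'; split=> //; split.
- by apply: (inj _ _ _ _ _ fY0); rewrite ?vee_map_comp ?fE1 ?fE0 //; auto.
- by apply: (inj _ _ _ _ _ fX0); rewrite ?vee_map_comp ?gE1 ?gE0 //; auto.
- by apply: (inj _ _ _ _ _ fX1); rewrite ?D ?vee_map1 ?vee_map_comp ?fE1 ?gE1 ?hE //; auto.
- by apply: (inj _ _ _ _ _ fX0); rewrite ?D ?vee_map1 ?vee_map_comp ?fE0 ?gE0 ?hE //; auto.
- by apply: (inj _ _ _ _ _ fY1); rewrite ?D ?vee_map1 ?vee_map_comp ?fE1 ?gE1 ?hE' //; auto.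
by apply: (inj _ _ _ _ _ fY0); rewrite ?D ?vee_map1 ?vee_map_comp ?fE0 ?gE0 ?hE' //; auto.
Qed.

End Generic.

(** * Principal components *)

Lemma posneg (Q : quiver) (delta : vert Q -> int) u :
  delta u = (pospart delta u)%:Z - (negpart delta u)%:Z.
Proof.
rewrite /pospart /negpart; case: (lerP 0 (delta u)) => h; lia.
Qed.

(** The arrows at u are sorted by their other end. *)
Lemma sum_Bmat (Q : quiver) (alpha : vert Q -> nat) u :
  \sum_v (alpha v)%:Z * Bmat v u =
  (\sum_(a | tgt a == u) alpha (src a))%N%:Z - (\sum_(a | src a == u) alpha (tgt a))%N%:Z.
Proof.
have S (f g : arr Q -> vert Q) : \sum_v (alpha v)%:Z * #|[set a : arr Q | (f a == v) && (g a == u)]%SET|%:Z =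
    (\sum_(a | g a == u) alpha (f a))%N%:Z.
  rewrite (partition_big f xpredT) //= (big_morph Posz PoszD (erefl 0)); apply: eq_bigr => v _.
  rewrite -PoszM cardsE -sum1_card big_distrr /=; congr Posz.
  by apply: eq_big => [a|a /andP[/eqP-> _]]; rewrite ?muln1 // unfold_in andbC.
rewrite -!S -sumrB; apply: eq_bigr => v _; rewrite -mulrBr /Bmat; congr (_ * (_ - _)).
by congr Posz; apply: eq_card => a; rewrite !inE andbC.
Qed.

Lemma polyfun_dmap (k : fieldType) (V W : vectType k) (G : 'Hom('Hom(W, k^o), 'Hom(V, k^o)) -> k) :
  polyfun (@lin_coord k 'Hom('Hom(W, k^o), 'Hom(V, k^o))) G ->
  polyfun (@lin_coord k 'Hom(V, W)) (fun z => G (dmap z)).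
Proof. by apply: polyfun_linear => c z z'; rewrite dmapP. Qed.

Section Bidual.
Variables (k : closedFieldType) (A B : falgType k) (tau : B -> A) (sigma : A -> B).
Hypotheses (Ht : is_anti tau) (Hs : is_anti sigma).
Hypotheses (ts : cancel sigma tau) (st : cancel tau sigma).
Local Notation D := (dual Ht).
Local Notation D' := (dual Hs).

Lemma ev_iso_hom (M : rmod A) : lker (ev M) = 0%VS /\ limg (ev M) = fullv.
Proof. by rewrite lker_ev limg_ev. Qed.

Lemma bidual_homotopy (X Y : rmod A) (d : 'Hom(X, Y)) :
  @homotopy_equiv _ _ X Y d (D' (D X)) (D' (D Y)) (dmap (dmap d)).
Proof.
have i1 (V : vectType k) : ((ev V)^-1 \o ev V)%VF = \1%VF.
  by apply/lfunP=> v; rewrite comp_lfunE evK id_lfunE.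
have i2 (V : vectType k) : (ev V \o (ev V)^-1)%VF = \1%VF.
  by apply/lfunP=> v; rewrite comp_lfunE evVK id_lfunE.
exact: (@homotopy_iso _ _ X Y d (D' (D X)) (D' (D Y)) (dmap (dmap d)) _ _ _ _
  (ev_hom Ht Hs ts X) (ev_hom Ht Hs ts Y) (evV_hom Ht Hs ts X) (evV_hom Ht Hs ts Y)
  (dmap_dmap d) (i1 X) (i2 X) (i1 Y) (i2 Y)).
Qed.

End Bidual.

Lemma nakayama_map_hom (k : closedFieldType) (A : falgType k) (X Y : rmod A) (d : 'Hom(X, Y)) :
  is_hom d -> is_hom (nakayama_map d).
Proof.
move=> dH x; apply/lfunP=> phi; rewrite !comp_lfunE nakayama_mapE.
have E1 : ract (nakayama X) x phi = (phi \o homA_act X x)%VF := nak_actE x phi.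
have E2 : ract (nakayama Y) x (dmap (vee_map d) phi) = (dmap (vee_map d) phi \o homA_act Y x)%VF :=
  nak_actE x (dmap (vee_map d) phi).
rewrite E1 E2 !dmapE -!comp_lfunA; congr (_ \o _)%VF.
exact: (esym (vee_map_hom dH (x : conv_alg A))).
Qed.

Lemma zopen_in_sub (k : fieldType) (X : Type) (crd : set (X -> k)) (R C U : set X) :
  U `<=` C -> C `<=` R -> zopen_in crd R U -> zopen_in crd C U.
Proof.
move=> UC CR [O oO UE]; exists O => //; apply/seteqP; split=> x.
  by move=> Ux; split; [apply: UC | move: Ux; rewrite UE => -[]].
by move=> [Cx Ox]; rewrite UE; split=> //; apply: CR.
Qed.

(** * Presentations over a Jacobian algebra and the two assertions *)

Section JacobianPresentations.
Variables (k : closedFieldType) (k_char0 : [pchar k] =i pred0).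
Variables (Q : quiver) (Q_loopless : loopless Q) (W : potential k Q) (J : jacobian_algebra W).
Local Notation A := (jalg J).
Local Notation B := (conv_alg J).

(** The identity, typed so that it reverses products: source and target carry opposite
    multiplications. *)
Definition to_conv (x : A) : B := x.
Definition of_conv (x : B) : A := x.
Lemma of_conv_anti : is_anti of_conv. Proof. by []. Qed.
Lemma to_conv_anti : is_anti to_conv. Proof. by []. Qed.

Local Notation D := (dual of_conv_anti).
Local Notation D' := (dual to_conv_anti).
Let HA := jacobian_qpa Q_loopless J.
Let HB := jacobian_qpa_conv Q_loopless J.
Let te u : of_conv (jvert J u : B) = jvert J u. Proof. by []. Qed.
Let ta a : of_conv (jarr J a : B) = jarr J a. Proof. by []. Qed.
Let tdd a b : of_conv (jdd J b a : B) = jdd J b a. Proof. by []. Qed.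

Local Notation freeA := (freeb (jvert J)).
Local Notation freeB := (freeb (A := B) (jvert J)).

Lemma PsumP b X : is_Psum b X <-> freeA b X.
Proof. exact: (gis_PsumP HA b X). Qed.

Lemma IsumP b (X : rmod A) : is_Isum b X <-> freeB b (D X).
Proof. exact: (gis_IsumP of_conv_anti to_conv_anti (fun=> erefl) (fun=> erefl) HB te ta b X). Qed.


(** The definition of the dual weight without subtraction, in the shape required by
    [dual_generic_coker]. *)
Lemma dual_weight_balance delta alpha u :
  (pospart delta u + negpart (dual_weight delta alpha) u + \sum_(a : arr Q | tgt a == u) alpha (src a) =
   negpart delta u + pospart (dual_weight delta alpha) u + \sum_(a : arr Q | src a == u) alpha (tgt a))%N.
Proof.
have := posneg (dual_weight delta alpha) u; rewrite {1}/dual_weight sum_Bmat posneg.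
move: (\sum_(a | tgt a == u) _)%N (\sum_(a | src a == u) _)%N (pospart _ _) (pospart _ _) (negpart _ _) (negpart _ _).
by move=> *; lia.
Qed.

Lemma bidual_freeb b (P : rmod B) : freeB b P -> freeB b (D (D' P)).
Proof.
apply: (freeb_iso (ev_hom to_conv_anti of_conv_anti (fun=> erefl) P) (evV_hom to_conv_anti of_conv_anti (fun=> erefl) P)).
  by apply/lfunP=> v; rewrite comp_lfunE evK id_lfunE.
by apply/lfunP=> v; rewrite comp_lfunE evVK id_lfunE.
Qed.

Section Main.
Variables (delta : vert Q -> int) (alpha : vert Q -> nat).
Hypothesis alpha_dim : general_dimv J delta alpha.
Local Notation dw := (dual_weight delta alpha).
Local Notation cokers Y1 Y0 := (@coker_set k A _ _ (@src Q) (@tgt Q) (jvert J) (jarr J) alpha Y1 Y0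
  (@minimal_coker k A _ (jvert J) alpha Y1 Y0)).

Lemma generic_cokerA Y1 Y0 : freeA (negpart delta) Y1 -> freeA (pospart delta) Y0 ->
  generic_coker (jvert J) alpha Y1 Y0.
Proof.
have [X1 [X0 [/PsumP fX1 /PsumP fX0 gen]]] := alpha_dim.
by move=> fY1 fY0; apply: (generic_coker_transport HA fX1 fX0 fY1 fY0); apply: (general_generic_coker HA gen).
Qed.

(** [dual_generic_coker] with the two algebras exchanged: from general cokernels over [J] to the
    converse algebra, with the same [alpha]. *)
Lemma generic_cokerB (P1 P0 : rmod B) : freeB (negpart dw) P1 -> freeB (pospart dw) P0 ->
  generic_coker (A := B) (jvert J) alpha P1 P0.
Proof.
have [Y1 fY1] := exists_freeb HA (negpart delta); have [Y0 fY0] := exists_freeb HA (pospart delta).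
move=> fP1 fP0; have gA := generic_cokerA fY1 fY0.
have wt u : (pospart dw u + negpart delta u + \sum_(a : arr Q | src a == u) alpha (tgt a) =
   negpart dw u + pospart delta u + \sum_(a : arr Q | tgt a == u) alpha (src a))%N.
  have := dual_weight_balance delta alpha u.
  by move: (\sum_(a | tgt a == u) _)%N (\sum_(a | src a == u) _)%N => *; lia.
by have [] := dual_generic_coker to_conv_anti of_conv_anti (fun=> erefl) (fun=> erefl) HB HA
  (fun=> erefl) (fun _ _ => erefl) k_char0 fY1 fY0 fP1 fP0 wt gA.
Qed.

(** [C0] is the closure of the general cokernels, and also of the general kernels since the two open
    sets meet. A component satisfying either definition contains a point of the corresponding open
    set, hence equals [C0]. *)
Lemma principalP Y1 Y0 : freeA (negpart delta) Y1 -> freeA (pospart delta) Y0 ->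
  exists C0, [/\ irreducible_component (@rep_coord k Q alpha) (@repvar k Q W J alpha) C0,
    cokers Y1 Y0 `<=` C0,
    forall C, principal_component J delta C <-> C = C0 &
    forall C, dual_principal_component J dw C <-> C = C0].
Proof.
move=> fY1 fY0; have gA := generic_cokerA fY1 fY0.
have [P1 fP1] := exists_freeb HB (negpart dw); have [P0 fP0] := exists_freeb HB (pospart dw).
have gB := generic_cokerB fP1 fP0; have wt := dual_weight_balance delta alpha.
have comp := cokers_closure_component of_conv_anti to_conv_anti (fun=> erefl) (fun=> erefl) HA HB te tdd k_char0 wt fP1 fP0 gB fY1 fY0.
have uni := cokers_closure_unique of_conv_anti to_conv_anti (fun=> erefl) (fun=> erefl) HA HB te tdd k_char0 wt fP1 fP0 gB fY1 fY0.
have ksub := kers_sub of_conv_anti to_conv_anti (fun=> erefl) (fun=> erefl) HA HB te ta tdd k_char0 wt fP1 fP0 gB fY1 fY0.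
have kuni := cokers_closure_unique_kers of_conv_anti to_conv_anti (fun=> erefl) (fun=> erefl) HA HB te ta tdd k_char0 wt fP1 fP0 gB fY1 fY0.
have [compI compS] := comp.
exists (@cokers_closure k A _ _ (@src Q) (@tgt Q) (jvert J) (jarr J) alpha Y1 Y0); split=> // C.
  split=> [[CI [X1 [X0 [/PsumP fX1 /PsumP fX0 gen]]]]|->].
    have [d [dH dm [N [x [dN xN Cx]]]]] := general_meets_minimal_coker HA (generic_cokerA fX1 fX0) gen.
    apply: uni => //; exists x; split=> //.
    by apply: (cokers_transport HA fX1 fX0 fY1 fY0); exists d, N.
  split=> //; exists Y1, Y0; split; [exact/PsumP | exact/PsumP |].
  apply: (generic_coker_general HA gA) => z zH zm.
  have [N [x [zN xN xc]]] := minimal_coker_exists (ar := jarr J) HA zH zm.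
  by exists N, x; split=> //; apply: compS.
split=> [[CI [X0 [X1 [/IsumP fX0 /IsumP fX1 gen]]]]|->].
  have gX := generic_cokerB fX1 fX0.
  have [_ [d0 d0H d0m]] := gX; have d0m' : minimal_coker (A := B) (jvert J) alpha d0 by [].
  have [G [pG Gd0 GP]] := minimal_coker_open HB gX d0H d0m'.
  have [i0 i0H i0E] := dual_hom_lift to_conv_anti (fun=> erefl) d0H.
  have [F [pF [d dH Fd] FP]] := (generalP _ _ _).1 gen.
  have pG' : polyfun (@lin_coord k 'Hom(X0, X1)) (fun z => G (dmap z)).
    exact: polyfun_dmap.
  have Gi0 : G (dmap i0) != 0 by rewrite i0E.
  have [|| z [/hom_spaceP zH Fz Gz]] := @polyfun_irr _ _ (hom_space X0 X1) _ _ _ _ pF pG' _ _ Fd Gi0.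
  - exact/hom_spaceP.
  - exact/hom_spaceP.
  have [N [x [zN xN Cx]]] := FP z zH Fz.
  have dzH := dmap_hom of_conv_anti zH; have dzN := coker_dual of_conv_anti zN.
  apply: kuni => //; exists x; split=> //.
  apply: (cokers_transport HB fX1 fX0 fP1 fP0); exists (dmap z), (D N); split=> //.
    exact: GP.
  exact: (grealizes_dual of_conv_anti HA te ta xN).
split=> //; exists (D' P0), (D' P1).
have fDP1 := bidual_freeb fP1; have fDP0 := bidual_freeb fP0.
split; [exact/IsumP | exact/IsumP |].
have gX := generic_cokerB fDP1 fDP0.
have [_ [d0 d0H d0m]] := gX; have d0m' : minimal_coker (A := B) (jvert J) alpha d0 by [].
have [G [pG Gd0 GP]] := minimal_coker_open HB gX d0H d0m'.
have [i0 i0H i0E] := dual_hom_lift to_conv_anti (fun=> erefl) d0H.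
apply/generalP; exists (fun z => G (dmap z)); split.
- exact: polyfun_dmap.
- by exists i0; rewrite ?i0E.
move=> z zH Gz; have dzH := dmap_hom of_conv_anti zH.
have dzm : @minimal_coker k B _ (jvert J) alpha (D (D' P1)) (D (D' P0)) (dmap z) := GP _ dzH Gz.
have [N [i [iH ik iI]]] := exists_sub (submodule_ker zH).
have zN : is_ker z N by exists i.
have dzN := coker_dual of_conv_anti zN.
have dN u : \dim (vsp (jvert J) N u) = alpha u.
  by rewrite -(vsp_dual_dim of_conv_anti te); apply: ((coker_minimal_coker HB alpha dzH dzN).1 dzm).
have [x xN] := exists_realization HA dN; exists N, x; split=> //.
apply: ksub; apply: (cokers_transport HB fDP1 fDP0 fP1 fP0); exists (dmap z), (D N); split=> //.
exact: (grealizes_dual of_conv_anti HA te ta xN).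
Qed.

Lemma part_one (C : set (repspace k alpha)) :
  principal_component J delta C <-> dual_principal_component J dw C.
Proof.
have [Y1 fY1] := exists_freeb HA (negpart delta); have [Y0 fY0] := exists_freeb HA (pospart delta).
have [C0 [_ _ pc dc]] := principalP fY1 fY0.
by split=> [/pc|/dc] E; [apply/dc | apply/pc].
Qed.

End Main.
Let se u : to_conv (jvert J u) = jvert J u :> B. Proof. by []. Qed.
Let sa a : to_conv (jarr J a) = jarr J a :> B. Proof. by []. Qed.
Let ts : cancel to_conv of_conv. Proof. by []. Qed.
Let st : cancel of_conv to_conv. Proof. by []. Qed.

Local Notation indimA := (indim (@src Q) (@tgt Q) (jvert J)).
Local Notation grkA := (grk (@src Q) (@tgt Q) (jdd J)).
Local Notation vspA := (vsp (jvert J)).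
Local Notation indimB := (indim (A := B) (@tgt Q) (@src Q) (jvert J)).
Local Notation grkB := (grk (A := B) (@tgt Q) (@src Q) (fun a b => jdd J b a)).
Local Notation vspB := (vsp (A := B) (jvert J)).

Lemma proj_pres_free (M : decrep J) (Z1 Z0 : rmod A) (d : 'Hom(Z1, Z0)) : proj_pres M d ->
  exists c1 c0, [/\ freeA c1 Z1, freeA c0 Z0, is_hom d, is_coker d (dmod M) &
    forall u, (c0 u + indimA (dmod M) u + dec_dim M u =
               c1 u + \dim (vspA (dmod M) u) + grkA (dmod M) u)%N].
Proof.
move=> [X1 [R [dM [inj [prj [[p [[pH pP pI psup] [dMH X1P dMI dMs]]] fR bp ->]]]]]].
have [bH b1 b0 bs] := bp; have [injH prjH] := bH true.
have fX1 := proj_freeb HA X1P; have fZ0 := proj_freeb HA pP; have fR' := (PsumP _ _).1 fR.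
pose c1 := topd (@tgt Q) (jvert J) (jarr J) (fullv : {vspace X1}).
pose c0 := topd (@tgt Q) (jvert J) (jarr J) (fullv : {vspace Z0}).
have fZ1 : freeA (fun v => (\sum_(b : bool) (if b then c1 else dec_dim M) v)%N) Z1.
  by apply: biproduct_freeb bp _; case.
exists (fun u => c1 u + dec_dim M u)%N, c0; split=> //.
- by have <- : (fun v => (\sum_(b : bool) (if b then c1 else dec_dim M) v)%N) = fun u => (c1 u + dec_dim M u)%N
    by apply/funext=> v; rewrite big_bool.
- exact: is_hom_comp.
- exists p; split=> //; rewrite limg_comp.
  have -> : limg (prj true) = fullv.
    apply/vspaceP=> v; rewrite memvf -[v]id_lfunE -(b1 true) comp_lfunE memv_img ?memvf //.
  by rewrite dMI.
move=> u; have := min_presentation_weight HA u fX1 fZ0 dMH pH pI (esym dMI) dMs.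
by rewrite -/c1 -/c0; move: (c1 u) (c0 u) (dec_dim M u) (\dim _) (grkA _ u) (indimA _ u) => *; lia.
Qed.

Lemma exists_proj_pres (M : decrep J) : exists (Z1 Z0 : rmod A) (d : 'Hom(Z1, Z0)), proj_pres M d.
Proof.
have [b1 [b0 [Y1 [Y0 [d [p [fY1 fY0 pc [dH dI ds]]]]]]]] := exists_min_presentation HA (dmod M).
have [R fR] := exists_freeb HA (dec_dim M).
have [Z1 fZ1] := exists_freeb HA (fun v => b1 v + dec_dim M v)%N.
have [i [q [j [r [[iH qH jH rH] [qi rj] [qj ri] sum]]]]] := freeb_split fZ1 fY1 fR.
pose inj (b : bool) : 'Hom(two Y1 R b, Z1) := if b return 'Hom(two Y1 R b, Z1) then i else j.
pose prj (b : bool) : 'Hom(Z1, two Y1 R b) := if b return 'Hom(Z1, two Y1 R b) then q else r.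
exists Z1, Y0, (d \o q)%VF, Y1, R, d, inj, prj; split=> //.
- by exists p; split=> //; split=> //; apply: (freeb_projective HA fY1).
- exact/PsumP.
split.
- by case.
- by case; apply/lfunP=> v; rewrite comp_lfunE id_lfunE /= ?qi ?rj.
- by case; case=> // _; apply/lfunP=> v; rewrite comp_lfunE zero_lfunE /= ?ri ?qj.
rewrite big_bool /=; apply/lfunP=> v.
by rewrite add_lfunE !comp_lfunE id_lfunE sum.
Qed.

(** The rank formula for minimal presentations makes the weight a function of the module and its
    decoration, whatever presentation was chosen. *)
Lemma has_weightP (M : decrep J) delta : has_weight M delta <->
  forall u, delta u = (\dim (vspA (dmod M) u) + grkA (dmod M) u)%N%:Z -
                      (indimA (dmod M) u + dec_dim M u)%N%:Z.
Proof.
split=> [[bm [bp [Z1 [Z0 [d [pd /PsumP f1 /PsumP f0 E]]]]]] u|E].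
  have [c1 [c0 [fc1 fc0 _ _ wt]]] := proj_pres_free pd; have := wt u; rewrite E.
  rewrite (freeb_inj HA f1 fc1) (freeb_inj HA f0 fc0).
  by move: (c1 u) (c0 u) (dec_dim M u) (\dim _) (grkA _ u) (indimA _ u) => *; lia.
have [Z1 [Z0 [d pd]]] := exists_proj_pres M; have [c1 [c0 [fc1 fc0 _ _ wt]]] := proj_pres_free pd.
exists c1, c0, Z1, Z0, d; split=> //; [exact/PsumP | exact/PsumP |].
move=> u; have := wt u; rewrite E.
by move: (c1 u) (c0 u) (dec_dim M u) (\dim _) (grkA _ u) (indimA _ u) => *; lia.
Qed.

Lemma inj_pres_free (E : decrep J) (X0 Z1 : rmod A) (d : 'Hom(X0, Z1)) : inj_pres E d ->
  exists b1 b0, [/\ freeB b1 (D Z1), freeB b0 (D X0), is_hom d, is_ker d (dmod E) &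
    forall u, (b0 u + indimB (D (dmod E)) u + dec_dim E u =
               b1 u + \dim (vspB (D (dmod E)) u) + grkB (D (dmod E)) u)%N].
Proof.
move=> [X1 [R [dM [inj [prj [mip fR bp ->]]]]]].
have [p [[pH pP pI psup] [dMH X1P dMI dMs]]] := min_inj_dual of_conv_anti to_conv_anti ts st mip.
have [i [[iH _ ik _] [dH _ dk _]]] := mip.
have bp' := biproduct_dual of_conv_anti bp.
have [bH b1 b0 bs] := bp; have [injH prjH] := bH true.
have fX1 := proj_freeb HB X1P; have fX0 := proj_freeb HB pP; have fR' := (IsumP _ _).1 fR.
pose c1 := topd (A := B) (@src Q) (jvert J) (jarr J) (fullv : {vspace D X1}).
pose c0 := topd (A := B) (@src Q) (jvert J) (jarr J) (fullv : {vspace D X0}).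
have fZ1 : freeB (fun v => (\sum_(b : bool) (if b then c1 else dec_dim E) v)%N) (D Z1).
  by apply: biproduct_freeb bp' _; case.
exists (fun u => c1 u + dec_dim E u)%N, c0; split=> //.
- by have <- : (fun v => (\sum_(b : bool) (if b then c1 else dec_dim E) v)%N) = fun u => (c1 u + dec_dim E u)%N
    by apply/funext=> v; rewrite big_bool.
- exact: is_hom_comp.
- exists i; split=> //; rewrite -dk; apply/vspaceP=> v; rewrite !memv_ker comp_lfunE.
  apply/eqP/eqP => [->|E0]; first exact: linear0.
  by rewrite -[LHS]id_lfunE -(b1 true) comp_lfunE E0 linear0.
move=> u; have := min_presentation_weight HB u fX1 fX0 dMH pH pI (esym dMI) dMs.
by rewrite -/c1 -/c0; move: (c1 u) (c0 u) (dec_dim E u) (\dim _) (grkB _ u) (indimB _ u) => *; lia.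
Qed.

Lemma exists_inj_pres (E : decrep J) : exists (X0 Z1 : rmod A) (d : 'Hom(X0, Z1)), inj_pres E d.
Proof.
pose N := D (dmod E).
have [b1 [b0 [Y1 [Y0 [d [p [fY1 fY0 pc [dH dI ds]]]]]]]] := exists_min_presentation HB N.
have [R fR] := exists_freeb HB (dec_dim E).
have [Z1 fZ1] := exists_freeb HB (fun v => b1 v + dec_dim E v)%N.
have [i [q [j [r [[iH qH jH rH] [qi rj] [qj ri] sum]]]]] := freeb_split fZ1 fY1 fR.
have mp : min_proj_pres N d.
  by exists p; split=> //; split=> //; apply: (freeb_projective HB fY1).
have [i0 [[i0H i0P i0k i0s] rest]] := min_proj_dual of_conv_anti to_conv_anti ts st mp.
have [ek eI] := ev_iso_hom (dmod E).
have eH := ev_hom of_conv_anti to_conv_anti ts (dmod E).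
pose i1 : 'Hom(dmod E, D' Y0) := (i0 \o ev (dmod E))%VF.
have i1I : limg i1 = limg i0 by rewrite limg_comp eI.
have mi : @min_inj_pres _ _ (dmod E) (D' Y0) (D' Y1) (dmap d).
  exists i1; rewrite i1I; split=> //; split=> //.
  - exact: (@is_hom_comp _ _ (dmod E) (D' N) (D' Y0)).
  - apply/eqP/lker0P => v w; rewrite !comp_lfunE.
    have i0inj : injective i0 by apply/lker0P/eqP.
    have einj : injective (ev (dmod E)) by apply/lker0P/eqP.
    by move=> /i0inj/einj.
  by rewrite i1I.
pose inj' (b : bool) : 'Hom(two (D' Y1) (D' R) b, D' Z1) :=
  if b return 'Hom(two (D' Y1) (D' R) b, D' Z1) then dmap q else dmap r.
pose prj' (b : bool) : 'Hom(D' Z1, two (D' Y1) (D' R) b) :=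
  if b return 'Hom(D' Z1, two (D' Y1) (D' R) b) then dmap i else dmap j.
exists (D' Y0), (D' Z1), (inj' true \o dmap d)%VF, (D' Y1), (D' R), (dmap d), inj', prj'; split=> //.
  by apply/IsumP; apply: bidual_freeb.
have dc (U V V' : vectType k) (f : 'Hom(U, V)) (g : 'Hom(V, V')) : (dmap f \o dmap g)%VF = dmap (g \o f)%VF.
  by rewrite dmap_comp.
split.
- by case; split; apply: (dmap_hom to_conv_anti).
- case; apply: (etrans (dc _ _ _ _ _)).
    by rewrite -[RHS]dmap_id; congr dmap; apply/lfunP=> v; rewrite comp_lfunE qi id_lfunE.
  by rewrite -[RHS]dmap_id; congr dmap; apply/lfunP=> v; rewrite comp_lfunE rj id_lfunE.
- case; case=> // _; apply: (etrans (dc _ _ _ _ _)).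
    by rewrite -[RHS]dmap0; congr dmap; apply/lfunP=> v; rewrite comp_lfunE qj zero_lfunE.
  by rewrite -[RHS]dmap0; congr dmap; apply/lfunP=> v; rewrite comp_lfunE ri zero_lfunE.
rewrite big_bool /=; apply/lfunP=> phi; apply/lfunP=> v.
rewrite add_lfunE !comp_lfunE id_lfunE add_lfunE !dmapE !comp_lfunE -linearD.
by rewrite sum.
Qed.

(** The Nakayama functor is the dual of Hom(-, J), so its kernels are duals of cokernels over the
    converse algebra. *)
Lemma ker_nakayama (X1 X0 N : rmod A) (d : 'Hom(X1, X0)) : is_hom d ->
  is_ker (nakayama_map d) N <-> is_coker (vee_map d) (D N).
Proof.
move=> dH; have sE (x : A) : to_conv x = x by [].
have nh := nakayama_homotopy sE to_conv_anti d.
have bh := bidual_homotopy to_conv_anti of_conv_anti st (vee_map d).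
split=> [/(homotopy_ker nh) kN|cN].
  exact: homotopy_coker (homotopy_sym bh) (coker_dual of_conv_anti kN).
apply: (homotopy_ker (homotopy_sym nh)).
have [ek eI] := ev_iso_hom N.
apply: (@ker_iso _ _ (D' (vee X1)) (D' (vee X0)) (D' (D N)) N _ (ev N)) => //.
  exact: (ev_hom of_conv_anti to_conv_anti ts N).
exact: (ker_dual to_conv_anti cN).
Qed.

(** Over the converse algebra both maps become projective presentations of the dual of [K] with the
    same weight; [schanuel] applies there and the equivalence is dualised back. *)
Lemma nakayama_schanuel c1 c0 b1 b0 (Z1 Z0 X0 X1 K : rmod A) (f : 'Hom(Z1, Z0)) (d : 'Hom(X0, X1)) :
  freeA c1 Z1 -> freeA c0 Z0 -> freeB b1 (D X1) -> freeB b0 (D X0) -> is_hom f -> is_hom d ->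
  (forall u, c1 u + b1 u = b0 u + c0 u)%N ->
  is_ker (nakayama_map f) K -> is_ker d K -> homotopy_equiv (nakayama_map f) d.
Proof.
move=> fZ1 fZ0 fX1 fX0 fH dH wt /(ker_nakayama K fH) cK /(coker_dual of_conv_anti) cK'.
have sE (x : A) : to_conv x = x by [].
have nh := nakayama_homotopy sE to_conv_anti f.
have bh := bidual_homotopy of_conv_anti to_conv_anti ts d.
have ddH := dmap_hom of_conv_anti dH; have vH := vee_map_hom fH.
have h1 := schanuel HB (vee_freeb HA fZ0) (vee_freeb HA fZ1) fX1 fX0 wt vH ddH cK cK'.
have h2 := homotopy_dual to_conv_anti h1.
have dvH := dmap_hom to_conv_anti vH; have dddH := dmap_hom to_conv_anti ddH.
have nH := nakayama_map_hom fH.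
exact: (homotopy_trans nH dvH dH nh (homotopy_trans dvH dddH dH h2 (homotopy_sym bh))).
Qed.


(** The decoration records how far the weight of [d] falls short of the weight of a minimal
    presentation; by [presentation_weight] the truncated subtraction in [m] loses nothing. *)
Lemma decrep_of_coker delta (X1 X0 N : rmod A) (d : 'Hom(X1, X0)) :
  freeA (negpart delta) X1 -> freeA (pospart delta) X0 -> is_hom d -> is_coker d N ->
  exists dec, has_weight (@DecRep k Q W J N dec) delta.
Proof.
move=> f1 f0 dH [p [pH pI pk]].
pose m u := (negpart delta u + \dim (vsp (jvert J) N u) + grk (@src Q) (@tgt Q) (jdd J) N u -
  (pospart delta u + indim (@src Q) (@tgt Q) (jvert J) N u))%N.
exists (fun u => 'rV[k]_(m u)); apply/has_weightP => u.
rewrite {1}posneg /dec_dim /= dimvf /dim /= mul1n.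
have := presentation_weight HA u f1 f0 dH pH pI pk; rewrite /m.
by move: (negpart _ u) (pospart _ u) (\dim _) (grk _ _ _ N u) (indim _ _ _ N u) => *; lia.
Qed.

Lemma weight_homotopy (M : decrep J) delta (Z1 Z0 X1 X0 : rmod A) (dM : 'Hom(Z1, Z0)) (d : 'Hom(X1, X0)) :
  proj_pres M dM -> has_weight M delta ->
  freeA (negpart delta) X1 -> freeA (pospart delta) X0 -> is_hom d -> is_coker d (dmod M) ->
  homotopy_equiv dM d.
Proof.
move=> /proj_pres_free[c1 [c0 [f1 f0 dMH dMc wt]]] /has_weightP wM fX1 fX0 dH dc.
apply: (schanuel HA f1 f0 fX1 fX0 _ dMH dH dMc dc) => u.
have := wt u; have := wM u; rewrite posneg.
by move: (negpart _ u) (pospart _ u) (c1 u) (c0 u) (\dim _) (grk _ _ _ _ u) (indim _ _ _ _ u) (dec_dim M u) => *; lia.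
Qed.

Lemma is_tauE (M N : decrep J) delta (X1 X0 : rmod A) (d : 'Hom(X1, X0)) :
  has_weight M delta -> freeA (negpart delta) X1 -> freeA (pospart delta) X0 -> is_hom d ->
  is_coker d (dmod M) -> is_tau M N -> is_ker (nakayama_map d) (dmod N).
Proof.
move=> wM fX1 fX0 dH dc [Z1 [Z0 [dM [pM [Y0 [Y1 [d' [iN he]]]]]]]].
have h := weight_homotopy pM wM fX1 fX0 dH dc.
have [c1 [c0 [_ _ dMH _ _]]] := proj_pres_free pM.
have [b1 [b0 [_ _ d'H d'k _]]] := inj_pres_free iN.
apply/(ker_nakayama _ dH); apply: homotopy_coker (vee_homotopy dMH dH h) _.
by apply/(ker_nakayama _ dMH); apply: homotopy_ker (homotopy_sym he) d'k.
Qed.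

Lemma dual_nakayama_homotopy (X1 X0 : rmod A) (d : 'Hom(X1, X0)) : is_hom d ->
  @homotopy_equiv _ _ _ _ (vee_map d) (D (nakayama X0)) (D (nakayama X1)) (dmap (nakayama_map d)).
Proof.
move=> dH; have sE (x : A) : to_conv x = x by [].
have nh := homotopy_dual of_conv_anti (nakayama_homotopy sE to_conv_anti d).
have bh := bidual_homotopy to_conv_anti of_conv_anti st (vee_map d).
have vH := vee_map_hom dH.
apply: (homotopy_trans vH _ _ bh (homotopy_sym nh)).
  exact: (dmap_hom of_conv_anti (dmap_hom to_conv_anti vH)).
exact: (dmap_hom of_conv_anti (nakayama_map_hom dH)).
Qed.

(** The injective presentation of [E] is homotopy equivalent to the Nakayama image of [d], so its
    multiplicities have the difference given by [d]. The rank and decoration terms of the injective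
    and of the projective weight formula agree and cancel. *)
Lemma dual_weight_tau (E : decrep J) eta c1 c0 (X1 X0 : rmod A) (d : 'Hom(X1, X0)) alpha :
  freeA c1 X1 -> freeA c0 X0 -> is_hom d -> dec_of_inj E (nakayama_map d) -> has_weight E eta ->
  (forall u, \dim (vsp (jvert J) (dmod E) u) = alpha u) ->
  forall u, (pospart eta u + c0 u + \sum_(a : arr Q | tgt a == u) alpha (src a) =
             negpart eta u + c1 u + \sum_(a : arr Q | src a == u) alpha (tgt a))%N.
Proof.
move=> f1 f0 dH [Y0 [Y1 [d' [iE he]]]] /has_weightP wE Ed u.
have [b1 [b0 [g1 g0 d'H d'k wt]]] := inj_pres_free iE.
have h1 := homotopy_dual of_conv_anti he; have h0 := dual_nakayama_homotopy dH.
have vH := vee_map_hom dH; have d'dH := dmap_hom of_conv_anti d'H.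
have nH := dmap_hom of_conv_anti (nakayama_map_hom dH).
have := homotopy_weight HB (vee_freeb HA f0) (vee_freeb HA f1) g1 g0 vH d'dH
  (homotopy_trans vH nH d'dH h0 h1) u.
have := wt u; have := wE u; rewrite posneg.
rewrite (indim_dual of_conv_anti (@src Q) (@tgt Q) te) (grk_dual of_conv_anti (@src Q) (@tgt Q) tdd).
rewrite (vsp_dual_dim of_conv_anti te) Ed /indim.
under eq_bigr do rewrite Ed; under [in X in _ -> X]eq_bigr do rewrite Ed.
move: (\sum_(a | tgt a == u) _)%N (\sum_(a | src a == u) _)%N (negpart _ u) (pospart _ u) (grk _ _ _ _ u) => *.
lia.
Qed.


Local Notation minimal_cokerA alpha := (@minimal_coker k A _ (jvert J) alpha _ _).
Local Notation minimal_cokerB alpha := (@minimal_coker k B _ (jvert J) alpha _ _).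

Lemma vee_minimal_coker_open alpha (X1 X0 : rmod A) : generic_coker (A := B) (jvert J) alpha (vee X0) (vee X1) ->
  forall d : 'Hom(X1, X0), is_hom d -> minimal_cokerB alpha (vee_map d) ->
  exists F, [/\ polyfun (@lin_coord k 'Hom(X1, X0)) F, F d != 0 &
    forall d', is_hom d' -> F d' != 0 -> minimal_cokerB alpha (vee_map d')].
Proof.
move=> gB d dH dm; have [G [pG Gd GP]] := minimal_coker_open HB gB (vee_map_hom dH) dm.
exists (fun d => G (vee_map d)); split=> // [|d' d'H].
  exact: polyfun_linear (@vee_map_linear _ _ X1 X0) _ pG.
by apply: GP; apply: vee_map_hom.
Qed.

(** A linear left inverse on homomorphisms; it transports polynomial functions through Hom(-, J). *)
Lemma vee_inverse c1 c0 (X1 X0 : rmod A) : freeA c1 X1 -> freeA c0 X0 ->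
  exists L : 'Hom('Hom(vee X0, vee X1), 'Hom(X1, X0)), forall d, is_hom d -> L (vee_map d) = d.
Proof.
move=> f1 [x f0]; pose Vl := hom_of (@vee_map_linear _ _ X1 X0).
have VlE d : Vl d = vee_map d by rewrite hom_ofE.
pose i := subincl (hom_space X1 X0).
have inj : lker (Vl \o i)%VF = 0%VS.
  apply/eqP/lker0P => v w; rewrite !comp_lfunE !VlE !subinclE => E.
  by apply/val_inj; apply: (vee_map_inj HA f0) E; apply/hom_spaceP; apply: subvsP.
exists (i \o (Vl \o i)^-1)%VF => d /hom_spaceP dH; rewrite comp_lfunE -VlE.
have -> : Vl d = (Vl \o i)%VF (vsproj (hom_space X1 X0) d).
  by rewrite comp_lfunE subinclE vsprojK.
by rewrite lker0_lfunK ?inj // subinclE vsprojK.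
Qed.

Variables (delta : vert Q -> int) (alpha : vert Q -> nat).
Hypothesis alpha_dim : general_dimv J delta alpha.
Variables (eta : vert Q -> int) (alpha' : vert Q -> nat).
Variables (C : set (repspace k alpha)) (DC : set (repspace k alpha')).
Hypothesis tau_eta : general_tau J delta eta.
Hypothesis C_pc : principal_component J delta C.
Hypothesis D_pc : principal_component J eta DC.

Lemma eta_dim : general_dimv J eta alpha'.
Proof.
have [_ [X1 [X0 [f1 f0 gen]]]] := D_pc; exists X1, X0; split=> //.
have /generalP[F [pF ex FP]] := gen; apply/generalP; exists F; split=> // d dH Fd.
have [N [x [dN xN _]]] := FP d dH Fd; exists N => // u.
exact: (grealizes_dim HA u xN).
Qed.

(** Some [d] is general both for [tau_eta] and for the rank of Hom(d, J). Then tau d has weight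
    [eta] and a module of the generic dimension vector [beta], which [dual_generic_coker] makes
    generic for [eta]; uniqueness of generic vectors gives beta = alpha'. *)
Lemma tau_generic_coker (X1 X0 : rmod A) : freeA (negpart delta) X1 -> freeA (pospart delta) X0 ->
  generic_coker (A := B) (jvert J) alpha' (vee X0) (vee X1) /\
  forall u, (pospart eta u + pospart delta u + \sum_(a : arr Q | tgt a == u) alpha' (src a) =
             negpart eta u + negpart delta u + \sum_(a : arr Q | src a == u) alpha' (tgt a))%N.
Proof.
have [Z1 [Z0 [/PsumP g1 /PsumP g0 gen]]] := tau_eta.
have [beta gB] := exists_generic_coker (A := B) (jvert J) (vee Z0) (vee Z1).
have [_ [j jH jm]] := gB; have [d0 d0H d0E] := vee_map_full HA g1 g0 jH.
have d0m : minimal_cokerB beta (vee_map d0) by rewrite d0E.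
have [G [pG Gd0 GP]] := vee_minimal_coker_open gB d0H d0m.
have [F [pF [d1 d1H Fd1] FP]] := (generalP _ _ _).1 gen.
have [|| d [/hom_spaceP dH Fd Gd]] := @polyfun_irr _ _ (hom_space Z1 Z0) _ _ _ _ pF pG _ _ Fd1 Gd0.
- exact/hom_spaceP.
- exact/hom_spaceP.
have [E dE wE] := FP d dH Fd; have dm := GP d dH Gd.
have [Y0 [Y1 [d' [iE he]]]] := dE; have [b1 [b0 [_ _ _ d'k _]]] := inj_pres_free iE.
have kE := (ker_nakayama (dmod E) dH).1 (homotopy_ker (homotopy_sym he) d'k).
have Ed u : \dim (vsp (jvert J) (dmod E) u) = beta u.
  rewrite -(vsp_dual_dim of_conv_anti te).
  exact: ((coker_minimal_coker HB beta (vee_map_hom dH) kE).1 dm).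
have wt := dual_weight_tau g1 g0 dH dE wE Ed.
have [Y1' fY1] := exists_freeb HA (negpart eta); have [Y0' fY0] := exists_freeb HA (pospart eta).
have [gA _] := dual_generic_coker of_conv_anti to_conv_anti ts st HA HB te tdd k_char0
  (vee_freeb HA g0) (vee_freeb HA g1) fY1 fY0 wt gB.
have E' : alpha' = beta := generic_coker_unique (generic_cokerA eta_dim fY1 fY0) gA.
move=> f1 f0; rewrite E'; split=> //.
exact: (generic_coker_transport HB (vee_freeb HA g0) (vee_freeb HA g1) (vee_freeb HA f0) (vee_freeb HA f1) gB).
Qed.

Lemma part_two : exists (U : set (repspace k alpha)) (V : set (repspace k alpha')),
  [/\ zopen_in (@rep_coord k Q alpha) C U /\ U !=set0,
      zopen_in (@rep_coord k Q alpha') DC V /\ V !=set0,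
      forall x, U x -> exists2 M : decrep J, has_weight M delta & realizes x (dmod M),
      forall y, V y -> exists M N : decrep J, [/\ has_weight M delta, is_tau M N & realizes y (dmod N)]
    & forall M N : decrep J, has_weight M delta -> is_tau M N ->
        ((exists2 x, U x & realizes x (dmod M)) <-> (exists2 y, V y & realizes y (dmod N)))].
Proof.
have [X1 f1] := exists_freeb HA (negpart delta); have [X0 f0] := exists_freeb HA (pospart delta).
have gA := generic_cokerA alpha_dim f1 f0; have [gB wt] := tau_generic_coker f1 f0.
have vf0 := vee_freeb HA f0; have vf1 := vee_freeb HA f1.
(* Presentations for which both [d] and Hom(d, J) are general: [U] will consist of their cokernels,
   [V] of the kernels of their Nakayama images. *)
pose S : set 'Hom(X1, X0) := [set d | minimal_cokerA alpha d /\ minimal_cokerB alpha' (vee_map d)].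
have S_open d : is_hom d -> S d -> exists F, [/\ polyfun (@lin_coord k 'Hom(X1, X0)) F, F d != 0 &
    forall d', is_hom d' -> F d' != 0 -> S d'].
  move=> dH [dm vm]; have [F [pF Fd FP]] := minimal_coker_open HA gA dH dm.
  have [G [pG Gd GP]] := vee_minimal_coker_open gB dH vm.
  exists (fun z => F z * G z); split; [exact: polyfun_mul | exact: mulf_neq0 |].
  move=> d' d'H; rewrite mulf_eq0 negb_or => /andP[Fd' Gd'].
  by split; [apply: FP | apply: GP].
have [ds dsH Sds] : exists2 d, is_hom d & S d.
  have [_ [da daH dam]] := gA; have [F [pF Fd FP]] := minimal_coker_open HA gA daH dam.
  have [_ [j jH jm]] := gB; have [db dbH dbE] := vee_map_full HA f1 f0 jH.
  have dbm : minimal_cokerB alpha' (vee_map db) by rewrite dbE.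
  have [G [pG Gd GP]] := vee_minimal_coker_open gB dbH dbm.
  have [|| d [/hom_spaceP dH Fd' Gd']] := @polyfun_irr _ _ (hom_space X1 X0) _ _ _ _ pF pG _ _ Fd Gd.
  - exact/hom_spaceP.
  - exact/hom_spaceP.
  by exists d => //; split; [apply: FP | apply: GP].
(* The same maps after Hom(-, J), so that those kernels become, by duality, a set of cokernels to
   which [coker_set_open] applies. *)
pose S' : set 'Hom(vee X0, vee X1) := [set j | exists d, [/\ is_hom d, S d & vee_map d = j]].
have S'_open j : is_hom j -> S' j -> exists F, [/\ polyfun (@lin_coord k 'Hom(vee X0, vee X1)) F, F j != 0 &
    forall j', is_hom j' -> F j' != 0 -> S' j'].
  move=> jH [d [dH Sd dE]]; have [F [pF Fd FP]] := S_open d dH Sd.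
  have [L LE] := vee_inverse f1 f0; exists (fun j => F (L j)); split.
  - have linL : linear (fun j => L j) by move=> c u v; rewrite linearP.
    exact: polyfun_linear linL _ pF.
  - by rewrite -dE LE.
  move=> j' j'H; have [d' d'H <-] := vee_map_full HA f1 f0 j'H; rewrite LE // => Fd'.
  by exists d'; split=> //; apply: FP.
pose U := @coker_set k A _ _ (@src Q) (@tgt Q) (jvert J) (jarr J) alpha X1 X0 S.
pose V' := @coker_set k B _ _ (@tgt Q) (@src Q) (jvert J) (jarr J) alpha' (vee X0) (vee X1) S'.
pose V : set (repspace k alpha') := [set y | V' (grepT y)].
have U_open : zopen_in (@rep_coord k Q alpha) (@repvar k Q W J alpha) U :=
  coker_set_open HA alpha f1 f0 S_open.
have V_open : zopen_in (@rep_coord k Q alpha') (@repvar k Q W J alpha') V :=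
  transpose_open of_conv_anti to_conv_anti st HA HB te ta
    (coker_set_open HB alpha' vf0 vf1 S'_open).
have [C0 [CI CS CP _]] := principalP alpha_dim f1 f0.
have CC0 : C = C0 by apply/CP.
have [Y1 fY1] := exists_freeb HA (negpart eta); have [Y0 fY0] := exists_freeb HA (pospart eta).
have [E0 [EI ES EP _]] := principalP eta_dim fY1 fY0.
have DE0 : DC = E0 by apply/EP.
(* The comparison of cokernels and kernels for the weight [eta]: general kernels of Nakayama images
   lie in the closure of the general cokernels of weight [eta]. *)
have ksub := kers_sub of_conv_anti to_conv_anti ts st HA HB te ta tdd k_char0 wt vf0 vf1 gB fY1 fY0.
have gE := generic_cokerA eta_dim fY1 fY0.
have [[y0 y0c] _] := cokers_irr (ar := jarr J) HA gE.
have kE := cokers_closure_unique of_conv_anti to_conv_anti ts st HA HB te tdd k_char0 wt vf0 vf1 gB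
  fY1 fY0 EI (ex_intro _ y0 (conj (ES _ y0c) y0c)).
have V_sub : V `<=` DC.
  move=> y [z [N [zH [d [dH [_ vm] dE]] zN yN]]]; rewrite DE0 kE; apply: ksub.
  by exists z, N; split=> //; rewrite -dE.
have U_sub : U `<=` C.
  by move=> x [d [N [dH [dm _] dN xN]]]; rewrite CC0; apply: CS; exists d, N.
have lift_V y : V y -> exists d K, [/\ is_hom d, S d, is_coker (vee_map d) (D K) & grealizes (jvert J) (jarr J) y K].
  move=> [z [N [zH [d [dH Sd dE]] zN yN]]]; exists d, (D' N); split=> //.
    rewrite dE; have [ek eI] := ev_iso_hom N.
    exact: (coker_iso (ev_hom to_conv_anti of_conv_anti st N) ek eI zN).
  by have := grealizes_dual to_conv_anti HB se sa yN; rewrite grepTK.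
exists U, V; split.
- split.
    by apply: zopen_in_sub U_open => //; rewrite CC0; have [] := CI.
  have [N [x [dN xN _]]] := minimal_coker_exists (ar := jarr J) HA dsH Sds.1.
  by exists x, ds, N.
- split.
    by apply: zopen_in_sub V_open => //; rewrite DE0; have [] := EI.
  have [N [y [dN yN _]]] := minimal_coker_exists HB (vee_map_hom dsH) Sds.2.
  exists (grepT y); rewrite /V /= grepTK; exists (vee_map ds), N; split=> //.
    exact: vee_map_hom.
  by exists ds.
- move=> x [d [N [dH _ dN xN]]]; have [dec wM] := decrep_of_coker f1 f0 dH dN.
  by exists (DecRep N dec).
- move=> y /lift_V[d [K [dH Sd cK yK]]].
  have [N dN] := exists_coker dH; have [dec wM] := decrep_of_coker f1 f0 dH dN.
  have [Z1 [Z0 [dM pM]]] := exists_proj_pres (DecRep N dec).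
  have [c1 [c0 [g1 g0 dMH _ _]]] := proj_pres_free pM.
  have h := weight_homotopy pM wM f1 f0 dH dN.
  have cMK := homotopy_coker (vee_homotopy dH dMH (homotopy_sym h)) cK.
  have [p [pH pI pk]] := cMK.
  have le u := presentation_weight HB u (vee_freeb HA g0) (vee_freeb HA g1) (vee_map_hom dMH) pH pI pk.
  (* The decoration of tau M: the gap between the weight of the presentation Hom(dM, J) and that of
     a minimal presentation of the dual of [K]. By [le] the subtraction is exact. *)
  pose m u := (c0 u + \dim (vsp (A := B) (jvert J) (D K) u) + grk (A := B) (@tgt Q) (@src Q) (fun a b => jdd J b a) (D K) u -
    (c1 u + indim (A := B) (@tgt Q) (@src Q) (jvert J) (D K) u))%N.
  pose E := @DecRep k Q W J K (fun u => 'rV[k]_(m u)).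
  have [X0' [Z1' [d' iE]]] := exists_inj_pres E.
  have [b1 [b0 [h1 h0 d'H d'k wtE]]] := inj_pres_free iE.
  have wtM u : (c1 u + b1 u = b0 u + c0 u)%N.
    have := wtE u; have := le u; rewrite /dec_dim /= dimvf /dim /= mul1n /m.
    by move: (c0 u) (c1 u) (b0 u) (b1 u) (\dim _) (grk _ _ _ _ u) (indim _ _ _ _ u) => *; lia.
  have kM : is_ker (nakayama_map dM) K by apply/(ker_nakayama _ dMH).
  have he := nakayama_schanuel g1 g0 h1 h0 dMH d'H wtM kM d'k.
  exists (DecRep N dec), E; split=> //.
  by exists Z1, Z0, dM; split=> //; exists X0', Z1', d'.
(* Forward, [d] and the presentation of [M] have the same weight and cokernel, so their Nakayama
   images have the same kernel. Backward, Hom(d, J) and Hom(dM, J) are compared over the converse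
   algebra by [schanuel], and full faithfulness brings the equivalence down to [d] and [dM]. *)
move=> M N wM tMN; split=> [[x [d [N' [dH Sd dN' xN']]] xM]|[y /lift_V[d [K [dH Sd cK yK]]] yN]].
  have [f [fH fk fI]] := realizes_iso HA xN' xM.
  have dM := coker_iso fH fk fI dN'.
  have kN := is_tauE wM f1 f0 dH dM tMN.
  have cN := (ker_nakayama (dmod N) dH).1 kN.
  have Nd u : \dim (vsp (jvert J) (dmod N) u) = alpha' u.
    rewrite -(vsp_dual_dim of_conv_anti te).
    exact: ((coker_minimal_coker HB alpha' (vee_map_hom dH) cN).1 Sd.2).
  have [y yN] := exists_realization HA Nd; exists y => //.
  exists (vee_map d), (D (dmod N)); split=> //; first exact: vee_map_hom.
    by exists d.
  exact: (grealizes_dual of_conv_anti HA te ta yN).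
have [f [fH fk fI]] := realizes_iso HA yN yK.
have kN : is_ker (nakayama_map d) (dmod N) by apply: (ker_iso fH fk fI); apply/(ker_nakayama _ dH).
have [Z1 [Z0 [dM [pM [Y0' [Y1' [d' [iN he]]]]]]]] := tMN.
have [c1 [c0 [g1 g0 dMH dMc wtM]]] := proj_pres_free pM.
have [b1 [b0 [_ _ d'H d'k _]]] := inj_pres_free iN.
have cMN := (ker_nakayama _ dMH).1 (homotopy_ker (homotopy_sym he) d'k).
have cdN := (ker_nakayama _ dH).1 kN.
have wts u : (negpart delta u + c0 u = c1 u + pospart delta u)%N.
  have := wtM u; have := (has_weightP M delta).1 wM u; rewrite posneg.
  by move: (negpart _ u) (pospart _ u) (c1 u) (c0 u) (\dim _) (grk _ _ _ _ u) (indim _ _ _ _ u) (dec_dim M u) => *; lia.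
have h := schanuel HB vf0 vf1 (vee_freeb HA g0) (vee_freeb HA g1) wts (vee_map_hom dH) (vee_map_hom dMH) cdN cMN.
have h' := vee_homotopy_reflect HA f1 f0 g1 g0 dH dMH h.
have dc := homotopy_coker (homotopy_sym h') dMc.
have Md := (coker_minimal_coker HA alpha dH dc).1 Sd.1.
have [x xM] := exists_realization HA Md; exists x => //.
by exists d, (dmod M).
Qed.

End JacobianPresentations.

Theorem theorem3p11 (k : closedFieldType) (k_char0 : [pchar k] =i pred0)
    (Q : quiver) (Q_loopless : loopless Q) (W : potential k Q)
    (J : jacobian_algebra W) (delta : vert Q -> int) (alpha : vert Q -> nat)
    (alpha_dim : general_dimv J delta alpha) :
  (forall C : set (repspace k alpha),
     principal_component J delta C <->
     dual_principal_component J (dual_weight delta alpha) C)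
  /\
  (forall (eta : vert Q -> int) (alpha' : vert Q -> nat)
      (C : set (repspace k alpha)) (D : set (repspace k alpha')),
     general_tau J delta eta ->
     principal_component J delta C ->
     principal_component J eta D ->
     exists (U : set (repspace k alpha)) (V : set (repspace k alpha')),
       [/\ zopen_in (@rep_coord k Q alpha) C U /\ U !=set0,
           zopen_in (@rep_coord k Q alpha') D V /\ V !=set0,
           forall x, U x ->
             exists2 M : decrep J, has_weight M delta & realizes x (dmod M),
           forall y, V y ->
             exists M N : decrep J,
               [/\ has_weight M delta, is_tau M N & realizes y (dmod N)]
         & forall M N : decrep J, has_weight M delta -> is_tau M N ->
             ((exists2 x, U x & realizes x (dmod M)) <->
              (exists2 y, V y & realizes y (dmod N)))]).
Proof.
split=> [C|eta alpha' C D tau_eta pcC pcD]; first exact: (part_one k_char0 Q_loopless alpha_dim).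
exact: (part_two k_char0 Q_loopless alpha_dim tau_eta pcC pcD).
Qed.
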